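(* Let $\mathcal O$ be a quadratic operad that is Koszul, with quadratic dual $\mathcal O^!$, and let $\overline{\mathcal O}$, $\overline{\mathcal O^!}$ be the associated 2-colored operads. Then $\overline{\mathcal O}$ has a resolution given by the cobar dual of $\overline{\mathcal O^!}$: for every nonempty finite sequence $\vec X$ of colors from $\{\mathsf f,\mathsf d\}$ and every $x\in\{\mathsf f,\mathsf d\}$, the natural map $$\mathbf D(\overline{\mathcal O^!})(\vec X;x)\longrightarrow\overline{\mathcal O}(\vec X;x)$$ is a quasi-isomorphism (where the target, when nonzero, equals $\mathcal O(n)$, $n=|\vec X|$).
   Context: $k$ is a field of characteristic $0$. An operad $\mathcal O$ is a symmetric operad of (ungraded) $k$-vector spaces $\mathcal O(n)$, $n\ge1$, with partial compositions $\circ_i$ and $\mathcal O(1)=k\cdot1$ spanned by the unit; all spaces to which duals are applied are finite dimensional. Colors are $\mathsf f$ (''full'') and $\mathsf d$ (''dashed''). A 2-colored operad $\mathcal P$ consists of vector spaces $\mathcal P(\vec X;x)$ for nonempty finite sequences $\vec X$ of colors and a color $x$, symmetric group actions $\sigma:\mathcal P(\vec X;x)\to\mathcal P(\sigma(\vec X);x)$, and compositions $\circ_i:\mathcal P(\vec X;x)\otimes\mathcal P(\vec Y;y)\to\mathcal P(\vec Z;x)$ when $y$ is the $i$-th color of $\vec X$ ($\vec Z$ is $\vec X$ with the $i$-th entry replaced by $\vec Y$), with the usual associativity, equivariance and unit axioms; the only nonzero spaces with one input are $\mathcal P(\mathsf f;\mathsf f)=k$ and $\mathcal P(\mathsf d;\mathsf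 d)=k$. For an operad $\mathcal O$ and $|\vec X|=n$: $\overline{\mathcal O}(\vec X;\mathsf f)=\mathcal O(n)$ if $\vec X=(\mathsf f,\dots,\mathsf f)$; $\overline{\mathcal O}(\vec X;\mathsf d)=\mathcal O(n)$ if $\vec X$ has exactly one entry $\mathsf d$; all other spaces are $0$; symmetric group actions and compositions are those of $\mathcal O$, keeping track of colors. $\mathcal O$ is quadratic if $\mathcal O=\mathcal F(E)/(R)$, with $\mathcal F(E)$ the free operad on an $S_2$-module $E$ of binary generators, $\mathcal F(E)(n)=\bigoplus_TE(T)$ over binary trees with $n$ labeled inputs, $E(T)=\bigotimes_vE(v)$, and $(R)$ the ideal generated by an $S_3$-submodule $R\subset\mathcal F(E)(3)$. For an $S_n$-module $V$, $V^\vee=V^*\otimes\mathrm{sgn}_n$. The quadratic dual is $\mathcal O^!=\mathcal F(E^\vee)/(R^\perp)$, $R^\perp\subset\mathcal F(E)(3)^\vee\cong\mathcal F(E^\vee)(3)$ the orthogonal complement of $R$ (identify $E^\vee(T)\cong E(T)^*\otimes\mathrm{Det}(T)$, $\mathrm{Det}$ as below, trivializing $\mathrm{Det}(T)$ by (internal edge)$\wedge$(inputs in order)). Cobar dual: trees are rooted with colored edges, every vertex having at least two inputs; a tree is of type $(\vec X;x)$ if its root edge has color $x$ and its leaves are labeled by $\vec X$ respecting colors. $\mathcal P(T)=\bigotimes_v\mathcal P(v)$, with $\mathcal P(v)$ the coinvariants of the sum over labelings of the inputs of $v$; $\mathrm{Det}(T)=\bigwedge^{\mathrm{top}}k^{\mathrm{Edge}(T)}$,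 $\mathrm{Edge}(T)$ all edges except the root. $\mathbf D(\mathcal P)(\vec X;x)=\bigoplus_T\mathcal P(T)^*\otimes\mathrm{Det}(T)$ over isomorphism classes of trees of type $(\vec X;x)$, a tree with $j$ internal edges in degree $j+2-|\vec X|$; the differential (degree $+1$) is dual to the compositions contracting one internal edge $e$, with $\mathrm{Det}(T/e)\to\mathrm{Det}(T)$, $\omega\mapsto e\wedge\omega$. For $|\vec X|=1$ it is $k$ in degree $0$ (trivial tree) when $\vec X=(x)$. The same definition applies to 1-colored operads. $\mathcal O$ is Koszul if for all $n$ the complex $\mathbf D(\mathcal O^!)(n)$ has cohomology concentrated in degree $0$ (where it is always $\mathcal O(n)$). The natural map is zero in negative degrees; in degree $0$, where all trees are binary, it evaluates a decorated binary tree with the compositions of $\overline{\mathcal O}$, using the identification $(E^\vee)^*\otimes\bigwedge^2k^{\mathrm{In}(v)}\cong E$ at each vertex $v$ with set of inputs $\mathrm{In}(v)$. *)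

(* Defs.v *)
From HB Require Import structures.
From mathcomp Require Import functions.
From mathcomp Require Import all_boot all_order all_fingroup all_algebra.

Set Implicit Arguments.
Unset Strict Implicit.
Unset Printing Implicit Defensive.
Import GRing.Theory.
Local Open Scope ring_scope.

(* Conventions.  Input positions are numbered from 0.  A permutation s : 'S_n
   acts on the left: it sends the input in position i to position s i.
   The structure maps of operads are total functions; the predicates
   [permutes], [grafts] and the arithmetical side conditions say when they
   are meaningful, and the axioms are only required in those cases. *)

Definition permutes (A : eqType) n (s : 'S_n) (X Y : seq A) : bool :=
  [&& size X == n, size Y == n & [forall i : 'I_n, onth Y (s i) == onth X i]].

Definition splice (A : Type) (X : seq A) (i : nat) (Y : seq A) : seq A :=
  take i X ++ Y ++ drop i.+1 X.

Definition grafts (A : eqType) (X : seq A) i (y : A) (Y Z : seq A) : bool :=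
  (onth X i == Some y) && (Z == splice X i Y).

(* Position, in a composite a o_i b with b of arity n, of the input k != i
   of a. *)
Definition outer_pos (i n k : nat) : nat := if (k < i)%N then k else (k + n).-1.

(* u is the permutation of the inputs of a o_i b induced by s (on the inputs
   of a) and t (on the inputs of b). *)
Definition block_perm m n p (i : 'I_m) (s : 'S_m) (t : 'S_n) (u : 'S_p) : Prop :=
  (forall (k : 'I_m) (l : 'I_p), k != i ->
     l = outer_pos i n k :> nat -> u l = outer_pos (s i) n (s k) :> nat) /\
  (forall (j : 'I_n) (l : 'I_p),
     l = (i + j)%N :> nat -> u l = (s i + t j)%N :> nat).

(* Sign relating two orderings w, w' of the same elements:
   /\w = osign w w' /\w' in the top exterior power. *)
Definition osign (k : fieldType) (A : eqType) (w w' : seq A) : k :=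
  if [pick s : 'S_(size w) | permutes s w w'] is Some s then (-1) ^+ s else 0.

Record smodule (k : fieldType) (n : nat) := SModule {
  sm_sort :> vectType k;
  sm_act : 'S_n -> 'End(sm_sort);
  sm_act1 : forall v, sm_act 1%g v = v;
  sm_actM : forall s t v, sm_act (s * t)%g v = sm_act t (sm_act s v) }.

Section DualModule.
Variables (k : fieldType) (n : nat) (V : smodule k n).

Definition sdual_fun (s : 'S_n) (f : 'Hom(V, k^o)) : 'Hom(V, k^o) :=
  (-1) ^+ s *: (f \o sm_act V s^-1%g)%VF.

Fact sdual_fun_is_linear s : linear (sdual_fun s).
Proof.
move=> c f g; apply/lfunP => v.
by rewrite /sdual_fun !(scale_lfunE, add_lfunE, comp_lfunE) !scalerDr !scalerA
           (mulrC c).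
Qed.

HB.instance Definition _ s :=
  GRing.isLinear.Build k 'Hom(V, k^o) 'Hom(V, k^o) _ (sdual_fun s)
    (sdual_fun_is_linear s).

Fact sdual_act1 v : linfun (sdual_fun 1%g) v = v.
Proof.
rewrite lfunE /= /sdual_fun odd_perm1 expr0 scale1r; apply/lfunP => x.
by rewrite comp_lfunE invg1 sm_act1.
Qed.

Fact sdual_actM s t v :
  linfun (sdual_fun (s * t)%g) v = linfun (sdual_fun t) (linfun (sdual_fun s) v).
Proof.
rewrite !lfunE /= /sdual_fun odd_permM signr_addb; apply/lfunP => x.
rewrite !(scale_lfunE, comp_lfunE) invMg sm_actM scalerA.
by rewrite (mulrC ((-1) ^+ t)).
Qed.

(* V^* tensored with the sign representation *)
Definition sdual : smodule k n := SModule sdual_act1 sdual_actM.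

End DualModule.

(* [ocomp p i a b] is a o_i b, where p = m + n - 1.  The spaces O n are only
   of interest for n >= 1; O 0 is taken to be 0. *)
Record operad (k : fieldType) := Operad {
  op :> nat -> vectType k;
  oact : forall n, 'S_n -> op n -> op n;
  ocomp : forall m n p : nat, nat -> op m -> op n -> op p;
  ounit : op 1%N;
  op_nullary : forall a : op 0%N, a = 0;
  op_unary : forall a : op 1%N, exists c : k, a = c *: ounit;
  ounit_neq0 : ounit != 0;
  oact_linear : forall n (s : 'S_n), linear (@oact n s);
  ocomp_linearl : forall m n p i (b : op n), linear (fun a => @ocomp m n p i a b);
  ocomp_linearr : forall m n p i (a : op m), linear (@ocomp m n p i a);
  oact1 : forall n (a : op n), oact 1%g a = a;
  oactM : forall n (s t : 'S_n) (a : op n), oact (s * t)%g a = oact t (oact s a);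
  ocomp1l : forall n (a : op n), ocomp n 0%N ounit a = a;
  ocomp1r : forall n i (a : op n), (i < n)%N -> ocomp n i a ounit = a;
  ocompA : forall l m n p q r i j (a : op l) (b : op m) (c : op n),
    (i < l)%N -> (j < m)%N ->
    p.+1 = (l + m)%N -> q.+1 = (m + n)%N -> r.+1 = (p + n)%N ->
    ocomp r (i + j) (ocomp p i a b) c = ocomp r i a (ocomp q j b c);
  ocompAC : forall l m n p q r i j (a : op l) (b : op m) (c : op n),
    (i < j)%N -> (j < l)%N ->
    p.+1 = (l + m)%N -> q.+1 = (l + n)%N -> r.+1 = (p + n)%N ->
    ocomp r (j + m).-1 (ocomp p i a b) c = ocomp r i (ocomp q j a c) b;
  ocomp_act : forall m n p (i : 'I_m) (s : 'S_m) (t : 'S_n) (u : 'S_p)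
      (a : op m) (b : op n),
    p.+1 = (m + n)%N -> block_perm i s t u ->
    ocomp p (s i) (oact s a) (oact t b) = oact u (ocomp p i a b) }.

Arguments oact {k o n}.
Arguments ocomp {k o m n}.
Arguments ounit {k o}.

(* C-colored operads.  [cact Y s a] is the image of a : P X x in P Y x when
   Y = s(X), and [ccomp Z i a b] is a o_i b in P Z x when Z is obtained from X
   by replacing its i-th entry y by Y. *)
Record coperad (C : eqType) (k : fieldType) := COperad {
  cop :> seq C -> C -> vectType k;
  cact : forall n X Y x, 'S_n -> cop X x -> cop Y x;
  ccomp : forall X Y Z x y, nat -> cop X x -> cop Y y -> cop Z x;
  cunit : forall x, cop [:: x] x;
  cop_nullary : forall x (a : cop [::] x), a = 0;
  cop_unary : forall x (a : cop [:: x] x), exists c : k, a = c *: cunit x;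
  cop_unary0 : forall c x (a : cop [:: c] x), c != x -> a = 0;
  cunit_neq0 : forall x, cunit x != 0;
  cact_linear : forall n X Y x (s : 'S_n), linear (@cact n X Y x s);
  ccomp_linearl : forall X Y Z x y i (b : cop Y y),
    linear (fun a => @ccomp X Y Z x y i a b);
  ccomp_linearr : forall X Y Z x y i (a : cop X x), linear (@ccomp X Y Z x y i a);
  cact1 : forall n X x (a : cop X x), size X = n ->
    cact X (1%g : 'S_n) a = a;
  cactM : forall n X Y Z x (s t : 'S_n) (a : cop X x),
    permutes s X Y -> permutes t Y Z ->
    cact Z (s * t)%g a = cact Z t (cact Y s a);
  ccomp1l : forall X x (a : cop X x), ccomp X 0%N (cunit x) a = a;
  ccomp1r : forall X x i y (a : cop X x), onth X i = Some y ->
    ccomp X i a (cunit y) = a;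
  ccompA : forall X x Y y Z z U V W i j (a : cop X x) (b : cop Y y) (c : cop Z z),
    grafts X i y Y U -> grafts U (i + j) z Z W ->
    grafts Y j z Z V -> grafts X i y V W ->
    ccomp W (i + j) (ccomp U i a b) c = ccomp W i a (ccomp V j b c);
  ccompAC : forall X x Y y Z z U V W i j (a : cop X x) (b : cop Y y) (c : cop Z z),
    (i < j)%N ->
    grafts X i y Y U -> grafts U (j + size Y).-1 z Z W ->
    grafts X j z Z V -> grafts V i y Y W ->
    ccomp W (j + size Y).-1 (ccomp U i a b) c = ccomp W i (ccomp V j a c) b;
  ccomp_act : forall m n p X X' x Y Y' y Z Z' (i : 'I_m)
      (s : 'S_m) (t : 'S_n) (u : 'S_p) (a : cop X x) (b : cop Y y),
    permutes s X X' -> permutes t Y Y' -> permutes u Z Z' ->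
    grafts X i y Y Z -> grafts X' (s i) y Y' Z' -> block_perm i s t u ->
    ccomp Z' (s i) (cact X' s a) (cact Y' t b) = cact Z' u (ccomp Z i a b) }.

Arguments cact {C k P n X} Y {x} : rename.
Arguments ccomp {C k P X Y} Z {x y} : rename.
Arguments cunit {C k P} : rename.

(* Transport O m -> O n along m = n (and 0 if m != n). *)
Definition ocast (k : fieldType) (O : operad k) m n (a : O m) : O n :=
  match m =P n with
  | ReflectT e => eq_rect m (fun i => O i) a n e
  | ReflectF _ => 0
  end.

Arguments ocast {k O m} n a.

Section OcastTheory.
Variables (k : fieldType) (O : operad k).

Lemma ocast_id n (a : O n) : ocast n a = a.
Proof. by rewrite /ocast; case: eqP => // e; rewrite eq_axiomK. Qed.

Lemma ocastK m n (a : O m) : m = n -> ocast m (ocast n a) = a.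
Proof. by move=> e; subst n; rewrite !ocast_id. Qed.

Lemma ocast_linear m n : linear (@ocast k O m n).
Proof.
move=> c a b; rewrite /ocast; case: eqP => [e|_]; first by subst n.
by rewrite scaler0 addr0.
Qed.

Lemma ocomp_castl m m' n p i (a : O m) (b : O n) :
  m = m' -> ocomp p i (ocast m' a) b = ocomp p i a b.
Proof. by move=> e; subst m'; rewrite ocast_id. Qed.

Lemma ocomp_castr m n n' p i (a : O m) (b : O n) :
  n = n' -> ocomp p i a (ocast n' b) = ocomp p i a b.
Proof. by move=> e; subst n'; rewrite ocast_id. Qed.

Lemma ocast_ocomp m n p p' i (a : O m) (b : O n) :
  p = p' -> ocast p' (ocomp p i a b) = ocomp p' i a b.
Proof. by move=> e; subst p'; rewrite ocast_id. Qed.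

Lemma ocomp0l m n p i (b : O n) : ocomp p i (0 : O m) b = 0.
Proof.
have := ocomp_linearl p i b (-1) (0 : O m) 0.
by rewrite scaler0 addr0 scaleN1r addNr.
Qed.

Lemma ocomp0r m n p i (a : O m) : ocomp p i a (0 : O n) = 0.
Proof.
have := ocomp_linearr p i a (-1) (0 : O n) 0.
by rewrite scaler0 addr0 scaleN1r addNr.
Qed.

Lemma oact0 n s : oact s (0 : O n) = 0.
Proof.
have := oact_linear s (-1) (0 : O n) 0.
by rewrite scaler0 addr0 scaleN1r addNr.
Qed.

Lemma ocast0 m n : ocast n (0 : O m) = 0.
Proof. by rewrite /ocast; case: eqP => // e; subst n. Qed.

End OcastTheory.

Section Colorize.
Variables (C : eqType) (adm : seq C -> C -> bool).
Hypothesis adm1 : forall c x, adm [:: c] x = (c == x).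
Hypothesis adm_perm :
  forall n (s : 'S_n) X Y x, permutes s X Y -> adm X x = adm Y x.
Hypothesis adm_graft : forall X i y Y Z x,
  grafts X i y Y Z -> adm X x -> adm Y y -> adm Z x.
Variables (k : fieldType) (O : operad k).

Definition col_sort (X : seq C) (x : C) : vectType k :=
  if adm X x then O (size X) else 'rV[k]_0.

Definition col_in X x : col_sort X x -> O (size X) :=
  match adm X x as b return (if b then O (size X) else 'rV[k]_0) -> O (size X) with
  | true => id
  | false => fun=> 0
  end.

Definition col_out X x : O (size X) -> col_sort X x :=
  match adm X x as b return O (size X) -> (if b then O (size X) else 'rV[k]_0) with
  | true => id
  | false => fun=> 0
  end.

Definition col_act n X Y x (s : 'S_n) (a : col_sort X x) : col_sort Y x :=
  col_out x (ocast (size Y) (oact s (ocast n (col_in a)))).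

Definition col_comp X Y Z x y i (a : col_sort X x) (b : col_sort Y y) :
  col_sort Z x := col_out x (ocomp (size Z) i (col_in a) (col_in b)).

Definition col_unit x : col_sort [:: x] x := @col_out [:: x] x ounit.

Fact col_outK X x (a : O (size X)) : adm X x -> col_in (col_out x a) = a.
Proof. by rewrite /col_in /col_out; case: (adm X x). Qed.

Fact col_inK X x (a : col_sort X x) : col_out x (col_in a) = a.
Proof.
move: a; rewrite /col_sort /col_in /col_out; case: (adm X x) => //= a.
by apply/rowP => -[].
Qed.

Fact col_in0 X x (a : col_sort X x) : ~~ adm X x -> col_in a = 0.
Proof. by move: a; rewrite /col_sort /col_in; case: (adm X x). Qed.

Fact col_eq0 X x (a : col_sort X x) : ~~ adm X x -> a = 0.
Proof.
by move: a; rewrite /col_sort; case: (adm X x) => // a _; apply/rowP => -[].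
Qed.

Fact col_in_linear X x : linear (@col_in X x).
Proof.
move=> c a b; move: a b; rewrite /col_sort /col_in; case: (adm X x) => //= _ _.
by rewrite scaler0 addr0.
Qed.

Fact col_out_linear X x : linear (@col_out X x).
Proof.
move=> c a b; rewrite /col_sort /col_out; case: (adm X x) => //=.
by rewrite scaler0 addr0.
Qed.

Fact col_out0 X x : col_out x (0 : O (size X)) = 0.
Proof. by rewrite /col_sort /col_out; case: (adm X x). Qed.

Fact size_grafts X i (y : C) Y Z :
  grafts X i y Y Z -> (i < size X)%N /\ (size Z).+1 = (size X + size Y)%N.
Proof.
case/andP => /eqP hi /eqP ->.
have lt_i : (i < size X)%N.
  by rewrite ltnNge; apply/negP => ?; rewrite onth_default in hi.
split=> //; rewrite /splice !size_cat size_take size_drop lt_i.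
by rewrite addnCA -addnS -addnS subnSK // subnKC 1?addnC // ltnW.
Qed.

Fact col_in_zero X x : col_in (0 : col_sort X x) = 0.
Proof.
have := col_in_linear (-1) (0 : col_sort X x) 0.
by rewrite scaler0 addr0 scaleN1r addNr.
Qed.

Fact col_act0 n X Y x (s : 'S_n) : col_act Y s (0 : col_sort X x) = 0.
Proof. by rewrite /col_act col_in_zero ocast0 oact0 ocast0 col_out0. Qed.

Fact col_comp0l X Y Z x y i (b : col_sort Y y) :
  col_comp Z i (0 : col_sort X x) b = 0.
Proof. by rewrite /col_comp col_in_zero ocomp0l col_out0. Qed.

Fact col_comp0r X Y Z x y i (a : col_sort X x) :
  col_comp Z i a (0 : col_sort Y y) = 0.
Proof. by rewrite /col_comp col_in_zero ocomp0r col_out0. Qed.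

Definition colorize : coperad C k.
Proof.
refine (@COperad C k col_sort col_act col_comp col_unit
  _ _ _ _ _ _ _ _ _ _ _ _ _ _).
- move=> x a; rewrite -[a]col_inK [col_in a]op_nullary; exact: col_out0.
- move=> x a; have [c ac] := op_unary (col_in a).
  by exists c; rewrite -[a]col_inK ac -[c *: _]addr0 col_out_linear col_out0 addr0.
- by move=> c x a cx; apply: col_eq0; rewrite adm1.
- move=> x; apply/eqP => /(congr1 (@col_in _ _)).
  rewrite col_outK ?adm1 ?eqxx // => u0; have := ounit_neq0 O.
  rewrite u0; apply/negP; rewrite negbK; apply/eqP.
  by have := col_in_linear (-1) (0 : col_sort [:: x] x) 0;
     rewrite scaler0 addr0 scaleN1r addNr.
- move=> n X Y x s c a b.
  by rewrite /col_act col_in_linear ocast_linear oact_linear ocast_linear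
             col_out_linear.
- move=> X Y Z x y i b c a a'.
  by rewrite /col_comp col_in_linear ocomp_linearl col_out_linear.
- move=> X Y Z x y i a c b b'.
  by rewrite /col_comp col_in_linear ocomp_linearr col_out_linear.
- by move=> n X x a e; rewrite /col_act oact1 ocastK // col_inK.
- move=> n X Y Z x s t a hs ht.
  have [admX|nadm] := boolP (adm X x); last by rewrite (col_eq0 a nadm) !col_act0.
  have admY : adm Y x by rewrite -(adm_perm x hs).
  have /and3P[_ /eqP eY _] := hs.
  by rewrite /col_act col_outK // ocastK // oactM.
- move=> X x a; rewrite /col_comp /col_unit col_outK ?adm1 //.
  by rewrite ocomp1l col_inK.
- move=> X x i y a hi; rewrite /col_comp /col_unit col_outK ?adm1 //.
  rewrite ocomp1r ?col_inK // ltnNge; apply/negP => ?.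
  by rewrite onth_default in hi.
- move=> X x Y y Z z U V W i j a b c g1 g2 g3 g4.
  have [l1 s1] := size_grafts g1; have [l2 s2] := size_grafts g2.
  have [l3 s3] := size_grafts g3; have [l4 s4] := size_grafts g4.
  have [hX|hX] := boolP (adm X x); last by rewrite (col_eq0 a hX) !col_comp0l.
  have [hY|hY] := boolP (adm Y y); last first.
    by rewrite (col_eq0 b hY) col_comp0l !col_comp0r col_comp0l.
  have hU := adm_graft g1 hX hY.
  have [hZ|hZ] := boolP (adm Z z); last by rewrite (col_eq0 c hZ) !col_comp0r.
  have hV := adm_graft g3 hY hZ.
  by rewrite /col_comp !col_outK //; congr col_out; apply: ocompA.
- move=> X x Y y Z z U V W i j a b c ij g1 g2 g3 g4.
  have [l1 s1] := size_grafts g1; have [l2 s2] := size_grafts g2.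
  have [l3 s3] := size_grafts g3; have [l4 s4] := size_grafts g4.
  have [hX|hX] := boolP (adm X x); last by rewrite (col_eq0 a hX) !col_comp0l.
  have [hY|hY] := boolP (adm Y y); last first.
    by rewrite (col_eq0 b hY) !col_comp0r col_comp0l.
  have hU := adm_graft g1 hX hY.
  have [hZ|hZ] := boolP (adm Z z); last first.
    by rewrite (col_eq0 c hZ) !col_comp0r col_comp0l.
  have hV := adm_graft g3 hX hZ.
  by rewrite /col_comp !col_outK //; congr col_out; apply: ocompAC.
- move=> m n p X X' x Y Y' y Z Z' i s t u a b hs ht hu g1 g2 bp.
  have [l1 s1] := size_grafts g1.
  have [hX|hX] := boolP (adm X x); last first.
    by rewrite (col_eq0 a hX) col_comp0l !col_act0 col_comp0l.
  have [hY|hY] := boolP (adm Y y); last first.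
    by rewrite (col_eq0 b hY) col_comp0r !col_act0 col_comp0r.
  have hZ := adm_graft g1 hX hY.
  have hX' : adm X' x by rewrite -(adm_perm x hs).
  have hY' : adm Y' y by rewrite -(adm_perm y ht).
  have /and3P[/eqP eX /eqP eX' _] := hs; have /and3P[/eqP eY /eqP eY' _] := ht.
  have /and3P[/eqP eZ /eqP eZ' _] := hu.
  rewrite /col_comp /col_act !col_outK //; congr col_out.
  rewrite ocomp_castl // ocomp_castr // -(ocast_ocomp (p := p)) //.
  rewrite (ocomp_act (u := u)) // ?(ocast_ocomp (p' := p)) //; last first.
    by rewrite -eZ -eX -eY; case: (size_grafts g1).
  by rewrite ocomp_castl // ocomp_castr.
Defined.

End Colorize.

Section Mono.
Variables (k : fieldType) (O : operad k).

Definition mono_adm (X : seq unit) (x : unit) : bool := true.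

Fact mono_adm1 c x : mono_adm [:: c] x = (c == x).
Proof. by case: c x => -[]. Qed.

Definition mono : coperad unit k :=
  @colorize _ mono_adm mono_adm1 (fun _ _ _ _ _ _ => erefl)
    (fun _ _ _ _ _ _ _ _ _ => erefl) k O.

End Mono.

Inductive color := full | dashed.

Definition color_bool (c : color) : bool := if c is full then true else false.
Definition bool_color (b : bool) : color := if b then full else dashed.
Fact color_boolK : cancel color_bool bool_color. Proof. by case. Qed.
HB.instance Definition _ := Finite.copy color (can_type color_boolK).

Section Bar.
Variables (k : fieldType) (O : operad k).

Definition bar_adm (X : seq color) (x : color) : bool :=
  match x with
  | full => all (pred1 full) X
  | dashed => count_mem dashed X == 1%N
  end.

Fact bar_adm1 c x : bar_adm [:: c] x = (c == x).
Proof. by case: c x => -[]. Qed.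

Fact permutes_perm_eq (A : eqType) n (s : 'S_n) (X Y : seq A) :
  permutes s X Y -> perm_eq X Y.
Proof.
case/and3P => /eqP eX /eqP eY /forallP h.
case: X eX h => [|x0 X'] eX h; first by move: eY; rewrite -eX => /size0nil ->.
set X := x0 :: X' in eX h *.
have nthE (i : 'I_n) : nth x0 X i = nth x0 Y (s i).
  by rewrite -!odflt_onth (eqP (h i)).
have EX : X = [seq nth x0 X (nat_of_ord i) | i <- enum 'I_n].
  apply: (@eq_from_nth _ x0); first by rewrite size_map size_enum_ord.
  by move=> i; rewrite eX => li; rewrite (nth_map (Ordinal li)) ?size_enum_ord //
                                        nth_enum_ord.
have EY : Y = [seq nth x0 Y (nat_of_ord i) | i <- enum 'I_n].
  apply: (@eq_from_nth _ x0); first by rewrite size_map size_enum_ord.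
  by move=> i; rewrite eY => li; rewrite (nth_map (Ordinal li)) ?size_enum_ord //
                                        nth_enum_ord.
rewrite EX EY (eq_map (g := (fun i => nth x0 Y (nat_of_ord i)) \o s)) // map_comp.
apply: perm_map.
apply: uniq_perm; rewrite ?enum_uniq ?(map_inj_uniq perm_inj) ?enum_uniq //.
move=> i; rewrite mem_enum inE; apply/mapP; exists ((s^-1)%g i).
  by rewrite mem_enum.
by rewrite permKV.
Qed.

Fact bar_adm_perm n (s : 'S_n) X Y x :
  permutes s X Y -> bar_adm X x = bar_adm Y x.
Proof.
move/permutes_perm_eq => e; case: x => /=; first exact: perm_all.
by rewrite (seq.permP e).
Qed.

Fact bar_adm_graft X i y Y Z x :
  grafts X i y Y Z -> bar_adm X x -> bar_adm Y y -> bar_adm Z x.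
Proof.
case/andP => /eqP hi /eqP ->.
have lt_i : (i < size X)%N by rewrite -onthTE hi.
have EX : X = take i X ++ y :: drop i.+1 X.
  by rewrite -[X in LHS](cat_take_drop i) (drop_nth y lt_i) -odflt_onth hi.
rewrite /splice; move: (take i X) (drop i.+1 X) EX => A B -> {X hi lt_i}.
have count0 s : all (pred1 full) s -> count_mem dashed s = 0%N.
  by elim: s => //= -[] s IH //.
case: x y => -[] /=; rewrite ?all_cat ?count_cat //=.
- by move=> /andP[-> ->] ->.
- by rewrite andbF.
- by rewrite add0n => h /count0 ->.
- by move=> hAB /eqP ->.
Qed.

Definition bar : coperad color k := colorize bar_adm1 bar_adm_perm bar_adm_graft O.

End Bar.

(* A tree of type (X; x) all of whose vertices have at least two inputs has no
   automorphisms, and it is determined up to isomorphism by the set of pairs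
   (A, c) where, for each edge, c is its color and A is the set of (labels of)
   leaves from which the path to the root passes through the edge.  A vertex
   is identified with the edge going out of it. *)
Section Trees.
Variables (C : finType) (X : seq C) (x : C).

Definition edge := ({set 'I_(size X)} * C)%type.

Definition root_edge : edge := ([set: 'I_(size X)], x).
Definition leaf_edge (i : 'I_(size X)) : edge := ([set i], tnth (in_tuple X) i).
Definition leaf_edges : seq edge := [seq leaf_edge i | i : 'I_(size X)].

Definition is_tree (T : {set edge}) : bool :=
  [&& root_edge \in T, [forall i, leaf_edge i \in T],
      [forall e in T, e.1 != set0] &
      [forall e in T, forall f in T,
         [|| e == f, e.1 \proper f.1, f.1 \proper e.1 | [disjoint e.1 & f.1]]]].

Definition vertices (T : {set edge}) : {set edge} := [set v in T | (1 < #|v.1|)%N].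

Definition inputs (T : {set edge}) (v : edge) : {set edge} :=
  [set e in T | (e.1 \proper v.1) &&
     [forall f in T, ~~ ((e.1 \proper f.1) && (f.1 \proper v.1))]].

Definition nonroot (T : {set edge}) : {set edge} := [set e in T | e.1 != setT].

Definition internal (T : {set edge}) : {set edge} := vertices T :&: nonroot T.

Definition is_binary (T : {set edge}) : bool :=
  [forall v in vertices T, #|inputs T v| == 2%N].

Definition tree_degree (T : {set edge}) : int :=
  if size X == 1%N then 0 else #|internal T|%:Z + 2 - (size X)%:Z.

(* An ordering of Edge(T) representing the product over the vertices v (in any
   order) of the generators of /\^2 k^In(v), for T binary, when the inputs of
   each v are listed by [enum (inputs T v)]. *)
Definition vertexwise_order (T : {set edge}) : seq edge :=
  flatten [seq enum (inputs T v) | v <- enum (vertices T)].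

End Trees.

Section Decorations.
Variables (C : finType) (k : fieldType) (P : coperad C k) (X : seq C) (x : C).
Local Notation edge := (edge X).

(* A labeled decoration of the vertex v: a list of the inputs of v and an
   operation whose inputs are colored accordingly.  A decoration of a tree is
   given on all v : edge, but only its values at the vertices matter. *)
Definition vdec (v : edge) : Type :=
  {l : seq edge & P [seq e.2 | e <- l] v.2}.

Definition decoration : Type := forall v, vdec v.

Definition vdec_op v (l : seq edge) (p : P [seq e.2 | e <- l] v.2) : vdec v :=
  Tagged (fun l : seq edge => P [seq e.2 | e <- l] v.2 : Type) p.

Definition labeled (T : {set edge}) (a : decoration) : bool :=
  [forall v in vertices T, perm_eq (tag (a v)) (enum (inputs T v))].

Definition contract (e : edge) (a : decoration) : decoration := fun v =>
  let l := tag (a v) in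
  if e \in l then
    let l' := splice l (index e l) (tag (a e)) in
    vdec_op (ccomp [seq f.2 | f <- l'] (index e l) (tagged (a v)) (tagged (a e)))
  else a v.

(* The composite of a labeled decoration of T in P(X; x): contract all internal
   edges, then permute the inputs of the resulting corolla.  The trivial tree
   is evaluated to the unit. *)
Definition tree_comp (T : {set edge}) (a : decoration) : P X x :=
  if size X == 1%N then cact X (1%g : 'S_1) (cunit x) else
  let b := foldl (fun b e => contract e b) a (enum (internal T)) (root_edge X x) in
  if [pick s : 'S_(size X) | permutes s (tag b) (leaf_edges X)] is Some s
  then cact X s (tagged b : P _ x) else 0.

End Decorations.

(* A space with a family of subspaces (the graded pieces) and an endomorphism;
   see [is_complex]. *)
Record complex (k : fieldType) := Complex {
  cx_sort :> lmodType k;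
  cx_deg : int -> cx_sort -> Prop;
  cx_d : cx_sort -> cx_sort }.

Arguments cx_deg {k} A d a : rename.
Arguments cx_d {k A} a : rename.

Definition is_complex (k : fieldType) (A : complex k) : Prop :=
  forall d : int,
  [/\ cx_deg A d 0,
      forall (c : k) a b, cx_deg A d a -> cx_deg A d b -> cx_deg A d (c *: a + b),
      forall a, cx_deg A d a -> cx_deg A (d + 1) (cx_d a),
      forall (c : k) (a b : A), cx_deg A d a -> cx_deg A d b ->
        cx_d (c *: a + b) = c *: cx_d a + cx_d b
    & forall a : A, cx_deg A d a -> cx_d (cx_d a) = 0].

Definition acyclic_at (k : fieldType) (A : complex k) (d : int) : Prop :=
  forall a : A, cx_deg A d a -> cx_d a = 0 ->
  exists2 b : A, cx_deg A (d - 1) b & cx_d b = a.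

Definition chain_map (k : fieldType) (A B : complex k) (f : A -> B) : Prop :=
  forall d : int,
  [/\ forall a, cx_deg A d a -> cx_deg B d (f a),
      forall (c : k) a b, cx_deg A d a -> cx_deg A d b ->
        f (c *: a + b) = c *: f a + f b
    & forall a, cx_deg A d a -> f (cx_d a) = cx_d (f a)].

(* The two conditions for each d are injectivity and surjectivity of f on the
   d-th cohomology. *)
Definition quasi_iso (k : fieldType) (A B : complex k) (f : A -> B) : Prop :=
  [/\ is_complex A, is_complex B, chain_map f & forall d : int,
    (forall a : A, cx_deg A d a -> cx_d a = 0 ->
       (exists2 b : B, cx_deg B (d - 1) b & f a = cx_d b) ->
       exists2 a' : A, cx_deg A (d - 1) a' & a = cx_d a') /\
    (forall b : B, cx_deg B d b -> cx_d b = 0 ->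
       exists a : A, [/\ cx_deg A d a, cx_d a = 0 &
         exists2 b' : B, cx_deg B (d - 1) b' & b = f a + cx_d b'])].

Definition concentrated (k : fieldType) (V : lmodType k) : complex k :=
  @Complex k V (fun d v => d = 0 \/ v = 0) (fun=> 0).

Section Cobar.
Variables (C : finType) (k : fieldType) (P : coperad C k) (X : seq C) (x : C).
Local Notation edge := (edge X).
Local Notation decoration := (decoration P X).

(* An element phi of the sum over T of P(T)^* (x) Det(T) is recorded through
   its coordinates phi T w a, where w is an ordering of Edge(T) -- so that the
   T-component of phi is (phi T w) (x) /\w -- and a is a labeled decoration of
   T.  For fixed T and w it is a linear form on the tensor product over v of
   the coinvariants P(v), i.e. a multilinear form in the values of a at the
   vertices which is invariant under relabeling the inputs of each vertex.
   It is 0 on meaningless data. *)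
Definition precochain : lmodType k := {set edge} -> seq edge -> decoration -> k^o.

Definition cobar_data (T : {set edge}) (w : seq edge) (a : decoration) : bool :=
  [&& is_tree x T, perm_eq w (enum (nonroot T)) & labeled T a].

Record cochain (phi : precochain) : Prop := Cochain {
  cochain_support : forall T w a, ~~ cobar_data T w a -> phi T w a = 0;
  cochain_local : forall T w a v (z : vdec P v),
    v \notin vertices T -> phi T w (dfwith a z) = phi T w a;
  cochain_linear : forall T w a v (l : seq edge), v \in vertices T ->
    linear (fun p : P [seq e.2 | e <- l] v.2 => phi T w (dfwith a (vdec_op p)));
  cochain_relabel : forall T w a v n (s : 'S_n) (l l' : seq edge)
      (p : P [seq e.2 | e <- l] v.2), permutes s l l' ->
    phi T w (dfwith a (vdec_op (cact [seq e.2 | e <- l'] s p))) =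
    phi T w (dfwith a (vdec_op p));
  cochain_det : forall T n (s : 'S_n) w w' a, permutes s w w' ->
    phi T w' a = (-1) ^+ s * phi T w a }.

Definition homogeneous (d : int) (phi : precochain) : Prop :=
  forall T w a, tree_degree T != d -> phi T w a = 0.

(* The sum over e is the dual of the contractions of one internal edge, and the
   sign comes from /\w = (-1)^(index e w) e /\ (/\(rem e w)). *)
Definition cobar_d (phi : precochain) : precochain := fun T w a =>
  if cobar_data T w a then
    \sum_(e in internal T)
       (-1) ^+ index e w * phi (T :\ e) (rem e w) (contract e a)
  else 0.

Definition cobar : complex k :=
  @Complex k precochain (fun d phi => cochain phi /\ homogeneous d phi) cobar_d.

End Cobar.

(* The space (+)_T E(T), the sum being over the binary trees T of type (X; x),
   for E with a basis indexed by 'I_m.  It has a basis of monomials: trees T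
   with a basis element of E at each vertex v, the inputs of v being listed by
   [enum (inputs T v)]. *)
Section TreeMonomials.
Variables (k : fieldType) (C : finType) (m : nat) (X : seq C) (x : C).

Definition binary_tree := {T : {set edge X} | is_tree x T && is_binary T}.

Definition monomial :=
  {T : binary_tree & {ffun {v | v \in vertices (val T)} -> 'I_m}}.

Definition mono_tree (mu : monomial) : {set edge X} := val (tag mu).

Definition tree_space : vectType k := {ffun monomial -> k^o}.

Variables (P : coperad C k) (g : 'I_m -> forall Y y, P Y y).

Definition mono_dec (mu : monomial) : decoration P X := fun v =>
  @vdec_op _ _ P X v (enum (inputs (mono_tree mu) v))
    (if insub v is Some v' then g (tagged mu v') _ _ else 0).

Definition tree_eval (z : tree_space) : P X x :=
  \sum_(mu : monomial) z mu *: tree_comp x (mono_tree mu) (mono_dec mu).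

End TreeMonomials.

Definition mono_gen (k : fieldType) (O : operad k) m (g : 'I_m -> O 2%N) :
  'I_m -> forall Y y, mono O Y y :=
  fun i Y y => @col_out _ mono_adm k O Y y (ocast (size Y) (g i)).

Definition bar_gen (k : fieldType) (O : operad k) m (g : 'I_m -> O 2%N) :
  'I_m -> forall Y y, bar O Y y :=
  fun i Y y => @col_out _ bar_adm k O Y y (ocast (size Y) (g i)).

(* An operad F with generators E is F(E) when evaluation identifies the direct
   sum of the E(T) with F(n), i.e. when the tree monomials in a basis of E form
   a basis of F(n). *)
Record free_operad (k : fieldType) (E : smodule k 2%N) := FreeOperad {
  fo_op :> operad k;
  fo_gen : {linear E -> fo_op 2%N};
  fo_gen_act : forall (s : 'S_2) v, fo_gen (sm_act E s v) = oact s (fo_gen v);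
  fo_free : forall (e : (\dim {:E}).-tuple E), basis_of {:E} e ->
    forall n : nat, (0 < n)%N ->
    bijective (@tree_eval k unit _ (nseq n tt) tt (mono fo_op)
                 (mono_gen (fun i => fo_gen (tnth e i)))) }.

Inductive ideal (k : fieldType) (F : operad k) (R : F 3%N -> Prop) :
    forall n, F n -> Prop :=
| ideal_gen r of R r : ideal R r
| ideal_zero n : ideal R (0 : F n)
| ideal_lin n c (a b : F n) of ideal R a & ideal R b : ideal R (c *: a + b)
| ideal_act n (s : 'S_n) (a : F n) of ideal R a : ideal R (oact s a)
| ideal_compl m n p i (a : F m) (b : F n) of
    (i < m)%N & p.+1 = (m + n)%N & ideal R a : ideal R (ocomp p i a b)
| ideal_compr m n p i (a : F m) (b : F n) of
    (i < m)%N & p.+1 = (m + n)%N & ideal R b : ideal R (ocomp p i a b).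

Record quotient_of (k : fieldType) (F : operad k) (I : forall n, F n -> Prop)
    (O : operad k) := QuotientOf {
  quo :> forall n, {linear F n -> O n};
  quo_unit : quo 1%N ounit = ounit;
  quo_act : forall n (s : 'S_n) a, quo n (oact s a) = oact s (quo n a);
  quo_comp : forall m n p i (a : F m) (b : F n),
    (i < m)%N -> p.+1 = (m + n)%N ->
    quo p (ocomp p i a b) = ocomp p i (quo m a) (quo n b);
  quo_surj : forall n (b : O n), exists a, quo n a = b;
  quo_ker : forall n (a : F n), quo n a = 0 <-> I n a }.

Record quadratic_operad (k : fieldType) := QuadraticOperad {
  q_gen : smodule k 2%N;
  q_free : free_operad q_gen;
  q_rel : {vspace q_free 3%N};
  q_rel_stable : forall (s : 'S_3) r, r \in q_rel -> oact s r \in q_rel;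
  q_op :> operad k;
  q_quo : quotient_of (@ideal k q_free (fun r => r \in q_rel)) q_op }.

Section Orthogonal.
Variables (k : fieldType) (E : smodule k 2%N) (F : free_operad E).
Variable (F' : free_operad (sdual E)).

Definition gen_basis (i : 'I_(\dim {:E})) : E := (vbasis {:E})`_i.
Definition dual_basis (i : 'I_(\dim {:E})) : sdual E :=
  linfun (coord (vbasis {:E}) i : E -> k^o).

(* Sign of the trivialization of Det(T) by (internal edge) /\ (inputs in
   order), on the generator given by [vertexwise_order T]. *)
Definition det_sign (T : {set edge (nseq 3%N tt)}) : k :=
  osign k (vertexwise_order T) (enum (internal T) ++ leaf_edges (nseq 3%N tt)).

Local Notation space3 := (tree_space k (\dim {:E}) (nseq 3%N tt) tt).

(* The pairing of F(E)(3) with F(E^v)(3), in the bases of monomials coming from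
   [gen_basis] and [dual_basis] *)
Definition tree_pairing (z z' : space3) : k :=
  \sum_mu det_sign (mono_tree mu) * (z mu * z' mu).

Definition orthogonal (R : {vspace F 3%N}) (y : F' 3%N) : Prop :=
  forall z z' : space3,
    (tree_eval (mono_gen (fun i => fo_gen F (gen_basis i))) z : F 3%N) \in R ->
    tree_eval (mono_gen (fun i => fo_gen F' (dual_basis i))) z' = y ->
    tree_pairing z z' = 0.

End Orthogonal.

Record quadratic_dual (k : fieldType) (O : quadratic_operad k) := QuadraticDual {
  d_free : free_operad (sdual (q_gen O));
  d_op :> operad k;
  d_quo : quotient_of (@ideal k d_free (orthogonal (q_rel O))) d_op }.

Definition koszul (k : fieldType) (O : quadratic_operad k)
    (O' : quadratic_dual O) : Prop :=
  forall (n : nat) (d : int), (0 < n)%N -> d != 0 ->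
  acyclic_at (cobar (mono O') (nseq n tt) tt) d.

Section NaturalMap.
Variables (k : fieldType) (O : quadratic_operad k) (O' : quadratic_dual O).
Variables (X : seq color) (x : color).

(* The generators of O and of O', in dual bases of E and E^v *)
Definition op_gen (i : 'I_(\dim {:q_gen O})) : O 2%N :=
  q_quo O 2%N (fo_gen (q_free O) (gen_basis i)).
Definition dual_gen (i : 'I_(\dim {:q_gen O})) : O' 2%N :=
  d_quo O' 2%N (fo_gen (d_free O') (dual_basis i)).

(* The sum over all binary trees T (all trees, in degree 0) of the composite
   of the image of phi in E(T), expanded in the basis of monomials *)
Definition natural_map (phi : cobar (bar O') X x) : concentrated (bar O X x) :=
  tree_eval (bar_gen op_gen)
    [ffun mu => phi (mono_tree mu) (vertexwise_order (mono_tree mu))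
                    (mono_dec (bar_gen dual_gen) mu)].

End NaturalMap.

(* Main.v *)
From mathcomp Require Import boolp.
From mathcomp Require Import all_boot all_order all_fingroup all_algebra.
From mathcomp Require Import zify ring.
Require Import Defs.

Set Implicit Arguments.
Unset Strict Implicit.
Unset Printing Implicit Defensive.
Import GRing.Theory Num.Theory.
Local Open Scope ring_scope.

(** Over one color the statement is a description of the cohomology of the cobar
    dual D(O^!): by Koszulness it is concentrated in degree 0, and there it is
    O(n).  The second part holds for every quadratic operad and is where most of
    the work lies.  Write F for the free operad on E and R for the relations, so
    that O = F/(R).  The sum over binary trees of the values of a cochain on dual
    generators, times the composites of generators, is a map [natsum] from
    cochains of degree 0 to F(n).  It is bijective, because tree monomials form a
    basis of F(n) ([natsum_inj], [natsum_surj]).  It carries the coboundaries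
    onto the ideal (R).  In one direction, the contractions of edges of
    binary trees leave trees with one ternary vertex, and the terms with a given
    tree add up to a composite whose ternary vertex carries an element [rot3 lam]
    of F(3), where [lam] is a linear form on O^!(3) ([natsum_d]); such a form is
    the same thing as a relation ([rot3_in_R], [R_rot3]), as O^!(3) is the
    quotient of the free operad on the dual generators by the orthogonal of R.
    In the other direction, the ideal is spanned by the composites along trees
    with one ternary vertex decorated by a relation and the others binary
    ([ideal_late], [graft_exists]), and each of them comes from the coboundary
    of a product of linear forms on the vertices ([natsum_ternary]).

    Two colors bring nothing new.  In a tree all of whose vertices carry nonzero
    operations of the 2-colored operad, the colors of the edges are determined by
    those of the leaves: an edge is dashed when it lies below a dashed leaf
    ([tree_colors]), and this coloring of an uncolored tree is admissible as
    soon as there is at most one dashed leaf ([up_adm]).  So, for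
    the types (X;x) whose space of operations is O(n), forgetting the colors
    identifies the 2-colored cobar dual with the 1-colored one ([pull_d],
    [pull_push], [pull_inj]), compatibly with the natural maps
    ([natural_pull]); for the other types there are no nonzero
    cochains at all ([tree_adm]).

    Signs are handled through lists: an orientation of a tree is an ordering of
    its edges, and a reordering contributes its parity [par].  The natural map is
    insensitive to the orderings chosen at the vertices, as the sign by which
    the S_2-action on E is twisted on the dual generators compensates the change
    of orientation ([tree_sum_indep]). *)

(** * Permutations of lists and orientations *)

Lemma permutesP (A : eqType) n (s : 'S_n) (X Y : seq A) :
  reflect [/\ size X = n, size Y = n & forall i : 'I_n, onth Y (s i) = onth X i]
          (permutes s X Y).
Proof.
apply: (iffP and3P) => [[/eqP ? /eqP ? /forallP h]|[-> -> h]]; split=> //.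
  by move=> i; apply/eqP.
by apply/forallP => i; apply/eqP.
Qed.

Section Permutes.
Variable A : eqType.
Implicit Types (X Y Z : seq A).

Lemma permutes1 n X : size X = n -> permutes (1%g : 'S_n) X X.
Proof. by move=> h; apply/permutesP; split=> // i; rewrite perm1. Qed.

Lemma permutesM n (s t : 'S_n) X Y Z :
  permutes s X Y -> permutes t Y Z -> permutes (s * t)%g X Z.
Proof.
move=> /permutesP[h1 h2 h3] /permutesP[h4 h5 h6].
by apply/permutesP; split=> // i; rewrite permM h6.
Qed.

Lemma permutesV n (s : 'S_n) X Y : permutes s X Y -> permutes s^-1%g Y X.
Proof.
move=> /permutesP[h1 h2 h3]; apply/permutesP.
by split=> // i; rewrite -h3 permKV.
Qed.

Lemma permutes_map (B : eqType) (f : A -> B) n (s : 'S_n) X Y :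
  permutes s X Y -> permutes s (map f X) (map f Y).
Proof.
move=> /permutesP[h1 h2 h3]; apply/permutesP; rewrite !size_map; split=> // i.
by rewrite !onth_map h3.
Qed.

Lemma permutes_uniq n (s t : 'S_n) X Y :
  uniq Y -> permutes s X Y -> permutes t X Y -> s = t.
Proof.
move=> uY /permutesP[h1 h2 h3] /permutesP[h4 h5 h6]; apply/permP => i.
apply/val_inj; apply: (onth_inj _ _ _ uY); last by rewrite h3 h6.
by rewrite h2 gtn_min ltn_ord.
Qed.

Lemma permutes_index n (s : 'S_n) X Y x :
  uniq Y -> permutes s X Y -> forall i : 'I_n, onth X i = Some x ->
  s i = index x Y :> nat.
Proof.
move=> uY /permutesP[h1 h2 h3] i hi; rewrite -h3 in hi.
by rewrite -(onth_nth x _ _ _ hi) index_uniq // h2.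
Qed.

Lemma permutesE n (s : 'S_n) X Y : size X = n -> size Y = n ->
  (forall x0 (i : 'I_n), nth x0 Y (s i) = nth x0 X i) -> permutes s X Y.
Proof.
move=> h1 h2 h; apply/permutesP; split=> // i.
case: X h1 h => [|x X] h1 h; first by case: i => m hm /=; exfalso; move: hm; rewrite -h1.
have [l1 l2] : (s i < size Y)%N /\ (i < size (x :: X))%N by rewrite h1 h2.
rewrite !onthE !(nth_map x) //; congr Some; exact: h.
Qed.

Lemma perm_eq_permutes n X Y :
  perm_eq X Y -> size X = n -> exists s : 'S_n, permutes s X Y.
Proof.
move=> h e; have eY : size Y == n by rewrite -(perm_size h) e.
have [s hs] := @tuple_permP _ _ X (Tuple eY) h.
exists s; apply: permutesE => //; first exact/eqP.
by move=> x0 i; rewrite hs nth_mktuple (tnth_nth x0).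
Qed.

(** Parity of the permutation relating two duplicate-free orderings of the
    same elements, computed by moving the entries of the first one to the
    front of the second one, one after the other: this form is suited to the
    deletion of an edge from an orientation. *)
Fixpoint par (w w' : seq A) : bool :=
  if w is e :: t then odd (index e w') (+) par t (rem e w') else false.

Lemma permutes_par n (s : 'S_n) w w' :
  uniq w' -> permutes s w w' -> odd_perm s = par w w'.
Proof.
elim: n w w' s => [|n IH] w w' s uw' h.
  have /permutesP[/size0nil -> _ _] := h.
  have -> : s = 1%g by apply/permP => -[].
  by rewrite odd_perm1.
have /permutesP[h1 h2 h3] := h.
case: w h h1 h3 => [|e t] // h h1 h3; rewrite /=.
have sj : s ord0 = index e w' :> nat by apply: permutes_index h _ _.
set j := s ord0.
have us : {u : 'S_n | s = lift_perm ord0 j u}.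
  have inj : injective (fun k => odflt k (unlift j (s (lift ord0 k)))).
    move=> k k'.
    have n1 x : j != s (lift ord0 x) by rewrite (inj_eq perm_inj) neq_lift.
    case/unlift_some: (n1 k) => a ha ->; case/unlift_some: (n1 k') => b hb -> /= ab.
    by apply: (@lift_inj _ ord0); apply: (@perm_inj _ s); rewrite ha hb ab.
  exists (perm inj); apply/permP => k.
  case: (unliftP ord0 k) => [k'|] ->; last by rewrite lift_perm_id.
  rewrite lift_perm_lift permE.
  have n1 x : j != s (lift ord0 x) by rewrite (inj_eq perm_inj) neq_lift.
  by case/unlift_some: (n1 k') => a ha ->.
have [u eu] := us; rewrite eu odd_lift_perm /= -sj; congr (_ (+) _).
have ew' : e \in w' by rewrite -index_mem -sj h2.
apply: IH; first exact: rem_uniq.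
case: h1 => h1; apply: permutesE => //; first by rewrite size_rem // h2.
move=> x0 i; have := h3 (lift ord0 i); rewrite eu lift_perm_lift => hi.
have -> : nth x0 t i = nth x0 (e :: t) (lift ord0 i) by rewrite lift0.
rewrite -!odflt_onth -hi odflt_onth remE -sj -/j nth_cat size_take h2 ltn_ord.
rewrite odflt_onth /= /bump; case: (leqP j (u i)) => c /=.
  by rewrite nth_drop add1n addSn subnKC.
by rewrite add0n nth_take.
Qed.

Lemma par_trans w w' w'' : uniq w -> perm_eq w w' -> perm_eq w' w'' ->
  par w w'' = par w w' (+) par w' w''.
Proof.
move=> uw p1 p2; have uw' : uniq w' by rewrite -(perm_uniq p1).
have uw'' : uniq w'' by rewrite -(perm_uniq p2).
have [s hs] := perm_eq_permutes p1 erefl.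
have [t ht] := perm_eq_permutes p2 (esym (perm_size p1)).
rewrite -(permutes_par uw' hs) -(permutes_par uw'' ht).
by rewrite -(permutes_par uw'' (permutesM hs ht)) odd_permM.
Qed.

Lemma par_refl w : par w w = false.
Proof. by elim: w => //= e w IH; rewrite !eqxx. Qed.

Lemma par_sym w w' : uniq w -> perm_eq w w' -> par w w' = par w' w.
Proof.
move=> uw p; have p' : perm_eq w' w by rewrite perm_sym.
have := par_trans uw p p'; rewrite par_refl => /esym/eqP.
by rewrite addbC; case: (par _ _); case: (par _ _).
Qed.

Lemma par_cons e w w' : par (e :: w) (e :: w') = par w w'.
Proof. by rewrite /= !eqxx. Qed.

Lemma par_rem e w : par (e :: rem e w) w = odd (index e w).
Proof. by rewrite /= par_refl addbF. Qed.

Lemma par_catl u w w' : par (u ++ w) (u ++ w') = par w w'.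
Proof. by elim: u => //= e u IH; rewrite !eqxx. Qed.

Lemma rem_cat (x : A) s1 s2 :
  rem x (s1 ++ s2) = if x \in s1 then rem x s1 ++ s2 else s1 ++ rem x s2.
Proof.
elim: s1 => //= y s1 ->; rewrite in_cons [x == y]eq_sym.
by case: eqP => //= _; case: (x \in s1).
Qed.

Lemma par_catr u u' w : perm_eq u u' -> par (u ++ w) (u' ++ w) = par u u'.
Proof.
elim: u u' => [|e u IH] u' p /=.
  have -> : u' = [::] by apply: size0nil; rewrite -(perm_size p).
  by rewrite par_refl.
have eu' : e \in u' by rewrite -(perm_mem p) mem_head.
rewrite index_cat eu' rem_cat eu' IH // -(perm_cons e).
by rewrite (perm_trans p) // perm_to_rem.
Qed.

Lemma par_swap u v : uniq (u ++ v) ->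
  par (u ++ v) (v ++ u) = odd (size u) && odd (size v).
Proof.
elim: u => [|e u IH] /=; first by rewrite cats0 par_refl.
case/andP => nin uu; have nv : e \notin v.
  by apply: contra nin; rewrite mem_cat orbC => ->.
rewrite index_cat (negbTE nv) /= eqxx addn0 rem_cat (negbTE nv) /= eqxx IH //.
by case: (odd _); case: (odd _).
Qed.

Lemma par_osign (k : fieldType) w w' : uniq w -> perm_eq w w' ->
  osign k w w' = (-1) ^+ par w w'.
Proof.
move=> uw p; have uw' : uniq w' by rewrite -(perm_uniq p).
rewrite /osign; case: pickP => [s hs|]; first by rewrite (permutes_par uw' hs).
by have [s hs] := perm_eq_permutes p erefl => /(_ s); rewrite hs.
Qed.

End Permutes.

Section ParMap.
Variables (A B : eqType) (f : A -> B).

Lemma par_map w w' : perm_eq w w' -> uniq w -> uniq (map f w) ->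
  par (map f w) (map f w') = par w w'.
Proof.
move=> p uw ufw; have [s hs] := perm_eq_permutes p erefl.
rewrite -(permutes_par _ hs) -?(perm_uniq p) //.
by rewrite -(permutes_par _ (permutes_map f hs)) // -(perm_uniq (perm_map f p)).
Qed.
End ParMap.

(** * Trees as sets of edges *)

Section TreeTheory.
Variables (C : finType) (X : seq C) (x : C).
Implicit Types (T : {set edge X}) (e f g v : edge X) (i : 'I_(size X)).

Lemma inputsP T v e :
  reflect [/\ e \in T, e.1 \proper v.1
            & forall f, f \in T -> e.1 \proper f.1 -> f.1 \proper v.1 -> False]
          (e \in inputs T v).
Proof.
rewrite inE; apply: (iffP and3P) => -[h1 h2 h3]; split=> //.
  by move=> f fT ef fv; move/forall_inP/(_ f fT): h3; rewrite ef fv.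
by apply/forall_inP => f fT; apply/negP => /andP[]; apply: h3.
Qed.

Lemma in_vertices T v : (v \in vertices T) = (v \in T) && (1 < #|v.1|)%N.
Proof. by rewrite inE. Qed.

Lemma in_nonroot T v : (v \in nonroot T) = (v \in T) && (v.1 != setT).
Proof. by rewrite inE. Qed.

Lemma in_internal T v :
  (v \in internal T) = [&& v \in T, (1 < #|v.1|)%N & v.1 != setT].
Proof. by rewrite inE in_vertices in_nonroot; case: (v \in T); case: (1 < _)%N. Qed.

Lemma internal_vertex T e : e \in internal T -> e \in vertices T.
Proof. by rewrite inE => /andP[]. Qed.

Lemma vertex_in T e : e \in vertices T -> e \in T.
Proof. by rewrite inE => /andP[]. Qed.

Lemma internal_in T e : e \in internal T -> e \in T.
Proof. by move/internal_vertex/vertex_in. Qed.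

Lemma inputs_in T v e : e \in inputs T v -> e \in T.
Proof. by case/inputsP. Qed.

Lemma inputs_nonroot T v e : e \in inputs T v -> e \in nonroot T.
Proof.
case/inputsP => eT ev _; rewrite in_nonroot eT; apply: contraTneq ev => ->.
by rewrite properE subsetT andbF.
Qed.

Lemma inputs_neq T v e : e \in inputs T v -> e != v.
Proof. by case/inputsP => _ ev _; apply: contraTneq ev => ->; rewrite properxx. Qed.

Section OneTree.
Variable T : {set edge X}.
Hypothesis treeT : is_tree x T.

Lemma root_in : root_edge X x \in T.
Proof. by case/and4P: treeT. Qed.

Lemma leaf_in i : leaf_edge i \in T.
Proof. by case/and4P: treeT => _ /forallP. Qed.

Lemma tree_neq0 e : e \in T -> exists i, i \in e.1.
Proof. by case/and4P: treeT => _ _ /forall_inP h _ /h /set0Pn. Qed.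

Lemma tree_cmp e f i : e \in T -> f \in T -> i \in e.1 -> i \in f.1 ->
  [\/ e = f, e.1 \proper f.1 | f.1 \proper e.1].
Proof.
case/and4P: treeT => _ _ _ /forall_inP h eT fT ie jf.
case/or4P: (forall_inP (h e eT) f fT) => [/eqP|||/pred0P/(_ i)/=].
- by constructor 1.
- by constructor 2.
- by constructor 3.
- by rewrite ie jf.
Qed.

Lemma tree_inj e f : e \in T -> f \in T -> e.1 = f.1 -> e = f.
Proof.
move=> eT fT ef; have [i ie] := tree_neq0 eT.
have jf : i \in f.1 by rewrite -ef.
by case: (tree_cmp eT fT ie jf) => //; rewrite ef properxx.
Qed.

Lemma tree_disjoint e f : e \in T -> f \in T ->
  ~~ (e.1 \subset f.1) -> ~~ (f.1 \subset e.1) -> [disjoint e.1 & f.1].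
Proof.
case/and4P: treeT => _ _ _ /forall_inP h eT fT ef fe.
case/or4P: (forall_inP (h e eT) f fT) => // [/eqP efe|/proper_sub|/proper_sub].
- by rewrite efe subxx in ef.
- by rewrite (negbTE ef).
- by rewrite (negbTE fe).
Qed.

Lemma parent_exists e : e \in nonroot T -> exists2 v, v \in vertices T & e \in inputs T v.
Proof.
rewrite in_nonroot => /andP[eT e1].
have P0 : (root_edge X x \in T) && (e.1 \proper (root_edge X x).1).
  by rewrite root_in properEneq e1 subsetT.
case: (arg_minnP (P := fun f => (f \in T) && (e.1 \proper f.1))
                (fun f => #|f.1|) P0) => v /andP[vT ev] vmin.
have [i ie] := tree_neq0 eT.
exists v; last first.
  apply/inputsP; split=> // f fT ef fv.
  have := vmin f; rewrite fT ef => /(_ isT); apply/negP.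
  by rewrite -ltnNge proper_card.
rewrite in_vertices vT; apply: leq_ltn_trans (proper_card ev).
by rewrite card_gt0; apply/set0Pn; exists i.
Qed.

Lemma parent_unique e v v' : v \in T -> v' \in T ->
  e \in inputs T v -> e \in inputs T v' -> v = v'.
Proof.
move=> vT v'T /inputsP[eT ev h] /inputsP[_ ev' h'].
have [i ie] := tree_neq0 eT.
have iv := subsetP (proper_sub ev) _ ie; have iv' := subsetP (proper_sub ev') _ ie.
case: (tree_cmp vT v'T iv iv') => // c; first by case: (h' v vT ev c).
by case: (h v' v'T ev' c).
Qed.

(** A maximal edge of the tree among those between [g] and [v] is an input
    of [v]. *)
Lemma below_input g v : g \in T -> g.1 \proper v.1 ->
  exists2 f, f \in inputs T v & g.1 \subset f.1.
Proof.
move=> gT gv.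
have P0 : [&& g \in T, g.1 \subset g.1 & g.1 \proper v.1] by rewrite gT subxx.
case: (arg_maxnP (P := fun f => [&& f \in T, g.1 \subset f.1 & f.1 \proper v.1])
                (fun f => #|f.1|) P0) => f /and3P[fT gf fv] fmax.
exists f => //; apply/inputsP; split=> // h hT fh hv.
have := fmax h; rewrite hT hv (subset_trans gf (proper_sub fh)) => /(_ isT).
by apply/negP; rewrite -ltnNge proper_card.
Qed.

Lemma inputs_disjoint v e f : e \in inputs T v -> f \in inputs T v ->
  e != f -> [disjoint e.1 & f.1].
Proof.
move=> /inputsP[eT ev eh] /inputsP[fT fv fh] nef.
apply/pred0P => i /=; apply/negP => /andP[ie jf].
case: (tree_cmp eT fT ie jf) => [ef|c|c]; first by rewrite ef eqxx in nef.
  exact: eh fT c fv.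
exact: fh eT c ev.
Qed.

Lemma cover_input v i : v \in vertices T -> i \in v.1 ->
  exists2 f, f \in inputs T v & i \in f.1.
Proof.
rewrite in_vertices => /andP[vT v1] iv.
have pr : (leaf_edge i).1 \proper v.1.
  by rewrite properEcard sub1set iv cards1.
have [f fv if1] := below_input (leaf_in i) pr.
by exists f => //; rewrite sub1set in if1.
Qed.

Lemma inputs_gt1 v : v \in vertices T -> (1 < #|inputs T v|)%N.
Proof.
move=> vV; have := vV; rewrite in_vertices => /andP[vT v1].
have [i iv] := tree_neq0 vT; have [f fv jf] := cover_input vV iv.
have /inputsP[_ /properP[_ [j jv njf]] _] := fv.
have [h hv jh] := cover_input vV jv.
rewrite (cardsD1 f) fv ltnS card_gt0; apply/set0Pn; exists h.
by apply/setD1P; split=> //; apply: contraNneq njf => <-.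
Qed.

Lemma parent_internal e : e \in internal T ->
  exists2 v, v \in vertices T & e \in inputs T v.
Proof. by rewrite inE => /andP[_ /parent_exists]. Qed.

(** As a tree is the set of its edges, contracting [e] amounts to erasing
    it: the inputs of [e] become inputs of the vertex below. *)
Section Erase.
Variable e : edge X.
Hypothesis eI : e \in internal T.

Let eT : e \in T. Proof. exact: internal_in. Qed.

Lemma tree_erase : is_tree x (T :\ e).
Proof.
move: eI; rewrite in_internal => /and3P[_ e1 e2].
case/and4P: treeT => h1 /forallP h2 /forall_inP h3 /forall_inP h4; apply/and4P; split.
- by rewrite in_setD1 h1 andbT; apply: contraNneq e2 => <-.
- apply/forallP => i; rewrite in_setD1 h2 andbT.
  by apply: contraTneq e1 => <-; rewrite cards1.
- by apply/forall_inP => f /setD1P[_ /h3].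
- apply/forall_inP => f /setD1P[_ fT]; apply/forall_inP => g /setD1P[_ gT].
  exact: (forall_inP (h4 f fT)).
Qed.

Lemma vertices_erase : vertices (T :\ e) = vertices T :\ e.
Proof. by apply/setP => f; rewrite !inE andbA. Qed.

Lemma nonroot_erase : nonroot (T :\ e) = nonroot T :\ e.
Proof. by apply/setP => f; rewrite !inE andbA. Qed.

Lemma internal_erase : internal (T :\ e) = internal T :\ e.
Proof. by apply/setP => f; rewrite !inE; case: (f == e). Qed.

Lemma inputs_erase v : v \in T -> inputs (T :\ e) v =
  if e \in inputs T v then (inputs T v :\ e) :|: inputs T e else inputs T v.
Proof.
move=> vT; apply/setP => f; apply/inputsP/idP.
- case=> /setD1P[fe fT] fv h.
  have key : ~~ (f.1 \proper e.1) || ~~ (e.1 \proper v.1) -> f \in inputs T v.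
    move=> nb; apply/inputsP; split=> // g gT fg gv.
    have [ge|ge] := eqVneq g e; first by move: nb; rewrite -ge fg gv.
    by apply: (h g) => //; apply/setD1P.
  case: ifP => ev.
    rewrite in_setU in_setD1 fe /=.
    have [nb|] := boolP (~~ (f.1 \proper e.1) || ~~ (e.1 \proper v.1)).
      by rewrite key.
    rewrite negb_or !negbK => /andP[fpe epv]; apply/orP; right.
    apply/inputsP; split=> // g gT fg ge; apply: (h g) => //.
      by apply/setD1P; split=> //; apply: contraTneq ge => ->; rewrite properxx.
    exact: proper_trans ge epv.
  apply: key; apply/negP => /negP; rewrite negb_or !negbK => /andP[fpe epv].
  move/negP: ev; apply; apply/inputsP; split=> // g gT eg gv; apply: (h g) => //.
    by apply/setD1P; split=> //; apply: contraTneq eg => ->; rewrite properxx.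
  exact: proper_trans fpe eg.
- case: ifP => ev; last first.
    case/inputsP => fT fv h; split=> //.
      apply/setD1P; split=> //; apply/eqP => fe; move/negP: ev; apply.
      by rewrite -fe; apply/inputsP.
    by move=> g /setD1P[_ gT]; exact: h.
  have /inputsP[_ epv eh] := ev.
  case/setUP => [/setD1P[fe /inputsP[fT fv h]]|/inputsP[fT fpe h]].
    by split=> //; [apply/setD1P | move=> g /setD1P[_ gT]; exact: h].
  split; last 1 first.
  - move=> g /setD1P[gne gT] fg gv; have [i jf] := tree_neq0 fT.
    have ie := subsetP (proper_sub fpe) _ jf; have ig := subsetP (proper_sub fg) _ jf.
    case: (tree_cmp gT eT ig ie) => [ge|c|c]; first by rewrite ge eqxx in gne.
      exact: h gT fg c.
    exact: eh gT c gv.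
  - by apply/setD1P; split=> //; apply: contraTneq fpe => ->; rewrite properxx.
  - exact: proper_trans fpe epv.
Qed.

Lemma inputs_disj v : e \in inputs T v -> [disjoint inputs T v & inputs T e].
Proof.
case/inputsP => _ epv _; apply/pred0P => f /=; apply/negP => /andP[/inputsP[fT fv h]].
by case/inputsP => _ fe _; apply: (h e).
Qed.

End Erase.

(** Every edge but the root is an input of exactly one vertex. *)
Lemma sum_inputs : (\sum_(v in vertices T) #|inputs T v|)%N = #|nonroot T|.
Proof.
rewrite -sum1_card (eq_bigr (fun v => \sum_(e in nonroot T | e \in inputs T v) 1%N)).
  rewrite (exchange_big_dep (mem (nonroot T))) //=; last by move=> ? ? _ /andP[].
  apply: eq_bigr => e eN; have [v vV ev] := parent_exists eN.
  rewrite (big_pred1 v) // => w /=; rewrite eN /=; apply/andP/eqP => [[wV ew]|->//].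
  exact: (parent_unique (vertex_in wV) (vertex_in vV) ew ev).
move=> v vV; rewrite -sum1_card; apply: eq_bigl => e.
by apply/idP/andP => [ev|[]//]; split=> //; apply: inputs_nonroot ev.
Qed.

Lemma leaf_edge_inj : injective (@leaf_edge C X).
Proof. by move=> i j [/set1_inj]. Qed.

Lemma leafP e : e \in T -> (1 < #|e.1|)%N = false -> exists i, e = leaf_edge i.
Proof.
move=> eT e1; have [i ie] := tree_neq0 eT; exists i.
apply: tree_inj (leaf_in i) _ => //; apply/eqP; rewrite eq_sym eqEcard sub1set ie.
by rewrite cards1 leqNgt e1.
Qed.

Hypothesis X1 : (1 < size X)%N.

Lemma leaf_neqT i : (leaf_edge i).1 != setT.
Proof.
by apply/eqP => /(congr1 (fun A : {set _} => #|A|)); rewrite cards1 cardsT card_ord => h;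
   move: X1; rewrite -h.
Qed.

Lemma root_vertex : root_edge X x \in vertices T.
Proof. by rewrite in_vertices root_in cardsT card_ord. Qed.

Lemma card_nonroot : #|nonroot T| = (#|internal T| + size X)%N.
Proof.
rewrite -(cardsID (vertices T)) setIC; congr addn.
rewrite -[RHS]card_ord -(card_imset predT leaf_edge_inj); apply: eq_card => e.
rewrite in_setD in_nonroot in_vertices; apply/idP/imsetP => [|[i _ ->]].
  by case: (e \in T) (@leafP e) => //= /(_ isT) h /andP[/negbTE /h [i ->] _]; exists i.
by rewrite leaf_in cards1 /= leaf_neqT.
Qed.

Lemma card_vertices : #|vertices T| = #|internal T|.+1.
Proof.
rewrite (cardsD1 (root_edge X x)) root_vertex; congr (_.+1); apply: eq_card => e.
rewrite in_setD1 in_vertices in_internal; case eT: (e \in T); rewrite ?andbF //=.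
rewrite andbC; congr (_ && _); apply/idP/idP; apply: contraNneq => e1; last by rewrite e1.
by apply/eqP; apply: tree_inj => //; apply: root_in.
Qed.

(** Both sides count edges: internal edges and leaves are the inputs of the
    vertices, and all vertices but the root are internal edges. *)
Lemma degree_defect :
  ((\sum_(v in vertices T) (#|inputs T v| - 2)) + #|internal T| + 2)%N = size X.
Proof.
have h : (\sum_(v in vertices T) (#|inputs T v| - 2) + \sum_(v in vertices T) 2
          = #|nonroot T|)%N.
  rewrite -sum_inputs -big_split /=; apply: eq_bigr => v vV.
  by rewrite subnK // inputs_gt1.
move: h; rewrite sum_nat_const card_vertices card_nonroot => h.
by apply/(@addnI #|internal T|); rewrite -h; lia.
Qed.

End OneTree.

Lemma size_gt0_tree T : is_tree x T -> (0 < size X)%N.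
Proof.
move=> tT; have [i _] := tree_neq0 tT (root_in tT).
exact: leq_ltn_trans (ltn_ord i).
Qed.

End TreeTheory.

(** * Grafting of lists *)

Section Splice.
Variable A : eqType.
Implicit Types (l m : seq A) (e f : A).

Lemma splice_cat (Y l m : seq A) e : splice (l ++ e :: m) (size l) Y = l ++ Y ++ m.
Proof. by rewrite /splice take_size_cat // -cat_rcons drop_size_cat // size_rcons. Qed.

Lemma map_splice (B : Type) (h : A -> B) l i m :
  map h (splice l i m) = splice (map h l) i (map h m).
Proof. by rewrite /splice !map_cat map_take map_drop. Qed.

Lemma split_index l e : e \in l -> l = take (index e l) l ++ e :: drop (index e l).+1 l.
Proof. by move=> el; rewrite -[LHS](cat_take_drop (index e l)) (drop_nth e) ?index_mem // nth_index. Qed.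

Lemma size_take_index l e : size (take (index e l) l) = index e l.
Proof. by rewrite size_take; case: ltnP (index_size e l) => // h1 h2; apply/eqP; rewrite eqn_leq h1 h2. Qed.

Lemma splice_rem l e m : e \in l -> perm_eq (splice l (index e l) m) (rem e l ++ m).
Proof. by move=> _; rewrite remE /splice -catA perm_cat2l perm_catC. Qed.

Lemma mem_splice l e m f : uniq l -> e \in l ->
  (f \in splice l (index e l) m) = ((f != e) && (f \in l)) || (f \in m).
Proof. by move=> ul el; rewrite (perm_mem (splice_rem m el)) mem_cat mem_rem_uniq. Qed.

Lemma index_splice_in l e m f : e \in l -> f \notin l -> f \in m ->
  index f (splice l (index e l) m) = (index e l + index f m)%N.
Proof.
move=> el fl fm; rewrite /splice index_cat size_take_index index_cat fm.
by case: ifP => // /mem_take; rewrite (negbTE fl).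
Qed.

Lemma index_splice_out l e m f : uniq l -> e \in l -> f \in l -> f != e -> f \notin m ->
  index f (splice l (index e l) m) = outer_pos (index e l) (size m) (index f l).
Proof.
move=> ul el fl fe fm; rewrite /splice.
have := split_index el; have := size_take_index l e.
set a := take _ _; set b := drop _ _ => sa El.
have -> : index f l = index f (a ++ e :: b) by rewrite {1}El.
rewrite !index_cat (negbTE fm) /outer_pos -sa.
case fa: (f \in a); first by rewrite index_mem fa.
have efF : (e == f) = false by rewrite eq_sym (negbTE fe).
by rewrite /= efF; case: ltnP; lia.
Qed.

Lemma splice_splice_in l e m f n : e \in l -> f \in m ->
  splice (splice l (index e l) m) (index e l + index f m) n =
  splice l (index e l) (splice m (index f m) n).
Proof.
move=> el fm; set b := drop (index e l).+1 l.
have -> : splice l (index e l) m =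
          (take (index e l) l ++ take (index f m) m) ++ f :: (drop (index f m).+1 m ++ b).
  by rewrite /splice {1}(split_index fm) -!catA /=.
have -> : (index e l + index f m)%N =
          size (take (index e l) l ++ take (index f m) m).
  by rewrite size_cat !size_take_index.
rewrite splice_cat.
by rewrite /splice -!catA.
Qed.

Lemma splice_splice_out l e m f n : (index e l < index f l)%N -> f \in l ->
  splice (splice l (index e l) m) (index f l + size m).-1 n =
  splice (splice l (index f l) n) (index e l) m.
Proof.
move=> ef fl.
have el : e \in l by rewrite -index_mem (ltn_trans ef) // index_mem.
have sa := size_take_index l e; have El := split_index el.
set a := take _ _ in sa El; set b := drop _ _ in El.
have lb : (index f l - (size a).+1 < size b)%N.
  by move: fl; rewrite -index_mem {2}El size_cat /= sa; lia.
have fb : nth e b (index f l - (size a).+1) = f.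
  by rewrite nth_drop -sa subnKC ?sa // nth_index.
have Eb := cat_take_drop (index f l - (size a).+1) b.
rewrite (drop_nth e lb) fb in Eb; set b1 := take _ b in Eb; set b2 := drop _ b in Eb.
have sb1 : size b1 = (index f l - (size a).+1)%N by rewrite size_takel // ltnW.
have idxf : index f l = size (a ++ e :: b1) by rewrite size_cat /= sb1 sa; lia.
have El2 : l = (a ++ e :: b1) ++ f :: b2 by rewrite -catA /= Eb.
have -> : splice l (index f l) n = a ++ e :: (b1 ++ n ++ b2).
  by rewrite {1}El2 idxf splice_cat -catA.
rewrite -[index e l]sa splice_cat.
have -> : splice l (size a) m = (a ++ m ++ b1) ++ f :: b2.
  by rewrite {1}El splice_cat -Eb -!catA.
have -> : (index f l + size m).-1 = size (a ++ m ++ b1).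
  by rewrite idxf !size_cat /=; lia.
by rewrite splice_cat -!catA.
Qed.

End Splice.

Section SpliceFin.
Variable A : finType.
Implicit Types (l m : seq A) (e f : A).

Lemma uniq_splice l e m : uniq l -> uniq m -> e \in l -> [disjoint l & m] ->
  uniq (splice l (index e l) m).
Proof.
move=> ul um el dlm; rewrite (perm_uniq (splice_rem m el)) cat_uniq rem_uniq // um andbT.
by apply/hasPn => f fm; apply/negP => /mem_rem fl; move/pred0P/(_ f): dlm => /=; rewrite fl fm.
Qed.

(** Reading the operations off lists of distinct edges turns the arithmetic
    of block permutations into the comparison of positions in two lists. *)
Lemma block_perm_splice e l l1 m m1 nl nm np (i : 'I_nl) (s : 'S_nl) (t : 'S_nm) (u : 'S_np) :
  uniq l -> uniq m -> [disjoint l & m] -> e \in l -> i = index e l :> nat ->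
  permutes s l l1 -> permutes t m m1 ->
  permutes u (splice l (index e l) m) (splice l1 (index e l1) m1) ->
  block_perm i s t u /\ s i = index e l1 :> nat.
Proof.
move=> ul um dis el ei ps pt pu.
have pl := permutes_perm_eq ps; have pm := permutes_perm_eq pt.
have ul1 : uniq l1 by rewrite -(perm_uniq pl).
have um1 : uniq m1 by rewrite -(perm_uniq pm).
have el1 : e \in l1 by rewrite -(perm_mem pl).
have dis1 : [disjoint l1 & m1].
  by apply/pred0P => f /=; move/pred0P/(_ f): dis; rewrite /= (perm_mem pl) (perm_mem pm).
have /permutesP[sl sl1 hs] := ps; have /permutesP[sm sm1 ht] := pt.
have /permutesP[su _ _] := pu.
have usp := uniq_splice ul1 um1 el1 dis1.
have usp0 := uniq_splice ul um el dis.
have onl (k : 'I_nl) : exists f, onth l k = Some f.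
  by case E: (onth l k) => [f|]; [exists f | move: (onthNE l k); rewrite E /= sl leqNgt ltn_ord].
have onm (k : 'I_nm) : exists f, onth m k = Some f.
  by case E: (onth m k) => [f|]; [exists f | move: (onthNE m k); rewrite E /= sm leqNgt ltn_ord].
have onI (w : seq A) (f : A) : f \in w -> onth w (index f w) = Some f.
  by move=> fw; rewrite onthE (nth_map f) ?index_mem // nth_index.
have idx (w : seq A) (f : A) k : uniq w -> onth w k = Some f -> index f w = k /\ f \in w.
  move=> uw hk; have kw : (k < size w)%N by rewrite -onthTE hk.
  by have <- := onth_nth f _ _ _ hk; rewrite index_uniq ?mem_nth.
have si : s i = index e l1 :> nat.
  by apply: (permutes_index ul1 ps); rewrite ei onI.
split=> //; split.
- move=> k q ki eq; have [f hf] := onl k; have [kf fl] := idx _ _ _ ul hf.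
  have fe : f != e by apply: contraNneq ki => fe; rewrite -val_eqE /= -kf fe ei.
  have fm : f \notin m by apply/negP => fm; move/pred0P/(_ f): dis; rewrite /= fl fm.
  have fl1 : f \in l1 by rewrite -(perm_mem pl).
  have fm1 : f \notin m1 by rewrite -(perm_mem pm).
  have qf : q = index f (splice l (index e l) m) :> nat.
    by rewrite index_splice_out // kf eq ei sm.
  rewrite (permutes_index usp pu (x := f)); last first.
    by rewrite qf onI // mem_splice // fe fl.
  by rewrite index_splice_out // sm1 -si (permutes_index ul1 ps hf).
- move=> j q eq; have [f hf] := onm j; have [jf fm] := idx _ _ _ um hf.
  have fl : f \notin l by apply/negP => fl; move/pred0P/(_ f): dis; rewrite /= fl fm.
  have fm1 : f \in m1 by rewrite -(perm_mem pm).
  have fl1 : f \notin l1 by rewrite -(perm_mem pl).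
  have qf : q = index f (splice l (index e l) m) :> nat.
    by rewrite index_splice_in // jf eq ei.
  rewrite (permutes_index usp pu (x := f)); last first.
    by rewrite qf onI // mem_splice // fm orbT.
  by rewrite index_splice_in // -si (permutes_index um1 pt hf).
Qed.

End SpliceFin.

(** * Contraction of decorated trees *)

Notation cols l := [seq e.2 | e <- l].

Section Contraction.
Variables (C : finType) (k : fieldType) (P : coperad C k) (X : seq C) (x : C).
Local Notation edge := (edge X).
Local Notation decoration := (decoration P X).
Implicit Types (T : {set edge}) (e f v : edge) (a b : decoration).

Definition agree (V : {set edge}) a b := forall v, v \in V -> a v = b v.

Lemma vdec_eta v (d : vdec P v) : vdec_op (tagged d) = d.
Proof. by case: d. Qed.

Lemma labeledP T a :
  reflect (forall v, v \in vertices T -> perm_eq (tag (a v)) (enum (inputs T v))) (labeled T a).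
Proof. exact: forall_inP. Qed.

Lemma labeled_agree T a b : agree (vertices T) a b -> labeled T a = labeled T b.
Proof. by move=> ab; apply/labeledP/labeledP => h v vV; [rewrite -ab|rewrite ab] => //; apply: h. Qed.

Lemma labeled_mem T a v f : labeled T a -> v \in vertices T ->
  (f \in tag (a v)) = (f \in inputs T v).
Proof. by move=> /labeledP h /h /perm_mem ->; rewrite mem_enum. Qed.

Lemma labeled_uniq T a v : labeled T a -> v \in vertices T -> uniq (tag (a v)).
Proof. by move=> /labeledP h /h /perm_uniq ->; rewrite enum_uniq. Qed.

Lemma grafts_splice l (e : edge) m : e \in l ->
  grafts (cols l) (index e l) e.2 (cols m) (cols (splice l (index e l) m)).
Proof.
move=> el; rewrite /grafts map_splice eqxx andbT onthE -map_comp (nth_map e) ?index_mem //=.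
by rewrite nth_index.
Qed.

Lemma contract_in e a v : e \in tag (a v) -> contract e a v =
  vdec_op (ccomp (cols (splice (tag (a v)) (index e (tag (a v))) (tag (a e))))
             (index e (tag (a v))) (tagged (a v)) (tagged (a e))).
Proof. by rewrite /contract => ->. Qed.

Lemma contract_op e a v l (p : P (cols l) v.2) m (q : P (cols m) e.2) :
  a v = vdec_op p -> a e = vdec_op q -> e \in l ->
  contract e a v = vdec_op (ccomp (cols (splice l (index e l) m)) (index e l) p q).
Proof. by rewrite /contract => -> -> /= ->. Qed.

Lemma contract_out e a v : e \notin tag (a v) -> contract e a v = a v.
Proof. by rewrite /contract => /negbTE ->. Qed.

Lemma contract_eq e a b v : a v = b v -> a e = b e -> contract e a v = contract e b v.
Proof. by rewrite /contract => -> ->. Qed.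

Lemma tag_contract e a v : tag (contract e a v) =
  if e \in tag (a v) then splice (tag (a v)) (index e (tag (a v))) (tag (a e)) else tag (a v).
Proof. by rewrite /contract; case: ifP. Qed.

Section OneTree.
Variable T : {set edge}.
Hypothesis treeT : is_tree x T.

Lemma contract_labeled e a : e \in internal T -> labeled T a -> labeled (T :\ e) (contract e a).
Proof.
move=> eI la; apply/labeledP => v; rewrite vertices_erase => /setD1P[ve vV].
have eV := internal_vertex eI.
rewrite tag_contract (labeled_mem _ la vV) (inputs_erase treeT eI (vertex_in vV)).
case: ifP => ev; last exact: (labeledP _ _ la).
have ela : e \in tag (a v) by rewrite (labeled_mem _ la vV).
apply: uniq_perm; rewrite ?enum_uniq //.
  apply: uniq_splice => //; rewrite ?(labeled_uniq la) //.
  apply/pred0P => f /=; rewrite !(labeled_mem _ la) //.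
  by move/pred0P: (inputs_disj eI ev) => /(_ f).
move=> f; rewrite mem_splice ?(labeled_uniq la) // !(labeled_mem _ la) //.
by rewrite mem_enum in_setU in_setD1.
Qed.

Lemma contract_agree e a b : e \in internal T -> agree (vertices T) a b ->
  agree (vertices (T :\ e)) (contract e a) (contract e b).
Proof.
move=> eI ab v; rewrite vertices_erase => /setD1P[_ vV].
by rewrite /contract (ab v) // (ab e) // internal_vertex.
Qed.

(** Two internal edges may be consecutive or inputs of the same vertex, and
    these cases are the two associativity axioms of an operad; otherwise the
    contractions do not interact.  Only the vertices that survive both
    contractions matter. *)
Lemma contractC e f a : e \in internal T -> f \in internal T -> e != f -> labeled T a ->
  agree (vertices (T :\ e :\ f)) (contract f (contract e a)) (contract e (contract f a)).
Proof.
suff main e' f' : e' \in internal T -> f' \in internal T -> e' != f' -> labeled T a ->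
    forall v, v \in vertices T -> e' \in tag (a v) ->
    (f' \in tag (a v) -> (index e' (tag (a v)) < index f' (tag (a v)))%N) ->
    contract f' (contract e' a) v = contract e' (contract f' a) v.
  move=> eI fI ef la v; rewrite vertices_erase ?vertices_erase => /setD1P[vf /setD1P[ve vV]].
  have [ev|ev] := boolP (e \in tag (a v)); have [fv|fv] := boolP (f \in tag (a v)).
  - case: (ltngtP (index e (tag (a v))) (index f (tag (a v)))) => c.
    + by apply: main.
    + by apply: esym; apply: main => //; rewrite eq_sym.
    + by move/(congr1 (fun i => nth e (tag (a v)) i)): c; rewrite !nth_index // => c; rewrite c eqxx in ef.
  - by apply: main => //; rewrite (negbTE fv).
  - by apply: esym; apply: main => //; [rewrite eq_sym|rewrite (negbTE ev)].
  - by rewrite !contract_out ?tag_contract ?(negbTE ev) ?(negbTE fv).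
move=> {e f}; move: e' f' => e f eI fI ef la v vV ev lt.
have eV := internal_vertex eI; have fV := internal_vertex fI.
have fe : f != e by rewrite eq_sym.
have uV u w g : u \in vertices T -> w \in vertices T -> u != w ->
    g \in tag (a u) -> g \in tag (a w) -> False.
  move=> uV wV uw; rewrite !(labeled_mem _ la) // => gu gw.
  by move/eqP: uw; apply; apply: (parent_unique treeT (vertex_in uV) (vertex_in wV) gu gw).
have selfF u : u \in vertices T -> u \in tag (a u) = false.
  move=> uVV; rewrite (labeled_mem _ la) //.
  by apply/negP => /inputs_neq; rewrite eqxx.
have ne_v : v != e by apply: contraTneq ev => ->; rewrite selfF.
have lv := labeled_uniq la vV; have le := labeled_uniq la eV.
have [fv|fv] := boolP (f \in tag (a v)).
  (* both edges are inputs of v *)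
  have nfe : f \notin tag (a e) by apply/negP => h; apply: (uV v e f).
  have ne_v' : v != f by apply: contraTneq fv => ->; rewrite selfF.
  have nef : e \notin tag (a f) by apply/negP => h; apply: (uV v f e).
  have cef : contract e a f = a f by rewrite contract_out.
  have cfe : contract f a e = a e by rewrite contract_out.
  have i1 : index f (splice (tag (a v)) (index e (tag (a v))) (tag (a e))) =
            (index f (tag (a v)) + size (tag (a e))).-1.
    by rewrite index_splice_out // /outer_pos ltnNge ltnW // lt.
  have i2 : index e (splice (tag (a v)) (index f (tag (a v))) (tag (a f))) =
            index e (tag (a v)).
    by rewrite index_splice_out // /outer_pos lt.
  have E1 := contract_op (esym (vdec_eta (a v))) (esym (vdec_eta (a e))) ev.
  have E2 := contract_op (esym (vdec_eta (a v))) (esym (vdec_eta (a f))) fv.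
  rewrite (contract_op E1 (etrans cef (esym (vdec_eta _)))); last first.
    by rewrite mem_splice // fe fv.
  rewrite (contract_op E2 (etrans cfe (esym (vdec_eta _)))); last first.
    by rewrite mem_splice // ef ev.
  rewrite i1 i2 splice_splice_out ?lt //; congr vdec_op.
  have sz : size (tag (a e)) = size (cols (tag (a e))) by rewrite size_map.
  rewrite [in LHS]sz; apply: ccompAC; [exact: lt|exact: grafts_splice| |exact: grafts_splice|].
  - rewrite -sz -i1 -splice_splice_out ?lt // -i1; apply: grafts_splice.
    by rewrite mem_splice // fe fv.
  - have h : e \in splice (tag (a v)) (index f (tag (a v))) (tag (a f)).
      by rewrite mem_splice // ef ev.
    by have := grafts_splice (tag (a e)) h; rewrite i2.
have [fae|fae] := boolP (f \in tag (a e)).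
  (* f is an input of e *)
  have i1 : index f (splice (tag (a v)) (index e (tag (a v))) (tag (a e))) =
            (index e (tag (a v)) + index f (tag (a e)))%N by rewrite index_splice_in.
  have cfv : contract f a v = a v by rewrite contract_out.
  have cef : contract e a f = a f.
    rewrite contract_out //; apply/negP; rewrite (labeled_mem _ la) // => /inputsP[_ h _].
    move: fae; rewrite (labeled_mem _ la) // => /inputsP[_ /proper_trans/(_ h)].
    by rewrite properxx.
  have E1 := contract_op (esym (vdec_eta (a v))) (esym (vdec_eta (a e))) ev.
  have E2 := contract_op (esym (vdec_eta (a e))) (esym (vdec_eta (a f))) fae.
  rewrite (contract_op E1 (etrans cef (esym (vdec_eta _)))); last first.
    by rewrite mem_splice // fae orbT.
  rewrite (contract_op (etrans cfv (esym (vdec_eta _))) E2) // i1.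
  rewrite splice_splice_in //; congr vdec_op.
  apply: ccompA; try exact: grafts_splice.
  rewrite -i1 -splice_splice_in // -i1; apply: grafts_splice.
  by rewrite mem_splice // fae orbT.
have E1 : f \notin tag (contract e a v).
  by rewrite tag_contract ev mem_splice // (negbTE fv) (negbTE fae) andbF.
have cfv : contract f a v = a v by rewrite contract_out.
have cfe : contract f a e = a e by rewrite contract_out.
by rewrite (contract_out E1); apply: contract_eq.
Qed.

End OneTree.
End Contraction.

(** * Multilinear forms on decorations *)

Section LinearForms.
Variables (k : fieldType).

Lemma lin0 (U V : lmodType k) (f : U -> V) : linear f -> f 0 = 0.
Proof. by move=> h; have := h (-1) 0 0; rewrite scaler0 addr0 scaleN1r addNr. Qed.

Lemma linZ (U V : lmodType k) (f : U -> V) c u : linear f -> f (c *: u) = c *: f u.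
Proof. by move=> h; have := h c u 0; rewrite !addr0 (lin0 h) addr0. Qed.

Lemma linD (U V : lmodType k) (f : U -> V) u v : linear f -> f (u + v) = f u + f v.
Proof. by move=> h; have := h 1 u v; rewrite !scale1r. Qed.

Lemma lin_sum (U V : lmodType k) (f : U -> V) (I : Type) (r : seq I) (Q : pred I) (F : I -> U) :
  linear f -> f (\sum_(i <- r | Q i) F i) = \sum_(i <- r | Q i) f (F i).
Proof.
move=> h; elim/big_rec2: _ => [|i y z _ <-]; first exact: lin0.
by rewrite linD.
Qed.

Lemma sum_linear (U V : lmodType k) (I : Type) (r : seq I) (Q : pred I) (F : I -> U -> V) :
  (forall i, Q i -> linear (F i)) -> linear (fun u => \sum_(i <- r | Q i) F i u).
Proof.
move=> h c u v; rewrite scaler_sumr -big_split; apply: eq_bigr => i Qi; exact: h.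
Qed.

Lemma scale_linear (U V : lmodType k) (d : k) (F : U -> V) :
  linear F -> linear (fun u => d *: F u).
Proof. by move=> h c u v; rewrite h scalerDr !scalerA mulrC. Qed.

End LinearForms.

Section Forms.
Variables (C : finType) (k : fieldType) (P : coperad C k) (X : seq C) (x : C).
Local Notation edge := (edge X).
Local Notation decoration := (decoration P X).
Implicit Types (T : {set edge}) (e f v : edge) (a b : decoration).

Definition relab v (d d' : vdec P v) : Prop :=
  exists2 s : 'S_(size (tag d)), permutes s (tag d) (tag d')
  & d' = vdec_op (cact (cols (tag d')) s (tagged d)).

Definition relabeling T a b := forall v, v \in vertices T -> relab (a v) (b v).

Lemma relab_refl v (d : vdec P v) : relab d d.
Proof.
exists 1%g; first exact: permutes1.
by rewrite cact1 ?vdec_eta // size_map.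
Qed.

Lemma relab_op v n (s : 'S_n) (l l' : seq edge) (p : P (cols l) v.2) :
  permutes s l l' -> @relab v (vdec_op p) (vdec_op (cact (cols l') s p)).
Proof. by move=> h; have /permutesP[e _ _] := h; subst n; exists s. Qed.

Lemma relabeling_labeled T a b : relabeling T a b -> labeled T a -> labeled T b.
Proof.
move=> h /labeledP la; apply/labeledP => v vV; have [s hs _] := h v vV.
by apply: perm_trans (la v vV); rewrite perm_sym; apply: permutes_perm_eq hs.
Qed.

(** This is the equivariance axiom: the block permutation is the one between
    the two lists of inputs of the contracted vertex. *)
Lemma contract_relab T e a b : is_tree x T -> e \in internal T -> labeled T a ->
  relabeling T a b -> relabeling (T :\ e) (contract e a) (contract e b).
Proof.
move=> tT eI la ab v; rewrite vertices_erase => /setD1P[ve vV].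
have eV := internal_vertex eI.
have [s hs Eb] := ab v vV; have [t ht Ee] := ab e eV.
have tb : (e \in tag (b v)) = (e \in tag (a v)).
  by rewrite (perm_mem (permutes_perm_eq hs)).
have [ev|ev] := boolP (e \in tag (a v)); last first.
  by rewrite !contract_out ?tb //; apply: ab.
have evb : e \in tag (b v) by rewrite tb.
rewrite (contract_op Eb Ee) // (contract_in ev).
set Z := splice _ _ (tag (a e)); set Z' := splice _ _ (tag (b e)).
have pZ : perm_eq Z Z'.
  rewrite (perm_trans (splice_rem _ ev)) // perm_sym (perm_trans (splice_rem _ evb)) //.
  rewrite perm_sym perm_cat ?(permutes_perm_eq ht) //.
  rewrite -(perm_cons e); apply: perm_trans (perm_to_rem evb).
  by apply: perm_trans (permutes_perm_eq hs); rewrite perm_sym perm_to_rem.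
have [u hu] := perm_eq_permutes pZ erefl.
have ie : (index e (tag (a v)) < size (tag (a v)))%N by rewrite index_mem.
have dis : [disjoint tag (a v) & tag (a e)].
  apply/pred0P => f /=; rewrite !(labeled_mem _ la) //.
  by rewrite (labeled_mem _ la) // in ev; move/pred0P: (inputs_disj eI ev) => /(_ f).
have [bp si] := @block_perm_splice _ e _ _ _ _ _ _ _ (Ordinal ie) s t u
   (labeled_uniq la vV) (labeled_uniq la eV) dis ev erefl hs ht hu.
rewrite -si (ccomp_act (p := size Z) (u := u) (Z := cols Z)); last first.
- exact: bp.
- by rewrite si; apply: grafts_splice.
- exact: grafts_splice.
- exact: permutes_map.
- exact: permutes_map.
- exact: permutes_map.
exact: relab_op.
Qed.

(** Contracting an edge composes the operation at [v] with a fixed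
    operation, or leaves it alone; so multilinearity is inherited from the
    contracted tree. *)
Lemma contract_dfwith T e a v l : is_tree x T -> e \in internal T -> v \in vertices T ->
  labeled T (dfwith a (@vdec_op _ _ P X v l 0)) ->
  exists v' l' (f : P (cols l) v.2 -> P (cols l') v'.2) b,
  [/\ v' \in vertices (T :\ e), linear f
    & forall p, agree (vertices (T :\ e))
        (contract e (dfwith a (@vdec_op _ _ P X v l p))) (dfwith b (vdec_op (f p)))].
Proof.
move=> tT eI vV la; have eV := internal_vertex eI.
have lap p : labeled T (dfwith a (@vdec_op _ _ P X v l p)).
  apply/labeledP => w wV; move/labeledP: la => /(_ w wV).
  by case: (eqVneq v w) => [<-|vw]; rewrite ?dfwith_in // !dfwith_out.
have tagE p w : tag (dfwith a (@vdec_op _ _ P X v l p) w) =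
                tag (dfwith a (@vdec_op _ _ P X v l 0) w).
  by case: (eqVneq v w) => [<-|vw]; rewrite ?dfwith_in // !dfwith_out.
have mem w : w \in vertices T ->
    (e \in tag (dfwith a (@vdec_op _ _ P X v l 0) w)) = (e \in inputs T w).
  exact: labeled_mem.
have [u uV eu] := parent_internal tT eI.
have eu' : e != u := inputs_neq eu.
have uq w : w \in vertices T -> e \in inputs T w -> w = u.
  by move=> wV ew; apply: (parent_unique tT (vertex_in wV) (vertex_in uV) ew eu).
have [ve|ve] := eqVneq v e.
  subst v; have Eau p : dfwith a (@vdec_op _ _ P X e l p) u = a u by rewrite dfwith_out.
  have eau : e \in tag (a u) by rewrite -(Eau 0) mem.
  exists u, (splice (tag (a u)) (index e (tag (a u))) l),
    (fun p => ccomp _ (index e (tag (a u))) (tagged (a u)) p), a; split.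
  - by rewrite vertices_erase; apply/setD1P; rewrite eq_sym.
  - exact: ccomp_linearr.
  move=> p w; rewrite vertices_erase => /setD1P[we wV].
  case: (eqVneq u w) => [<-|uw].
    rewrite dfwith_in; apply: contract_op => //; last by rewrite dfwith_in.
    by rewrite Eau vdec_eta.
  rewrite (dfwith_out _ _ uw) contract_out; first by rewrite dfwith_out // eq_sym.
  by rewrite tagE mem //; apply: contra uw => /uq -> //.
have Eae p : dfwith a (@vdec_op _ _ P X v l p) e = a e by rewrite dfwith_out.
have vVe : v \in vertices (T :\ e) by rewrite vertices_erase; apply/setD1P.
have [vu|vu] := eqVneq v u.
  subst u; have el : e \in l by move: eu; rewrite -mem // dfwith_in.
  exists v, (splice l (index e l) (tag (a e))),
    (fun p => ccomp _ (index e l) p (tagged (a e))), a; split=> //.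
    exact: ccomp_linearl.
  move=> p w; rewrite vertices_erase => /setD1P[we wV].
  case: (eqVneq v w) => [<-|vw].
    rewrite dfwith_in; apply: contract_op => //; first by rewrite dfwith_in.
    by rewrite Eae vdec_eta.
  rewrite (dfwith_out _ _ vw) contract_out; first by rewrite dfwith_out.
  by rewrite tagE mem //; apply: contra vw => /uq -> //.
exists v, l, id, (contract e a); split=> // p w; rewrite vertices_erase => /setD1P[we wV].
case: (eqVneq v w) => [<-|vw].
  rewrite dfwith_in contract_out ?dfwith_in //=.
  have := mem _ vV; rewrite dfwith_in /= => ->.
  by apply: contra vu => /uq ->.
by rewrite (dfwith_out _ _ vw); apply: contract_eq; rewrite dfwith_out.
Qed.

(** What the components of a cochain and the evaluation of decorated trees
    have in common; multilinearity and invariance are only required on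
    decorations that fit the tree. *)
Record mform (V : lmodType k) T (F : decoration -> V) : Prop := MForm {
  mf_agree : forall a b, labeled T a -> agree (vertices T) a b -> F a = F b;
  mf_linear : forall a v l, v \in vertices T ->
    labeled T (dfwith a (@vdec_op _ _ P X v l 0)) ->
    linear (fun p => F (dfwith a (@vdec_op _ _ P X v l p)));
  mf_relab : forall a b, labeled T a -> relabeling T a b -> F a = F b }.

Lemma labeled_dfwith T a v l (p q : P (cols l) v.2) :
  labeled T (dfwith a (@vdec_op _ _ P X v l p)) = labeled T (dfwith a (vdec_op q)).
Proof.
apply/labeledP/labeledP => h w wV; have := h w wV;
by case: (eqVneq v w) => [<-|vw]; rewrite ?dfwith_in // !dfwith_out.
Qed.

Lemma mform_contract (V : lmodType k) T e (F : decoration -> V) :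
  is_tree x T -> e \in internal T -> mform (T :\ e) F -> mform T (fun a => F (contract e a)).
Proof.
move=> tT eI [h1 h2 h3]; split.
- move=> a b la ab; apply: h1; first exact: (contract_labeled tT eI la).
  exact: contract_agree.
- move=> a v l vV la c p q.
  have [v' [l' [f [b [v'V lf hb]]]]] := contract_dfwith tT eI vV la.
  have lab r : labeled (T :\ e) (contract e (dfwith a (@vdec_op _ _ P X v l r))).
    by apply: (contract_labeled tT eI); rewrite (labeled_dfwith _ _ _ 0).
  rewrite !(h1 _ _ (lab _) (hb _)) lf; apply: h2 => //.
  by rewrite (labeled_dfwith _ _ _ (f 0)) -(labeled_agree (hb 0)) lab.
- move=> a b la ab; apply: h3; first exact: (contract_labeled tT eI la).
  exact: (contract_relab tT eI la ab).
Qed.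

Lemma mform_sum (V : lmodType k) T (I : Type) (r : seq I) (Q : pred I)
    (F : I -> decoration -> V) :
  (forall i, Q i -> mform T (F i)) -> mform T (fun a => \sum_(i <- r | Q i) F i a).
Proof.
move=> h; split.
- by move=> a b la ab; apply: eq_bigr => i /h[h1 _ _]; apply: h1.
- by move=> a v l vV la; apply: sum_linear => i /h[_ h2 _]; apply: h2.
- by move=> a b la ab; apply: eq_bigr => i /h[_ _ h1]; apply: h1.
Qed.

Lemma mform_scale (V : lmodType k) T d (F : decoration -> V) :
  mform T F -> mform T (fun a => d *: F a).
Proof.
case=> h1 h2 h3; split.
- by move=> a b la ab; rewrite (h1 _ b).
- by move=> a v l vV la; apply: scale_linear; apply: h2.
- by move=> a b la ab; rewrite (h3 _ b).
Qed.

Lemma mform_eq (V : lmodType k) T (F G : decoration -> V) :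
  (forall a, labeled T a -> F a = G a) -> mform T G -> mform T F.
Proof.
move=> FG [h1 h2 h3]; split.
- by move=> a b la ab; rewrite !FG // -?(labeled_agree ab) //; apply: h1.
- move=> a v l vV la c p q; rewrite !FG ?(labeled_dfwith _ _ _ 0) //; exact: h2.
- by move=> a b la ab; rewrite !FG ?(relabeling_labeled ab) //; apply: h3.
Qed.

(** Multilinearity is exploited by changing a decoration on the vertices of
    a list, one after the other. *)
Definition patch a b (s : seq edge) : decoration := fun v => if v \in s then b v else a v.

Lemma patch_cons a b v s : patch a b (v :: s) = dfwith (patch a b s) (b v).
Proof.
apply: functional_extensionality_dep => w; rewrite /patch inE.
by case: (eqVneq v w) => [<-|vw]; rewrite ?dfwith_in ?eqxx // dfwith_out // eq_sym (negbTE vw).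
Qed.

Lemma patch_nil a b : patch a b [::] = a.
Proof. by apply: functional_extensionality_dep. Qed.

Lemma patch_all a b s : (forall v, v \notin s -> a v = b v) -> patch a b s = b.
Proof.
by move=> h; apply: functional_extensionality_dep => w; rewrite /patch; case: ifPn => // /h.
Qed.

Lemma dfwith_id a v : dfwith a (a v) = a.
Proof.
apply: functional_extensionality_dep => w.
by case: (eqVneq v w) => [<-|vw]; rewrite ?dfwith_in ?dfwith_out.
Qed.

Section Cochains.
Variable phi : precochain P X.

Lemma cochain_agree (h : cochain x phi) T w a b :
  agree (vertices T) a b -> phi T w a = phi T w b.
Proof.
move=> ab; rewrite -(@patch_all a b (enum [pred v | v \notin vertices T])); last first.
  by move=> v; rewrite mem_enum inE negbK; apply: ab.
have : {subset enum [pred v | v \notin vertices T] <= [pred v | v \notin vertices T]}.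
  by move=> v; rewrite mem_enum.
elim: (enum _) => [|v s IH] sub; first by rewrite patch_nil.
rewrite patch_cons (cochain_local h).
  by apply: IH => u us; apply: sub; rewrite inE us orbT.
by apply: (sub v); apply: mem_head.
Qed.

Lemma cochain_mform (h : cochain x phi) T w : mform T (phi T w : decoration -> k^o).
Proof.
split=> [a b _|a v l vV _|a b _ ab]; first exact: cochain_agree.
  by move=> c p q; apply: (cochain_linear h).
rewrite -[RHS](@cochain_agree h T w (patch a b (enum (vertices T)))); last first.
  by move=> v vV; rewrite /patch mem_enum vV.
have : {subset enum (vertices T) <= vertices T} by move=> v; rewrite mem_enum.
have : uniq (enum (vertices T)) := enum_uniq _.
elim: (enum _) => [|v s IH] us sub; first by rewrite patch_nil.
have vV : v \in vertices T by apply: (sub v); apply: mem_head.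
case/andP: us => vs us.
rewrite patch_cons IH //; last by move=> u us'; apply: sub; rewrite inE us' orbT.
have av : patch a b s v = a v by rewrite /patch (negbTE vs).
have [t ht ->] := ab v vV; rewrite (cochain_relabel h) //.
by rewrite vdec_eta -av dfwith_id.
Qed.

Lemma cochain_par (h : cochain x phi) T w w' a : uniq w -> perm_eq w w' ->
  phi T w' a = (-1) ^+ par w w' * phi T w a.
Proof.
move=> uw p; have [s hs] := perm_eq_permutes p erefl.
by rewrite (cochain_det h T a hs) (permutes_par _ hs) // -(perm_uniq p).
Qed.

(** It is enough to check the axioms of a cochain on the decorations that
    fit a tree. *)
Lemma mk_cochain :
  (forall T w a, ~~ cobar_data x T w a -> phi T w a = 0) ->
  (forall T w, is_tree x T -> mform T (phi T w : decoration -> k^o)) ->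
  (forall T w w' a, cobar_data x T w a -> perm_eq w w' ->
     phi T w' a = (-1) ^+ par w w' * phi T w a) ->
  cochain x phi.
Proof.
move=> h1 h2 h3; split=> //.
- move=> T w a v z vV; have ag : agree (vertices T) (dfwith a z) a.
    by move=> u uV; rewrite dfwith_out //; apply: contraNneq vV => ->.
  have [/and3P[t p l]|c] := boolP (cobar_data x T w a).
    by have [m _ _] := h2 T w t; apply: m => //; rewrite (labeled_agree ag).
  by rewrite !h1 // /cobar_data (labeled_agree ag).
- move=> T w a v l vV c p q; have [/and3P[t pe la]|nc] :=
    boolP (cobar_data x T w (dfwith a (@vdec_op _ _ P X v l 0))).
    by have [_ m _] := h2 T w t; apply: m.
  rewrite !h1 ?scaler0 ?addr0 //; by rewrite /cobar_data (labeled_dfwith _ _ _ 0).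
- move=> T w a v n s l l' p ps.
  set a1 := dfwith a (vdec_op p); set a2 := dfwith a _.
  have [la|nla] := boolP (labeled T a1); have [tT|ntT] := boolP (is_tree x T);
    last 3 first.
  + by rewrite !h1 // /cobar_data (negbTE ntT).
  + have nla2 : ~~ labeled T a2.
      apply: contra nla => /labeledP h; apply/labeledP => u uV; move: (h u uV).
      rewrite /a1 /a2; case: (eqVneq v u) => [<-|vu]; last by rewrite !dfwith_out.
      by rewrite !dfwith_in; apply: perm_trans; apply: permutes_perm_eq ps.
    by rewrite !h1 // /cobar_data ?(negbTE nla) ?(negbTE nla2) !andbF.
  + by rewrite !h1 // /cobar_data (negbTE ntT).
  have [_ _ m] := h2 T w tT; apply/esym; apply: m => // u uV.
  rewrite /a1 /a2; case: (eqVneq v u) => [<-|vu]; first by rewrite !dfwith_in; apply: relab_op.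
  by rewrite !dfwith_out //; apply: relab_refl.
- move=> T n s w w' a ps; have pe := permutes_perm_eq ps.
  have [c|nc] := boolP (cobar_data x T w a).
    rewrite (h3 _ _ _ _ c pe) (permutes_par _ ps) // -(perm_uniq pe).
    by case/and3P: c => _ /perm_uniq -> _; apply: enum_uniq.
  rewrite !h1 ?mulr0 //; apply: contra nc; rewrite /cobar_data.
  by case/and3P => -> h ->; rewrite (perm_trans pe h).
Qed.

End Cochains.
End Forms.

(** * The cobar complex *)

Section CobarComplex.
Variables (C : finType) (k : fieldType) (P : coperad C k) (X : seq C) (x : C).
Local Notation edge := (edge X).
Local Notation decoration := (decoration P X).
Implicit Types (T : {set edge}) (e f v : edge) (a b : decoration) (phi psi : precochain P X).

Lemma cobar_dE phi T w a : cobar_data x T w a ->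
  cobar_d x phi T w a =
  \sum_(e in internal T) (-1) ^+ index e w * phi (T :\ e) (rem e w) (contract e a).
Proof. by rewrite /cobar_d => ->. Qed.

Lemma signM (b c : bool) (r : k) : (-1) ^+ b * ((-1) ^+ c * r) = (-1) ^+ (b (+) c) * r.
Proof. by rewrite mulrA signr_addb. Qed.

Lemma internal_order T w a e : cobar_data x T w a -> e \in internal T ->
  [/\ uniq w, e \in w & cobar_data x (T :\ e) (rem e w) (contract e a)].
Proof.
move=> /and3P[tT pw la] eI; have uw : uniq w by rewrite (perm_uniq pw) enum_uniq.
have ew : e \in w.
  by rewrite (perm_mem pw) mem_enum in_nonroot; move: eI; rewrite in_internal => /and3P[-> _ ->].
split=> //; apply/and3P; split; [exact: tree_erase| |exact: (contract_labeled tT eI la)].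
rewrite nonroot_erase; apply: uniq_perm; rewrite ?rem_uniq ?enum_uniq // => f.
by rewrite mem_rem_uniq // inE mem_enum in_setD1 (perm_mem pw) mem_enum.
Qed.

(** The term of the differential for one edge, extended by 0 to all edges:
    the differential becomes a sum over a fixed index set of cochains. *)
Definition cobar_term phi e : precochain P X := fun T w a =>
  if cobar_data x T w a && (e \in internal T)
  then (-1) ^+ index e w * phi (T :\ e) (rem e w) (contract e a) else 0.

Lemma cobar_d_term phi T w a : cobar_d x phi T w a = \sum_e cobar_term phi e T w a.
Proof.
rewrite /cobar_d /cobar_term; case: ifP => _; last by rewrite big1.
by rewrite [LHS]big_mkcond.
Qed.

Lemma mform0 (V : lmodType k) T : mform T (fun _ : decoration => 0 : V).
Proof. by split=> // *; move=> ? ? ?; rewrite scaler0 addr0. Qed.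

Lemma mform_add (V : lmodType k) T (F G : decoration -> V) :
  mform T F -> mform T G -> mform T (fun a => F a + G a).
Proof.
move=> [f1 f2 f3] [g1 g2 g3]; split.
- by move=> a b la ab; rewrite (f1 a b) // (g1 a b).
- by move=> a v l vV la r p q; rewrite (f2 a v l) // (g2 a v l) // scalerDr addrACA.
- by move=> a b la ab; rewrite (f3 a b) // (g3 a b).
Qed.

Lemma cobar_term_cochain phi e : cochain x phi -> cochain x (cobar_term phi e).
Proof.
move=> h; apply: mk_cochain => [T w a|T w tT|T w w' a cd pw].
- by rewrite /cobar_term => /negbTE ->.
- have [/andP[pw eI]|npw] := boolP (perm_eq w (enum (nonroot T)) && (e \in internal T)); last first.
    apply: (@mform_eq _ _ _ _ _ _ _ (fun=> 0)); last exact: mform0.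
    move=> a la; rewrite /cobar_term /cobar_data; case: ifP => //.
    by case/andP=> /and3P[_ pw _] eI; rewrite pw eI in npw.
  apply: (@mform_eq _ _ _ _ _ _ _ (fun a =>
       (-1) ^+ index e w *: (phi (T :\ e) (rem e w) (contract e a) : k^o))).
    by move=> a la; rewrite /cobar_term /cobar_data tT pw la eI.
  apply: mform_scale.
  apply: (@mform_contract _ _ _ _ x _ T e (phi (T :\ e) (rem e w) : _ -> k^o)) => //.
  exact: (cochain_mform h _ _).
- have cd' : cobar_data x T w' a.
    case/and3P: cd => t p l; apply/and3P; split=> //.
    by rewrite (perm_trans _ p) // perm_sym.
  rewrite /cobar_term cd cd' /=; case: ifP => eI; last by rewrite mulr0.
  have [uw ew _] := internal_order cd eI; have [uw' ew' _] := internal_order cd' eI.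
  have pr : perm_eq (rem e w) (rem e w').
    rewrite -(perm_cons e); apply: perm_trans (perm_to_rem ew').
    by apply: perm_trans pw; rewrite perm_sym perm_to_rem.
  rewrite (cochain_par h _ _ _ pr) ?rem_uniq //.
  rewrite -[(-1) ^+ index e w']signr_odd -[(-1) ^+ index e w]signr_odd !signM.
  congr (_ ^+ _ * _); congr nat_of_bool.
  have pe : perm_eq (e :: rem e w) w by rewrite perm_sym perm_to_rem.
  have up : uniq (e :: rem e w) by rewrite /= rem_uniq // andbT mem_rem_uniq // inE eqxx.
  by have := par_trans up pe pw; rewrite par_rem /= [par w w' (+) _]addbC => <-.
Qed.

Lemma cobar_d_cochain phi : cochain x phi -> cochain x (cobar_d x phi).
Proof.
move=> h; apply: mk_cochain => [T w a|T w tT|T w w' a cd pw].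
- by rewrite /cobar_d => /negbTE ->.
- apply: (@mform_eq _ _ _ _ _ _ _ (fun a => \sum_e (cobar_term phi e T w a : k^o))).
    by move=> a _; apply: cobar_d_term.
  by apply: mform_sum => e _; apply: cochain_mform; apply: cobar_term_cochain.
- rewrite !cobar_d_term mulr_sumr; apply: eq_bigr => e _.
  have uw : uniq w by case/and3P: cd => _ /perm_uniq -> _; apply: enum_uniq.
  exact: (cochain_par (cobar_term_cochain e h)).
Qed.

Lemma cobar_d_homogeneous (d : int) phi : homogeneous d phi ->
  homogeneous (d + 1) (cobar_d x phi).
Proof.
move=> h T w a dT; rewrite /cobar_d; case: ifP => // /and3P[tT pw la].
apply: big1 => e eI; rewrite h ?mulr0 //.
apply: contra dT; rewrite /tree_degree.
have X1 : size X != 1%N.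
  move: eI; rewrite in_internal => /and3P[_ e1 _].
  by have := leq_trans e1 (max_card _); rewrite card_ord; case: eqP => // ->.
rewrite (negbTE X1) internal_erase => /eqP <-.
by rewrite (cardsD1 e (internal T)) eI add1n -addn1 PoszD; apply/eqP; ring.
Qed.

(** The terms that contract the same two internal edges in either order
    cancel. *)
Lemma cobar_dd phi : cochain x phi -> cobar_d x (cobar_d x phi) = 0.
Proof.
move=> h; apply: functional_extensionality_dep => T.
apply: functional_extensionality_dep => w.
apply: functional_extensionality_dep => a.
have [cd|/negbTE nc] := boolP (cobar_data x T w a); last by rewrite /cobar_d nc.
rewrite cobar_dE //.
pose F e f : k := (-1) ^+ index e w * ((-1) ^+ index f (rem e w) *
   phi (T :\ e :\ f) (rem f (rem e w)) (contract f (contract e a))).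
transitivity (\sum_(p | [&& p.1 \in internal T, p.2 \in internal T & p.1 != p.2]) F p.1 p.2).
  rewrite -(pair_big_dep (mem (internal T)) (fun e f => (f \in internal T) && (e != f)) F).
  apply: eq_bigr => e eI; have [uw ew cde] := internal_order cd eI.
  rewrite cobar_dE // mulr_sumr internal_erase; apply: eq_bigl => f.
  by rewrite in_setD1 andbC eq_sym.
rewrite (bigID (fun p => (index p.1 w < index p.2 w)%N)) /=.
apply/eqP; rewrite addr_eq0; apply/eqP.
rewrite -sumrN (reindex_inj (h := fun p : edge * edge => (p.2, p.1))) /=; last first.
  by move=> [? ?] [? ?] [-> ->].
apply: eq_big => [[e f]|[e f]] /=.
  have [eI|] := boolP (e \in internal T); rewrite ?andbF //=.
  have [fI|] := boolP (f \in internal T); rewrite ?andbF //=.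
  have [uw ew _] := internal_order cd eI; have [_ fw _] := internal_order cd fI.
  rewrite eq_sym -leqNgt; case: (eqVneq e f) => //= ef.
  case: (ltngtP (index f w) (index e w)) => // ife.
  by move: ef; have := congr1 (nth e w) ife; rewrite !nth_index // => ->; rewrite eqxx.
case/andP=> /and3P[fI eI fe] lt.
have [uw ew _] := internal_order cd eI; have [_ fw _] := internal_order cd fI.
have tT : is_tree x T by case/and3P: cd.
have la : labeled T a by case/and3P: cd.
have ef : e != f by rewrite eq_sym.
have rC : rem f (rem e w) = rem e (rem f w).
  by rewrite !rem_filter ?filter_uniq // -!filter_predI; apply: eq_filter => g /=; rewrite andbC.
rewrite /F; have -> : phi (T :\ f :\ e) (rem e (rem f w)) (contract e (contract f a)) =
          phi (T :\ e :\ f) (rem f (rem e w)) (contract f (contract e a)).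
  have -> : T :\ f :\ e = T :\ e :\ f by rewrite !setDDl setUC.
  by rewrite rC; apply/esym/(cochain_agree h)/(contractC tT).
set r := phi _ _ _.
have -> : index e (rem f w) = (index e w).-1.
  rewrite remE; have El := split_index fw; have sa := size_take_index w f.
  set A := take _ _ in sa El *; set B := drop _ _ in El *.
  have eA : e \notin A.
    by apply/negP => eA; move: lt; rewrite {2}El index_cat eA -sa ltnNge index_size.
  rewrite [in RHS]El !index_cat (negbTE eA) /= (negbTE fe); lia.
have -> : index f (rem e w) = index f w.
  have El := split_index ew; have sa := size_take_index w e.
  rewrite remE; set A := take _ _ in sa El *; set B := drop _ _ in El *.
  have fA : f \in A by rewrite -index_mem sa; move: lt; rewrite {1}El index_cat; case: ifP => // fA; rewrite sa; lia.
  by rewrite [in RHS]El !index_cat fA.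
case: (index e w) lt => // n _ /=; rewrite exprS !mulN1r mulNr opprK.
by rewrite !mulrA [(-1) ^+ n * _]mulrC.
Qed.

Lemma cobar_is_complex : is_complex (cobar P X x).
Proof.
move=> d; split=> /=.
- split; last by [].
  apply: mk_cochain => // [T w _|]; [|by move=> ? ? ? ? _ _; rewrite [RHS]mulr0].
  exact: (@mform0 k^o).
- move=> c phi psi [h1 h2] [h3 h4]; split; last first.
    by move=> T w a dT; rewrite [LHS]/(c * phi T w a + psi T w a) h2 // h4 // mulr0; apply: addr0.
  apply: mk_cochain => [T w a nc|T w tT|T w w' a cd pw].
  + by rewrite [LHS]/(c * phi T w a + psi T w a) (cochain_support h1) // (cochain_support h3) // mulr0; apply: addr0.
  + exact: (mform_add (mform_scale c (cochain_mform h1 T w)) (cochain_mform h3 T w)).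
  + have uw : uniq w by case/and3P: cd => _ /perm_uniq -> _; apply: enum_uniq.
    rewrite [LHS]/(c * phi T w' a + psi T w' a) (cochain_par h1 _ _ uw pw).
    by rewrite (cochain_par h3 _ _ uw pw) mulrCA; apply: esym; apply: mulrDr.
- by move=> phi [h1 h2]; split; [apply: cobar_d_cochain|apply: cobar_d_homogeneous].
- move=> c phi psi _ _; apply: functional_extensionality_dep => T.
  apply: functional_extensionality_dep => w.
  apply: functional_extensionality_dep => a.
  rewrite [RHS]/(c * cobar_d x phi T w a + cobar_d x psi T w a) /cobar_d.
  case: ifP => _; last by rewrite mulr0; apply: esym; apply: addr0.
  rewrite mulr_sumr; apply: etrans (big_split _ _ _ _ _); apply: eq_bigr => e eI /=.
  rewrite [X in _ * X = _]/(c * phi _ _ _ + psi _ _ _) mulrDr; congr (_ + _).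
  by rewrite mulrCA.
- by move=> phi [h _]; apply: cobar_dd.
Qed.

End CobarComplex.

(** * Evaluation of decorated trees *)

Lemma leaf_edges_uniq (C : finType) (X : seq C) : uniq (leaf_edges X).
Proof. by rewrite map_inj_uniq ?enum_uniq //; apply: leaf_edge_inj. Qed.

Lemma size_leaf_edges (C : finType) (X : seq C) : size (leaf_edges X) = size X.
Proof. by rewrite size_map size_enum_ord. Qed.

Lemma nth_leaf_edges (C : finType) (X : seq C) e0 (j : 'I_(size X)) :
  nth e0 (leaf_edges X) j = leaf_edge j.
Proof. by rewrite (nth_map j) ?size_enum_ord // (ord_inj (nth_enum_ord _ _)). Qed.

Lemma cols_leaf_edges (C : finType) (X : seq C) : cols (leaf_edges X) = X.
Proof.
case: X => [|c X']; first by apply: size0nil; rewrite size_map size_leaf_edges.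
apply: (@eq_from_nth _ c); first by rewrite size_map size_leaf_edges.
move=> i; rewrite size_map size_leaf_edges => li.
rewrite (nth_map (leaf_edge (Ordinal li))) ?size_leaf_edges // /leaf_edges.
rewrite (nth_map (Ordinal li)) ?size_enum_ord //=.
by rewrite (tnth_nth c) /= nth_enum_ord.
Qed.

Section TreeComp.
Variables (C : finType) (k : fieldType) (P : coperad C k) (X : seq C) (x : C).
Local Notation edge := (edge X).
Local Notation decoration := (decoration P X).
Local Notation root := (root_edge X x).
Implicit Types (T : {set edge}) (e f v : edge) (a b : decoration) (s : seq edge).

Local Notation fold a s := (foldl (fun b e => contract e b) a s).

Lemma size_gt1 T e : e \in internal T -> (1 < size X)%N.
Proof.
rewrite in_internal => /and3P[_ e1 _].
by have := leq_trans e1 (max_card _); rewrite card_ord.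
Qed.

Lemma fold_agree T a b s : is_tree x T -> (1 < size X)%N -> labeled T a -> agree (vertices T) a b ->
  uniq s -> {subset s <= internal T} -> fold a s root = fold b s root.
Proof.
elim: s T a b => [|e s IH] T a b tT X1 la ab /=.
  by move=> _ _; apply: ab; apply: root_vertex.
case/andP=> es us sub; have eI : e \in internal T by apply: sub; apply: mem_head.
apply: (IH (T :\ e)) => //; [exact: tree_erase|exact: (contract_labeled tT eI la)|exact: contract_agree|].
move=> f fs; rewrite internal_erase; apply/setD1P; split.
  by apply: contraNneq es => <-.
by apply: sub; rewrite inE fs orbT.
Qed.

(** Contractions commute, so any of them may be performed first. *)
Lemma fold_move T a s e : is_tree x T -> labeled T a -> uniq s ->
  {subset s <= internal T} -> e \in s -> fold a s root = fold (contract e a) (rem e s) root.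
Proof.
elim: s T a => [|f s IH] T a tT la //= /andP[fs us] sub.
have fI : f \in internal T by apply: sub; apply: mem_head.
case: (eqVneq f e) => [->//|fe]; rewrite inE eq_sym (negbTE fe) /= => es.
have eI : e \in internal T by apply: sub; rewrite inE es orbT.
have sub' : {subset s <= internal (T :\ f)}.
  move=> g gs; rewrite internal_erase; apply/setD1P; split.
    by apply: contraNneq fs => <-.
  by apply: sub; rewrite inE gs orbT.
rewrite (IH (T :\ f)) //; [|exact: tree_erase|exact: (contract_labeled tT fI la)].
have tf := tree_erase tT fI; have lf := contract_labeled tT fI la.
have eIf := sub' _ es.
apply: (fold_agree (T := T :\ f :\ e)) => //.
- exact: tree_erase.
- exact: size_gt1 fI.
- exact: (contract_labeled tf eIf lf).
- exact: (contractC tT fI eI fe la).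
- exact: rem_uniq.
move=> g gs; rewrite internal_erase; apply/setD1P; split.
  by apply: contraTneq gs => ->; rewrite mem_rem_uniq // inE eqxx.
exact/sub'/(mem_rem gs).
Qed.

Lemma fold_perm T a s t : is_tree x T -> labeled T a -> uniq s ->
  {subset s <= internal T} -> perm_eq s t -> fold a s root = fold a t root.
Proof.
move=> tT la us sub pst.
elim: t T a s tT la us sub pst => [|e t IH] T a s tT la us sub pst.
  by have /size0nil -> := perm_size pst.
have es : e \in s by rewrite (perm_mem pst) mem_head.
have eI := sub _ es.
rewrite (fold_move tT la us sub es) /=; apply: (IH (T :\ e)).
- exact: tree_erase.
- exact: (contract_labeled tT eI la).
- exact: rem_uniq.
- move=> g gs; rewrite internal_erase; apply/setD1P; split.
    by apply: contraTneq gs => ->; rewrite mem_rem_uniq // inE eqxx.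
  exact/sub/(mem_rem gs).
- by rewrite -(perm_cons e); apply: perm_trans pst; rewrite perm_sym perm_to_rem.
Qed.

(** Internal edges may be contracted in any order. *)
Lemma tree_comp_contract T a e : is_tree x T -> labeled T a -> e \in internal T ->
  tree_comp x T a = tree_comp x (T :\ e) (contract e a).
Proof.
move=> tT la eI; rewrite /tree_comp; case: ifP => // _.
suff -> : fold a (enum (internal T)) root = fold (contract e a) (enum (internal (T :\ e))) root by [].
apply: (@fold_perm T a (enum (internal T)) (e :: enum (internal (T :\ e)))) => //.
- exact: enum_uniq.
- by move=> g; rewrite mem_enum.
apply: uniq_perm; rewrite /= ?enum_uniq //.
  by rewrite mem_enum internal_erase in_setD1 eqxx.
move=> f; rewrite inE !mem_enum internal_erase in_setD1.
by case: eqP => // ->; rewrite eI.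
Qed.

Section Corolla.
Variable T : {set edge}.
Hypotheses (tT : is_tree x T) (iT : internal T = set0) (X1 : (1 < size X)%N).

Lemma vertices_corolla : vertices T = [set root].
Proof.
apply/setP => v; rewrite in_set1; apply/idP/eqP => [vV|->]; last exact: root_vertex.
apply: (tree_inj tT (vertex_in vV) (root_in tT)); apply/eqP/negPn/negP => v1.
have : v \in internal T.
  by rewrite in_internal v1 andbT -in_vertices.
by rewrite iT inE.
Qed.

Lemma inputs_corolla : perm_eq (enum (inputs T root)) (leaf_edges X).
Proof.
apply: uniq_perm; rewrite ?enum_uniq ?leaf_edges_uniq // => f; rewrite mem_enum.
apply/idP/mapP => [fi|[i _ ->]].
  have fT := inputs_in fi.
  have f1 : (1 < #|f.1|)%N = false.
    apply/negP => f1; have : f \in internal T.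
      by rewrite inE in_vertices fT f1 (inputs_nonroot fi).
    by rewrite iT inE.
  by have [i ->] := leafP tT fT f1; exists i; rewrite ?mem_enum.
have [v vV iv] : exists2 v, v \in vertices T & leaf_edge i \in inputs T v.
  by apply: (parent_exists tT); rewrite in_nonroot (leaf_in tT) leaf_neqT.
by move: vV iv; rewrite vertices_corolla in_set1 => /eqP ->.
Qed.

Lemma tree_comp_corolla a (s : 'S_(size X)) :
  permutes s (tag (a root)) (leaf_edges X) ->
  tree_comp x T a = cact X s (tagged (a root)).
Proof.
move=> hs; rewrite /tree_comp; case: ifP => [/eqP e|_]; first by exfalso; move: (X1); rewrite e.
rewrite iT enum_set0 /=; case: pickP => [t ht|/(_ s)]; last by rewrite hs.
by rewrite (permutes_uniq (leaf_edges_uniq X) ht hs).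
Qed.

Lemma corolla_perm a : labeled T a -> exists s : 'S_(size X),
  permutes s (tag (a root)) (leaf_edges X).
Proof.
move=> la; have p : perm_eq (tag (a root)) (leaf_edges X).
  apply: perm_trans inputs_corolla; apply: (labeledP _ _ la).
  by rewrite vertices_corolla in_set1.
by apply: perm_eq_permutes => //; rewrite (perm_size p) size_leaf_edges.
Qed.

End Corolla.

Lemma tree_ind (Q : {set edge} -> Prop) :
  (forall T, is_tree x T -> internal T = set0 -> Q T) ->
  (forall T e, is_tree x T -> e \in internal T -> Q (T :\ e) -> Q T) ->
  forall T, is_tree x T -> Q T.
Proof.
move=> h0 h1 T tT; move En : #|internal T| => n.
elim: n T tT En => [|n IH] T tT En; first by apply: h0 => //; apply/eqP; rewrite -cards_eq0 En.
have [e eI] : exists e, e \in internal T by apply/set0Pn; rewrite -card_gt0 En.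
apply: (h1 _ e) => //; apply: IH; first exact: tree_erase.
by move: En; rewrite (cardsD1 e) eI internal_erase => -[].
Qed.

(** Contractions preserve the property, which for a corolla is the linearity
    and the functoriality of the symmetric group action. *)
Lemma tree_comp_mform T : is_tree x T -> mform T (tree_comp x T : decoration -> P X x).
Proof.
move: T; apply: tree_ind => [T tT iT|T e tT eI IH]; last first.
  apply: (mform_eq _ (mform_contract tT eI IH)) => a la.
  exact: tree_comp_contract.
have [X1|X1] := leqP (size X) 1.
  have X1' : (size X == 1)%N by rewrite eqn_leq X1 (size_gt0_tree tT).
  split=> [a b _ _|a v l vV|a b _ _]; rewrite /tree_comp X1' //.
  have : (#|v.1| <= size X)%N by have := max_card (mem v.1); rewrite card_ord.
  by move=> h; have := leq_trans h X1; move: vV; rewrite in_vertices ltnNge => /andP[_ /negbTE ->].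
have VT := vertices_corolla tT iT X1.
have rV : root \in vertices T by rewrite VT in_set1.
split.
- move=> a b la ab; have [s hs] := corolla_perm tT iT X1 la.
  have E := ab _ rV; rewrite (tree_comp_corolla iT X1 hs).
  by rewrite (@tree_comp_corolla T iT X1 b s) -E.
- move=> a v l; rewrite VT in_set1 => /eqP -> la c p q.
  have [s] := corolla_perm tT iT X1 la; rewrite dfwith_in /= => hs.
  rewrite !(tree_comp_corolla iT X1 (s := s)) ?dfwith_in //=.
  exact: cact_linear.
- move=> a b la ab; have [s hs] := corolla_perm tT iT X1 la.
  have [t ht] := corolla_perm tT iT X1 (relabeling_labeled ab la).
  rewrite (tree_comp_corolla iT X1 hs) (tree_comp_corolla iT X1 ht).
  have [u hu Eb] := ab _ rV; move: ht; rewrite Eb /= => ht.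
  have eu : size (tag (a root)) = size X by have /permutesP[] := hs.
  move: u hu Eb ht; rewrite eu => u hu Eb ht.
  have hm := permutes_map (fun f : edge => f.2) hu.
  have := permutes_map (fun f : edge => f.2) ht; rewrite cols_leaf_edges => ht'.
  rewrite -(cactM (tagged (a root)) hm ht').
  by congr (cact _ _ _); apply: (permutes_uniq (leaf_edges_uniq X) hs); apply: permutesM ht.
Qed.

End TreeComp.

(** * Degrees and elementary cochains *)

Section Degree.
Variables (C : finType) (X : seq C) (x : C).
Implicit Types (T : {set edge X}) (e f v : edge X).

Lemma vertices_small T v : v \in vertices T -> (1 < size X)%N.
Proof.
by rewrite in_vertices => /andP[_ h]; have := leq_trans h (max_card _); rewrite card_ord.
Qed.

(** Up to sign, the degree measures by how much the numbers of inputs exceed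
    2; hence degree 0 means that all vertices are binary, and degree -1 that
    all are but one, which is ternary. *)
Lemma degreeE T : is_tree x T ->
  tree_degree T = - (\sum_(v in vertices T) (#|inputs T v| - 2))%N%:Z.
Proof.
move=> tT; rewrite /tree_degree; case: ifP => X1.
  by rewrite big1 // => v /vertices_small h; exfalso; move: h; rewrite (eqP X1).
have X2 : (1 < size X)%N by have := size_gt0_tree tT; lia.
by have := degree_defect tT X2; lia.
Qed.

Lemma degree_le0 T : is_tree x T -> tree_degree T <= 0.
Proof. by move/degreeE->; rewrite oppr_le0. Qed.

Lemma degree0_binary T : is_tree x T -> (tree_degree T == 0) = is_binary T.
Proof.
move=> tT; rewrite degreeE // oppr_eq0 eqz_nat sum_nat_eq0.
apply: eq_forallb => v; rewrite subn_eq0; case vV: (v \in vertices T) => //=.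
by rewrite eqn_leq (inputs_gt1 tT) // andbT.
Qed.

Lemma degree_erase T e : e \in internal T -> tree_degree (T :\ e) = tree_degree T - 1.
Proof.
move=> eI; rewrite /tree_degree (internal_erase).
have X1 := size_gt1 eI; case: ifP => [/eqP h|_]; first by move: (X1); rewrite h.
by rewrite (cardsD1 e (internal T)) eI add1n -[in RHS]addn1 PoszD; ring.
Qed.

Lemma degree_ternary T : is_tree x T -> tree_degree T = -1 ->
  exists2 u, u \in vertices T & #|inputs T u| = 3%N /\
    (forall v, v \in vertices T -> v != u -> #|inputs T v| = 2%N).
Proof.
move=> tT; rewrite degreeE // => d.
have {}d : (\sum_(v in vertices T) (#|inputs T v| - 2))%N = 1%N by lia.
have [u uV u0] : exists2 u, u \in vertices T & (#|inputs T u| - 2 != 0)%N.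
  apply/exists_inP; rewrite -[X in is_true X]negbK negb_exists_in; apply/negP => /forall_inP h.
  by move: d; rewrite big1 // => v /h /negPn/eqP.
exists u => //; move: d; rewrite (bigD1 u) //=; set S := (\sum_(_ in _ | _) _)%N => d.
have h3 : #|inputs T u| = 3%N.
  move: u0 d; move: (#|inputs T u|) S => c S. lia.
split=> // v vV vu; have : (#|inputs T v| - 2 <= 0)%N.
  have S0 : S = 0%N by move: d; rewrite h3; lia.
  rewrite -[X in (_ <= X)%N]S0.
  by rewrite /S (bigD1 v); [exact: leq_addr | rewrite vV vu].
by have := inputs_gt1 tT vV; move: (#|inputs T v|) => c; lia.
Qed.

Lemma ternary_degree T u : is_tree x T -> u \in vertices T -> #|inputs T u| = 3%N ->
  (forall v, v \in vertices T -> v != u -> #|inputs T v| = 2%N) -> tree_degree T = -1.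
Proof.
move=> tT uV h3 h; rewrite degreeE // (bigD1 u) //= big1 ?h3 // => v /andP[vV vu].
by rewrite h.
Qed.

End Degree.

Section Elementary.
Variables (C : finType) (k : fieldType) (P : coperad C k) (X : seq C) (x : C).
Local Notation edge := (edge X).
Local Notation decoration := (decoration P X).
Implicit Types (T : {set edge}) (e f v : edge) (a b : decoration).

(** The operation that [d] becomes when its inputs are listed by [l] *)
Definition reord v (l : seq edge) (d : vdec P v) : P (cols l) v.2 :=
  if [pick s : 'S_(size (tag d)) | permutes s (tag d) l] is Some s
  then cact (cols l) s (tagged d) else 0.

Lemma reord_permutes v n (s : 'S_n) l l' (p : P (cols l) v.2) : uniq l' -> permutes s l l' ->
  reord l' (@vdec_op _ _ P X v l p) = cact (cols l') s p.
Proof.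
move=> ul hs; have /permutesP[e _ _] := hs; subst n.
rewrite /reord /=; case: pickP => [t ht|/(_ s)]; last by rewrite hs.
by rewrite (permutes_uniq ul ht hs).
Qed.

Lemma reord_id v l (p : P (cols l) v.2) : uniq l -> reord l (@vdec_op _ _ P X v l p) = p.
Proof.
move=> ul; rewrite (@reord_permutes _ (size l) 1%g) //; last exact: permutes1.
by rewrite cact1 // size_map.
Qed.

Lemma reord_relab v l (d d' : vdec P v) : uniq l -> perm_eq (tag d) l -> relab d d' ->
  reord l d = reord l d'.
Proof.
move=> ul pl [s hs Ed]; have [t ht] := perm_eq_permutes pl erefl.
have hst := permutesM (permutesV hs) ht.
rewrite Ed -[in LHS](vdec_eta d) (reord_permutes _ ul ht) (reord_permutes _ ul hst).
rewrite -(cactM (Y := cols (tag d'))); try exact: permutes_map.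
by rewrite mulgA mulgV mul1g.
Qed.

Lemma relab_reord v l (d : vdec P v) : uniq l -> perm_eq (tag d) l ->
  relab d (vdec_op (reord l d)).
Proof.
move=> ul pl; have [t ht] := perm_eq_permutes pl erefl.
by exists t => //; rewrite -[in LHS](vdec_eta d) (reord_permutes _ ul ht).
Qed.

Variables (T0 : {set edge}) (w0 : seq edge) (L : edge -> seq edge).
Variable lam : forall v, P (cols (L v)) v.2 -> k^o.
Hypothesis treeT0 : is_tree x T0.
Hypothesis perm_w0 : perm_eq w0 (enum (nonroot T0)).
Hypothesis perm_L : forall v, v \in vertices T0 -> perm_eq (L v) (enum (inputs T0 v)).
Hypothesis lam_linear : forall v, v \in vertices T0 -> linear (@lam v).

(** Cochains supported on one tree, where they are products of linear forms
    on the operations at the vertices, the inputs of [v] being listed by [L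
    v]; they provide preimages and primitives. *)
Definition elem_cochain : precochain P X := fun T w a =>
  if (T == T0) && cobar_data x T w a
  then (-1) ^+ par w0 w * \prod_(v in vertices T0) lam (reord (L v) (a v)) else 0.

Let uw0 : uniq w0. Proof. by rewrite (perm_uniq perm_w0) enum_uniq. Qed.
Let uL v : v \in vertices T0 -> uniq (L v).
Proof. by move/perm_L/perm_uniq->; rewrite enum_uniq. Qed.

Lemma elem_cochain_cochain : cochain x elem_cochain.
Proof.
apply: mk_cochain => [T w a nc|T w tT|T w w' a cd pw].
- by rewrite /elem_cochain (negbTE nc) andbF.
- have [->|TT] := eqVneq T T0; last first.
    apply: (@mform_eq _ _ _ _ _ _ _ (fun=> 0)).
      by move=> a _; rewrite /elem_cochain (negbTE TT).
    by split=> // *; move=> ? ? ?; rewrite scaler0 addr0.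
  have [pw|npw] := boolP (perm_eq w (enum (nonroot T0))); last first.
    apply: (@mform_eq _ _ _ _ _ _ _ (fun=> 0)).
      by move=> a _; rewrite /elem_cochain /cobar_data (negbTE npw) !andbF.
    by split=> // *; move=> ? ? ?; rewrite scaler0 addr0.
  apply: (@mform_eq _ _ _ _ _ _ _ (fun a => (-1) ^+ par w0 w *:
            ((\prod_(v in vertices T0) lam (reord (L v) (a v))) : k^o))).
    by move=> a la; rewrite /elem_cochain eqxx /cobar_data treeT0 pw la.
  apply: mform_scale; split.
  + by move=> a b la ab; apply: eq_bigr => v vV; rewrite (ab v vV).
  + move=> a v l vV la; set R := \prod_(u in vertices T0 | u != v) lam (reord (L u) (a u)).
    have E p : \prod_(u in vertices T0) lam (reord (L u) (dfwith a (@vdec_op _ _ P X v l p) u)) =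
               R * lam (reord (L v) (vdec_op p)).
      rewrite (bigD1 v) //= dfwith_in mulrC; congr (_ * _); apply: eq_bigr => u /andP[_ uv].
      by rewrite dfwith_out // eq_sym.
    have pl : perm_eq l (L v).
      move/labeledP: la => /(_ v vV); rewrite dfwith_in /= => h.
      by apply: perm_trans h _; rewrite perm_sym perm_L.
    have [s hs] := perm_eq_permutes pl erefl.
    move=> c p q; rewrite !E !(reord_permutes _ (uL vV) hs) cact_linear lam_linear //.
    by rewrite [LHS]mulrDr -[_ *: _]/(_ * _) mulrCA.
  + move=> a b la ab; apply: eq_bigr => v vV; congr lam; apply: reord_relab (ab v vV).
      exact: uL.
    apply: perm_trans (labeledP _ _ la v vV) _.
    by rewrite perm_sym perm_L.
- rewrite /elem_cochain cd; have -> : cobar_data x T w' a.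
    case/and3P: cd => t p l; apply/and3P; split=> //.
    by rewrite (perm_trans _ p) // perm_sym.
  rewrite !andbT; case: eqP => [eT|_]; last by rewrite mulr0.
  have p0 : perm_eq w0 w.
    by case/and3P: cd => _ p _; rewrite (perm_trans perm_w0) // perm_sym -eT.
  by rewrite (par_trans uw0 p0 pw) addbC mulrA signr_addb.
Qed.

Lemma elem_homogeneous : homogeneous (tree_degree T0) elem_cochain.
Proof.
move=> T w a dT; rewrite /elem_cochain; case: eqP => // eT.
by move: dT; rewrite eT eqxx.
Qed.

Lemma elem_cochain_out T w a : T != T0 -> elem_cochain T w a = 0.
Proof. by rewrite /elem_cochain => /negbTE ->. Qed.

Lemma elem_cochain_in a (p : forall v, P (cols (L v)) v.2) :
  (forall v, v \in vertices T0 -> a v = vdec_op (p v)) ->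
  elem_cochain T0 w0 a = \prod_(v in vertices T0) lam (p v).
Proof.
move=> h; rewrite /elem_cochain eqxx /cobar_data treeT0 perm_w0 par_refl mul1r.
have -> : labeled T0 a by apply/labeledP => v vV; rewrite h //=; apply: perm_L.
by apply: eq_bigr => v vV; rewrite h // reord_id // uL.
Qed.

End Elementary.

(** * Sums over dual generators *)

Section Dfwith.
Variables (I : eqType) (T : I -> Type).

Lemma dfwithC (a : forall i, T i) i j (y : T i) (z : T j) : i != j ->
  dfwith (dfwith a y) z = dfwith (dfwith a z) y.
Proof.
move=> ij; apply: functional_extensionality_dep => u.
have [<-|ju] := eqVneq j u; first by rewrite dfwith_in dfwith_out // dfwith_in.
rewrite (dfwith_out _ _ ju); have [<-|iu] := eqVneq i u; first by rewrite !dfwith_in.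
by rewrite !dfwith_out.
Qed.
End Dfwith.

Section GenSum.
Variables (k : fieldType) (m : nat) (C : finType) (P Q : coperad C k) (X : seq C).
Local Notation edge := (edge X).
Variables (gP : 'I_m -> forall Y y, P Y y) (gQ : 'I_m -> forall Y y, Q Y y).

Definition gdec (R : coperad C k) (g : 'I_m -> forall Y y, R Y y) v (l : seq edge) i :
  vdec R v := @vdec_op _ _ R X v l (g i _ _).

(** The canonical element of the product of E and its dual inserted at each
    of the vertices [vs], where [a] and [b] receive the same generator.  It
    is an iterated sum rather than a sum over functions, so that the
    vertices may be treated one after the other. *)
Fixpoint gsum (V : lmodType k) (L : edge -> seq edge) (vs : seq edge)
    (G : decoration P X -> decoration Q X -> V) a b : V :=
  if vs is v :: vs' then
    \sum_i gsum L vs' G (dfwith a (gdec gP v (L v) i)) (dfwith b (gdec gQ v (L v) i))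
  else G a b.

Definition gen_dec (L : edge -> seq edge) (vs : seq edge) (a : decoration P X)
    (b : decoration Q X) :=
  forall v, v \in vs -> exists i, a v = gdec gP v (L v) i /\ b v = gdec gQ v (L v) i.

Section OneSpace.
Variable V : lmodType k.
Implicit Types (G : decoration P X -> decoration Q X -> V) (L : edge -> seq edge).

Lemma gsum_sum L vs (I : Type) (r : seq I) (q : pred I) (G : I -> _ -> _ -> V) a b :
  gsum L vs (fun a b => \sum_(j <- r | q j) G j a b) a b =
  \sum_(j <- r | q j) gsum L vs (G j) a b.
Proof.
elim: vs a b => //= v vs IH a b; rewrite exchange_big /=.
by apply: eq_bigr => i _; apply: IH.
Qed.

Lemma gsum_swap L v w vs G a b : v != w ->
  gsum L (v :: w :: vs) G a b = gsum L (w :: v :: vs) G a b.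
Proof.
move=> vw /=; rewrite exchange_big; apply: eq_bigr => j _; apply: eq_bigr => i _.
by rewrite !(dfwithC _ _ _ vw).
Qed.

Lemma gsum_perm L vs ws G a b : uniq vs -> perm_eq vs ws ->
  gsum L vs G a b = gsum L ws G a b.
Proof.
elim: ws vs a b => [|w ws IH] vs a b us pvw.
  by have /size0nil -> := perm_size pvw.
have wvs : w \in vs by rewrite (perm_mem pvw) mem_head.
have -> : gsum L vs G a b = gsum L (w :: rem w vs) G a b.
  elim: vs a b us wvs {pvw} => [|v vs IHv] a b //= /andP[nv us].
  case: (eqVneq v w) => [->//|vw]; rewrite inE eq_sym (negbTE vw) /= => wv.
  rewrite -[RHS]/(gsum L (w :: v :: rem w vs) G a b) gsum_swap 1?eq_sym //=.
  by apply: eq_bigr => i _; rewrite IHv.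
apply: eq_bigr => i _; apply: IH; first exact: rem_uniq.
by rewrite -(perm_cons w); apply: perm_trans pvw; rewrite perm_sym perm_to_rem.
Qed.

End OneSpace.

Lemma gen_dec_cons L v vs i a b a0 b0 : v \notin vs -> gen_dec L vs a b ->
  (forall w, w \notin vs -> a w = dfwith a0 (gdec gP v (L v) i) w /\
                            b w = dfwith b0 (gdec gQ v (L v) i) w) ->
  gen_dec L (v :: vs) a b /\
  (forall w, w \notin v :: vs -> a w = a0 w /\ b w = b0 w).
Proof.
move=> nv h1 h2; split.
  move=> w; rewrite inE => /orP[/eqP->|/h1 //].
  by exists i; have [-> ->] := h2 v nv; rewrite !dfwith_in.
move=> w; rewrite inE negb_or => /andP[wv nw]; have [-> ->] := h2 w nw.
by rewrite !dfwith_out // eq_sym.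
Qed.

Lemma gsum_eq (V : lmodType k) L vs (G H : decoration P X -> decoration Q X -> V) a0 b0 :
  uniq vs ->
  (forall a b, gen_dec L vs a b -> (forall w, w \notin vs -> a w = a0 w /\ b w = b0 w) ->
     G a b = H a b) ->
  gsum L vs G a0 b0 = gsum L vs H a0 b0.
Proof.
elim: vs a0 b0 => [|v vs IH] a0 b0 /=; first by move=> _ h; apply: h.
case/andP=> nv us h; apply: eq_bigr => i _; apply: IH => // a b h1 h2.
by have [h3 h4] := gen_dec_cons nv h1 h2; apply: h.
Qed.

Lemma gsum_linear_in (U V : lmodType k) L vs (G : U -> decoration P X -> decoration Q X -> V) a0 b0 :
  uniq vs ->
  (forall a b, gen_dec L vs a b -> (forall w, w \notin vs -> a w = a0 w /\ b w = b0 w) ->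
     linear (fun u => G u a b)) ->
  linear (fun u => gsum L vs (G u) a0 b0).
Proof.
elim: vs a0 b0 => [|v vs IH] a0 b0 /=; first by move=> _ h; apply: h.
case/andP=> nv us h; apply: sum_linear => i _; apply: IH => // a b h1 h2.
by have [h3 h4] := gen_dec_cons nv h1 h2; apply: h.
Qed.

End GenSum.

(** As the sums are iterated, it is enough to compare the terms; the trees,
    the operads and the lists of inputs may all change. *)
Lemma gsum_map (k : fieldType) m (C1 C2 : finType) (P1 Q1 : coperad C1 k) (P2 Q2 : coperad C2 k)
   X1 X2 gP1 gQ1 gP2 gQ2 (V1 V2 : lmodType k) (f : V1 -> V2) (h : edge X1 -> edge X2)
   L1 L2 (vs : seq (edge X1)) G1 G2 a1 b1 a2 b2 :
  linear f -> uniq vs -> {in vs &, injective h} ->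
  (forall c1 d1 c2 d2,
     (forall v, v \in vs -> exists i,
        [/\ c1 v = gdec gP1 v (L1 v) i, d1 v = gdec gQ1 v (L1 v) i,
            c2 (h v) = gdec gP2 (h v) (L2 (h v)) i & d2 (h v) = gdec gQ2 (h v) (L2 (h v)) i]) ->
     (forall w, w \notin vs -> c1 w = a1 w /\ d1 w = b1 w) ->
     (forall w, w \notin map h vs -> c2 w = a2 w /\ d2 w = b2 w) ->
     f (G1 c1 d1) = G2 c2 d2) ->
  f (@gsum k m C1 P1 Q1 X1 gP1 gQ1 V1 L1 vs G1 a1 b1) =
  @gsum k m C2 P2 Q2 X2 gP2 gQ2 V2 L2 (map h vs) G2 a2 b2.
Proof.
move=> lf; elim: vs a1 b1 a2 b2 => [|v vs IH] a1 b1 a2 b2 /=.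
  by move=> _ _ H; apply: H.
case/andP=> nv us inj H; rewrite (lin_sum _ _ _ lf); apply: eq_bigr => i _.
have nh : h v \notin map h vs.
  apply/mapP => -[u uvs E]; move/negP: nv; apply.
  by rewrite (inj v u) // ?mem_head // inE uvs orbT.
apply: IH => //; first by move=> u w uu ww; apply: inj; rewrite inE ?uu ?ww orbT.
move=> c1 d1 c2 d2 h1 h2 h3; apply: H.
- move=> w; rewrite inE => /orP[/eqP->|/h1 //]; exists i.
  have [-> ->] := h2 v nv; have [-> ->] := h3 (h v) nh; by rewrite !dfwith_in.
- move=> w; rewrite inE negb_or => /andP[wv nw]; have [-> ->] := h2 w nw.
  by rewrite !dfwith_out // eq_sym.
- move=> w; rewrite inE negb_or => /andP[wv nw]; have [-> ->] := h3 w nw.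
  by rewrite !dfwith_out // eq_sym.
Qed.

Section FfunSum.
Variables (E : finType) (V : zmodType) (m : nat).
Implicit Types (vs : seq E) (K : (E -> option 'I_m) -> V) (f : E -> option 'I_m).

(** A sum over functions on a set of vertices, unfolded one vertex at a
    time; the value [None] marks the vertices not yet reached. *)
Fixpoint itsum vs K f : V :=
  if vs is v :: vs' then \sum_i itsum vs' K (fun w => if w == v then Some i else f w) else K f.

Definition fits vs f (h : {ffun E -> option 'I_m}) :=
  [forall w, if w \in vs then isSome (h w) else h w == f w].

Lemma itsumE vs K f : uniq vs -> itsum vs K f = \sum_(h : {ffun E -> option 'I_m} | fits vs f h) K h.
Proof.
elim: vs f => [|v vs IH] f /=.
  move=> _; rewrite (big_pred1 (finfun f)).
    by congr K; apply/funext => w; rewrite ffunE.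
  move=> h; apply/forallP/eqP => [H|-> w]; last by rewrite ffunE eqxx.
  by apply/ffunP => w; rewrite ffunE; apply/eqP/H.
case/andP=> nv us.
rewrite (eq_bigr (fun i => \sum_(h | fits (v :: vs) f h && (h v == Some i)) K h)); last first.
  move=> i _; rewrite IH //; apply: eq_bigl => h; apply/forallP/andP.
    move=> H; have Hv : h v == Some i by have := H v; rewrite (negbTE nv) eqxx.
    split=> //; apply/forallP => w; have := H w; rewrite inE.
    by case: (eqVneq w v) => [->|]; rewrite ?(eqP Hv).
  case=> /forallP H Hv w; have := H w; rewrite inE.
  by case: (eqVneq w v) => [->|]; rewrite ?(negbTE nv).
rewrite (exchange_big_dep (fits (v :: vs) f)) /=; last by move=> i h _ /andP[].
apply: eq_bigr => h fh; case Hv : (h v) => [j|].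
  by rewrite (big_pred1 j) // => i; rewrite fh /= eq_sym.
by move/forallP/(_ v): fh; rewrite inE eqxx Hv.
Qed.

Lemma sum_ffun_sig (A : {set E}) K :
  \sum_(g : {ffun {v | v \in A} -> 'I_m}) K (fun w => omap g (insub w)) =
  itsum (enum A) K (fun=> None).
Proof.
rewrite itsumE ?enum_uniq //.
pose F (g : {ffun {v | v \in A} -> 'I_m}) : {ffun E -> option 'I_m} :=
  [ffun w => omap g (insub w)].
rewrite (eq_bigr (fun g => \sum_(h | fits (enum A) (fun=> None) h && (h == F g)) K h)); last first.
  move=> g _; rewrite (big_pred1 (F g)) /=.
    by congr K; apply/funext => w; rewrite ffunE.
  move=> h; rewrite andb_idl // => /eqP ->; apply/forallP => w; rewrite mem_enum ffunE.
  by case: insubP => [u -> _|/negbTE ->].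
rewrite (exchange_big_dep (fits (enum A) (fun=> None))) /=; last by move=> ? ? _ /andP[].
apply: eq_bigr => h fh.
have hs (u : {v | v \in A}) : {i | h (val u) == Some i}.
  move/forallP/(_ (val u)): fh; rewrite mem_enum (valP u).
  by case: (h (val u)) => // i _; exists i.
rewrite (big_pred1 [ffun u => sval (hs u)]) // => g; rewrite fh /=.
apply/eqP/eqP => [hg|->].
  apply/ffunP => u; rewrite ffunE; have /eqP := svalP (hs u).
  by rewrite {1}hg ffunE valK => -[].
apply/ffunP => w; rewrite ffunE; case: insubP => [u uA <-|nA] /=.
  by rewrite ffunE; apply/eqP/(svalP (hs u)).
by move/forallP/(_ w): fh; rewrite mem_enum (negbTE nA) => /eqP.
Qed.

End FfunSum.

Section ParFlatten.
Variables (A E : eqType).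
Implicit Types (u w : seq A) (vs : seq E) (L : E -> seq A).

Lemma par_cat u u' w w' : uniq (u ++ w) -> perm_eq u u' -> perm_eq w w' ->
  par (u ++ w) (u' ++ w') = par u u' (+) par w w'.
Proof.
move=> uuw pu pw.
have p1 : perm_eq (u ++ w) (u' ++ w) by rewrite perm_cat2r.
have p2 : perm_eq (u' ++ w) (u' ++ w') by rewrite perm_cat2l.
by rewrite (par_trans uuw p1 p2) par_catr // par_catl.
Qed.

Lemma perm_flatten_map L vs ws : perm_eq vs ws ->
  perm_eq (flatten (map L vs)) (flatten (map L ws)).
Proof. by move=> p; apply: perm_flatten; apply: perm_map. Qed.

(** Each vertex of a binary tree contributes two edges, so that the order of
    the vertices is immaterial for the orientation. *)
Lemma par_flatten_perm L vs ws : uniq vs -> perm_eq vs ws -> uniq (flatten (map L vs)) ->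
  {in vs, forall v, ~~ odd (size (L v))} ->
  par (flatten (map L vs)) (flatten (map L ws)) = false.
Proof.
elim: vs ws => [|v vs IH] ws //=.
case/andP=> nv us p uf ev.
have vws : v \in ws by rewrite -(perm_mem p) mem_head.
have Ew := split_index vws; set s := take _ _ in Ew; set t := drop _ _ in Ew.
have p' : perm_eq vs (s ++ t).
  by rewrite -(perm_cons v); apply: perm_trans p _; rewrite Ew perm_catC /= perm_cons perm_catC.
have uf' : uniq (flatten (map L vs)) by move: uf; rewrite cat_uniq => /and3P[].
have ev' : {in vs, forall z, ~~ odd (size (L z))}.
  by move=> z zv; apply: ev; rewrite inE zv orbT.
have q1 : perm_eq (L v ++ flatten (map L vs)) (L v ++ flatten (map L (s ++ t))).
  by rewrite perm_cat2l perm_flatten_map.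
have q2 : perm_eq (L v ++ flatten (map L (s ++ t))) (flatten (map L ws)).
  by rewrite Ew !map_cat !flatten_cat /= perm_catCA.
rewrite (par_trans uf q1 q2) par_catl IH // Ew !map_cat !flatten_cat /= !catA.
have uu : uniq ((L v ++ flatten (map L s)) ++ flatten (map L t)).
  by rewrite -catA -flatten_cat -map_cat -(perm_uniq q1).
rewrite par_catr; last by rewrite perm_catC.
rewrite par_swap; last by move: uu; rewrite cat_uniq => /andP[].
by rewrite (negbTE (ev v _)) // mem_head.
Qed.
End ParFlatten.

Section Orders.
Variables (C : finType) (X : seq C) (x : C) (T : {set edge X}).
Hypothesis treeT : is_tree x T.
Variable L : edge X -> seq (edge X).

Definition lists_inputs (vs : seq (edge X)) :=
  {in vs, forall v, perm_eq (L v) (enum (inputs T v))}.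

Lemma uniq_flatten_inputs vs : uniq vs -> {subset vs <= vertices T} -> lists_inputs vs ->
  uniq (flatten (map L vs)).
Proof.
elim: vs => //= v vs IH /andP[nv us] sub h.
have vV : v \in vertices T by apply: sub; apply: mem_head.
have sub' : {subset vs <= vertices T} by move=> w wv; apply: sub; rewrite inE wv orbT.
have h' : lists_inputs vs by move=> w wv; apply: h; rewrite inE wv orbT.
rewrite cat_uniq (IH us sub' h') andbT (perm_uniq (h v _)) ?mem_head // enum_uniq /=.
apply/hasPn => e /flattenP[l /mapP[w wv ->]] ew; apply/negP => /= ev.
move: ew ev; rewrite (perm_mem (h' w wv)) (perm_mem (h v _)) ?mem_head // !mem_enum => ew ev.
move/negP: nv; apply.
by rewrite (parent_unique treeT (vertex_in vV) (vertex_in (sub' _ wv)) ev ew).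
Qed.

Lemma perm_flatten_inputs vs : perm_eq vs (enum (vertices T)) -> lists_inputs vs ->
  perm_eq (flatten (map L vs)) (enum (nonroot T)).
Proof.
move=> p h; have us : uniq vs by rewrite (perm_uniq p) enum_uniq.
have mem v : (v \in vs) = (v \in vertices T) by rewrite (perm_mem p) mem_enum.
apply: uniq_perm; rewrite ?enum_uniq //.
  by apply: uniq_flatten_inputs => // v; rewrite mem.
move=> e; rewrite mem_enum; apply/flattenP/idP => [[l /mapP[v vv ->]]|eN].
  by rewrite (perm_mem (h v vv)) mem_enum => /inputs_nonroot.
have [v vV ev] := parent_exists treeT eN; exists (L v).
  by apply: map_f; rewrite mem.
by rewrite (perm_mem (h v _)) ?mem // mem_enum.
Qed.
End Orders.

Section NaturalSum.
Variables (k : fieldType) (m : nat) (C : finType) (P Q : coperad C k) (X : seq C) (x : C).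
Local Notation edge := (edge X).
Variables (gP : 'I_m -> forall Y y, P Y y) (gQ : 'I_m -> forall Y y, Q Y y).
Local Notation gsum := (gsum gP gQ).

(** The generators of [P] and [Q] behave like dual bases of an S_2-module
    and of its dual twisted by the sign: the canonical element is multiplied
    by the sign. *)
Definition sign_dual := forall (Y Y' : seq C) y (s : 'S_2) (V : lmodType k)
  (B : P Y' y -> Q Y' y -> V), permutes s Y Y' ->
  (forall q, linear (fun p => B p q)) -> (forall p, linear (B p)) ->
  \sum_i B (cact Y' s (gP i Y y)) (cact Y' s (gQ i Y y)) =
  (-1) ^+ s *: \sum_i B (gP i Y' y) (gQ i Y' y).

Hypothesis dualPQ : sign_dual.

Lemma gsum_dfwith (V : lmodType k) L vs (G : decoration P X -> decoration Q X -> V) v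
    (z : vdec P v) (z' : vdec Q v) a b : v \notin vs ->
  gsum L vs G (dfwith a z) (dfwith b z') =
  gsum L vs (fun a b => G (dfwith a z) (dfwith b z')) a b.
Proof.
elim: vs a b => //= w vs IH a b; rewrite inE negb_or => /andP[vw nv].
by apply: eq_bigr => i _; rewrite !(dfwithC _ _ _ vw) IH.
Qed.

Definition biform (V : lmodType k) T (G : decoration P X -> decoration Q X -> V) :=
  (forall b, labeled T b -> mform T (fun a => G a b)) /\
  (forall a, labeled T a -> mform T (G a)).

(** Relisting the inputs of a vertex lets the same transposition act on both
    generators there, which multiplies the canonical element by its sign. *)
Lemma gsum_list (V : lmodType k) T (G : decoration P X -> decoration Q X -> V) L L' vs a0 b0 :
  is_tree x T -> biform T G -> uniq vs -> {subset vs <= vertices T} ->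
  lists_inputs T L vs -> lists_inputs T L' vs -> {in vs, forall v, size (L v) = 2%N} ->
  (forall v, v \in vertices T -> v \notin vs ->
     perm_eq (tag (a0 v)) (enum (inputs T v)) /\ perm_eq (tag (b0 v)) (enum (inputs T v))) ->
  gsum L vs G a0 b0 =
  (-1) ^+ par (flatten (map L vs)) (flatten (map L' vs)) *: gsum L' vs G a0 b0.
Proof.
move=> tT [G1 G2]; elim: vs a0 b0 => [|v vs IH] a0 b0 /=; first by rewrite expr0 scale1r.
case/andP=> nv us sub hL hL' sz h0.
have vV : v \in vertices T by apply: sub; apply: mem_head.
have sub' : {subset vs <= vertices T} by move=> w wv; apply: sub; rewrite inE wv orbT.
have hLt : lists_inputs T L vs by move=> w wv; apply: hL; rewrite inE wv orbT.
have hLt' : lists_inputs T L' vs by move=> w wv; apply: hL'; rewrite inE wv orbT.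
have szt : {in vs, forall v, size (L v) = 2%N}.
  by move=> w wv; apply: sz; rewrite inE wv orbT.
have pLv := hL v (mem_head _ _); have pLv' := hL' v (mem_head _ _).
have pvv : perm_eq (L v) (L' v) by rewrite (perm_trans pLv) // perm_sym.
have [s hs] := perm_eq_permutes pvv (sz v (mem_head _ _)).
have uLv' : uniq (L' v) by rewrite (perm_uniq pLv') enum_uniq.
have uLv : uniq (L v) by rewrite (perm_uniq pLv) enum_uniq.
rewrite par_cat //; last 2 first.
- by have := @uniq_flatten_inputs _ _ _ _ tT L (v :: vs); apply=> //=; rewrite nv.
- apply: (@perm_trans _ (flatten (map (fun v => enum (inputs T v)) vs))).
    by elim: vs hLt {IH nv us sub hL hL' sz h0 sub' hLt' szt} => //= w vs IH h;
       rewrite perm_cat ?h ?mem_head // IH // => z zv; apply: h; rewrite inE zv orbT.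
  rewrite perm_sym.
  by elim: vs hLt' {IH nv us sub hL hL' sz h0 sub' hLt szt} => //= w vs IH h;
       rewrite perm_cat ?h ?mem_head // IH // => z zv; apply: h; rewrite inE zv orbT.
rewrite signr_addb -scalerA -(permutes_par uLv' hs).
rewrite (eq_bigr (fun i => (-1) ^+ par (flatten (map L vs)) (flatten (map L' vs)) *:
   gsum L' vs G (dfwith a0 (gdec gP v (L v) i)) (dfwith b0 (gdec gQ v (L v) i)))); last first.
  move=> i _; apply: IH => // w wV nw; have [<-|vw] := eqVneq v w.
    by rewrite !dfwith_in.
  by rewrite !dfwith_out //; apply: h0 => //; rewrite inE negb_or eq_sym vw.
rewrite -scaler_sumr scalerA mulrC -scalerA; congr (_ *: _).
pose B (p : P (cols (L' v)) v.2) (q : Q (cols (L' v)) v.2) : V :=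
  gsum L' vs (fun c d => G (dfwith c (@vdec_op _ _ P X v _ p)) (dfwith d (@vdec_op _ _ Q X v _ q))) a0 b0.
have lab c d (z : vdec P v) (z' : vdec Q v) : gen_dec gP gQ L' vs c d ->
    (forall w, w \notin vs -> c w = a0 w /\ d w = b0 w) ->
    perm_eq (tag z) (enum (inputs T v)) -> perm_eq (tag z') (enum (inputs T v)) ->
    labeled T (dfwith c z) /\ labeled T (dfwith d z').
  move=> hg ho pz pz'; suff H w : w \in vertices T ->
    perm_eq (tag (dfwith c z w)) (enum (inputs T w)) /\
    perm_eq (tag (dfwith d z' w)) (enum (inputs T w)).
    by split; apply/labeledP => w /H[].
  move=> wV; have [<-|vw] := eqVneq v w; first by rewrite !dfwith_in.
  rewrite !dfwith_out //; have [wv|nw] := boolP (w \in vs).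
    by have [i [-> ->]] := hg w wv; split; apply: hLt'.
  by have [-> ->] := ho w nw; apply: h0 => //; rewrite inE negb_or eq_sym vw.
transitivity (\sum_i B (cact (cols (L' v)) s (gP i (cols (L v)) v.2))
                       (cact (cols (L' v)) s (gQ i (cols (L v)) v.2))).
  apply: eq_bigr => i _; rewrite gsum_dfwith //; apply: gsum_eq => // c d hg ho.
  have [l1 l2] := lab c d (gdec gP v (L v) i) (gdec gQ v (L v) i) hg ho pLv pLv.
  have [l3 l4] := lab c d (@vdec_op _ _ P X v _ (cact (cols (L' v)) s (gP i (cols (L v)) v.2)))
     (gdec gQ v (L v) i) hg ho pLv' pLv.
  have r1 (R : coperad C k) (e : decoration R X) (p : R (cols (L v)) v.2) :
     relabeling T (dfwith e (@vdec_op _ _ R X v _ p))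
                  (dfwith e (@vdec_op _ _ R X v _ (cact (cols (L' v)) s p))).
    move=> w wV; have [<-|vw] := eqVneq v w; first by rewrite !dfwith_in; apply: relab_op.
    by rewrite !dfwith_out //; apply: relab_refl.
  by rewrite (mf_relab (G1 _ l2) l1 (r1 _ _ _)) (mf_relab (G2 _ l3) l2 (r1 _ _ _)).
rewrite (dualPQ (permutes_map _ hs)).
- congr (_ *: _); apply: eq_bigr => i _; rewrite gsum_dfwith //.
- move=> q; apply: (@gsum_linear_in _ _ _ _ _ _ _ _ _ _ _ _
    (fun p c d => G (dfwith c (@vdec_op _ _ P X v _ p)) (dfwith d (@vdec_op _ _ Q X v _ q)))) => // c d hg ho.
  have [l1 l2] := lab c d (@vdec_op _ _ P X v (L' v) 0) (@vdec_op _ _ Q X v (L' v) q) hg ho pLv' pLv'.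
  by apply: (mf_linear (G1 _ l2)).
- move=> p; apply: (@gsum_linear_in _ _ _ _ _ _ _ _ _ _ _ _
    (fun q c d => G (dfwith c (@vdec_op _ _ P X v _ p)) (dfwith d (@vdec_op _ _ Q X v _ q)))) => // c d hg ho.
  have [l1 l2] := lab c d (@vdec_op _ _ P X v (L' v) p) (@vdec_op _ _ Q X v (L' v) 0) hg ho pLv' pLv'.
  by apply: (mf_linear (G2 _ l1)).
Qed.

Definition dec0 (R : coperad C k) : decoration R X := fun v => @vdec_op _ _ R X v [::] 0.

Definition term (phi : precochain Q X) T w (a : decoration P X) (b : decoration Q X) : P X x :=
  phi T w b *: tree_comp x T a.

Lemma term_biform phi T w : is_tree x T -> cochain x phi -> biform T (term phi T w).
Proof.
move=> tT h; split=> [b lb|a la].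
  by apply: (@mform_scale _ _ _ _ (P X x) T (phi T w b)); apply: tree_comp_mform.
have [m1 m2 m3] := cochain_mform h T w; split.
- by move=> c d lc cd; rewrite /term (m1 c d).
- by move=> c v l vV lc r p q; rewrite /term (m2 c v l vV lc) scalerDl scalerA.
- by move=> c d lc cd; rewrite /term (m3 c d).
Qed.

Definition tree_sum phi T L vs : P X x :=
  gsum L vs (term phi T (flatten (map L vs))) (dec0 P) (dec0 Q).

Lemma binary_size (T : {set edge}) L vs v : is_binary T -> lists_inputs T L vs -> v \in vs ->
  v \in vertices T -> size (L v) = 2%N.
Proof.
move=> bT hL vv vV; rewrite (perm_size (hL v vv)) -cardE.
by apply/eqP; move/forall_inP: bT; apply.
Qed.

(** The signs coming from the new lists of inputs are those by which the
    orientation changes. *)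
Lemma tree_sum_indep phi T L vs L' vs' : is_tree x T -> is_binary T -> cochain x phi ->
  perm_eq vs (enum (vertices T)) -> perm_eq vs' (enum (vertices T)) ->
  lists_inputs T L vs -> lists_inputs T L' vs' ->
  tree_sum phi T L vs = tree_sum phi T L' vs'.
Proof.
move=> tT bT h p p' hL hL'.
have us : uniq vs by rewrite (perm_uniq p) enum_uniq.
have us' : uniq vs' by rewrite (perm_uniq p') enum_uniq.
have mem v : (v \in vs) = (v \in vertices T) by rewrite (perm_mem p) mem_enum.
have mem' v : (v \in vs') = (v \in vertices T) by rewrite (perm_mem p') mem_enum.
have pv : perm_eq vs vs' by rewrite (perm_trans p) // perm_sym.
have hL2 : lists_inputs T L vs' by move=> v vv; apply: hL; rewrite mem -mem'.
have uf := uniq_flatten_inputs tT us (fun v vv => etrans (esym (mem v)) vv) hL.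
have uf' := uniq_flatten_inputs tT us' (fun v vv => etrans (esym (mem' v)) vv) hL'.
have pf := perm_flatten_inputs tT p hL; have pf' := perm_flatten_inputs tT p' hL'.
have pf2 := perm_flatten_inputs tT p' hL2.
rewrite /tree_sum (@gsum_perm _ _ _ _ _ _ _ _ _ _ vs vs') //.
rewrite (@gsum_list _ T _ L L' vs') //; last first.
- by move=> v vV; rewrite mem' vV.
- by move=> v vv; apply: (binary_size bT hL2 vv); rewrite -mem'.
- by move=> v; rewrite mem'.
- exact: term_biform.
have lin : linear (fun u : P X x => (-1) ^+ par (flatten (map L vs')) (flatten (map L' vs')) *: u).
  by move=> c y z; rewrite scalerDr !scalerA mulrC.
have := @gsum_map k m C C P Q P Q X X gP gQ gP gQ _ _ _ id L' L' vs'
  (term phi T (flatten (map L vs))) (term phi T (flatten (map L' vs')))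
  (dec0 P) (dec0 Q) (dec0 P) (dec0 Q) lin us'; rewrite map_id; apply; first by move=> ? ? _ _.
move=> c1 d1 c2 d2 h1 h2 h3.
have E : c1 = c2 /\ d1 = d2.
  split; apply: functional_extensionality_dep => v; have [vv|nv] := boolP (v \in vs').
  - by have [i [-> _ -> _]] := h1 v vv.
  - by have [-> _] := h2 v nv; have [-> _] := h3 v nv.
  - by have [i [_ -> _ ->]] := h1 v vv.
  - by have [_ ->] := h2 v nv; have [_ ->] := h3 v nv.
case: E => <- <-; rewrite /term scalerA; congr (_ *: _).
have pff : perm_eq (flatten (map L' vs')) (flatten (map L vs)).
  by rewrite (perm_trans pf') // perm_sym.
rewrite (cochain_par h _ _ uf' pff) mulrA -signr_addb.
have pff2 : perm_eq (flatten (map L vs')) (flatten (map L' vs')).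
  by rewrite (perm_trans pf2) // perm_sym.
rewrite -par_trans //; last by rewrite (perm_uniq pf2) enum_uniq.
rewrite par_flatten_perm ?mul1r //.
- by rewrite perm_sym.
- by rewrite (perm_uniq pf2) enum_uniq.
- by move=> v vv; rewrite (binary_size bT hL2 vv) // -mem'.
Qed.

End NaturalSum.

Section Monomials.
Variables (k : fieldType) (m : nat) (C : finType) (P Q : coperad C k) (X : seq C) (x : C).
Local Notation edge := (edge X).
Variables (gP : 'I_m -> forall Y y, P Y y) (gQ : 'I_m -> forall Y y, Q Y y).
Local Notation gsum := (gsum gP gQ).

Definition std_list (T : {set edge}) v := enum (inputs T v).

Lemma std_lists T vs : lists_inputs T (std_list T) vs. Proof. by move=> v _. Qed.

(** A monomial chooses one generator at each vertex of a binary tree. *)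
Lemma monomial_sum (V : lmodType k) (F : {set edge} -> decoration P X -> decoration Q X -> V) :
  (forall T a a' b b', is_tree x T -> is_binary T -> labeled T a -> labeled T b ->
     agree (vertices T) a a' -> agree (vertices T) b b' -> F T a b = F T a' b') ->
  \sum_(mu : monomial m X x) F (mono_tree mu) (mono_dec gP mu) (mono_dec gQ mu) =
  \sum_(T : {set edge} | is_tree x T && is_binary T)
     gsum (std_list T) (enum (vertices T)) (F T) (@dec0 k C X P) (@dec0 k C X Q).
Proof.
move=> loc; pose dec (R : coperad C k) (g : 'I_m -> forall Y y, R Y y) (T : {set edge})
   (f : edge -> option 'I_m) (a : decoration R X) : decoration R X :=
   fun v => if f v is Some i then gdec g v (std_list T v) i else a v.
pose H (T : {set edge}) : V :=
  \sum_(iota : {ffun {v | v \in vertices T} -> 'I_m})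
     F T (dec P gP T (fun w => omap iota (insub w)) (@dec0 k C X P))
         (dec Q gQ T (fun w => omap iota (insub w)) (@dec0 k C X Q)).
transitivity (\sum_(T : {set edge} | is_tree x T && is_binary T) H T).
  rewrite (big_sub (fun T : {set edge} => is_tree x T && is_binary T) H) /H /=.
  rewrite (sig_big_dep (fun _ => true)
    (fun (T : binary_tree X x) (_ : {ffun {v | v \in vertices (val T)} -> 'I_m}) => true)
    (fun (T : binary_tree X x) iota => F (val T)
     (dec P gP (val T) (fun w => omap iota (insub w)) (@dec0 k C X P))
     (dec Q gQ (val T) (fun w => omap iota (insub w)) (@dec0 k C X Q)))) /=.
  apply: eq_bigr => -[T iota] _ /=; rewrite /mono_tree /=.
  have /andP[tT bT] := valP T.
  apply: loc => //; try by apply/labeledP => v vV.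
    by move=> v vV; rewrite /dec /mono_dec /=; case: insubP => [u _ _|] /=; rewrite ?vV.
  by move=> v vV; rewrite /dec /mono_dec /=; case: insubP => [u _ _|] /=; rewrite ?vV.
apply: eq_bigr => T _; rewrite /H.
rewrite (sum_ffun_sig (vertices T) (fun f => F T (dec P gP T f (@dec0 k C X P)) (dec Q gQ T f (@dec0 k C X Q)))).
have dE (R : coperad C k) (g : 'I_m -> forall Y y, R Y y) f v i a :
    dec R g T f (@dec0 k C X R) = a ->
    dec R g T (fun w => if w == v then Some i else f w) (@dec0 k C X R) =
    dfwith a (gdec g v (std_list T v) i).
  move=> <-; apply: functional_extensionality_dep => w; rewrite /dec.
  by have [->|wv] := eqVneq w v; rewrite ?dfwith_in // dfwith_out // eq_sym.
suff H' vs f a b : dec P gP T f (@dec0 k C X P) = a -> dec Q gQ T f (@dec0 k C X Q) = b ->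
    itsum vs (fun f => F T (dec P gP T f (@dec0 k C X P)) (dec Q gQ T f (@dec0 k C X Q))) f =
    gsum (std_list T) vs (F T) a b by apply: H'.
elim: vs f a b => [|v vs IH] f a b /=; first by move=> -> ->.
by move=> ha hb; apply: eq_bigr => i _; apply: IH; apply: dE.
Qed.

End Monomials.

(** * Maps of operads and evaluation *)

Lemma ocast_trans (k : fieldType) (O : operad k) m n p (a : O m) :
  m = n -> ocast p (ocast n a) = ocast p a.
Proof. by move=> e; subst n; rewrite ocast_id. Qed.

Lemma oact_cast (k : fieldType) (O : operad k) n (s : 'S_n) (a : O n) p (e : n = p) :
  ocast p (oact s a) = oact (cast_perm e s) (ocast p a).
Proof. by subst p; rewrite !ocast_id cast_perm_id. Qed.

(** Compositions are only required to be preserved when they are meaningful. *)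
Record opmap (k : fieldType) (O1 O2 : operad k) (h : forall n, O1 n -> O2 n) : Prop := OpMap {
  opm_unit : h 1%N ounit = ounit;
  opm_act : forall n (s : 'S_n) a, h n (oact s a) = oact s (h n a);
  opm_comp : forall m n p i (a : O1 m) (b : O1 n), (i < m)%N -> p.+1 = (m + n)%N ->
    h p (ocomp p i a b) = ocomp p i (h m a) (h n b) }.

Lemma opm_cast (k : fieldType) (O1 O2 : operad k) (h : forall n, O1 n -> O2 n) m n (a : O1 m) :
  m = n -> h n (ocast n a) = ocast n (h m a).
Proof. by move=> e; subst n; rewrite !ocast_id. Qed.

Lemma opmap_id (k : fieldType) (O : operad k) : opmap (fun n (a : O n) => a).
Proof. by []. Qed.

Definition mval (k : fieldType) (O : operad k) (X : seq unit) (v : edge X)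
  (d : vdec (mono O) v) : O (size (cols (tag d))) := tagged d.

Section Naturality.
Variables (k : fieldType) (O1 O2 : operad k) (h : forall n, O1 n -> O2 n).
Hypothesis mh : opmap h.
Variables (C : finType) (adm : seq C -> C -> bool).
Hypothesis adm1 : forall c x, adm [:: c] x = (c == x).
Hypothesis adm_perm :
  forall n (s : 'S_n) X Y x, permutes s X Y -> adm X x = adm Y x.
Hypothesis adm_graft : forall X i y Y Z x,
  grafts X i y Y Z -> adm X x -> adm Y y -> adm Z x.
Local Notation P1 := (mono O1).
Local Notation P2 := (colorize adm1 adm_perm adm_graft O2).
Variables (X1 : seq unit) (X2 : seq C) (theta : edge X1 -> edge X2).
Hypothesis theta_inj : injective theta.

(** A relation rather than a function: the operations at [v1] and [v2] live
    in spaces that depend on the lists of inputs. *)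
Definition image_dec (v1 : edge X1) (v2 : edge X2) (d1 : vdec P1 v1) (d2 : vdec P2 v2) : Prop :=
  [/\ tag d2 = map theta (tag d1), adm (cols (tag d2)) v2.2
    & @col_in _ adm k O2 _ _ (tagged d2) = h (ocast (size (cols (tag d2))) (mval d1))].

Lemma image_contract e v (a1 : decoration P1 X1) (a2 : decoration P2 X2) :
  image_dec (a1 v) (a2 (theta v)) -> image_dec (a1 e) (a2 (theta e)) ->
  image_dec (contract e a1 v) (contract (theta e) a2 (theta v)).
Proof.
move=> [tv av cv] [te ae ce].
have mem : (theta e \in tag (a2 (theta v))) = (e \in tag (a1 v)) by rewrite tv mem_map.
have [ev|ev] := boolP (e \in tag (a1 v)); last by rewrite !contract_out ?mem.
have ev2 : theta e \in tag (a2 (theta v)) by rewrite mem.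
rewrite !contract_in //.
have Ei : index (theta e) (tag (a2 (theta v))) = index e (tag (a1 v)).
  by rewrite tv index_map.
have g2 := grafts_splice (tag (a2 (theta e))) ev2.
have g1 := grafts_splice (tag (a1 e)) ev.
have ad := adm_graft g2 av ae.
have [l1 s1] := size_grafts g1; have [l2 s2] := size_grafts g2.
split=> //=; first by rewrite map_splice -tv -te Ei.
rewrite [LHS](col_outK _ ad) /mval /= cv ce.
rewrite -(opm_comp mh) //; congr (h _).
rewrite Ei ocomp_castl; last by rewrite tv !size_map.
rewrite ocomp_castr; last by rewrite te !size_map.
rewrite /col_comp /=.
rewrite (ocast_ocomp (p' := size (cols (splice (tag (a2 (theta v))) (index e (tag (a1 v)))
  (tag (a2 (theta e))))))) //.
apply: succn_inj; rewrite s1 -Ei s2 tv te; by rewrite !size_map.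
Qed.

Section TreeImage.
Variables (x1 : unit) (x2 : C).
Hypothesis hleaf : leaf_edges X2 = map theta (leaf_edges X1).
Hypothesis hroot : theta (root_edge X1 x1) = root_edge X2 x2.
Hypothesis htree : forall T, is_tree x1 T -> is_tree x2 (theta @: T).
Hypothesis hint : forall T, is_tree x1 T -> internal (theta @: T) = theta @: internal T.
Hypothesis hver : forall T, is_tree x1 T -> vertices (theta @: T) = theta @: vertices T.
Hypothesis hlab : forall T (a1 : decoration P1 X1) (a2 : decoration P2 X2),
  is_tree x1 T -> labeled T a1 -> {in vertices T, forall v, image_dec (a1 v) (a2 (theta v))} ->
  labeled (theta @: T) a2.
Hypothesis admX : adm X2 x2.

Let sX : size X1 = size X2.
Proof. by rewrite -(size_leaf_edges X1) -(size_leaf_edges X2) hleaf size_map. Qed.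

Definition mtree_comp T (a : decoration P1 X1) : O1 (size X1) := tree_comp x1 T a.

(** Contractions correspond to contractions, which reduces the claim to
    corollas. *)
Lemma image_tree_comp T (a1 : decoration P1 X1) (a2 : decoration P2 X2) :
  is_tree x1 T -> labeled T a1 ->
  {in vertices T, forall v, image_dec (a1 v) (a2 (theta v))} ->
  @col_in _ adm k O2 _ _ (tree_comp x2 (theta @: T) a2) = h (ocast (size X2) (mtree_comp T a1)).
Proof.
move=> tT; move: T tT a1 a2; apply: tree_ind => [T tT iT|T e tT eI IH] a1 a2 la ha; last first.
  have eI2 : theta e \in internal (theta @: T) by rewrite hint // imset_f.
  rewrite /mtree_comp (tree_comp_contract tT la eI).
  rewrite (tree_comp_contract (htree tT) (hlab tT la ha) eI2).
  have -> : theta @: T :\ theta e = theta @: (T :\ e).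
    apply/setP => f; apply/setD1P/imsetP => [[fe /imsetP[g gT E]]|[g /setD1P[ge gT] ->]].
      by exists g => //; apply/setD1P; split=> //; apply: contraNneq fe => <-; rewrite E.
    by rewrite (inj_eq theta_inj) imset_f.
  apply: IH; first exact: (contract_labeled tT eI la).
  move=> v; rewrite vertices_erase => /setD1P[ve vV].
  by apply: image_contract; apply: ha => //; apply: internal_vertex.
have iT2 : internal (theta @: T) = set0 by rewrite hint // iT imset0.
have [X1s|X1l] := leqP (size X1) 1.
  have X11 : (size X1 == 1)%N by rewrite eqn_leq X1s (size_gt0_tree tT).
  have X21 : (size X2 == 1)%N by rewrite -sX.
  rewrite /mtree_comp /tree_comp X11 X21 /=.
  have su : size [:: x1] = 1%N by [].
  rewrite /col_act /col_unit /= !col_outK ?adm1 ?eqxx //= !ocast_id.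
  have o1 (O : operad k) (s : 'S_1) (a : O 1%N) : oact s a = a.
    have -> : s = 1%g by apply/permP => i; rewrite [LHS]ord1 [RHS]ord1.
    exact: oact1.
  rewrite !o1 ocast_trans; last by rewrite (eqP X11).
  by rewrite (opm_cast h) ?opm_unit // (eqP X21).
have X2l : (1 < size X2)%N by rewrite -sX.
have rV : root_edge X1 x1 \in vertices T by apply: root_vertex.
have [tr ar cr] := ha _ rV; rewrite hroot in tr ar cr.
have [s hs] := corolla_perm tT iT X1l la.
have hs2 : permutes (cast_perm sX s) (tag (a2 (root_edge X2 x2))) (leaf_edges X2).
  have := permutes_map theta hs; rewrite -hleaf -tr.
  move=> /permutesP[p1 p2 p3]; apply/permutesP; split; [exact: etrans p1 sX|exact: etrans p2 sX|].
  by move=> i; rewrite cast_permE /= -(p3 (cast_ord (esym sX) i)).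
rewrite /mtree_comp (tree_comp_corolla iT X1l hs) (tree_comp_corolla iT2 X2l hs2).
rewrite [cact X2 _ _]/(@col_act _ adm k O2 _ _ _ _ (cast_perm sX s) _) /col_act col_outK //.
rewrite cr [cact X1 _ _]/(@col_act _ mono_adm k O1 _ _ _ _ s (mval _)) /col_act /=.
have z1 : size (cols (tag (a1 (root_edge X1 x1)))) = size X1.
  by rewrite size_map; have /permutesP[] := hs.
have z2 : size (cols (tag (a2 (root_edge X2 x2)))) = size X2.
  by rewrite size_map; have /permutesP[] := hs2.
rewrite !ocast_id -(opm_cast h) // ocast_trans ?z1 ?z2 //.
by rewrite -(opm_act mh) oact_cast ocast_trans.
Qed.

End TreeImage.
End Naturality.

Section SignDual.
Variables (k : fieldType) (O1 O2 : operad k) (m : nat).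
Variables (C : finType) (adm : seq C -> C -> bool).
Hypothesis adm1 : forall c x, adm [:: c] x = (c == x).
Hypothesis adm_perm :
  forall n (s : 'S_n) X Y x, permutes s X Y -> adm X x = adm Y x.
Hypothesis adm_graft : forall X i y Y Z x,
  grafts X i y Y Z -> adm X x -> adm Y y -> adm Z x.
Variables (g1 : 'I_m -> O1 2%N) (g2 : 'I_m -> O2 2%N).

(** The same property as [sign_dual], before operations are viewed as
    colored ones *)
Definition op_sign_dual := forall (s : 'S_2) (V : lmodType k) (B : O1 2%N -> O2 2%N -> V),
  (forall q, linear (fun p => B p q)) -> (forall p, linear (B p)) ->
  \sum_i B (oact s (g1 i)) (oact s (g2 i)) = (-1) ^+ s *: \sum_i B (g1 i) (g2 i).

Definition col_gen (O : operad k) (g : 'I_m -> O 2%N) :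
    'I_m -> forall Y y, colorize adm1 adm_perm adm_graft O Y y :=
  fun i Y y => @col_out _ adm k O Y y (ocast (size Y) (g i)).

Lemma sign_dual_col : op_sign_dual -> sign_dual (col_gen g1) (col_gen g2).
Proof.
move=> H Y Y' y s V B hs B1 B2.
have [aY'|naY'] := boolP (adm Y' y); last first.
  rewrite !big1 ?scaler0 // => i _.
    by rewrite [gP in B gP _](col_eq0 _ naY') (lin0 (B1 _)).
  by rewrite [X in B X _](col_eq0 _ naY') (lin0 (B1 _)).
have aY : adm Y y by rewrite (adm_perm y hs).
have /permutesP[sY sY' _] := hs.
pose f (O : operad k) (p : O 2%N) : colorize adm1 adm_perm adm_graft O Y' y :=
  @col_out _ adm k O Y' y (ocast (size Y') p).
have fl (O : operad k) : linear (@f O).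
  by move=> c p q; rewrite /f ocast_linear; apply: col_out_linear.
have := H s V (fun p q => B (f O1 p) (f O2 q)); rewrite -/(f _ _) => <-.
- apply: eq_bigr => i _; rewrite /f; congr (B _ _).
    rewrite [LHS]/(@col_act _ adm k O1 _ _ _ _ s _) /col_act /col_gen col_outK //.
    by rewrite ocastK.
  rewrite [LHS]/(@col_act _ adm k O2 _ _ _ _ s _) /col_act /col_gen col_outK //.
  by rewrite ocastK.
- by move=> q c p p'; rewrite fl B1.
- by move=> p c q q'; rewrite fl B2.
Qed.

End SignDual.

(** * Resolution of a ternary vertex *)

Lemma big_bij (V : zmodType) (I J : finType) (A : pred I) (B : pred J) (h : J -> I) (F : I -> V) :
  (forall q, B q -> A (h q)) -> (forall p, A p -> exists2 q, B q & h q = p) ->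
  (forall q q', B q -> B q' -> h q = h q' -> q = q') ->
  \sum_(p | A p) F p = \sum_(q | B q) F (h q).
Proof.
move=> hA hS hI.
rewrite (eq_bigr (fun p => \sum_(q | B q && (h q == p)) F p)); last first.
  move=> p /hS[q Bq <-]; rewrite (big_pred1 q) // => q'; apply/andP/eqP => [[Bq' /eqP]|->].
    exact: hI.
  by rewrite Bq eqxx.
rewrite (exchange_big_dep B) /=; last by move=> ? ? _ /andP[].
apply: eq_bigr => q Bq; rewrite (eq_bigl (pred1 (h q))); last first.
  by move=> p; rewrite Bq /= eq_sym; case: eqP => [->|]; rewrite ?andbF // hA.
by rewrite big_pred1_eq.
Qed.

Section SplitVertex.
Variables (C : finType) (X : seq C) (x c : C).
Local Notation edge := (edge X).
Implicit Types (T : {set edge}) (e f v : edge).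

(** Resolving a ternary vertex with inputs [y0], [y1], [y2] by a new edge above
    which are [y0] and [y1] *)
Section Split.
Variables (T : {set edge}) (u y0 y1 y2 : edge).
Hypothesis treeT : is_tree x T.
Hypothesis uV : u \in vertices T.
Hypothesis pu : perm_eq [:: y0; y1; y2] (enum (inputs T u)).

(** The edge above which lie exactly the leaves above [y0] and [y1] *)
Definition join_edge (y0 y1 : edge) : edge := (y0.1 :|: y1.1, c).
Let e := join_edge y0 y1.

Let memu f : (f \in inputs T u) = (f \in [:: y0; y1; y2]).
Proof. by rewrite (perm_mem pu) mem_enum. Qed.
Let i0 : y0 \in inputs T u. Proof. by rewrite memu mem_head. Qed.
Let i1 : y1 \in inputs T u. Proof. by rewrite memu !inE eqxx orbT. Qed.
Let i2 : y2 \in inputs T u. Proof. by rewrite memu !inE eqxx !orbT. Qed.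
Let uy : uniq [:: y0; y1; y2]. Proof. by rewrite (perm_uniq pu) enum_uniq. Qed.
Let ny : [/\ y0 != y1, y0 != y2 & y1 != y2].
Proof. by move: uy; rewrite /= !inE !negb_or andbT => /andP[/andP[]]. Qed.
Let d01 : [disjoint y0.1 & y1.1].
Proof. by case: ny => h _ _; apply: (inputs_disjoint treeT i0 i1). Qed.
Let d02 : [disjoint y0.1 & y2.1].
Proof. by case: ny => _ h _; apply: (inputs_disjoint treeT i0 i2). Qed.
Let d12 : [disjoint y1.1 & y2.1].
Proof. by case: ny => _ _ h; apply: (inputs_disjoint treeT i1 i2). Qed.

Let disjE (A B : {set 'I_(size X)}) i : [disjoint A & B] -> i \in A -> i \in B -> False.
Proof. by move=> /pred0P/(_ i) /= h iA iB; rewrite iA iB in h. Qed.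

Let p0e : y0.1 \proper e.1.
Proof.
apply/properP; split; first exact: subsetUl.
have [i h] := tree_neq0 treeT (inputs_in i1); exists i; first by rewrite inE h orbT.
by apply/negP => h'; apply: disjE d01 h' h.
Qed.
Let p1e : y1.1 \proper e.1.
Proof.
apply/properP; split; first exact: subsetUr.
have [i h] := tree_neq0 treeT (inputs_in i0); exists i; first by rewrite inE h.
by apply/negP => h'; apply: disjE d01 h h'.
Qed.
Let s0u : y0.1 \subset u.1. Proof. by case/inputsP: i0 => _ /proper_sub. Qed.
Let s1u : y1.1 \subset u.1. Proof. by case/inputsP: i1 => _ /proper_sub. Qed.
Let s2u : y2.1 \subset u.1. Proof. by case/inputsP: i2 => _ /proper_sub. Qed.
Let de2 : [disjoint e.1 & y2.1].
Proof.
apply/pred0P => i /=; apply/negP => /andP[]; rewrite inE => /orP[]; first exact: disjE d02.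
exact: disjE d12.
Qed.
Let eu : e.1 \proper u.1.
Proof.
apply/properP; split; first by rewrite subUset s0u s1u.
have [i h] := tree_neq0 treeT (inputs_in i2); exists i; first exact: (subsetP s2u).
by apply/negP => h'; apply: disjE de2 h' h.
Qed.

Let cases f : f \in T -> [\/ e.1 \proper f.1, f.1 \proper e.1 | [disjoint e.1 & f.1]].
Proof.
move=> fT; have [fu|fu] := boolP (f.1 \proper u.1).
  have [y] := below_input fT fu; rewrite memu !inE => /or3P[]/eqP-> fy.
  - by constructor 2; apply: sub_proper_trans p0e.
  - by constructor 2; apply: sub_proper_trans p1e.
  - constructor 3; apply/pred0P => i /=; apply/negP => /andP[ie jf].
    exact: disjE de2 ie (subsetP fy _ jf).
have [uf|uf] := boolP (u.1 \subset f.1); first by constructor 1; apply: proper_sub_trans uf.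
have nfu : ~~ (f.1 \subset u.1).
  apply: contra fu => fu; rewrite properE fu; exact: uf.
have dd := tree_disjoint treeT (vertex_in uV) fT uf nfu.
constructor 3; apply/pred0P => i /=; apply/negP => /andP[ie jf].
exact: disjE dd (subsetP (proper_sub eu) _ ie) jf.
Qed.

Lemma join_notin : e \notin T.
Proof.
apply/negP => /cases[]; rewrite ?properxx // => d.
have [i h] := tree_neq0 treeT (inputs_in i0).
have ie : i \in e.1 by rewrite inE h.
exact: (disjE d ie ie).
Qed.

Lemma split_tree : is_tree x (e |: T).
Proof.
case/and4P: (treeT) => h1 /forallP h2 /forall_inP h3 /forall_inP h4; apply/and4P; split.
- by rewrite in_setU1 h1 orbT.
- by apply/forallP => i; rewrite in_setU1 h2 orbT.
- apply/forall_inP => f /setU1P[->|/h3 //]; apply/set0Pn.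
  by have [i h] := tree_neq0 treeT (inputs_in i0); exists i; rewrite inE h.
apply/forall_inP => f /setU1P[->|fT]; apply/forall_inP => g /setU1P[->|gT].
- by rewrite eqxx.
- by apply/or4P; case: (cases gT) => d; [constructor 2|constructor 3|constructor 4].
- apply/or4P; case: (cases fT) => d; [by constructor 3|by constructor 2|constructor 4].
  by rewrite disjoint_sym.
- exact: (forall_inP (h4 f fT)).
Qed.

Lemma join_internal : e \in internal (e |: T).
Proof.
rewrite in_internal setU11 /=; apply/andP; split.
  have [i h] := tree_neq0 treeT (inputs_in i0).
  apply: leq_ltn_trans (proper_card p0e); rewrite card_gt0; apply/set0Pn; by exists i.
by apply: contraTneq eu => h; rewrite properE [e.1]h subsetT andbF.
Qed.

Lemma split_erase : (e |: T) :\ e = T.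
Proof. by apply: setU1K; apply: join_notin. Qed.

Let nbetween f : f \in T -> e.1 \proper f.1 -> f.1 \proper u.1 -> False.
Proof.
move=> fT ef fu; have [y] := below_input fT fu; rewrite memu !inE => /or3P[]/eqP-> fy.
- by have := proper_sub_trans ef fy => /proper_trans/(_ p0e); rewrite properxx.
- by have := proper_sub_trans ef fy => /proper_trans/(_ p1e); rewrite properxx.
have [i h] := tree_neq0 treeT (inputs_in i0).
exact: disjE d02 h (subsetP fy _ (subsetP (proper_sub ef) _ (subsetP (proper_sub p0e) _ h))).
Qed.

Lemma split_inputs_new : perm_eq [:: y0; y1] (enum (inputs (e |: T) e)).
Proof.
apply: uniq_perm; rewrite ?enum_uniq //; first by case: ny => h _ _; rewrite /= inE h.
move=> f; rewrite mem_enum; apply/idP/idP.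
  have H y : y \in inputs T u -> y.1 \proper e.1 -> y \in inputs (e |: T) e.
    move=> /inputsP[yT yu yh] ye; apply/inputsP; split=> //; first by rewrite in_setU1 yT orbT.
    move=> g /setU1P[->|gT] yg ge; first by rewrite properxx in ge.
    exact: yh gT yg (proper_trans ge eu).
  by rewrite in_cons mem_seq1 => /orP[]/eqP->; apply: H.
case/inputsP=> /setU1P[->|fT] fe hf; first by rewrite properxx in fe.
have [y] := below_input fT (proper_trans fe eu); rewrite memu !inE.
have H z : z \in inputs T u -> z.1 \proper e.1 -> f.1 \subset z.1 -> f = z.
  move=> zi ze; rewrite subEproper => /orP[/eqP fz|fz].
    exact: (tree_inj treeT fT (inputs_in zi)).
  have zT : z \in e |: T by rewrite in_setU1 (inputs_in zi) orbT.
  by case: (hf z zT fz ze).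
case/or3P=> /eqP-> fy; first by rewrite (H y0) ?eqxx.
  by rewrite (H y1) ?eqxx ?orbT.
have [i h] := tree_neq0 treeT fT.
by case: (disjE de2 (subsetP (proper_sub fe) _ h) (subsetP fy _ h)).
Qed.

Let uT : u \in e |: T. Proof. by rewrite in_setU1 (vertex_in uV) orbT. Qed.

Lemma join_input : e \in inputs (e |: T) u.
Proof.
apply/inputsP; split=> //; first exact: setU11.
by move=> f /setU1P[->|fT] ef fu; [rewrite properxx in ef | apply: nbetween ef fu].
Qed.

Lemma split_inputs_old : perm_eq [:: e; y2] (enum (inputs (e |: T) u)).
Proof.
have := inputs_erase split_tree join_internal uT; rewrite join_input split_erase => E.
have D := inputs_disj join_internal join_input.
apply: uniq_perm; rewrite ?enum_uniq //=.
  by rewrite inE andbT; apply: contraTneq i2 => <-; apply: contra join_notin => /inputs_in.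
move=> f; rewrite mem_enum in_cons mem_seq1.
have [->|fe] := eqVneq f e; first by rewrite join_input.
have : (f \in inputs T u) = (f \in inputs (e |: T) u) || (f \in inputs (e |: T) e).
  by rewrite E in_setU in_setD1 fe.
rewrite memu -(mem_enum (inputs (e |: T) e)) -(perm_mem split_inputs_new) !in_cons in_nil /= !orbF.
have [fu|fu] := boolP (f \in inputs (e |: T) u).
  move/pred0P/(_ f): D => /=; rewrite fu /= -mem_enum -(perm_mem split_inputs_new) !in_cons in_nil orbF.
  by case: (f == y0) => //; case: (f == y1) => //= _ ->.
rewrite /=; have [->|] := eqVneq f y2; last by [].
by case: ny => _ n02 n12; rewrite orbT eq_sym (negbTE n02) eq_sym (negbTE n12).
Qed.

Lemma split_inputs_other v : v \in T -> v != u -> inputs (e |: T) v = inputs T v.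
Proof.
move=> vT vu; have vS : v \in e |: T by rewrite in_setU1 vT orbT.
have := inputs_erase split_tree join_internal vS; rewrite split_erase => ->.
case: ifP => // ev; case/eqP: vu.
exact: (parent_unique split_tree vS uT ev join_input).
Qed.

Lemma split_vertices : vertices (e |: T) = e |: vertices T.
Proof.
have := @vertices_erase _ _ (e |: T) e; rewrite split_erase => ->.
by rewrite setD1K // internal_vertex // join_internal.
Qed.

End Split.

(** Conversely, every internal edge of a binary tree arises in this way from
    the tree where it is contracted. *)
Lemma merge_tree T e : is_tree x T -> is_binary T -> e \in internal T ->
  exists u y0 y1 y2, [/\ u \in vertices (T :\ e), perm_eq [:: y0; y1; y2] (enum (inputs (T :\ e) u)),
    e.1 = y0.1 :|: y1.1 & T = e |: (T :\ e)].
Proof.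
move=> tT /forall_inP bT eI; have [u uV eu] := parent_internal tT eI.
have eV := internal_vertex eI; have eT := internal_in eI.
have ue : u != e by rewrite eq_sym (inputs_neq eu).
have [y2 [hy2 y2e]] : exists y2, inputs T u = [set e; y2] /\ e != y2.
  have : #|inputs T u :\ e| == 1%N by have := bT u uV; rewrite (cardsD1 e) eu.
  case/cards1P=> y2 h; exists y2; split; first by rewrite -h setD1K.
  have : y2 \in inputs T u :\ e by rewrite h in_set1.
  by case/setD1P; rewrite eq_sym.
have [y0 [y1 [hy y01]]] : exists y0 y1, inputs T e = [set y0; y1] /\ y0 != y1.
  by have /cards2P[y0 [y1 [h1 h2]]] := bT e eV; exists y0, y1; split.
exists u, y0, y1, y2; split.
- by rewrite vertices_erase; apply/setD1P.
- have D := inputs_disj eI eu.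
  apply: uniq_perm; rewrite ?enum_uniq //=.
    rewrite !inE !negb_or y01 /= andbT; move/pred0P: D => D.
    have := D y0; have := D y1; rewrite /= hy hy2 !inE !eqxx ?orbT !andbT => /norP[_ ->] /norP[_ ->].
    by [].
  move=> f; rewrite mem_enum (inputs_erase tT eI (vertex_in uV)) eu hy hy2 !inE.
  have [->|fe] := eqVneq f e.
    by rewrite /= (negbTE y2e) ?orbF.
  by case: (f == y0); case: (f == y1); case: (f == y2).
- apply/setP => i; rewrite inE; apply/idP/orP => [ie|].
    have [f] := cover_input tT eV ie; rewrite hy !inE => /orP[]/eqP->; by [left|right].
  have s y : y \in inputs T e -> y.1 \subset e.1 by case/inputsP => _ /proper_sub.
  by case=> h; apply: (subsetP (s _ _) _ h); rewrite hy !inE eqxx ?orbT.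
- by rewrite setD1K.
Qed.

End SplitVertex.

Section Rotations.

(** Chosen rather than given by a formula: only its effect on lists matters. *)
Definition rotp (c : 'I_3) : 'S_3 :=
  odflt 1%g [pick s : 'S_3 | permutes s (rot c (iota 0 3)) (iota 0 3)].

Lemma rotp_permutes (A : eqType) (l : seq A) c : size l = 3%N -> permutes (rotp c) (rot c l) l.
Proof.
case: l => [|a l] // sl.
have h : permutes (rotp c) (rot c (iota 0 3)) (iota 0 3).
  rewrite /rotp; case: pickP => //= H.
  have hp : perm_eq (rot c (iota 0 3)) (iota 0 3) by rewrite perm_rot.
  have hz : size (rot c (iota 0 3)) = 3%N by rewrite size_rot.
  have [s hs] := perm_eq_permutes hp hz.
  by have := H s; rewrite hs.
have := permutes_map (nth a (a :: l)) h; rewrite map_rot.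
have -> // : map (nth a (a :: l)) (iota 0 3) = a :: l.
by rewrite -[RHS](mkseq_nth a) sl.
Qed.

Lemma rot3_cases (A : Type) (l : seq A) (c : 'I_3) : size l = 3%N ->
  exists y0 y1 y2, rot c l = [:: y0; y1; y2].
Proof.
move=> sl; have := size_rot c l; rewrite sl.
by case: (rot c l) => [|y0 [|y1 [|y2 []]]] // _; exists y0, y1, y2.
Qed.

(** Moving the last of three elements to the front is an even permutation,
    and so are the rotations; hence no signs appear in [rot3]. *)
Lemma par_rot3 (A : eqType) (l : seq A) (c : 'I_3) y0 y1 y2 : uniq l -> size l = 3%N ->
  rot c l = [:: y0; y1; y2] -> par [:: y2; y0; y1] l = false.
Proof.
case: l => [|a [|b [|d []]]] // /=; rewrite !inE !negb_or => /and3P[/andP[ab ad] bd _] _.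
have ba : (b == a) = false by rewrite eq_sym (negbTE ab).
have da : (d == a) = false by rewrite eq_sym (negbTE ad).
have db : (d == b) = false by rewrite eq_sym (negbTE bd).
case: c => [[|[|[|//]]]] /= _ [<- <- <-];
  by rewrite ?eqxx ?(negbTE ab) ?(negbTE ad) ?(negbTE bd) ?ba ?da ?db /= ?eqxx
             ?(negbTE ab) ?(negbTE ad) ?(negbTE bd) ?ba ?da ?db /= ?eqxx.
Qed.

End Rotations.

Section MonoDec.
Variables (k : fieldType) (O : operad k) (X : seq unit).
Local Notation edge := (edge X).

(** Transport makes the operation fit a list of inputs of any length; it is
    the intended one when the lengths agree. *)
Definition mop (v : edge) (l : seq edge) n (q : O n) : vdec (mono O) v :=
  @vdec_op _ _ (mono O) X v l (ocast (size (cols l)) q).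

Lemma mop_linear (v : edge) (l : seq edge) n : linear (fun q : O n => ocast (size (cols l)) q : mono O (cols l) v.2).
Proof. exact: ocast_linear. Qed.

Lemma relab_mop (v : edge) n (s : 'S_n) (l l' : seq edge) (q : O n) : permutes s l l' ->
  relab (mop v l q) (mop v l' (oact s q)).
Proof.
move=> hs; have /permutesP[sl _ _] := hs.
have := @relab_op _ _ (mono O) X v n s l l' (ocast (size (cols l)) q) hs.
rewrite [cact _ _ _]/(col_act _ _ _) /col_act /= ocast_trans; last by rewrite size_map.
by rewrite ocast_id.
Qed.

Lemma contract_mop (e u y0 y1 y2 : edge) (a : decoration (mono O) X) (p q : O 2%N) :
  a u = mop u [:: e; y2] p -> a e = mop e [:: y0; y1] q ->
  contract e a u = mop u [:: y0; y1; y2] (ocomp 3 0%N p q).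
Proof.
move=> Eu Ee; rewrite (contract_op Eu Ee) ?mem_head // /mop /= eqxx /=.
by rewrite /ccomp /= /col_comp /= !ocast_id.
Qed.

Lemma mono_tree_linear (T : {set edge}) (a : decoration (mono O) X) u (l : seq edge) n : is_tree tt T ->
  u \in vertices T -> labeled T (dfwith a (mop u l (0 : O n))) ->
  linear (fun q : O n => tree_comp tt T (dfwith a (mop u l q))).
Proof.
move=> tT uV la c p q; rewrite /mop mop_linear.
apply: (mf_linear (tree_comp_mform (mono O) tT)) => //.
by move: la; rewrite /mop ocast0.
Qed.

End MonoDec.

Section TernaryVertex.
Variable X : seq unit.
Local Notation edge := (edge X).
Implicit Types (T : {set edge}).

Definition tern T : edge :=
  if [pick u in vertices T | #|inputs T u| == 3%N] is Some u then u else root_edge X tt.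

Lemma ternP T : is_tree tt T -> tree_degree T = -1 ->
  [/\ tern T \in vertices T, #|inputs T (tern T)| = 3%N
    & forall v, v \in vertices T -> v != tern T -> #|inputs T v| = 2%N].
Proof.
move=> tT dT; have [u uV [u3 h]] := degree_ternary tT dT.
rewrite /tern; case: pickP => [v /andP[vV /eqP v3]|/(_ u)]; last by rewrite uV u3 eqxx.
split=> // w wV wv; have [wu|wu] := eqVneq w u; last exact: h.
by have [vu|vu] := eqVneq v u; [rewrite wu vu eqxx in wv | have := h v vV vu; rewrite v3].
Qed.

Variable lu : {set edge} -> seq edge.
Hypothesis hlu : forall T, is_tree tt T -> tree_degree T = -1 ->
  perm_eq (lu T) (enum (inputs T (tern T))).

Definition new_edge T (c : 'I_3) : edge :=
  if rot c (lu T) is [:: y0, y1 & _] then join_edge tt y0 y1 else root_edge X tt.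

Lemma lu_size T : is_tree tt T -> tree_degree T = -1 -> size (lu T) = 3%N.
Proof. by move=> tT dT; have [_ h _] := ternP tT dT; rewrite (perm_size (hlu tT dT)) -cardE. Qed.

Lemma lu_rot T c y0 y1 y2 : is_tree tt T -> tree_degree T = -1 ->
  rot c (lu T) = [:: y0; y1; y2] -> perm_eq [:: y0; y1; y2] (enum (inputs T (tern T))).
Proof. by move=> tT dT <-; rewrite perm_rot; apply: hlu. Qed.

(** A ternary vertex can be resolved in three ways, according to the input
    that does not move to the new vertex. *)
Lemma sum_split (V : zmodType) (f : {set edge} -> edge -> V) :
  \sum_(T : {set edge} | is_tree tt T && is_binary T) \sum_(e in internal T) f T e =
  \sum_(T : {set edge} | is_tree tt T && (tree_degree T == -1))
     \sum_(c < 3) f (new_edge T c |: T) (new_edge T c).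
Proof.
rewrite (pair_big_dep (fun T : {set edge} => is_tree tt T && is_binary T)
   (fun T e => e \in internal T) f) /=.
rewrite (pair_big_dep (fun T : {set edge} => is_tree tt T && (tree_degree T == -1))
   (fun _ _ => true) (fun T c => f (new_edge T c |: T) (new_edge T c))) /=.
apply: (big_bij (h := fun q : {set edge} * 'I_3 => (new_edge q.1 q.2 |: q.1, new_edge q.1 q.2))).
- move=> [T c] /= /andP[/andP[tT /eqP dT] _].
  have [y0 [y1 [y2 E]]] := rot3_cases c (lu_size tT dT).
  have [uV _ _] := ternP tT dT; have pu := lu_rot tT dT E.
  rewrite /new_edge E /= (split_tree tt tT uV pu) (join_internal tt tT pu) andbT /=.
  rewrite -(degree0_binary (split_tree tt tT uV pu)).
  have := degree_erase (join_internal tt tT pu).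
  by rewrite (split_erase tt tT uV pu) dT => /eqP; rewrite -subr_eq0 => /eqP h; apply/eqP; lia.
- move=> [T e] /= /andP[/andP[tT bT] eI].
  have [u [y0 [y1 [y2 [uV pu ee ET]]]]] := merge_tree tT bT eI.
  have tE := tree_erase tT eI.
  have dE : tree_degree (T :\ e) = -1.
    by rewrite (degree_erase eI); move: bT; rewrite -(degree0_binary tT) => /eqP ->.
  have [tV t3 t2] := ternP tE dE.
  have u3 : #|inputs (T :\ e) u| = 3%N by rewrite cardE -(perm_size pu).
  have ut : u = tern (T :\ e).
    by apply/eqP; apply/negPn/negP => nu; have := t2 u uV nu; rewrite u3.
  have sl := lu_size tE dE.
  have pl : perm_eq [:: y0; y1; y2] (lu (T :\ e)).
    by rewrite (perm_trans pu) // perm_sym ut hlu.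
  have y2l : y2 \in lu (T :\ e) by rewrite -(perm_mem pl) !inE eqxx !orbT.
  have [c [z0 [z1 Ec]]] : exists c : 'I_3, exists z0 z1, rot c (lu (T :\ e)) = [:: z0; z1; y2].
    move: sl y2l; case: (lu _) => [|a [|b [|d []]]] // _.
    rewrite !inE => /or3P[] /eqP->.
    - by exists (@Ordinal 3 1 isT), b, d.
    - by exists (@Ordinal 3 2 isT), d, a.
    - by exists (@Ordinal 3 0 isT), a, b.
  have pz : perm_eq [:: z0; z1] [:: y0; y1].
    rewrite -(perm_cons y2); apply: (@perm_trans _ [:: z0; z1; y2]).
      by rewrite -(cat1s y2) perm_catC.
    rewrite -Ec perm_rot perm_sym (perm_trans _ pl) //.
    by rewrite -(cat1s y2) perm_catC.
  have ze : new_edge (T :\ e) c = e.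
    rewrite /new_edge Ec /join_edge; apply/eqP; rewrite -pair_eqE /=; apply/andP; split.
      have uz : uniq [:: z0; z1].
        rewrite (perm_uniq pz); have := perm_uniq pu; rewrite enum_uniq /= !inE negb_or.
        by rewrite andbT => /andP[/andP[-> _] _].
      rewrite ee; have m0 : z0 \in [:: y0; y1] by rewrite -(perm_mem pz) mem_head.
      have m1 : z1 \in [:: y0; y1] by rewrite -(perm_mem pz) !inE eqxx orbT.
      move: m0 m1 uz; rewrite /= !inE andbT => /orP[]/eqP-> /orP[]/eqP->; rewrite ?eqxx //.
      by rewrite setUC.
    by case: (e.2).
  by exists (T :\ e, c); rewrite /= ?tE ?dE ?eqxx //= ze -ET.
- move=> [T c] [T' c'] /= /andP[/andP[tT /eqP dT] _] /andP[/andP[tT' /eqP dT'] _] [ET Ee].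
  have TT : T = T'.
    have [y0 [y1 [y2 E]]] := rot3_cases c (lu_size tT dT).
    have [y0' [y1' [y2' E']]] := rot3_cases c' (lu_size tT' dT').
    have [uV _ _] := ternP tT dT; have [uV' _ _] := ternP tT' dT'.
    have h := split_erase tt tT uV (lu_rot tT dT E).
    have h' := split_erase tt tT' uV' (lu_rot tT' dT' E').
    have n1 : new_edge T c = join_edge tt y0 y1 by rewrite /new_edge E.
    have n2 : new_edge T' c' = join_edge tt y0' y1' by rewrite /new_edge E'.
    by rewrite -h -h' -n1 -n2 ET Ee.
  rewrite -TT in Ee *; congr (_, _).
  have [uV _ _] := ternP tT dT.
  have hu := hlu tT dT; have ul : uniq (lu T) by rewrite (perm_uniq hu) enum_uniq.
  have ne a : a \in lu T -> exists i, i \in a.1.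
    rewrite (perm_mem hu) mem_enum => /inputs_in; exact: (tree_neq0 tT).
  have dj a b i : a \in lu T -> b \in lu T -> i \in a.1 -> i \in b.1 -> a = b.
    rewrite !(perm_mem hu) !mem_enum => ha hb ia ib; apply/eqP/negPn/negP => nab.
    by have /pred0P/(_ i) := inputs_disjoint tT ha hb nab; rewrite /= ia ib.
  have sl := lu_size tT dT; move: Ee; rewrite /new_edge.
  move: ul ne dj sl; case: (lu T) => [|a [|b [|d []]]] // ul ne dj _.
  have mo y0 y1 z0 z1 : y0 \in [:: a; b; d] -> y1 \in [:: a; b; d] -> z0 \in [:: a; b; d] ->
      z1 \in [:: a; b; d] -> join_edge tt y0 y1 = join_edge tt z0 z1 -> y0 = z0 \/ y0 = z1.
    move=> my0 my1 mz0 mz1 /(congr1 fst) /= E; have [i iy] := ne y0 my0.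
    have : i \in z0.1 :|: z1.1 by rewrite -E inE iy.
    by rewrite inE => /orP[] iz; [left|right]; apply: (dj _ _ i).
  have mo1 y0 y1 z0 z1 : y0 \in [:: a; b; d] -> y1 \in [:: a; b; d] -> z0 \in [:: a; b; d] ->
      z1 \in [:: a; b; d] -> join_edge tt y0 y1 = join_edge tt z0 z1 -> y1 = z0 \/ y1 = z1.
    move=> my0 my1 mz0 mz1 E; apply: (mo y1 y0 z0 z1) => //.
    by rewrite -E /join_edge setUC.
  have ma : a \in [:: a; b; d] by rewrite !inE eqxx.
  have mb : b \in [:: a; b; d] by rewrite !inE eqxx orbT.
  have md : d \in [:: a; b; d] by rewrite !inE eqxx !orbT.
  have ab : a <> b by move=> h; move: ul; rewrite h cons_uniq mem_head.
  have ad : a <> d by move=> h; move: ul; rewrite h cons_uniq !in_cons eqxx !orbT.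
  have bd : b <> d by move=> h; move: ul; rewrite h !cons_uniq mem_head andbF.
  move=> {ET}; case: c => [[|[|[|//]]] /= hc]; case: c' => [[|[|[|//]]] /= hc'] E; apply: val_inj => //=;
    have := mo _ _ _ _ _ _ _ _ E; have := mo1 _ _ _ _ _ _ _ _ E;
    move=> /(_ ltac:(assumption) ltac:(assumption) ltac:(assumption) ltac:(assumption));
    move=> h1 /(_ ltac:(assumption) ltac:(assumption) ltac:(assumption) ltac:(assumption)) h2;
    exfalso; case: h1 => q1; case: h2 => q2; congruence.
Qed.

End TernaryVertex.

(** * The natural map with one color *)

Lemma sign_dual_mono (k : fieldType) (F G : operad k) m (g : 'I_m -> F 2%N) (g' : 'I_m -> G 2%N) :
  op_sign_dual g g' -> sign_dual (mono_gen g) (mono_gen g').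
Proof. exact: sign_dual_col. Qed.

Section Resolve.
Variables (k : fieldType) (F G : operad k) (m : nat).
Variables (g : 'I_m -> F 2%N) (g' : 'I_m -> G 2%N).
Hypothesis dual_gg' : op_sign_dual g g'.
Variable X : seq unit.
Local Notation edge := (edge X).
Local Notation gsum := (gsum (mono_gen g) (mono_gen g')).
Local Notation D' := (decoration (mono G) X).
Local Notation d0 := (@dec0 k _ X (mono F)).
Local Notation d0' := (@dec0 k _ X (mono G)).
Implicit Types (T : {set edge}) (phi : precochain (mono G) X).

(** The element of [F(3)] obtained from a linear form on [G(3)] by
    contraction with the canonical element, which is a sum over the three
    binary trees with three leaves. *)
Definition rot3 (lam : G 3%N -> k) : F 3%N :=
  \sum_(c < 3) \sum_i \sum_j
    lam (oact (rotp c) (ocomp 3 0%N (g' i) (g' j))) *: oact (rotp c) (ocomp 3 0%N (g i) (g j)).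

(** The natural map for one color, before the passage from the free operad
    to its quotient *)
Definition natsum phi : F (size X) :=
  \sum_(T : {set edge} | is_tree tt T && is_binary T)
     tree_sum tt (mono_gen g) (mono_gen g') phi T (std_list T) (enum (vertices T)).

Variable lu : {set edge} -> seq edge.
Hypothesis hlu : forall T, is_tree tt T -> tree_degree T = -1 ->
  perm_eq (lu T) (enum (inputs T (tern T))).

Definition rest T : seq edge := rem (tern T) (enum (vertices T)).
Definition tern_order T : seq edge := lu T ++ flatten (map (std_list T) (rest T)).
(** The linear form that [phi] defines at the ternary vertex of [T], once
    the other vertices are decorated *)
Definition tern_form phi T (b : D') (q : G 3%N) : k :=
  phi T (tern_order T) (dfwith b (mop (tern T) (lu T) q)).

Section OneTree.
Variable T : {set edge}.
Hypotheses (tT : is_tree tt T) (dT : tree_degree T = -1).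
Local Notation u := (tern T).

Let uV : u \in vertices T. Proof. by case: (ternP tT dT). Qed.
Let rest_uniq : uniq (rest T). Proof. by rewrite rem_uniq // enum_uniq. Qed.
Let mem_rest v : (v \in rest T) = (v != u) && (v \in vertices T).
Proof. by rewrite mem_rem_uniq ?enum_uniq // inE mem_enum. Qed.

Lemma tern_labeled (O : operad k) n (q : O n) (a : decoration (mono O) X) :
  (forall v, v \in rest T -> tag (a v) = std_list T v) -> labeled T (dfwith a (mop u (lu T) q)).
Proof.
move=> h; apply/labeledP => v vV; have [<-|uv] := eqVneq u v.
  by rewrite dfwith_in; apply: hlu.
by rewrite dfwith_out // h // mem_rest eq_sym uv.
Qed.

Lemma tern_order_perm : perm_eq (tern_order T) (enum (nonroot T)).
Proof.
pose M v := if v == u then lu T else std_list T v.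
have EM : map M (rest T) = map (std_list T) (rest T).
  by apply/eq_in_map => v; rewrite mem_rest /M => /andP[/negbTE ->].
have p : perm_eq (u :: rest T) (enum (vertices T)) by rewrite perm_sym perm_to_rem ?mem_enum.
have hM : lists_inputs T M (u :: rest T).
  by move=> v _; rewrite /M; case: eqP => [->|_]; [apply: hlu|].
by have := perm_flatten_inputs tT p hM; rewrite /= EM /M eqxx.
Qed.

(** The sum may be computed with the new edge listed first and with the new
    vertex placed right after the ternary one; contracting the edge then
    produces no sign. *)
Lemma tree_sum_split phi c : cochain tt phi ->
  tree_sum tt (mono_gen g) (mono_gen g') (cobar_term tt phi (new_edge lu T c))
    (new_edge lu T c |: T) (std_list (new_edge lu T c |: T))
    (enum (vertices (new_edge lu T c |: T))) =
  gsum (std_list T) (rest T) (fun a b => \sum_i \sum_j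
     tern_form phi T b (oact (rotp c) (ocomp 3 0%N (g' i) (g' j))) *:
     tree_comp tt T (dfwith a (mop u (lu T) (oact (rotp c) (ocomp 3 0%N (g i) (g j)))))) d0 d0'.
Proof.
move=> hphi; have sl := lu_size hlu tT dT.
have [y0 [y1 [y2 Ec]]] := rot3_cases c sl.
have pu := lu_rot hlu tT dT Ec.
have ul : uniq (lu T) by rewrite (perm_uniq (hlu tT dT)) enum_uniq.
have -> : new_edge lu T c = join_edge tt y0 y1 by rewrite /new_edge Ec.
set e := join_edge tt y0 y1; set T1 := e |: T.
have tT1 : is_tree tt T1 := split_tree tt tT uV pu.
have eI : e \in internal T1 := join_internal tt tT pu.
have eT : e \notin T := join_notin tt tT uV pu.
have ET : T1 :\ e = T := split_erase tt tT uV pu.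
have VT1 : vertices T1 = e |: vertices T := split_vertices tt tT uV pu.
have bT1 : is_binary T1.
  rewrite -(degree0_binary tT1); have := degree_erase eI; rewrite ET dT => /eqP.
  by rewrite -subr_eq0 => /eqP h; apply/eqP; lia.
have ue : u != e by apply: contraNneq eT => <-; apply: vertex_in.
(* the new edge comes first among the inputs of [u], as in [contract_mop] *)
pose L v := if v == u then [:: e; y2] else if v == e then [:: y0; y1] else std_list T v.
have Lu : L u = [:: e; y2] by rewrite /L eqxx.
have Le : L e = [:: y0; y1] by rewrite /L eq_sym (negbTE ue) eqxx.
have Lr v : v \in rest T -> L v = std_list T v.
  rewrite mem_rest => /andP[vu vV]; rewrite /L (negbTE vu).
  by case: eqP => // ve; move: eT; rewrite -ve (vertex_in vV).
have eV : e \notin vertices T by apply: contra eT; apply: vertex_in.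
have er : e \notin rest T by rewrite mem_rest (negbTE eV) andbF.
have ur : u \notin rest T by rewrite mem_rest eqxx.
have pvs : perm_eq (u :: e :: rest T) (enum (vertices T1)).
  apply: uniq_perm; rewrite ?enum_uniq /= ?rest_uniq ?er ?andbT //.
    by rewrite in_cons negb_or ue ur.
  move=> v; rewrite !in_cons mem_rest mem_enum VT1 in_setU1.
  by case: (eqVneq v u) => [->|] //=; rewrite uV orbT.
have hL : lists_inputs T1 L (u :: e :: rest T).
  move=> v; rewrite !in_cons => /or3P[/eqP->|/eqP->|vr].
  - by rewrite Lu; apply: (split_inputs_old tt tT uV pu).
  - by rewrite Le; apply: (split_inputs_new tt tT pu).
  rewrite (Lr v vr); move: vr; rewrite mem_rest => /andP[vu vV].
  by rewrite (split_inputs_other tt tT uV pu (vertex_in vV) vu).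
have hc := cobar_term_cochain e hphi.
rewrite (tree_sum_indep (sign_dual_mono dual_gg') tT1 bT1 hc (perm_refl _) pvs
           (@std_lists _ _ _ _) hL).
rewrite /tree_sum /=; set w := flatten _.
rewrite gsum_sum; apply: eq_bigr => i _; rewrite gsum_sum; apply: eq_bigr => j _.
have := @gsum_map k m _ _ _ _ _ _ X X (mono_gen g) (mono_gen g') (mono_gen g) (mono_gen g') _ _
   (@id (mono F X tt)) id L (std_list T) (rest T)
   (term tt (cobar_term tt phi e) T1 (L u ++ L e ++ w))
   (fun a b => tern_form phi T b (oact (rotp c) (ocomp 3 0%N (g' i) (g' j))) *:
      (tree_comp tt T (dfwith a (mop u (lu T) (oact (rotp c) (ocomp 3 0%N (g i) (g j))))) : mono F X tt)).
rewrite map_id; apply=> //.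
move=> c1 d1 c2 d2 h1 h2 h3.
have [cu du] := h2 u ur; rewrite !(dfwith_out _ _ (_ : e != u)) ?dfwith_in in cu du;
  rewrite 1?eq_sym //.
have [ce de] := h2 e er; rewrite !dfwith_in in ce de.
have lab (O : operad k) (gg : 'I_m -> O 2%N) (a : decoration (mono O) X) :
    a u = gdec (mono_gen gg) u (L u) i -> a e = gdec (mono_gen gg) e (L e) j ->
    (forall v, v \in rest T -> exists i', a v = gdec (mono_gen gg) v (L v) i') -> labeled T1 a.
  move=> au ae ar; apply/labeledP => v; rewrite VT1 in_setU1 => /orP[/eqP->|vV].
    by rewrite ae; apply: hL; rewrite !in_cons eqxx orbT.
  have [->|vu] := eqVneq v u; first by rewrite au; apply: hL; rewrite mem_head.
  have vr : v \in rest T by rewrite mem_rest vu.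
  by have [i' ->] := ar v vr; apply: hL; rewrite !in_cons vr !orbT.
have lc : labeled T1 c1 by apply: lab cu ce _ => v /h1[i' [-> _ _ _]]; exists i'.
have ld : labeled T1 d1 by apply: lab du de _ => v /h1[i' [_ -> _ _]]; exists i'.
have key (O : operad k) (gg : 'I_m -> O 2%N) (a a2 : decoration (mono O) X) :
    a u = gdec (mono_gen gg) u (L u) i -> a e = gdec (mono_gen gg) e (L e) j ->
    (forall v, v \in rest T -> a v = a2 v /\ tag (a2 v) = std_list T v) ->
    relabeling T (contract e a)
      (dfwith a2 (mop u (lu T) (oact (rotp c) (ocomp 3 0%N (gg i) (gg j))))).
  move=> au ae ar v vV; have [<-|uv] := eqVneq u v.
    rewrite dfwith_in (@contract_mop _ _ _ e u y0 y1 y2 a (gg i) (gg j)).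
    - by apply: relab_mop; rewrite -Ec; apply: rotp_permutes.
    - by rewrite au Lu.
    - by rewrite ae Le.
  have vr : v \in rest T by rewrite mem_rest eq_sym uv.
  have [E tv] := ar v vr; rewrite dfwith_out // contract_out; first by rewrite E; apply: relab_refl.
  by rewrite E tv mem_enum; apply: contra eT; apply: inputs_in.
have rc : relabeling T (contract e c1)
    (dfwith c2 (mop u (lu T) (oact (rotp c) (ocomp 3 0%N (g i) (g j))))).
  apply: (@key F g) => // v vr; have [i' [E _ E' _]] := h1 v vr.
  by rewrite E E' (Lr v vr).
have rd : relabeling T (contract e d1)
    (dfwith d2 (mop u (lu T) (oact (rotp c) (ocomp 3 0%N (g' i) (g' j))))).
  apply: (@key G g') => // v vr; have [i' [_ E _ E']] := h1 v vr.
  by rewrite E E' (Lr v vr).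
have lcT : labeled T (contract e c1) by rewrite -ET; exact: (contract_labeled tT1 eI lc).
have ldT : labeled T (contract e d1) by rewrite -ET; exact: (contract_labeled tT1 eI ld).
rewrite /term (tree_comp_contract tT1 lc eI) ET.
rewrite (mf_relab (tree_comp_mform (mono F) tT) lcT rc); congr (_ *: _).
have pw : perm_eq (L u ++ L e ++ w) (enum (nonroot T1)).
  by have := perm_flatten_inputs tT1 pvs hL.
have cd : cobar_data tt T1 (L u ++ L e ++ w) d1 by apply/and3P.
rewrite /cobar_term cd eI Lu /= !eqxx expr0 mul1r ET.
rewrite (mf_relab (cochain_mform hphi T _) ldT rd) /tern_form.
have -> : w = flatten (map (std_list T) (rest T)).
  by rewrite /w; congr flatten; apply/eq_in_map => v vr; apply: Lr.
rewrite Le; set W := flatten _.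
have p3 : perm_eq (lu T) [:: y2; y0; y1].
  rewrite -(perm_rot c (lu T)) Ec -[[:: y0; y1; y2]]/([:: y0; y1] ++ [:: y2]).
  by rewrite perm_catC.
have pW : perm_eq (tern_order T) (y2 :: y0 :: y1 :: W).
  by rewrite /tern_order -/W -[y2 :: _]/([:: y2; y0; y1] ++ W) perm_cat2r.
have uW : uniq (tern_order T) by rewrite (perm_uniq tern_order_perm) enum_uniq.
rewrite (cochain_par hphi _ _ uW pW).
have -> : par (tern_order T) (y2 :: y0 :: y1 :: W) = false.
  rewrite par_sym // -[y2 :: _]/([:: y2; y0; y1] ++ W) par_catr.
    exact: par_rot3 ul sl Ec.
  by rewrite perm_sym.
by rewrite mul1r.
Qed.

End OneTree.
End Resolve.

Section NatsumD.
Variables (k : fieldType) (F G : operad k) (m : nat).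
Variables (g : 'I_m -> F 2%N) (g' : 'I_m -> G 2%N).
Hypothesis dual_gg' : op_sign_dual g g'.
Variable X : seq unit.
Local Notation edge := (edge X).
Local Notation gsum := (gsum (mono_gen g) (mono_gen g')).
Local Notation d0 := (@dec0 k _ X (mono F)).
Local Notation d0' := (@dec0 k _ X (mono G)).
Implicit Types (T : {set edge}) (phi : precochain (mono G) X).
Variable lu : {set edge} -> seq edge.
Hypothesis hlu : forall T, is_tree tt T -> tree_degree T = -1 ->
  perm_eq (lu T) (enum (inputs T (tern T))).

(** Contracting an edge of a binary tree leaves a tree with one ternary
    vertex; the three resolutions of this vertex add up to [rot3] of the
    form that [phi] defines there. *)
Lemma natsum_d phi : cochain tt phi ->
  natsum g g' (cobar_d tt phi) =
  \sum_(T : {set edge} | is_tree tt T && (tree_degree T == -1))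
    gsum (std_list T) (rest T) (fun a b =>
      tree_comp tt T (dfwith a (mop (tern T) (lu T) (rot3 g g' (tern_form lu phi T b)))) : mono F X tt)
      d0 d0'.
Proof.
move=> hphi; rewrite /natsum.
rewrite (eq_bigr (fun T => \sum_(e in internal T)
   tree_sum tt (mono_gen g) (mono_gen g') (cobar_term tt phi e) T (std_list T) (enum (vertices T)))); last first.
  move=> T _; rewrite /tree_sum -gsum_sum; apply: gsum_eq => [|a b _ _]; first exact: enum_uniq.
  rewrite /term cobar_d_term scaler_suml [RHS]big_mkcond; apply: eq_bigr => e _.
  by case: ifPn => // eI; rewrite /cobar_term (negbTE eI) andbF scale0r.
rewrite (sum_split hlu (fun T e => tree_sum tt (mono_gen g) (mono_gen g') (cobar_term tt phi e) T (std_list T) (enum (vertices T)))).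
apply: eq_bigr => T /andP[tT /eqP dT].
under eq_bigr => c _ do rewrite (tree_sum_split dual_gg' hlu tT dT c hphi).
rewrite -gsum_sum; apply: gsum_eq => [|a b hg _]; first by rewrite rem_uniq // enum_uniq.
have lab n (q : F n) : labeled T (dfwith a (mop (tern T) (lu T) q)).
  by apply: (tern_labeled hlu tT dT) => v /hg[i [-> _]].
have [uV _ _] := ternP tT dT.
have lin := mono_tree_linear tT uV (lab 3%N 0).
rewrite /rot3 (lin_sum _ _ _ lin); apply: eq_bigr => c _.
rewrite (lin_sum _ _ _ lin); apply: eq_bigr => i _.
rewrite (lin_sum _ _ _ lin); apply: eq_bigr => j _.
by rewrite (linZ _ _ lin).
Qed.

End NatsumD.

Section Corolla.
Variables (C : finType) (X : seq C) (x : C).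
Hypothesis X1 : (1 < size X)%N.

Definition corolla : {set edge X} := root_edge X x |: [set leaf_edge i | i in 'I_(size X)].

Lemma corolla_tree : is_tree x corolla.
Proof.
have no1 : 1%N <> size X by move=> h; have := X1; rewrite -h.
have nT i : leaf_edge (X := X) i != root_edge X x.
  apply/eqP => /(congr1 (fun e : edge X => #|e.1|)); rewrite /= cards1 cardsT card_ord => h.
  exact: no1 h.
apply/and4P; split.
- exact: setU11.
- by apply/forallP => i; apply/setU1P; right; apply/imsetP; exists i.
- apply/forall_inP => e /setU1P[->|/imsetP[i _ ->]]; apply/set0Pn; last by exists i; rewrite inE.
  by exists (Ordinal (ltnW X1)); rewrite inE.
apply/forall_inP => e he; apply/forall_inP => f hf; apply/or4P.
case/setU1P: he => [->|/imsetP[i _ ->]]; case/setU1P: hf => [->|/imsetP[j _ ->]].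
- by constructor 1.
- constructor 3; rewrite properT; apply: contra (nT j) => /eqP h.
  by have := congr1 (fun A : {set _} => #|A|) h; rewrite cards1 cardsT card_ord => /no1.
- constructor 2; rewrite properT; apply: contra (nT i) => /eqP h.
  by have := congr1 (fun A : {set _} => #|A|) h; rewrite cards1 cardsT card_ord => /no1.
have [->|ij] := eqVneq i j; first by constructor 1.
by constructor 4; rewrite disjoints1 inE.
Qed.

Lemma corolla_internal : internal corolla = set0.
Proof.
apply/setP => e; rewrite in_set0 in_internal; apply/negP => /and3P[].
by case/setU1P=> [->|/imsetP[i _ ->]]; rewrite ?eqxx // cards1.
Qed.

(** Its edges are the root and the leaves. *)
Lemma corolla_unique T : is_tree x T -> internal T = set0 -> T = corolla.
Proof.
move=> tT iT; apply/setP => e; apply/idP/idP => [eT|]; last first.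
  by case/setU1P=> [->|/imsetP[i _ ->]]; [apply: root_in | apply: (leaf_in tT)].
have [e1|/negbTE e1] := boolP (1 < #|e.1|)%N; last first.
  by have [i ->] := leafP tT eT e1; apply/setU1P; right; apply/imsetP; exists i.
have : e \in vertices T by rewrite in_vertices eT e1.
by rewrite (vertices_corolla tT iT X1) in_set1 => /eqP ->; apply: setU11.
Qed.

Lemma corolla_vertices : vertices corolla = [set root_edge X x].
Proof. exact: vertices_corolla corolla_tree corolla_internal X1. Qed.

End Corolla.

Section Arity3.
Variables (k : fieldType) (F G : operad k) (m : nat).
Variables (g : 'I_m -> F 2%N) (g' : 'I_m -> G 2%N).
Hypothesis dual_gg' : op_sign_dual g g'.
Local Notation X := (nseq 3 tt).
Local Notation edge := (edge X).
Local Notation root := (root_edge X tt).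
Local Notation T0 := (corolla X tt).
Implicit Types (T : {set edge}).

Definition eval3 (O : operad k) T (a : decoration (mono O) X) : O 3%N := tree_comp tt T a.

(** The element of [F(3)] that corresponds to a linear form on [G(3)] under
    the pairing in which the monomials are dual bases, up to the signs
    [det_sign] *)
Definition mono3 (lam : G 3%N -> k) : F 3%N :=
  \sum_(mu : monomial m X tt)
    (det_sign k (mono_tree mu) * lam (eval3 (mono_tree mu) (mono_dec (mono_gen g') mu))) *:
    eval3 (mono_tree mu) (mono_dec (mono_gen g) mu).

Variable lam : G 3%N -> k^o.
Hypothesis lam_linear : linear lam.

(** A linear form on [G(3)], seen as a cochain of degree -1 on three leaves *)
Definition corolla_cochain : precochain (mono G) X := fun T w a =>
  if (T == T0) && cobar_data tt T w a then (-1) ^+ par (leaf_edges X) w * lam (eval3 T a) else 0.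

Let X1 : (1 < size X)%N. Proof. by []. Qed.
Let tT0 : is_tree tt T0 := corolla_tree tt X1.

Lemma corolla_nonroot : perm_eq (leaf_edges X) (enum (nonroot T0)).
Proof.
have := @perm_flatten_inputs _ X tt T0 tT0 (fun=> leaf_edges X) [:: root].
rewrite /= cats0; apply.
  by rewrite (corolla_vertices tt X1) enum_set1.
move=> v; rewrite inE => /eqP ->; rewrite perm_sym.
exact: (inputs_corolla tT0 (corolla_internal X tt) X1).
Qed.

Lemma corolla_cochainP : cochain tt corolla_cochain.
Proof.
apply: mk_cochain => [T w a nc|T w tT|T w w' a cd pw].
- by rewrite /corolla_cochain (negbTE nc) andbF.
- have [/andP[/eqP TT pw]|nc] := boolP ((T == T0) && perm_eq w (enum (nonroot T))); last first.
    apply: (@mform_eq _ _ _ _ _ _ _ (fun=> 0)); last exact: mform0.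
    move=> a _; rewrite /corolla_cochain /cobar_data; case: ifP => // /andP[h1 /and3P[_ h2 _]].
    by rewrite h1 h2 in nc.
  have [m1 m2 m3] := tree_comp_mform (mono G) tT.
  apply: (@mform_eq _ _ _ _ _ _ _ (fun a => (-1) ^+ par (leaf_edges X) w *: (lam (eval3 T a) : k^o))).
    by move=> a la; rewrite /corolla_cochain /cobar_data TT eqxx -TT tT pw la.
  apply: mform_scale; split.
  + by move=> a b la ab; rewrite /eval3 (m1 a b).
  + by move=> a v l vV la c p q; rewrite /eval3 (m2 a v l vV la) lam_linear.
  + by move=> a b la ab; rewrite /eval3 (m3 a b).
- have cd' : cobar_data tt T w' a.
    case/and3P: cd => t p l; apply/and3P; split=> //.
    by rewrite (perm_trans _ p) // perm_sym.
  rewrite /corolla_cochain cd cd' !andbT; case: eqP => [TT|_]; last by rewrite mulr0.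
  have pl : perm_eq (leaf_edges X) w.
    by rewrite (perm_trans corolla_nonroot) // -TT perm_sym; case/and3P: cd.
  by rewrite (par_trans (leaf_edges_uniq X) pl pw) addbC mulrA -signr_addb.
Qed.

Lemma binary3 T : is_tree tt T -> is_binary T -> exists e, internal T = [set e] /\ T :\ e = T0.
Proof.
move=> tT bT; have : tree_degree T == 0 by rewrite (degree0_binary tT).
rewrite /tree_degree /= => h; have : #|internal T| == 1%N.
  by move: h; move: #|internal T| => n; lia.
case/cards1P=> e he; exists e; split=> //.
have eI : e \in internal T by rewrite he inE.
apply: (corolla_unique X1); first exact: tree_erase.
by rewrite internal_erase he setDv.
Qed.

(** A binary tree with three leaves has a single internal edge, and the sign
    of its contraction is the one that trivializes the determinant. *)
Lemma corolla_d T a : is_tree tt T -> is_binary T -> labeled T a ->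
  cobar_d tt corolla_cochain T (vertexwise_order T) a = det_sign k T * lam (eval3 T a).
Proof.
move=> tT bT la; have [e [iT eT]] := binary3 tT bT.
have eI : e \in internal T by rewrite iT inE.
have pw : perm_eq (vertexwise_order T) (enum (nonroot T)).
  by apply: (perm_flatten_inputs tT (L := std_list T)) => //; apply: std_lists.
have cd : cobar_data tt T (vertexwise_order T) a by apply/and3P.
have [uw ew cde] := internal_order cd eI.
rewrite cobar_dE // iT big_set1 /corolla_cochain eT eqxx -eT cde /=.
have E3 : eval3 (T :\ e) (contract e a) = eval3 T a by rewrite /eval3 -(tree_comp_contract tT la eI).
rewrite E3 /det_sign iT enum_set1 cat1s.
have pr : perm_eq (rem e (vertexwise_order T)) (leaf_edges X).
  case/and3P: cde => _ p _; apply: (perm_trans p); rewrite eT perm_sym.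
  exact: corolla_nonroot.
have pe : perm_eq (e :: rem e (vertexwise_order T)) (vertexwise_order T) by rewrite perm_sym perm_to_rem.
have pel : perm_eq (vertexwise_order T) (e :: leaf_edges X).
  by rewrite (perm_trans (perm_to_rem ew)) // perm_cons.
rewrite (par_osign k uw pel) -[(-1) ^+ index e _]signr_odd mulrA -signr_addb; congr (_ ^+ _ * _).
have ue : uniq (e :: rem e (vertexwise_order T)) by rewrite (perm_uniq pe).
congr nat_of_bool.
have := par_trans ue pe pel; rewrite par_rem par_cons => E.
have ulr : uniq (rem e (vertexwise_order T)) by rewrite rem_uniq.
by rewrite -(par_sym ulr pr) E; case: (odd _); case: (par _ _).
Qed.

Lemma natsum_mono3 : natsum g g' (cobar_d tt corolla_cochain) = mono3 lam.
Proof.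
have loc T (a a' : decoration (mono F) X) (b b' : decoration (mono G) X) : is_tree tt T -> is_binary T -> labeled T a -> labeled T b ->
    agree (vertices T) a a' -> agree (vertices T) b b' ->
    (det_sign k T * lam (eval3 T b)) *: eval3 T a = (det_sign k T * lam (eval3 T b')) *: eval3 T a'.
  move=> tT bT la lb aa bb; rewrite /eval3.
  rewrite (mf_agree (tree_comp_mform (mono F) tT) la aa).
  by rewrite (mf_agree (tree_comp_mform (mono G) tT) lb bb).
rewrite /mono3 (monomial_sum (mono_gen g) (mono_gen g') loc) /natsum.
apply: eq_bigr => T /andP[tT bT]; rewrite /tree_sum; apply: gsum_eq; first exact: enum_uniq.
move=> a b hg _; rewrite /term corolla_d //.
by apply/labeledP => v vV; have [|i [_ ->]] := hg v; rewrite ?mem_enum.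
Qed.

(** Both sides compute [natsum] of the coboundary of [corolla_cochain].  The
    inputs of its vertex may be listed in any order, and this freedom makes
    the pairing equivariant up to the sign. *)
Lemma mono3_rot3 (s : 'S_3) : mono3 lam = (-1) ^+ s *: oact s (rot3 g g' (fun q => lam (oact s q))).
Proof.
(* the order of the inputs of the root that [s] turns into that of the leaves *)
have [l0 hs] : exists l0, permutes s l0 (leaf_edges X).
  exists (mkseq (fun i => nth root (leaf_edges X) (s (inord i))) 3).
  apply: permutesE; [by rewrite size_mkseq|by rewrite size_leaf_edges|].
  move=> x0 i; rewrite nth_mkseq // inord_val; apply: set_nth_default.
  by rewrite size_leaf_edges.
have pl0 := permutes_perm_eq hs.
have ul0 : uniq l0 by rewrite (perm_uniq pl0) leaf_edges_uniq.
have dcor T : is_tree tt T -> tree_degree T = -1 -> T = T0.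
  move=> tT; rewrite /tree_degree /= => h; apply: (corolla_unique X1) => //.
  by apply/eqP; rewrite -cards_eq0; move: h; move: #|internal T| => n; lia.
have dT0 : tree_degree T0 = -1 by rewrite /tree_degree /= (corolla_internal X tt) cards0.
have tern0 : tern T0 = root.
  by have [uV _ _] := ternP tT0 dT0; move: uV; rewrite (corolla_vertices tt X1) in_set1 => /eqP.
have hlu T : is_tree tt T -> tree_degree T = -1 -> perm_eq ((fun=> l0) T) (enum (inputs T (tern T))).
  move=> tT dT; rewrite (dcor T tT dT) tern0 (perm_trans pl0) // perm_sym.
  exact: (inputs_corolla tT0 (corolla_internal X tt) X1).
rewrite -natsum_mono3 (natsum_d dual_gg' hlu corolla_cochainP).
rewrite (big_pred1 T0); last first.
  move=> T /=; apply/andP/eqP => [[tT /eqP dT]|->]; first exact: dcor.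
  by split=> //; rewrite /tree_degree /= (corolla_internal X tt) cards0.
have r0 : rest T0 = [::] by rewrite /rest tern0 (corolla_vertices tt X1) enum_set1 /= eqxx.
rewrite r0 /= tern0.
have lab (O : operad k) (q : O 3%N) (a : decoration (mono O) X) : labeled T0 (dfwith a (mop root l0 q)).
  apply/labeledP => v; rewrite (corolla_vertices tt X1) inE => /eqP ->; rewrite dfwith_in.
  by rewrite (perm_trans pl0) // perm_sym (inputs_corolla tT0 (corolla_internal X tt) X1).
have ev (O : operad k) (q : O 3%N) (a : decoration (mono O) X) :
    eval3 T0 (dfwith a (mop root l0 q)) = oact s q.
  rewrite /eval3 (@tree_comp_corolla _ _ (mono O) X tt T0 (corolla_internal X tt) X1 _ s).
    rewrite dfwith_in /= [LHS]/(col_act _ _ _) /col_act /= ocast_id; congr oact.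
    have e3 : size (cols l0) = 3%N by rewrite size_map; have /permutesP[] := hs.
    by rewrite ocast_trans // ocast_id.
  by rewrite dfwith_in.
rewrite [LHS]ev.
have tf q : tern_form (fun=> l0) corolla_cochain T0 (@dec0 k _ X (mono G)) q =
            (-1) ^+ s * lam (oact s q).
  rewrite /tern_form tern0 /corolla_cochain eqxx /tern_order r0 /= cats0 ev.
  rewrite -(par_sym ul0 pl0) -(permutes_par (leaf_edges_uniq X) hs) /cobar_data tT0 lab.
  by rewrite (perm_trans pl0 corolla_nonroot).
rewrite -(linZ _ _ (oact_linear s)); congr oact.
rewrite /rot3 scaler_sumr; apply: eq_bigr => c _; rewrite scaler_sumr; apply: eq_bigr => i _.
by rewrite scaler_sumr; apply: eq_bigr => j _; rewrite tf scalerA.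
Qed.

End Arity3.

(** * Ideals of relations and orthogonality *)

Section Ideal.
Variables (k : fieldType) (F : operad k) (R : F 3%N -> Prop).

Lemma ideal_cast m n (a : F m) : m = n -> ideal R a -> ideal R (ocast n a).
Proof. by move=> e; subst n; rewrite ocast_id. Qed.

Lemma ideal_sum n (I : Type) (r : seq I) (q : pred I) (f : I -> F n) :
  (forall i, q i -> ideal R (f i)) -> ideal R (\sum_(i <- r | q i) f i).
Proof.
move=> h; elim/big_ind: _ => //; first exact: ideal_zero.
by move=> a b ha hb; rewrite -[a]scale1r; apply: ideal_lin.
Qed.

(** Composing an operation of arity at least 3 with others cannot lower its
    arity below 3, since there are no nonzero operations of arity 0. *)
Lemma ideal_low n (a : F n) : ideal R a -> (n < 3)%N -> a = 0.
Proof.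
elim=> {n a} [//|//|n c a b _ IHa _ IHb n3|n s a _ IHa n3|m n p i a b im pmn _ IHa p3|m n p i a b im pmn _ IHb p3].
- by rewrite IHa // IHb // scaler0 addr0.
- by rewrite IHa // oact0.
- have [m3|m3] := ltnP m 3; first by rewrite IHa // ocomp0l.
  have n0 : n = 0%N by lia.
  by subst n; rewrite (op_nullary b) ocomp0r.
- have [n3|n3] := ltnP n 3; first by rewrite IHb // ocomp0r.
  by lia.
Qed.

(** The only compositions that stay in arity 3 are those with operations of
    arity 1, which are scalars. *)
Lemma ideal_arity3 (S : F 3%N -> Prop) : S 0 ->
  (forall c a b, S a -> S b -> S (c *: a + b)) -> (forall s a, S a -> S (oact s a)) ->
  (forall r, R r -> S r) -> forall a : F 3%N, ideal R a -> S a.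
Proof.
move=> S0 Sl Sa SR a ha.
suff H N (b : F N) : ideal R b -> N = 3%N -> S (ocast 3 b) by have := H _ _ ha erefl; rewrite ocast_id.
move=> {a ha} hb.
have Sz c d : S d -> S (c *: d) by move=> h; rewrite -[c *: d]addr0; apply: Sl.
elim: hb => {N b} [r h _|n _|n c a b _ IHa _ IHb n3|n s a _ IHa n3|m n p i a b im pmn ha IHa p3|m n p i a b im pmn hb IHb p3].
- by rewrite ocast_id; apply: SR.
- by rewrite ocast0.
- by rewrite ocast_linear; apply: Sl; auto.
- by subst n; move: (IHa erefl); rewrite !ocast_id; apply: Sa.
- subst p; rewrite ocast_id.
  have [m3|m3] := ltnP m 3; first by rewrite (ideal_low ha) // ocomp0l.
  have [n0|n0] := eqVneq n 0%N; first by subst n; rewrite (op_nullary b) ocomp0r.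
  have e1 : n = 1%N by lia.
  have em : m = 3%N by lia.
  subst m n; have [c ->] := op_unary b.
  rewrite (linZ _ _ (ocomp_linearr 3 i a)) ocomp1r //; apply: Sz.
  by have := IHa erefl; rewrite ocast_id.
- subst p; rewrite ocast_id.
  have [n3|n3] := ltnP n 3; first by rewrite (ideal_low hb) // ocomp0r.
  have em : m = 1%N by lia.
  have en : n = 3%N by lia.
  subst m n; have [c ->] := op_unary a; have i0 : i = 0%N by lia.
  subst i; rewrite (linZ _ _ (ocomp_linearl 3 0%N b)) ocomp1l; apply: Sz.
  by have := IHb erefl; rewrite ocast_id.
Qed.

(** Contracting an edge next to this vertex composes an element of the ideal
    with another operation. *)
Lemma ideal_tree (X : seq unit) (T : {set edge X}) (a : decoration (mono F) X) v :
  is_tree tt T -> labeled T a -> v \in vertices T -> ideal R (mval (a v)) ->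
  ideal R (tree_comp tt T a : F (size X)).
Proof.
move=> tT; move: T tT a v; apply: tree_ind => [T tT iT|T e tT eI IH] a v la vV ha.
  have X1 := vertices_small vV; have [s hs] := corolla_perm tT iT X1 la.
  move: vV; rewrite (vertices_corolla tT iT X1) in_set1 => /eqP Ev; subst v.
  rewrite (tree_comp_corolla iT X1 hs).
  have e1 : size (cols (tag (a (root_edge X tt)))) = size X.
    by rewrite size_map; have /permutesP[] := hs.
  change (ideal R (ocast (size X) (oact s (ocast (size X) (mval (a (root_edge X tt))))))).
  by rewrite ocast_id; apply: ideal_act; apply: ideal_cast.
rewrite (tree_comp_contract tT la eI).
have lc := contract_labeled tT eI la.
have comp (u w : edge X) : u \in tag (a w) -> contract u a w =
    @vdec_op _ _ (mono F) X w _ (ocomp (size (cols (splice (tag (a w)) (index u (tag (a w))) (tag (a u)))))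
             (index u (tag (a w))) (mval (a w)) (mval (a u))).
  by move=> h; rewrite contract_in.
have sz (u w : edge X) : u \in tag (a w) -> (index u (tag (a w)) < size (cols (tag (a w))))%N /\
   (size (cols (splice (tag (a w)) (index u (tag (a w))) (tag (a u))))).+1 =
   (size (cols (tag (a w))) + size (cols (tag (a u))))%N.
  by move=> h; apply: size_grafts (grafts_splice _ h).
have [ve|ve] := eqVneq v e.
  subst v; have [w wV ew] := parent_internal tT eI.
  have we : w != e by rewrite eq_sym (inputs_neq ew).
  have ea : e \in tag (a w) by rewrite (labeled_mem _ la).
  have [s1 s2] := sz _ _ ea.
  apply: (IH _ w lc); first by rewrite vertices_erase; apply/setD1P.
  by rewrite comp //; apply: ideal_compr.
apply: (IH _ v lc); first by rewrite vertices_erase; apply/setD1P.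
have [ea|ea] := boolP (e \in tag (a v)); last by rewrite contract_out.
by have [s1 s2] := sz _ _ ea; rewrite comp //; apply: ideal_compl.
Qed.

End Ideal.

Section FreeBasis.
Variables (k : fieldType) (E : smodule k 2%N) (Fo : free_operad E).

Lemma free_bij m (e : m.-tuple E) : basis_of {:E} e -> forall X : seq unit, X != [::] ->
  bijective (@tree_eval k unit m X tt (mono Fo) (mono_gen (fun i => fo_gen Fo (tnth e i)))).
Proof.
move=> be X X0; have em : m = \dim {:E} by rewrite (size_basis be).
subst m; have EX : X = nseq (size X) tt.
  by elim: X {X0} => //= -[] X <-.
rewrite EX; apply: fo_free => //; by case: X X0 {EX}.
Qed.

Lemma tree_eval_linear m (X : seq unit) (g : 'I_m -> forall Y y, mono Fo Y y) :
  linear (@tree_eval k unit m X tt (mono Fo) g).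
Proof.
move=> c z z'; rewrite /tree_eval scaler_sumr -big_split; apply: eq_bigr => mu _ /=.
by rewrite !ffunE scalerDl scalerA.
Qed.

End FreeBasis.

Lemma bij_linear_inv (k : fieldType) (U V : lmodType k) (f : U -> V) h :
  linear f -> cancel f h -> cancel h f -> linear h.
Proof. by move=> lf c1 c2 c a b; apply: (can_inj c1); rewrite c2 lf !c2. Qed.

Section DualGens.
Variables (k : fieldType) (E : smodule k 2%N) (Fo : free_operad E) (Fo' : free_operad (sdual E)).

Definition fgen (i : 'I_(\dim {:E})) : Fo 2%N := fo_gen Fo (gen_basis i).
Definition fgen' (i : 'I_(\dim {:E})) : Fo' 2%N := fo_gen Fo' (dual_basis i).

Lemma gen_expand v : v = \sum_i coord (vbasis {:E}) i v *: gen_basis i.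
Proof. by rewrite [LHS](coord_vbasis (memvf v)). Qed.

Lemma dual_basisE i v : (dual_basis i : 'Hom(E, k^o)) v = coord (vbasis {:E}) i v.
Proof. by rewrite lfunE. Qed.

Lemma dual_expand (f : sdual E) : f = \sum_i (f : 'Hom(E, k^o)) (gen_basis i) *: dual_basis i.
Proof.
apply/lfunP => v; rewrite sum_lfunE {1}(gen_expand v) linear_sum; apply: eq_bigr => i _.
by rewrite scale_lfunE dual_basisE linearZ /= [LHS]mulrC.
Qed.

Lemma coord_gen i j : coord (vbasis {:E}) i (gen_basis j) = (i == j)%:R.
Proof. by rewrite coord_free ?(basis_free (vbasisP _)) // eq_sym. Qed.

Lemma dual_tuple_basis : basis_of {:sdual E} [tuple dual_basis i | i < \dim {:E}].
Proof.
apply/andP; split.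
  rewrite eqEsubv subvf /=; apply/subvP => f _; rewrite (dual_expand f).
  apply: memv_suml => i _; apply: memvZ; apply: memv_span.
  by apply/mapP; exists i; rewrite ?mem_enum /= ?mem_ord_enum ?val_ord_tuple ?mem_enum.
apply/freeP => c h i; have := congr1 (fun f : 'Hom(E, k^o) => f (gen_basis i)) h.
rewrite sum_lfunE zero_lfunE (bigD1 i) //= big1 ?addr0 => [|j ji].
  by rewrite scale_lfunE nth_mktuple dual_basisE coord_gen eqxx => h'; rewrite -[LHS]mulr1; exact: h'.
by rewrite scale_lfunE nth_mktuple dual_basisE coord_gen (negbTE ji) [LHS]mulr0.
Qed.

(** In dual bases the matrices of the two actions are inverse transposes of
    each other, up to the sign. *)
Lemma op_sign_dual_fgen : op_sign_dual fgen fgen'.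
Proof.
move=> s V B B1 B2.
have actE i : oact s (fgen i) = \sum_j coord (vbasis {:E}) j (sm_act E s (gen_basis i)) *: fgen j.
  rewrite /fgen -fo_gen_act {1}(gen_expand (sm_act E s (gen_basis i))) linear_sum.
  by apply: eq_bigr => j _; rewrite linearZ.
have actE' i : oact s (fgen' i) = (-1) ^+ s *: \sum_j
    coord (vbasis {:E}) i (sm_act E s^-1%g (gen_basis j)) *: fgen' j.
  rewrite /fgen' -fo_gen_act /= lfunE /= /sdual_fun linearZ /=; congr (_ *: _).
  rewrite {1}(dual_expand ((dual_basis i : 'Hom(E, k^o)) \o sm_act E s^-1%g)%VF) linear_sum.
  by apply: eq_bigr => j _; rewrite linearZ /= comp_lfunE dual_basisE.
transitivity ((-1) ^+ s *: \sum_i \sum_j \sum_l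
   (coord (vbasis {:E}) j (sm_act E s (gen_basis i)) *
    coord (vbasis {:E}) i (sm_act E s^-1%g (gen_basis l))) *: B (fgen j) (fgen' l)).
  rewrite scaler_sumr; apply: eq_bigr => i _; rewrite actE actE' (linZ _ _ (B2 _)); congr (_ *: _).
  rewrite (lin_sum _ _ _ (B1 _)); apply: eq_bigr => j _; rewrite (linZ _ _ (B1 _)).
  rewrite (lin_sum _ _ _ (B2 _)) scaler_sumr; apply: eq_bigr => l _.
  by rewrite (linZ _ _ (B2 _)) scalerA.
congr (_ *: _); rewrite exchange_big; apply: eq_bigr => j _; rewrite exchange_big /=.
transitivity (\sum_l (j == l)%:R *: B (fgen j) (fgen' l)).
  apply: eq_bigr => l _; rewrite -scaler_suml; congr (_ *: _).
  rewrite -coord_gen -[in RHS](sm_act1 (gen_basis l)) -(mulVg s) sm_actM.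
  rewrite {2}(gen_expand (sm_act E s^-1%g (gen_basis l))) !linear_sum /=.
  by apply: eq_bigr => i _; rewrite !linearZ /= mulrC.
rewrite (bigD1 j) //= eqxx scale1r big1 ?addr0 // => l lj.
by rewrite eq_sym (negbTE lj) scale0r.
Qed.

Lemma fgen_bij (X : seq unit) : X != [::] ->
  bijective (@tree_eval k unit _ X tt (mono Fo) (mono_gen fgen)).
Proof.
move=> X0; have := free_bij Fo (vbasisP {:E}) X0.
by have -> : (fun i => fo_gen Fo (tnth (vbasis {:E}) i)) = fgen by
  apply/funext => i; rewrite (tnth_nth 0).
Qed.

Lemma fgen'_bij (X : seq unit) : X != [::] ->
  bijective (@tree_eval k unit _ X tt (mono Fo') (mono_gen fgen')).
Proof.
move=> X0; have := free_bij Fo' dual_tuple_basis X0.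
by have -> : (fun i => fo_gen Fo' (tnth [tuple dual_basis i | i < \dim {:E}] i)) = fgen' by
  apply/funext => i; rewrite tnth_mktuple.
Qed.

Variable R : {vspace Fo 3%N}.
Hypothesis R_stable : forall (s : 'S_3) r, r \in R -> oact s r \in R.
Local Notation X3 := (nseq 3 tt).
Local Notation ev := (@tree_eval k unit _ X3 tt (mono Fo) (mono_gen fgen)).
Local Notation ev' := (@tree_eval k unit _ X3 tt (mono Fo') (mono_gen fgen')).
Local Notation space := (tree_space k (\dim {:E}) X3 tt).

(** The sign is not a default value, since the two lists order the same
    edges. *)
Lemma det_sign2 (mu : monomial (\dim {:E}) X3 tt) : 
  det_sign k (mono_tree mu) * det_sign k (mono_tree mu) = 1.
Proof.
have /andP[tT bT] := valP (tag mu); rewrite -/(mono_tree mu) in tT bT.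
set T := mono_tree mu in tT bT *.
have [e [iT eT]] := binary3 tT bT; have eI : e \in internal T by rewrite iT inE.
have pw : perm_eq (vertexwise_order T) (enum (nonroot T)).
  by apply: (perm_flatten_inputs tT (L := std_list T)) => //; apply: std_lists.
have uw : uniq (vertexwise_order T) by rewrite (perm_uniq pw) enum_uniq.
have eN : e \in nonroot T by move: eI; rewrite in_internal in_nonroot => /and3P[-> _ ->].
have pel : perm_eq (vertexwise_order T) (enum (internal T) ++ leaf_edges X3).
  rewrite (perm_trans pw) // iT enum_set1 perm_sym cat1s.
  have en : e \in enum (nonroot T) by rewrite mem_enum.
  rewrite perm_sym (perm_trans (perm_to_rem en)) // perm_cons perm_sym.
  rewrite (perm_trans corolla_nonroot) //; apply: uniq_perm; rewrite ?rem_uniq ?enum_uniq //.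
  by move=> f; rewrite mem_rem_uniq ?enum_uniq // inE !mem_enum -eT nonroot_erase in_setD1.
by rewrite /det_sign (par_osign k uw pel) -signr_addb addbb.
Qed.

(** The pairing of [F(3)] and [F'(3)] identifies a linear form on the latter
    with an element of the former. *)
Definition coords3 (lam : Fo' 3%N -> k) : space :=
  [ffun mu => det_sign k (mono_tree mu) * lam (eval3 (mono_tree mu) (mono_dec (mono_gen fgen') mu))].

Lemma ev_coords3 lam : ev (coords3 lam) = mono3 fgen fgen' lam.
Proof. by apply: eq_bigr => mu _; rewrite ffunE. Qed.

Lemma pairing_coords3 (lam : Fo' 3%N -> k^o) z' : linear lam ->
  tree_pairing (coords3 lam) z' = lam (ev' z').
Proof.
move=> ll; rewrite /tree_pairing [in RHS]/tree_eval (lin_sum _ _ _ ll); apply: eq_bigr => mu _.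
by rewrite ffunE (linZ _ _ ll) !mulrA det_sign2 mul1r mulrC.
Qed.

Lemma mono3_orthogonal (lam : Fo' 3%N -> k^o) (y : Fo' 3%N) : linear lam ->
  mono3 fgen fgen' lam \in R -> orthogonal R y -> lam y = 0.
Proof.
move=> ll rR oy; have [h c1 c2] := fgen'_bij (X := X3) isT.
rewrite -[y](c2 : forall y : Fo' 3%N, _ = y) -pairing_coords3 //; apply: oy; last exact: c2.
by rewrite -/fgen ev_coords3.
Qed.

(** A coordinate of the component outside [R] *)
Lemma vspace_separate (v : Fo 3%N) : v \notin R ->
  exists mu : Fo 3%N -> k^o, [/\ linear mu, forall r, r \in R -> mu r = 0 & mu v != 0].
Proof.
move=> vR; pose w := v - projv R v.
have w0 : w != 0.
  by rewrite subr_eq0; apply: contra vR => /eqP ->; apply: memv_proj.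
have [i wi] : exists i, coord (vbasis fullv) i w != 0.
  apply/existsP; rewrite -[X in is_true X]negbK negb_exists; apply/negP => /forallP h.
  case/eqP: w0; rewrite [w](coord_vbasis (memvf w)) big1 // => i _.
  by have := h i; rewrite negbK => /eqP ->; rewrite scale0r.
exists (fun x => coord (vbasis fullv) i (x - projv R x)); split=> //.
- move=> c x y; have -> : c *: x + y - projv R (c *: x + y) = c *: (x - projv R x) + (y - projv R y).
    by rewrite linearP /= scalerBr opprD addrACA.
  by rewrite linearD linearZ.
- by move=> r rR; rewrite projv_id // subrr linear0.
Qed.

(** This is the equality of a subspace with its double orthogonal: a linear
    form on [F(3)] that vanishes on [R] is given by an element of the
    orthogonal. *)
Lemma orthogonal_mono3 (lam : Fo' 3%N -> k^o) : linear lam ->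
  (forall y, orthogonal R y -> lam y = 0) -> mono3 fgen fgen' lam \in R.
Proof.
move=> ll h; apply/negPn/negP => /vspace_separate[mu [lmu muR]]; case/eqP.
pose zy : space := [ffun nu => det_sign k (mono_tree nu) * mu (eval3 (mono_tree nu) (mono_dec (mono_gen fgen) nu))].
have Elam : mu (mono3 fgen fgen' lam) = lam (ev' zy).
  rewrite /mono3 (lin_sum _ _ _ lmu) /tree_eval (lin_sum _ _ _ ll); apply: eq_bigr => nu _.
  by rewrite (linZ _ _ lmu) (linZ _ _ ll) ffunE; apply: mulrAC.
rewrite Elam; apply: h => z z' zR hz'.
have [inv c1 c2] := fgen'_bij (X := X3) isT.
have -> : z' = zy by apply: (can_inj c1).
rewrite -(muR _ zR) /tree_pairing /tree_eval (lin_sum _ _ _ lmu); apply: eq_bigr => nu _.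
by rewrite ffunE (linZ _ _ lmu) mulrCA (mulrA (det_sign _ _)) det_sign2 mul1r.
Qed.

(** The pairing is invariant up to the sign by [mono3_rot3]. *)
Lemma orthogonal_stable (s : 'S_3) (y : Fo' 3%N) : orthogonal R y -> orthogonal R (oact s y).
Proof.
move=> oy z z' zR hz'; have [inv c1 c2] := fgen'_bij (X := X3) isT.
have linv : linear inv := bij_linear_inv (@tree_eval_linear _ _ _ _ _ _) c1 c2.
(* pairing with [z], as a linear form *)
pose lam (q : Fo' 3%N) : k^o := tree_pairing z (inv q).
have ll : linear lam.
  move=> c p q; rewrite /lam linv /tree_pairing scaler_sumr -big_split; apply: eq_bigr => mu _ /=.
  by rewrite !ffunE !mulrDr -[_ *: _]/(_ * _); congr (_ + _); rewrite -[_ *: _]/(_ * _); ring.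
have lls : linear (fun q => lam (oact s q)) by move=> c p q; rewrite oact_linear ll.
have dd := op_sign_dual_fgen.
have Ez : mono3 fgen fgen' lam = ev z.
  rewrite -ev_coords3; congr (ev _); apply/ffunP => mu; rewrite ffunE /lam.
  have -> : inv (eval3 (mono_tree mu) (mono_dec (mono_gen fgen') mu)) = [ffun nu => (nu == mu)%:R].
    apply: (canLR c1); rewrite /tree_eval (bigD1 mu) //= ffunE eqxx scale1r big1 ?addr0 //.
    by move=> nu /negbTE nm; rewrite ffunE nm scale0r.
  rewrite /tree_pairing (bigD1 mu) //= big1 ?addr0 => [|nu /negbTE nm].
    by rewrite ffunE eqxx mulr1 mulrA det_sign2 mul1r.
  by rewrite ffunE nm !mulr0.
have rR : mono3 fgen fgen' (fun q => lam (oact s q)) \in R.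
  have E1 := mono3_rot3 dd ll s.
  have E2 := mono3_rot3 dd lls 1%g; rewrite odd_perm1 expr0 scale1r oact1 in E2.
  have E3 : rot3 fgen fgen' (fun q => lam (oact s (oact 1%g q))) = rot3 fgen fgen' (fun q => lam (oact s q)).
    by rewrite /rot3; do 3!(apply: eq_bigr => ? _); rewrite oact1.
  have E4 : rot3 fgen fgen' (fun q => lam (oact s q)) = oact s^-1%g ((-1) ^+ s *: mono3 fgen fgen' lam).
    rewrite E1 scalerA -signr_addb addbb expr0 scale1r -oactM mulgV oact1 //.
  by rewrite E2 E3 E4; apply: R_stable; apply: memvZ; rewrite Ez.
have := mono3_orthogonal lls rR oy; rewrite /lam => <-; congr tree_pairing.
by apply: (can_inj c1); rewrite c2.
Qed.

(** In arity 3, the ideal generated by the orthogonal is the orthogonal. *)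
Lemma ideal_orthogonal (lam : Fo' 3%N -> k^o) : linear lam -> mono3 fgen fgen' lam \in R ->
  forall y : Fo' 3%N, ideal (@orthogonal k E Fo Fo' R) y -> lam y = 0.
Proof.
move=> ll rR y iy; apply: (mono3_orthogonal ll rR); move: y iy; apply: ideal_arity3 => //.
- move=> z z' zR hz'; have [inv c1 c2] := fgen'_bij (X := X3) isT.
  have -> : z' = 0 by apply: (can_inj c1); rewrite hz' (lin0 (@tree_eval_linear _ _ _ _ _ _)).
  by rewrite /tree_pairing big1 // => mu _; rewrite ffunE !mulr0.
- move=> c a b oa ob z z' zR hz'; have [inv c1 c2] := fgen'_bij (X := X3) isT.
  have linv : linear inv := bij_linear_inv (@tree_eval_linear _ _ _ _ _ _) c1 c2.
  have -> : z' = c *: inv a + inv b by apply: (can_inj c1); rewrite hz' -linv c2.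
  have := oa z (inv a) zR (c2 a); have := ob z (inv b) zR (c2 b); rewrite /tree_pairing => hb ha.
  rewrite (eq_bigr (fun mu => c * (det_sign k (mono_tree mu) * (z mu * inv a mu)) +
                           det_sign k (mono_tree mu) * (z mu * inv b mu))).
    by rewrite big_split /= -mulr_sumr ha hb mulr0 addr0.
  by move=> mu _; rewrite !ffunE -[_ *: _]/(_ * _); ring.
- by move=> s a; apply: orthogonal_stable.
Qed.

End DualGens.

(** * Cochains of degree 0 and -1 over the quadratic dual *)

Section Expand.
Variables (k : fieldType) (C : finType) (m : nat) (P Q : coperad C k) (X : seq C).
Variables (gP : 'I_m -> forall Y y, P Y y) (gQ : 'I_m -> forall Y y, Q Y y).
Local Notation edge := (edge X).
Variables (L : edge -> seq edge) (c : edge -> 'I_m -> k).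
Variable kap : forall v : edge, vdec Q v -> k.
Hypothesis kapE : forall v i, kap (gdec gQ v (L v) i) = c v i.

Definition comb_dec : decoration P X := fun v =>
  @vdec_op _ _ P X v (L v) (\sum_i c v i *: gP i _ _).

Lemma gsum_scale (V : lmodType k) vs (d : k) (G : decoration P X -> decoration Q X -> V) a b :
  gsum gP gQ L vs (fun a b => d *: G a b) a b = d *: gsum gP gQ L vs G a b.
Proof.
elim: vs a b => //= v vs IH a b; rewrite scaler_sumr.
by apply: eq_bigr => i _; apply: IH.
Qed.

(** By multilinearity: [kap] reads off the coefficient of the generator of
    [P] from the generator of [Q] that goes with it. *)
Lemma gsum_expand (V : lmodType k) (H : decoration P X -> V) vs a0 b0 : uniq vs ->
  (forall v a, v \in vs -> (forall w, w \in vs -> tag (a w) = L w) ->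
     (forall w, w \notin vs -> a w = a0 w) ->
     linear (fun p => H (dfwith a (@vdec_op _ _ P X v (L v) p)))) ->
  gsum gP gQ L vs (fun a b => (\prod_(v <- vs) kap (b v)) *: H a) a0 b0 =
  H (patch a0 comb_dec vs).
Proof.
elim: vs a0 b0 => [|v vs IH] a0 b0; first by move=> _ _ /=; rewrite big_nil scale1r patch_nil.
case/andP=> nv us lin /=.
transitivity (\sum_i c v i *: H (patch (dfwith a0 (gdec gP v (L v) i)) comb_dec vs)).
  apply: eq_bigr => i _; rewrite -(IH _ (dfwith b0 (gdec gQ v (L v) i))) //; last first.
    move=> w a wv ta oa; apply: lin; first by rewrite inE wv orbT.
      move=> z; rewrite inE => /orP[/eqP->|/ta //].
      by rewrite oa // dfwith_in.
    by move=> z; rewrite inE negb_or => /andP[zv nz]; rewrite oa // dfwith_out // eq_sym.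
  rewrite -gsum_scale; apply: gsum_eq => // a b hg ho; rewrite big_cons scalerA; congr (_ * _ *: _).
  by have [_ ->] := ho v nv; rewrite dfwith_in kapE.
have pE d : patch (dfwith a0 (@vdec_op _ _ P X v (L v) d)) comb_dec vs =
            dfwith (patch a0 comb_dec vs) (@vdec_op _ _ P X v (L v) d).
  apply: functional_extensionality_dep => w; rewrite /patch.
  have [<-|vw] := eqVneq v w; first by rewrite (negbTE nv) !dfwith_in.
  by case: ifP => wv; rewrite !dfwith_out // wv.
have lv : linear (fun p => H (dfwith (patch a0 comb_dec (v :: vs)) (@vdec_op _ _ P X v (L v) p))).
  apply: lin; first exact: mem_head.
    by move=> w wv; rewrite /patch wv.
  by move=> w nw; rewrite /patch (negbTE nw).
have dd d : dfwith (patch a0 comb_dec vs) (@vdec_op _ _ P X v (L v) d) =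
            dfwith (patch a0 comb_dec (v :: vs)) (@vdec_op _ _ P X v (L v) d).
  apply: functional_extensionality_dep => w.
  have [<-|vw] := eqVneq v w; first by rewrite !dfwith_in.
  by rewrite !dfwith_out // /patch inE eq_sym (negbTE vw).
rewrite (eq_bigr (fun i => c v i *: H (dfwith (patch a0 comb_dec (v :: vs))
   (@vdec_op _ _ P X v (L v) (gP i _ _))))); last by move=> i _; rewrite /gdec pE dd.
under eq_bigr => i _ do rewrite -(linZ _ _ lv).
by rewrite -(lin_sum _ _ _ lv) -dd [in RHS]patch_cons.
Qed.

End Expand.

Section FoGen.
Variables (k : fieldType) (E : smodule k 2%N) (Fo : free_operad E).
Local Notation X2 := (nseq 2 tt).
Local Notation T0 := (corolla X2 tt).

Let X1 : (1 < size X2)%N. Proof. by []. Qed.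

Lemma binary2 T : is_tree tt T -> is_binary T -> T = T0.
Proof.
move=> tT bT; have : tree_degree T == 0 by rewrite (degree0_binary tT).
rewrite /tree_degree /= => h; apply: (corolla_unique X1 tT); apply/eqP.
by rewrite -cards_eq0; move: h; move: #|internal T| => n; lia.
Qed.

Lemma binary_corolla2 : is_tree tt T0 && is_binary T0.
Proof.
have tT := corolla_tree tt X1; rewrite tT -(degree0_binary tT) /tree_degree /=.
by rewrite (corolla_internal X2 tt) cards0.
Qed.

(** The corolla is the only binary tree with two leaves.  The permutation
    compares the list of inputs used by monomials with the list of the
    leaves. *)
Lemma fo_gen_mono : exists s : 'S_2, forall (m : nat) (g : 'I_m -> Fo 2%N) (mu : monomial m X2 tt),
  exists i, (tree_comp tt (mono_tree mu) (mono_dec (mono_gen g) mu) : Fo 2%N) = oact s (g i) /\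
    forall v : {v | v \in vertices (mono_tree mu)}, tagged mu v = i.
Proof.
have tT := corolla_tree tt X1; have iT := corolla_internal X2 tt.
have rV : root_edge X2 tt \in vertices T0 by rewrite (corolla_vertices tt X1) inE.
have [s hs] := @perm_eq_permutes _ 2 _ _ (inputs_corolla tT iT X1)
   (etrans (perm_size (inputs_corolla tT iT X1)) (size_leaf_edges X2)).
exists s => m g [[T hT] iota]; have /andP[tT' bT'] := hT.
have ET := binary2 tT' bT'; subst T.
exists (iota (exist _ (root_edge X2 tt) rV)); rewrite /mono_tree /=; split; last first.
  move=> v; congr (iota _); apply: val_inj => /=; case: v => v /= vV.
  by move: vV; rewrite (corolla_vertices tt X1) in_set1 => /eqP.
rewrite (@tree_comp_corolla _ _ (mono Fo) X2 tt T0 iT X1 _ s); last exact: hs.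
rewrite /= /mono_dec /= insubT /=.
rewrite [LHS]/(col_act _ _ _) /col_act /= ocast_id; congr oact.
rewrite /mono_gen /= ocast_trans ?ocast_id; last first.
  by rewrite size_map (perm_size (inputs_corolla tT iT X1)) size_leaf_edges.
by congr (g (iota _)); apply: val_inj.
Qed.

Lemma fo_gen_surj (p : Fo 2%N) : exists v, fo_gen Fo v = p.
Proof.
have [h c1 c2] := fgen_bij Fo (X := X2) isT.
have [s hs] := fo_gen_mono.
have H (mu : monomial (\dim {:E}) X2 tt) : exists v, fo_gen Fo v =
    tree_comp tt (mono_tree mu) (mono_dec (mono_gen (fgen Fo)) mu).
  have [i [-> _]] := hs _ (fgen Fo) mu.
  by exists (sm_act E s (gen_basis i)); rewrite fo_gen_act.
exists (\sum_mu h p mu *: sval (cid (H mu))); rewrite linear_sum -[RHS](c2 p).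
by apply: eq_bigr => mu _; rewrite linearZ /=; case: (cid (H mu)) => v /= ->.
Qed.

Lemma fo_gen_inj v : fo_gen Fo v = 0 -> v = 0.
Proof.
move=> v0; have [h c1 c2] := fgen_bij Fo (X := X2) isT.
have [s hs] := fo_gen_mono.
pose mu (i : 'I_(\dim {:E})) : monomial (\dim {:E}) X2 tt :=
  @existT (binary_tree X2 tt) (fun T => {ffun {v | v \in vertices (val T)} -> 'I_(\dim {:E})})
    (exist _ T0 binary_corolla2) [ffun=> i].
have rV : root_edge X2 tt \in vertices T0 by rewrite (corolla_vertices tt X1) inE.
have muE i : tree_comp tt (mono_tree (mu i)) (mono_dec (mono_gen (fgen Fo)) (mu i)) = oact s (fgen Fo i).
  have [j [-> hj]] := hs _ (fgen Fo) (mu i).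
  by have := hj (exist _ (root_edge X2 tt) rV); rewrite ffunE => ->.
have muI i j : (mu i == mu j) = (i == j).
  apply/eqP/eqP => [E'|-> //]; have [l [_ hl]] := hs _ (fgen Fo) (mu i).
  have [l' [_ hl']] := hs _ (fgen Fo) (mu j).
  have := hl (exist _ (root_edge X2 tt) rV); have := hl' (exist _ (root_edge X2 tt) rV).
  rewrite !ffunE => -> ->; move: hl; rewrite E' => hl.
  by rewrite -(hl (exist _ (root_edge X2 tt) rV)) -(hl' (exist _ (root_edge X2 tt) rV)).
pose z : tree_space k (\dim {:E}) X2 tt := \sum_i coord (vbasis {:E}) i v *:
  ([ffun nu => (nu == mu i)%:R] : tree_space k (\dim {:E}) X2 tt).
have lin := @tree_eval_linear k E Fo _ X2 (mono_gen (fgen Fo)).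
have z0 : z = 0.
  apply: (can_inj c1); rewrite (lin0 lin) (lin_sum _ _ _ lin).
  transitivity (oact s (fo_gen Fo v)); last by rewrite v0 oact0.
  rewrite {2}(gen_expand v) linear_sum (lin_sum _ _ _ (oact_linear s)); apply: eq_bigr => i _.
  rewrite (linZ _ _ lin) linearZ (linZ _ _ (oact_linear s)); congr (_ *: _).
  rewrite /tree_eval (bigD1 (mu i)) //= ffunE eqxx scale1r muE big1 ?addr0 // => nu /negbTE n.
  by rewrite ffunE n scale0r.
rewrite (gen_expand v) big1 // => i _; suff -> : coord (vbasis {:E}) i v = 0 by rewrite scale0r.
have := congr1 (fun z : tree_space k (\dim {:E}) X2 tt => z (mu i)) z0.
rewrite /z sum_ffunE ffunE (bigD1 i) //= big1 ?addr0 => [|j ji].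
  by rewrite !ffunE eqxx => h'; rewrite -[LHS]mulr1.
by rewrite !ffunE muI eq_sym (negbTE ji) [LHS]mulr0.
Qed.

End FoGen.

Lemma linB (k : fieldType) (U V : lmodType k) (f : U -> V) u v : linear f -> f (u - v) = f u - f v.
Proof. by move=> h; rewrite -[- v]scaleN1r (linD _ _ h) (linZ _ _ h) scaleN1r. Qed.

Lemma gsum_zero (k : fieldType) (C : finType) m (P Q : coperad C k) (X : seq C) gP gQ (V : lmodType k)
    L vs (G : decoration P X -> decoration Q X -> V) a b :
  (forall a b, G a b = 0) -> @gsum k m C P Q X gP gQ V L vs G a b = 0.
Proof. by move=> h; elim: vs a b => //= v vs IH a b; apply: big1 => i _; apply: IH. Qed.

Section QuadraticDual.
Variables (k : fieldType) (O : quadratic_operad k) (O' : quadratic_dual O).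
Local Notation F := (q_free O).
Local Notation G := (d_op O').
Local Notation m := (\dim {:q_gen O}).
Local Notation g := (fgen (q_free O)).
Local Notation g' := (@dual_gen k O O').
Local Notation q' := (d_quo O').
Local Notation inR := (fun r => r \in q_rel O).

Lemma quo_linear n : linear (q' n).
Proof. by move=> c a b; rewrite linearP. Qed.

(** The quotient map carries the dual generators to generators of the
    quadratic dual. *)
Lemma op_sign_dual_quadratic : op_sign_dual g g'.
Proof.
move=> s V B B1 B2.
have := @op_sign_dual_fgen k (q_gen O) (q_free O) (d_free O') s V (fun p q => B p (q' 2%N q)).
move=> H; rewrite -[RHS]H //; last by move=> p c a b; rewrite quo_linear B2.
by apply: eq_bigr => i _; rewrite quo_act.
Qed.

Lemma rot3_quo (lam : G 3%N -> k) :
  rot3 g g' lam = rot3 g (fgen' (d_free O')) (fun y => lam (q' 3%N y)).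
Proof.
rewrite /rot3; do 3!(apply: eq_bigr => ? _).
by rewrite quo_act quo_comp.
Qed.

Lemma rot3_mono3 (lam : d_free O' 3%N -> k^o) : linear lam ->
  rot3 g (fgen' (d_free O')) lam = mono3 g (fgen' (d_free O')) lam.
Proof.
move=> ll; rewrite (mono3_rot3 (@op_sign_dual_fgen _ _ _ _) ll 1%g) odd_perm1 expr0 scale1r oact1.
by rewrite /rot3; do 3!(apply: eq_bigr => ? _); rewrite oact1.
Qed.

(** A linear form on [O'(3)] is one on [F'(3)] that vanishes on the
    orthogonal of the relations, that is, a relation. *)
Lemma rot3_in_R (lam : G 3%N -> k^o) : linear lam -> rot3 g g' lam \in q_rel O.
Proof.
move=> ll; have lq : linear (fun y => lam (q' 3%N y)) by move=> c a b; rewrite quo_linear ll.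
rewrite rot3_quo rot3_mono3 //; apply: (orthogonal_mono3 lq) => y oy.
have -> : q' 3%N y = 0 by apply/quo_ker; apply: ideal_gen.
exact: lin0.
Qed.

(** The form on [F'(3)] given by pairing with a relation vanishes on the
    ideal, and so descends to the quotient. *)
Lemma R_rot3 r : r \in q_rel O -> exists lam : G 3%N -> k^o, linear lam /\ rot3 g g' lam = r.
Proof.
move=> rR; have [h c1 c2] := fgen_bij (q_free O) (X := nseq 3 tt) isT.
have [inv c1' c2'] := fgen'_bij (d_free O') (X := nseq 3 tt) isT.
have linv : linear inv := bij_linear_inv (@tree_eval_linear _ _ _ _ _ _) c1' c2'.
pose lam (y : d_free O' 3%N) : k^o := tree_pairing (h r) (inv y).
have ll : linear lam.
  move=> c p q; rewrite /lam linv /tree_pairing scaler_sumr -big_split; apply: eq_bigr => mu _ /=.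
  by rewrite !ffunE !mulrDr -[_ *: _]/(_ * _); congr (_ + _); rewrite -[_ *: _]/(_ * _); ring.
have Er : mono3 g (fgen' (d_free O')) lam = r.
  rewrite -ev_coords3; suff -> : coords3 lam = h r by apply: c2.
  apply/ffunP => mu; rewrite ffunE /lam.
  have -> : inv (eval3 (mono_tree mu) (mono_dec (mono_gen (fgen' (d_free O'))) mu)) = [ffun nu => (nu == mu)%:R].
    apply: (canLR c1'); rewrite /tree_eval (bigD1 mu) //= ffunE eqxx scale1r big1 ?addr0 //.
    by move=> nu /negbTE nm; rewrite ffunE nm scale0r.
  rewrite /tree_pairing (bigD1 mu) //= big1 ?addr0 => [|nu /negbTE nm].
    by rewrite ffunE eqxx mulr1 mulrA det_sign2 mul1r.
  by rewrite ffunE nm !mulr0.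
have kil y : ideal (orthogonal (q_rel O)) y -> lam y = 0.
  apply: (ideal_orthogonal (@q_rel_stable k O) ll); by rewrite Er.
(* a form on the quotient is computed on preimages *)
pose pre (z : G 3%N) := sval (cid (quo_surj q' z)).
have preK z : q' 3%N (pre z) = z by rewrite /pre; case: cid.
have lamE y z : q' 3%N y = q' 3%N z -> lam y = lam z.
  move=> yz; apply/eqP; rewrite -subr_eq0.
  have -> : lam y - lam z = lam (y - z) by rewrite (linB _ _ ll).
  by apply/eqP/kil/(quo_ker q'); rewrite (linB _ _ (@quo_linear 3)) yz subrr.
exists (fun z => lam (pre z)); split.
  by move=> c a b; rewrite -ll; apply: lamE; rewrite preK quo_linear !preK.
rewrite rot3_quo -[RHS]Er -rot3_mono3 //; rewrite /rot3; do 3!(apply: eq_bigr => ? _).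
by congr (_ *: _); apply: lamE; rewrite preK.
Qed.

(** As relations live in arity 3, [O'(2)] is still the dual of the space of
    generators. *)
Definition dual_iso (f : sdual (q_gen O)) : G 2%N := q' 2%N (fo_gen (d_free O') f).

Lemma dual_iso_linear : linear dual_iso.
Proof. by move=> c a b; rewrite /dual_iso !linearP. Qed.

Lemma dual_iso_inj : injective dual_iso.
Proof.
move=> a b ab; apply/eqP; rewrite -subr_eq0; apply/eqP; apply: (fo_gen_inj (Fo := d_free O')).
apply: (ideal_low (R := orthogonal (q_rel O))) => //; apply/(quo_ker q').
by have := linB a b dual_iso_linear; rewrite ab subrr.
Qed.

Lemma dual_iso_surj q : exists f, dual_iso f = q.
Proof.
by have [p <-] := quo_surj q' q; have [f <-] := fo_gen_surj p; exists f.
Qed.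

Definition dual_inv (q : G 2%N) : sdual (q_gen O) := sval (cid (dual_iso_surj q)).

Lemma dual_invK : cancel dual_inv dual_iso.
Proof. by move=> q; rewrite /dual_inv; case: cid. Qed.

Lemma dual_isoK : cancel dual_iso dual_inv.
Proof. by move=> f; apply: dual_iso_inj; rewrite dual_invK. Qed.

Lemma dual_inv_linear : linear dual_inv.
Proof. exact: bij_linear_inv dual_iso_linear dual_isoK dual_invK. Qed.

(** Coordinates on [O'(2)] in the basis dual to the generators *)
Definition dcoord i (q : G 2%N) : k^o := (dual_inv q : 'Hom(q_gen O, k^o)) (gen_basis i).

Lemma dcoord_linear i : linear (dcoord i).
Proof. by move=> c a b; rewrite /dcoord dual_inv_linear add_lfunE scale_lfunE. Qed.

Lemma dcoord_gen i j : dcoord i (g' j) = (i == j)%:R.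
Proof.
rewrite /dcoord -[g' j]/(dual_iso (dual_basis j)) dual_isoK dual_basisE coord_gen.
by rewrite eq_sym.
Qed.

Lemma dcoord_expand q : q = \sum_i dcoord i q *: g' i.
Proof.
rewrite -[LHS]dual_invK [in LHS](dual_expand (dual_inv q)) (lin_sum _ _ _ dual_iso_linear).
by apply: eq_bigr => i _; rewrite (linZ _ _ dual_iso_linear).
Qed.

Lemma gen_span (p : F 2%N) : exists c : 'I_m -> k, p = \sum_i c i *: g i.
Proof.
have [v <-] := fo_gen_surj p; exists (fun i => coord (vbasis {:q_gen O}) i v).
by rewrite {1}(gen_expand v) linear_sum; apply: eq_bigr => i _; rewrite linearZ.
Qed.

Section OneArity.
Variable X : seq unit.
Local Notation edge := (edge X).
Implicit Types (T : {set edge}) (phi : precochain (mono G) X).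
Local Notation gsum := (gsum (mono_gen g) (mono_gen g')).
Local Notation d0 := (@dec0 k _ X (mono F)).
Local Notation d0' := (@dec0 k _ X (mono G)).

Definition std_lu T : seq edge := std_list T (tern T).
Lemma std_luP T : is_tree tt T -> tree_degree T = -1 ->
  perm_eq (std_lu T) (enum (inputs T (tern T))).
Proof. by []. Qed.

Lemma gsum_ind (P : F (size X) -> Prop) L vs (H : decoration (mono F) X -> decoration (mono G) X -> mono F X tt) a b :
  P 0 -> (forall x y, P x -> P y -> P (x + y)) -> uniq vs ->
  (forall c d, gen_dec (mono_gen g) (mono_gen g') L vs c d ->
     (forall w, w \notin vs -> c w = a w /\ d w = b w) -> P (H c d)) ->
  P (gsum L vs H a b).
Proof.
move=> P0 PD; elim: vs a b => [|v vs IH] a b /=; first by move=> _ h; apply: h.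
case/andP=> nv us h; elim/big_ind: _ => // i _; apply: IH => // c d h1 h2.
by have [h3 h4] := gen_dec_cons nv h1 h2; apply: h.
Qed.

(** The ternary vertex in [natsum_d] carries a relation. *)
Lemma natsum_d_ideal phi : cochain tt phi -> ideal inR (natsum g g' (cobar_d tt phi)).
Proof.
move=> hphi; rewrite (natsum_d op_sign_dual_quadratic std_luP hphi).
apply: ideal_sum => T /andP[tT /eqP dT]; have [uV _ _] := ternP tT dT.
apply: gsum_ind.
- exact: ideal_zero.
- by move=> x y hx hy; rewrite -[x]scale1r; apply: ideal_lin.
- by rewrite rem_uniq // enum_uniq.
move=> c d hg _; apply: (ideal_tree (v := tern T)) => //.
  by apply: (tern_labeled std_luP tT dT) => v /hg[i [-> _]].
rewrite dfwith_in; have [_ t3 _] := ternP tT dT; apply: ideal_cast.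
  by rewrite size_map -cardE t3.
apply: ideal_gen; apply: rot3_in_R => e a b; rewrite /tern_form.
by rewrite {1}/mop mop_linear (cochain_linear hphi).
Qed.

Lemma mono_dec_of T (O1 : operad k) (gg : 'I_m -> O1 2%N) (a : decoration (mono O1) X) :
  is_tree tt T -> is_binary T ->
  (forall v, v \in vertices T -> exists i, a v = gdec (mono_gen gg) v (std_list T v) i) ->
  exists2 mu : monomial m X tt, mono_tree mu = T &
    agree (vertices T) a (mono_dec (mono_gen gg) mu).
Proof.
move=> tT bT h; have hT : is_tree tt T && is_binary T by rewrite tT.
have hs (v : {v | v \in vertices T}) : {i | a (val v) = gdec (mono_gen gg) (val v) (std_list T (val v)) i}.
  by apply: cid; apply: h; apply: valP.
exists (@existT (binary_tree X tt) (fun B : binary_tree X tt => {ffun {v | v \in vertices (val B)} -> 'I_m})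
    (exist _ T hT) [ffun v => sval (hs v)]) => //.
move=> v vV; rewrite /mono_dec /mono_tree /= insubT /= ffunE.
exact: (svalP (hs (exist _ v vV))).
Qed.

Lemma natsum_eval phi : cochain tt phi -> natsum g g' phi =
  tree_eval (mono_gen g) [ffun mu : monomial m X tt => phi (mono_tree mu)
    (vertexwise_order (mono_tree mu)) (mono_dec (mono_gen g') mu)].
Proof.
move=> h; rewrite /tree_eval.
have loc T (a a' : decoration (mono F) X) (b b' : decoration (mono G) X) :
    is_tree tt T -> is_binary T -> labeled T a -> labeled T b ->
    agree (vertices T) a a' -> agree (vertices T) b b' ->
    term tt phi T (vertexwise_order T) a b = term tt phi T (vertexwise_order T) a' b'.
  move=> tT bT la lb aa bb; rewrite /term (cochain_agree h _ bb).
  by rewrite (mf_agree (tree_comp_mform (mono F) tT) la aa).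
under [in RHS]eq_bigr => mu _ do rewrite ffunE.
by rewrite [RHS](monomial_sum (mono_gen g) (mono_gen g') loc).
Qed.

(** The values of the cochain on dual monomials are the coordinates of its
    image in the basis of monomials, and the other values follow by
    multilinearity. *)
Lemma natsum_inj phi : X != [::] -> cochain tt phi -> homogeneous 0 phi ->
  natsum g g' phi = 0 -> phi = 0.
Proof.
move=> X0 h h0; rewrite natsum_eval // => e0.
have [inv c1 c2] := fgen_bij (q_free O) X0.
have := congr1 inv e0; rewrite c1 => z0.
have inv0 : inv 0 = 0.
  by apply: (can_inj c1); rewrite c2 (lin0 (@tree_eval_linear _ _ _ _ _ _)).
rewrite inv0 in z0.
have val0 (mu : monomial m X tt) :
    phi (mono_tree mu) (vertexwise_order (mono_tree mu)) (mono_dec (mono_gen g') mu) = 0.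
  by have := congr1 (fun z : tree_space k m X tt => z mu) z0; rewrite !ffunE.
apply: functional_extensionality_dep => T; apply: functional_extensionality_dep => w.
apply: functional_extensionality_dep => a.
have [cd|nc] := boolP (cobar_data tt T w a); last by rewrite (cochain_support h).
have /and3P[tT pw la] := cd.
have [d0T|] := boolP (tree_degree T == 0); last by move/h0->.
have bT : is_binary T by rewrite -(degree0_binary tT).
have pvo : perm_eq (vertexwise_order T) (enum (nonroot T)).
  by apply: (perm_flatten_inputs tT (L := std_list T)) => //; apply: std_lists.
have uvo : uniq (vertexwise_order T) by rewrite (perm_uniq pvo) enum_uniq.
have pvw : perm_eq (vertexwise_order T) w by rewrite (perm_trans pvo) // perm_sym.
rewrite (cochain_par h _ _ uvo pvw).
suff -> : phi T (vertexwise_order T) a = 0 by rewrite mulr0.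
have ul v : uniq (std_list T v) by apply: enum_uniq.
have s2 v : v \in vertices T -> size (cols (std_list T v)) = 2%N.
  by move=> vV; rewrite size_map -cardE; apply/eqP; move/forall_inP: bT; apply.
have mf := cochain_mform h T (vertexwise_order T).
(* [cf v] are the coordinates of the operation at [v], and [kp] recovers them from the generators *)
pose cf v i : k := dcoord i (ocast 2 (reord (std_list T v) (a v) : G (size (cols (std_list T v))))).
pose a1 : decoration (mono G) X := fun v => @vdec_op _ _ (mono G) X v (std_list T v) (reord (std_list T v) (a v)).
have r1 : relabeling T a a1.
  by move=> v vV; apply: relab_reord => //; apply: (labeledP _ _ la).
rewrite (mf_relab mf la r1).
have l1 : labeled T a1 by apply: relabeling_labeled r1 la.
pose cd1 := @comb_dec k _ m (mono G) X (mono_gen g') (std_list T) cf.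
have a1E : agree (vertices T) a1 (patch d0' cd1 (enum (vertices T))).
  move=> v vV; rewrite /patch mem_enum vV /a1 /cd1 /comb_dec; congr vdec_op.
  rewrite -[LHS](ocastK (n := 2)) ?s2 //.
  rewrite [in LHS](dcoord_expand (ocast 2 _)) (lin_sum _ _ _ (@ocast_linear _ _ _ _)).
  by apply: eq_bigr => i _; rewrite (linZ _ _ (@ocast_linear _ _ _ _)).
rewrite (mf_agree mf l1 a1E).
pose kp (v : edge) (d : vdec (mono G) v) : k := \sum_i (cf v i) * (dcoord i (ocast 2 (mval d))).
have kpE v i : v \in vertices T -> kp v (gdec (mono_gen g') v (std_list T v) i) = cf v i.
  move=> vV; rewrite /kp /mval /= (bigD1 i) //= big1 ?addr0 => [|j ji].
    by rewrite ocastK ?s2 // dcoord_gen eqxx mulr1.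
  by rewrite ocastK ?s2 // dcoord_gen (negbTE ji) mulr0.
pose kp' (v : edge) (d : vdec (mono G) v) : k := if v \in vertices T then kp v d else 0.
pose cf' v i := if v \in vertices T then cf v i else 0.
have kpE' v i : kp' v (gdec (mono_gen g') v (std_list T v) i) = cf' v i.
  by rewrite /kp' /cf'; case: ifP => // vV; apply: kpE.
have -> : patch d0' cd1 (enum (vertices T)) =
  patch d0' (@comb_dec k _ m (mono G) X (mono_gen g') (std_list T) cf') (enum (vertices T)).
  apply: functional_extensionality_dep => v; rewrite /patch mem_enum; case: ifP => // vV.
  by rewrite /cd1 /comb_dec /cf' vV.
have := @gsum_expand k _ m (mono G) (mono G) X (mono_gen g') (mono_gen g') (std_list T) cf' kp' kpE'
   k^o (phi T (vertexwise_order T)) (enum (vertices T)) d0' d0' (enum_uniq _).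
move=> <-; last first.
  move=> v b vV tb ob; apply: (mf_linear mf); first by rewrite mem_enum in vV.
  apply/labeledP => w' wV; have [<-|vw] := eqVneq v w'; first by rewrite dfwith_in.
  by rewrite dfwith_out // tb ?mem_enum.
rewrite -[RHS](@gsum_zero k _ m (mono G) (mono G) X (mono_gen g') (mono_gen g') k^o (std_list T)
   (enum (vertices T)) (fun _ _ => 0) d0' d0') //.
apply: gsum_eq; first exact: enum_uniq.
move=> b b' hg _; have [mu Emu ag] : exists2 mu : monomial m X tt, mono_tree mu = T &
    agree (vertices T) b (mono_dec (mono_gen g') mu).
  apply: mono_dec_of => // v vV; have [|i [-> _]] := hg v; first by rewrite mem_enum.
  by exists i.
by rewrite (cochain_agree h _ ag) -Emu val0 scaler0.
Qed.

Section Realize.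
Variables (T : {set edge}) (a : decoration (mono F) X).
Hypotheses (tT : is_tree tt T) (la : labeled T a).

(** Decorations may be relabeled so that the inputs are listed as for
    monomials. *)
Lemma normal_form : exists p : forall v, mono F (cols (std_list T v)) v.2,
  relabeling T a (fun v => @vdec_op _ _ (mono F) X v (std_list T v) (p v)).
Proof.
exists (fun v => reord (std_list T v) (a v)) => v vV.
by apply: relab_reord; [apply: enum_uniq | apply: (labeledP _ _ la)].
Qed.

(** Expand the operations at the vertices in terms of generators, and take
    the product of the corresponding forms on the dual generators. *)
Lemma natsum_binary : is_binary T ->
  exists phi, [/\ cochain tt phi, homogeneous 0 phi & natsum g g' phi = tree_comp tt T a].
Proof.
move=> bT; have [p rp] := normal_form.
have s2 v : v \in vertices T -> size (cols (std_list T v)) = 2%N.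
  by move=> vV; rewrite size_map -cardE; apply/eqP; move/forall_inP: bT; apply.
pose cf v := sval (cid (gen_span (ocast 2 (p v : F (size (cols (std_list T v))))))).
have cfE v : ocast 2 (p v : F (size (cols (std_list T v)))) = \sum_i cf v i *: g i.
  by rewrite /cf; case: cid.
pose lam v (q : mono G (cols (std_list T v)) v.2) : k^o :=
  \sum_i cf v i * dcoord i (ocast 2 (q : G (size (cols (std_list T v))))).
have lam_lin v : linear (@lam v).
  apply: sum_linear => i _ c x y; rewrite ocast_linear dcoord_linear.
  by rewrite -[_ *: dcoord _ _]/(_ * _) -[_ *: (_ * _)]/(_ * _); ring.
have pvo : perm_eq (vertexwise_order T) (enum (nonroot T)).
  by apply: (perm_flatten_inputs tT (L := std_list T)) => //; apply: std_lists.
pose phi := elem_cochain tt T (vertexwise_order T) lam.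
exists phi; split.
- by apply: elem_cochain_cochain => // v _; apply: lam_lin.
- have -> : 0 = tree_degree T by apply/esym/eqP; rewrite (degree0_binary tT).
  exact: elem_homogeneous.
rewrite /natsum (bigD1 T) /=; last by rewrite tT.
rewrite [X in _ + X]big1 ?addr0; last first.
  move=> T' /andP[_ TT']; rewrite /tree_sum.
  by apply: gsum_zero => b b'; rewrite /term /phi elem_cochain_out // scale0r.
rewrite /tree_sum -/(vertexwise_order T).
pose kp (v : edge) (d : vdec (mono G) v) : k := if v \in vertices T then lam v (reord (std_list T v) d) else 0.
pose cf' v i := if v \in vertices T then cf v i else 0.
have kpE v i : kp v (gdec (mono_gen g') v (std_list T v) i) = cf' v i.
  rewrite /kp /cf'; case: ifP => // vV; rewrite /gdec reord_id ?enum_uniq // /lam.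
  rewrite (bigD1 i) //= big1 ?addr0 => [|j ji].
    by rewrite ocastK ?s2 // dcoord_gen eqxx mulr1.
  by rewrite ocastK ?s2 // dcoord_gen (negbTE ji) mulr0.
have mfT := tree_comp_mform (mono F) tT.
have := @gsum_expand k _ m (mono F) (mono G) X (mono_gen g) (mono_gen g') (std_list T) cf' kp kpE
   (mono F X tt) (tree_comp tt T) (enum (vertices T)) d0 d0' (enum_uniq _) => H.
rewrite (mf_relab mfT la rp) (mf_agree mfT (b := patch d0 (@comb_dec k _ m (mono F) X (mono_gen g) (std_list T) cf') (enum (vertices T)))).
- rewrite -H => [|v b vV tb ob].
    apply: gsum_eq => [|b b' hg _]; first exact: enum_uniq.
    rewrite /term; congr (_ *: _).
    pose pb v : mono G (cols (std_list T v)) v.2 := reord (std_list T v) (b' v).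
    rewrite /phi (@elem_cochain_in _ _ (mono G) X tt T _ (std_list T) lam tT pvo (fun v _ => perm_refl _) b' pb) //.
      rewrite big_enum /=; apply: eq_bigr => v vV; by rewrite /kp vV.
    move=> v vV; have [|i [_ E]] := hg v; first by rewrite mem_enum.
    by rewrite /pb E /gdec reord_id // enum_uniq.
  apply: (mf_linear mfT); first by rewrite mem_enum in vV.
  apply/labeledP => w' wV; have [<-|vw] := eqVneq v w'; first by rewrite dfwith_in.
  by rewrite dfwith_out // tb ?mem_enum.
- exact: relabeling_labeled rp la.
move=> v vV; rewrite /patch mem_enum vV /comb_dec; congr vdec_op.
rewrite -[LHS](ocastK (n := 2)) ?s2 // cfE (lin_sum _ _ _ (@ocast_linear _ _ _ _)).
by apply: eq_bigr => i _; rewrite (linZ _ _ (@ocast_linear _ _ _ _)) /cf' vV.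
Qed.

End Realize.
End OneArity.
End QuadraticDual.

Section Ternary.
Variables (k : fieldType) (O : quadratic_operad k) (O' : quadratic_dual O).
Local Notation F := (q_free O).
Local Notation G := (d_op O').
Local Notation m := (\dim {:q_gen O}).
Local Notation g := (fgen (q_free O)).
Local Notation g' := (@dual_gen k O O').
Variable X : seq unit.
Local Notation edge := (edge X).
Implicit Types (T : {set edge}) (phi : precochain (mono G) X).
Local Notation gsum := (gsum (mono_gen g) (mono_gen g')).
Local Notation d0 := (@dec0 k _ X (mono F)).
Local Notation d0' := (@dec0 k _ X (mono G)).

(** Take the product of the linear form that [R_rot3] attaches to the
    relation and of the forms dual to the binary operations. *)
Lemma natsum_ternary T (a : decoration (mono F) X) u (r : F 3%N) :
  is_tree tt T -> labeled T a -> u \in vertices T -> #|inputs T u| = 3%N ->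
  (forall v, v \in vertices T -> v != u -> #|inputs T v| = 2%N) ->
  r \in q_rel O -> mval (a u) = ocast _ r ->
  exists eta, [/\ cochain tt eta, homogeneous (-1) eta
    & natsum g g' (cobar_d tt eta) = tree_comp tt T a].
Proof.
move=> tT la uV u3 v2 rR au.
have dT := ternary_degree tT uV u3 v2.
have Eu : tern T = u.
  have [tV t3 t2] := ternP tT dT; apply/eqP/negPn/negP => nu.
  by have := v2 _ tV nu; rewrite t3.
have sv v : v \in vertices T -> v != u -> size (cols (std_list T v)) = 2%N.
  by move=> vV vu; rewrite size_map -cardE v2.
have su : size (cols (std_list T u)) = 3%N by rewrite size_map -cardE.
pose p v : mono F (cols (std_list T v)) v.2 := reord (std_list T v) (a v).
have rp : relabeling T a (fun v => @vdec_op _ _ (mono F) X v (std_list T v) (p v)).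
  by move=> v vV; apply: relab_reord; [apply: enum_uniq | apply: (labeledP _ _ la)].
have [r' [r'R pu]] : exists r' : F 3%N, r' \in q_rel O /\ p u = ocast (size (cols (std_list T u))) r'.
  have pau : perm_eq (tag (a u)) (std_list T u) by apply: (labeledP _ _ la).
  have sau : size (tag (a u)) = 3%N by rewrite (perm_size pau) -cardE.
  have [s hs] := perm_eq_permutes pau sau.
  exists (oact s r); split; first exact: q_rel_stable.
  rewrite /p -[a u]vdec_eta (reord_permutes _ (enum_uniq _) hs).
  change (ocast (size (cols (std_list T u))) (oact s (ocast 3 (mval (a u)))) =
          ocast (size (cols (std_list T u))) (oact s r)).
  by rewrite au ocastK // size_map.
have [rlam [rl rE]] := R_rot3 O' r'R.
pose cf v := sval (cid (gen_span (ocast 2 (p v : F (size (cols (std_list T v))))))).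
have cfE v : ocast 2 (p v : F (size (cols (std_list T v)))) = \sum_i cf v i *: g i.
  by rewrite /cf; case: cid.
pose lam v (q : mono G (cols (std_list T v)) v.2) : k^o :=
  if v == u then rlam (ocast 3 (q : G (size (cols (std_list T v)))))
  else \sum_i cf v i * dcoord i (ocast 2 (q : G (size (cols (std_list T v))))).
have lam_lin v : linear (@lam v).
  rewrite /lam; case: eqP => _; first by move=> c x y; rewrite ocast_linear rl.
  apply: sum_linear => i _ c x y; rewrite ocast_linear dcoord_linear.
  by rewrite -[_ *: dcoord _ _]/(_ * _) -[_ *: (_ * _)]/(_ * _); ring.
(* the orientation for which [tern_form] is evaluated *)
pose w0 := tern_order (@std_lu X) T.
have pw0 : perm_eq w0 (enum (nonroot T)) := tern_order_perm (@std_luP X) tT dT.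
pose eta := elem_cochain tt T w0 lam.
have ceta : cochain tt eta by apply: elem_cochain_cochain => // v _; apply: lam_lin.
exists eta; split=> //; first by rewrite -dT; apply: elem_homogeneous.
rewrite (natsum_d (@op_sign_dual_quadratic k O O') (@std_luP X) ceta).
rewrite (bigD1 T) /=; last by rewrite tT dT eqxx.
rewrite [X in _ + X]big1 ?addr0; last first.
  move=> T' /andP[/andP[tT' /eqP dT'] TT'].
  rewrite -[RHS](@gsum_zero k _ m (mono F) (mono G) X (mono_gen g) (mono_gen g') (mono F X tt) (std_list T')
     (rest T') (fun _ _ => 0) d0 d0') //.
  apply: gsum_eq => [|c d hg _]; first by rewrite rem_uniq // enum_uniq.
  have -> : rot3 g g' (tern_form (@std_lu X) eta T' d) = 0.
    by rewrite /rot3; do 3!(apply: big1 => ? _); rewrite /tern_form /eta elem_cochain_out // scale0r.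
  have lab : labeled T' (dfwith c (mop (tern T') (std_lu T') (0 : F 3%N))).
    by apply: (tern_labeled (@std_luP X) tT' dT') => v /hg[i [-> _]].
  have [uV' _ _] := ternP tT' dT'.
  exact: lin0 (mono_tree_linear tT' uV' lab).
have rest_uniq : uniq (rest T) by rewrite rem_uniq // enum_uniq.
have mem_rest v : (v \in rest T) = (v != u) && (v \in vertices T).
  by rewrite mem_rem_uniq ?enum_uniq // inE mem_enum Eu.
have prest : perm_eq (enum (vertices T)) (u :: rest T).
  by rewrite /rest Eu perm_to_rem // mem_enum.
pose kp (v : edge) (d : vdec (mono G) v) : k := if v \in rest T then lam v (reord (std_list T v) d) else 0.
pose cf' v i := if v \in rest T then cf v i else 0.
have kpE v i : kp v (gdec (mono_gen g') v (std_list T v) i) = cf' v i.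
  rewrite /kp /cf'; case: ifP => //; rewrite mem_rest => /andP[vu vV].
  rewrite /gdec reord_id ?enum_uniq // /lam (negbTE vu).
  rewrite (bigD1 i) //= big1 ?addr0 => [|j ji].
    by rewrite ocastK ?sv // dcoord_gen eqxx mulr1.
  by rewrite ocastK ?sv // dcoord_gen (negbTE ji) mulr0.
pose H (c : decoration (mono F) X) : mono F X tt := tree_comp tt T (dfwith c (mop u (std_list T u) r')).
have labH n (c : decoration (mono F) X) (q : F n) :
    (forall v, v \in rest T -> tag (c v) = std_list T v) -> labeled T (dfwith c (mop u (std_list T u) q)).
  by move=> tc; have := tern_labeled (@std_luP X) tT dT q tc; rewrite /std_lu Eu.
have step c d : gen_dec (mono_gen g) (mono_gen g') (std_list T) (rest T) c d ->
    tree_comp tt T (dfwith c (mop (tern T) (std_lu T) (rot3 g g' (tern_form (@std_lu X) eta T d)))) =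
    (\prod_(v <- rest T) kp v (d v)) *: H c.
  move=> hg.
  have tf q : tern_form (@std_lu X) eta T d q = (\prod_(v <- rest T) kp v (d v)) * rlam q.
    rewrite /tern_form /std_lu Eu.
    pose d1 : decoration (mono G) X := dfwith d (mop u (std_list T u) q).
    pose pb v : mono G (cols (std_list T v)) v.2 := reord (std_list T v) (d1 v).
    have hpb v : v \in vertices T -> d1 v = vdec_op (pb v).
      move=> vV; rewrite /pb /d1; have [<-|uv] := eqVneq u v.
        by rewrite dfwith_in /mop reord_id // enum_uniq.
      have vr : v \in rest T by rewrite mem_rest eq_sym uv.
      have [i [_ E]] := hg v vr.
      by rewrite dfwith_out // E /gdec reord_id // enum_uniq.
    rewrite [eta _ _ _](@elem_cochain_in _ _ (mono G) X tt T _ (std_list T) lam tT pw0 (fun v _ => perm_refl _) d1 pb hpb).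
    rewrite -big_enum (perm_big _ prest) /= big_cons mulrC; congr (_ * _).
      apply: eq_big_seq => v vr; rewrite /kp vr /pb /d1 dfwith_out //.
      by move: vr; rewrite mem_rest eq_sym => /andP[].
    rewrite /lam eqxx /pb /d1 dfwith_in /mop reord_id ?enum_uniq //.
    by rewrite ocastK // su.
  have -> : rot3 g g' (tern_form (@std_lu X) eta T d) = (\prod_(v <- rest T) kp v (d v)) *: r'.
    rewrite -rE /rot3 scaler_sumr; apply: eq_bigr => x _; rewrite scaler_sumr; apply: eq_bigr => i _.
    by rewrite scaler_sumr; apply: eq_bigr => j _; rewrite tf scalerA.
  have lab : labeled T (dfwith c (mop u (std_list T u) (0 : F 3%N))).
    by apply: labH => v /hg[i [-> _]].
  by rewrite /std_lu Eu (linZ _ _ (mono_tree_linear tT uV lab)).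
rewrite (gsum_eq (H := fun c d => (\prod_(v <- rest T) kp v (d v)) *: H c)) //; last by move=> c d hg _; apply: step.
have mfT := tree_comp_mform (mono F) tT.
rewrite (@gsum_expand k _ m (mono F) (mono G) X (mono_gen g) (mono_gen g') (std_list T) cf' kp kpE
   (mono F X tt) H (rest T) d0 d0' rest_uniq); last first.
  move=> v c vr tc oc x y z; rewrite /H.
  have vu : v != u by move: vr; rewrite mem_rest => /andP[].
  rewrite !(dfwithC _ _ _ vu).
  have vV : v \in vertices T by move: vr; rewrite mem_rest => /andP[].
  apply: (mf_linear mfT) => //; rewrite -dfwithC //.
  apply: labH => w wr; have [<-|vw] := eqVneq v w; first by rewrite dfwith_in.
  by rewrite dfwith_out // tc.
apply: etrans (esym (mf_relab mfT la rp)); rewrite /H; apply/esym; apply: (mf_agree mfT).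
  exact: relabeling_labeled rp la.
move=> v vV; have [<-|uv] := eqVneq u v; first by rewrite dfwith_in /mop -pu.
have vr : v \in rest T by rewrite mem_rest eq_sym uv.
rewrite dfwith_out // /patch vr /comb_dec; congr vdec_op.
have sv2 : size (cols (std_list T v)) = 2%N by apply: sv => //; rewrite eq_sym.
rewrite -[LHS](ocastK (n := 2)) // cfE (lin_sum _ _ _ (@ocast_linear _ _ _ _)).
by apply: eq_bigr => i _; rewrite (linZ _ _ (@ocast_linear _ _ _ _)) /cf' vr.
Qed.

Lemma natsum_linear : linear (@natsum k F G m g g' X : precochain (mono G) X -> mono F X tt).
Proof.
move=> c d1 d2; rewrite /natsum scaler_sumr -big_split.
apply: eq_bigr => T _ /=; rewrite /tree_sum -gsum_scale.
have := @gsum_sum k m _ (mono F) (mono G) X (mono_gen g) (mono_gen g') (mono F X tt) (std_list T)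
   (enum (vertices T)) bool [:: true; false] predT (fun b x y =>
     if b then c *: term tt d1 T (flatten (map (std_list T) (enum (vertices T)))) x y
     else term tt d2 T (flatten (map (std_list T) (enum (vertices T)))) x y) d0 d0'.
rewrite !big_cons big_nil /= addr0 => <-; apply: gsum_eq => [|x y _ _]; first exact: enum_uniq.
rewrite !big_cons big_nil /= addr0 /term.
rewrite [(c *: d1 + d2) _ _ _]/(c * d1 _ _ _ + d2 _ _ _).
by rewrite [LHS]scalerDl scalerA.
Qed.

Definition in_coboundary (f : F (size X)) := exists eta,
  [/\ cochain tt eta, homogeneous (-1) eta & natsum g g' (cobar_d tt eta) = f].

Lemma in_coboundary_lin c f f' : in_coboundary f -> in_coboundary f' -> in_coboundary (c *: f + f').
Proof.
move=> [e1 [c1 h1 E1]] [e2 [c2 h2 E2]].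
have [_ lin _ dlin _] := cobar_is_complex (mono G) X tt (-1).
have [cc hh] := lin c e1 e2 (conj c1 h1) (conj c2 h2).
exists (c *: e1 + e2); split=> //.
have dl : cobar_d tt (c *: e1 + e2) = c *: cobar_d tt e1 + cobar_d tt e2 :=
  dlin c e1 e2 (conj c1 h1) (conj c2 h2).
by rewrite dl natsum_linear E1 E2.
Qed.

Lemma in_coboundary0 : in_coboundary 0.
Proof.
have [[c0 h0] _ _ _ _] := cobar_is_complex (mono G) X tt (-1).
exists 0; split=> //; apply: big1 => T _; apply: gsum_zero => a b.
rewrite /term /cobar_d; case: ifP => _; last by rewrite scale0r.
rewrite big1 ?scale0r // => e _; exact: mulr0.
Qed.

End Ternary.

(** * Grafting a corolla on a leaf *)

Section Preimage.
Variables (I J : finType) (pi : J -> I).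
Hypothesis pi_surj : forall i, exists j, pi j = i.
Implicit Types A B : {set I}.

Lemma pre_subset A B : (pi @^-1: A \subset pi @^-1: B) = (A \subset B).
Proof.
apply/idP/idP => [/subsetP h|]; last exact: preimsetS.
apply/subsetP => i iA; have [j ji] := pi_surj i.
by have := h j; rewrite !inE ji; apply.
Qed.

Lemma pre_proper A B : (pi @^-1: A \proper pi @^-1: B) = (A \proper B).
Proof. by rewrite !properE !pre_subset. Qed.

Lemma pre_inj A B : pi @^-1: A = pi @^-1: B -> A = B.
Proof. by move=> h; apply/eqP; rewrite eqEsubset -!pre_subset h subxx. Qed.

Lemma pre_disjoint A B : [disjoint A & B] -> [disjoint pi @^-1: A & pi @^-1: B].
Proof. by move=> /pred0P h; apply/pred0P => j /=; rewrite !inE; apply: h. Qed.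

Lemma pre_card A : (#|A| <= #|pi @^-1: A|)%N.
Proof.
rewrite -(card_imset (mem A) (f := fun i => sval (cid (pi_surj i)))).
  apply: subset_leq_card; apply/subsetP => j /imsetP[i iA ->].
  by rewrite inE; case: (cid _) => j' /= ->.
move=> i i' h; have E i1 : pi (sval (cid (pi_surj i1))) = i1 by case: (cid _).
by rewrite -[i]E h E.
Qed.

End Preimage.

(** [pi] sends a leaf of the bigger tree to the leaf of [T] above which it
    lies, so that the edges of [T] become preimages under [pi]; the edge of
    the leaf [i0] becomes the new vertex [B]. *)
Section Graft.
Variables (X Z : seq unit) (i0 : 'I_(size X)) (pi : 'I_(size Z) -> 'I_(size X)).
Local Notation edge := (edge X).
Local Notation edgeZ := (Defs.edge Z).
Implicit Types (T : {set edge}).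
Hypothesis pi_surj : forall i, exists j, pi j = i.

Definition graft_edge (e : edge) : edgeZ := (pi @^-1: e.1, tt).
Local Notation theta := graft_edge.
Let B := theta (leaf_edge i0).
Variable lB : seq edgeZ.

Hypothesis X1 : (1 < size X)%N.
Hypothesis B1 : (1 < #|B.1|)%N.
Hypothesis mem_lB : forall j, (leaf_edge j \in lB) = (pi j == i0).
Hypothesis lB_leaf : forall e, e \in lB -> exists j, e = leaf_edge j.
Hypothesis uniq_lB : uniq lB.
Hypothesis theta_leaf : forall i, i != i0 -> exists j, theta (leaf_edge i) = leaf_edge j.

Definition graft_tree T : {set edgeZ} := theta @: T :|: [set leaf_edge j | j in 'I_(size Z)].

Lemma graft_edge_inj : injective theta.
Proof. by move=> [A []] [A' []] [/(pre_inj pi_surj) ->]. Qed.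

Lemma in_B j : (j \in B.1) = (pi j == i0).
Proof. by rewrite !inE. Qed.

Lemma leaf_cases (e : edgeZ) T : e \in graft_tree T ->
  (exists2 f, f \in T & e = theta f) \/ (exists j, e = leaf_edge j).
Proof. by case/setUP=> /imsetP[f fT ->]; [left; exists f|right; exists f]. Qed.

Lemma theta_in T f : f \in T -> theta f \in graft_tree T.
Proof. by move=> fT; rewrite in_setU imset_f. Qed.

Lemma leafZ_in T j : leaf_edge j \in graft_tree T.
Proof. by rewrite in_setU; apply/orP; right; apply/imsetP; exists j. Qed.

Lemma proper_leaf (e : edgeZ) j : e.1 \proper (leaf_edge j).1 -> e.1 = set0.
Proof. by move=> h; apply/eqP; move: h; rewrite properEcard cards1 ltnS leqn0 cards_eq0 => /andP[]. Qed.

Section OneTree.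
Variable T : {set edge}.
Hypothesis tT : is_tree tt T.

Lemma theta_neq0 f : f \in T -> (theta f).1 != set0.
Proof.
move=> /(tree_neq0 tT)[i ifi]; have [j ji] := pi_surj i.
by apply/set0Pn; exists j; rewrite inE ji.
Qed.

Lemma theta_root : theta (root_edge X tt) = root_edge Z tt.
Proof. by rewrite /theta /= preimsetT. Qed.

Lemma graft_is_tree : is_tree tt (graft_tree T).
Proof.
apply/and4P; split.
- by rewrite -theta_root; exact: (theta_in (root_in tT)).
- by apply/forallP => j; apply: leafZ_in.
- apply/forall_inP => e /leaf_cases[[f fT ->]|[j ->]]; first exact: theta_neq0.
  by apply/set0Pn; exists j; rewrite inE.
apply/forall_inP => e he; apply/forall_inP => f hf; apply/or4P.
have L j (h : edgeZ) : [\/ leaf_edge j == h, (leaf_edge j).1 \proper h.1 | [disjoint (leaf_edge j).1 & h.1]].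
  have [jh|jh] := boolP (j \in h.1); last by constructor 3; rewrite disjoints1.
  have [h1|h1] := eqVneq h.1 [set j].
    by constructor 1; apply/eqP; case: h h1 {jh} => A u /= ->; rewrite /leaf_edge; case: u (tnth _ _) => -[].
  by constructor 2; rewrite properEneq sub1set jh andbT eq_sym.
case: (leaf_cases he) => [[f0 f0T ->]|[j ->]]; last first.
  by case: (L j f) => h; [constructor 1|constructor 2|constructor 4].
case: (leaf_cases hf) => [[g0 g0T ->]|[j ->]]; last first.
  case: (L j (theta f0)) => h; [constructor 1|constructor 3|constructor 4] => //.
    by rewrite eq_sym.
  by rewrite disjoint_sym.
have [->|ne] := eqVneq f0 g0; first by constructor 1.
have [s1|s1] := boolP (f0.1 \subset g0.1).
  constructor 2; rewrite pre_proper // properEneq s1 andbT.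
  by apply: contraNneq ne => h; apply/eqP; apply: (tree_inj tT).
have [s2|s2] := boolP (g0.1 \subset f0.1).
  constructor 3; rewrite pre_proper // properEneq s2 andbT.
  by apply: contraNneq ne => h; apply/eqP; apply: (tree_inj tT).
by constructor 4; apply: pre_disjoint; apply: (tree_disjoint tT).
Qed.

Lemma graft_vertices : vertices (graft_tree T) = B |: theta @: vertices T.
Proof.
apply/setP => e; rewrite in_vertices; apply/andP/setU1P.
  case=> /leaf_cases[[f fT ->]|[j ->]]; last by rewrite cards1.
  have [f1|/negbTE f1] := boolP (1 < #|f.1|)%N.
    by right; rewrite imset_f // in_vertices fT.
  have [i Ei] := leafP tT fT f1; subst f; have [->|ii] := eqVneq i i0; first by left.
  by have [j ->] := theta_leaf ii; rewrite cards1.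
case=> [->|/imsetP[f]]; first by split=> //; exact: (theta_in (leaf_in tT i0)).
rewrite in_vertices => /andP[fT f1] ->; split; first exact: theta_in.
exact: leq_trans f1 (pre_card pi_surj _).
Qed.

Lemma B_notin : B \notin theta @: vertices T.
Proof.
apply/imsetP => -[f]; rewrite in_vertices => /andP[_ f1] /graft_edge_inj h.
by move: f1; rewrite -h cards1.
Qed.

Lemma graft_internal : internal (graft_tree T) = B |: theta @: internal T.
Proof.
apply/setP => e; rewrite inE graft_vertices in_nonroot; apply/andP/setU1P.
  case=> /setU1P[->|/imsetP[f fV ->]]; first by left.
  case/andP=> _ fT; right; rewrite imset_f // inE fV in_nonroot (vertex_in fV) /=.
  by apply: contra fT => /eqP h; rewrite /= h preimsetT.
have np f : f \in T -> f.1 != setT -> (theta f).1 != setT.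
  move=> fT; apply: contra => /eqP h; apply/eqP; apply: (pre_inj pi_surj).
  by rewrite [LHS]h preimsetT.
case=> [->|/imsetP[f fI ->]].
  split; first exact: setU11.
  rewrite (theta_in (leaf_in tT i0)) /=; exact: (np _ (leaf_in tT i0) (leaf_neqT X1 i0)).
split; first by rewrite in_setU1 imset_f ?orbT // internal_vertex.
rewrite (theta_in (internal_in fI)) /=; apply: (np _ (internal_in fI)).
by move: fI; rewrite in_internal => /and3P[].
Qed.

(** No new edge separates an input of [v] from [v], as the new leaves lie
    above [B]. *)
Lemma graft_inputs v : v \in vertices T -> inputs (graft_tree T) (theta v) = theta @: inputs T v.
Proof.
move=> vV; have vT := vertex_in vV; apply/setP => e; apply/inputsP/imsetP.
  case=> /leaf_cases[[f fT ->]|[j ->]] ev h.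
    exists f => //; apply/inputsP; split=> //; first by rewrite -(pre_proper pi_surj).
    move=> g' gT fg gv; apply: (h (theta g')); first exact: theta_in.
      by rewrite pre_proper.
    by rewrite pre_proper.
  have [ji|ji] := eqVneq (pi j) i0.
    have jB : (leaf_edge j).1 \proper B.1 by rewrite properEcard sub1set in_B ji eqxx cards1.
    have iv : i0 \in v.1.
      by have := subsetP (proper_sub ev) j; rewrite !inE eqxx ji => /(_ isT).
    case: (h B (theta_in (leaf_in tT i0)) jB).
    rewrite pre_proper // properEcard sub1set iv cards1.
    by move: vV; rewrite in_vertices => /andP[].
  have [j' Ej'] := theta_leaf ji; have : j \in (theta (leaf_edge (pi j))).1 by rewrite !inE.
  rewrite Ej' inE => /eqP jj; subst j'; exists (leaf_edge (pi j)) => //.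
  apply/inputsP; split; first exact: (leaf_in tT).
    rewrite -(pre_proper pi_surj).
    have -> : pi @^-1: (leaf_edge (pi j)).1 = (leaf_edge j).1 by rewrite -Ej'.
    exact: ev.
  move=> g' gT fg gv; apply: (h (theta g')); first exact: theta_in.
    rewrite -Ej'; by rewrite /= pre_proper.
  by rewrite /= pre_proper.
case=> f /inputsP[fT fv h] ->; split; [exact: theta_in|by rewrite pre_proper|].
move=> g' /leaf_cases[[g0 g0T ->]|[j ->]] fg gv.
  by rewrite !pre_proper // in fg gv; apply: (h g0).
by have := theta_neq0 fT; rewrite (proper_leaf fg) eqxx.
Qed.

Lemma graft_inputs_B : perm_eq lB (enum (inputs (graft_tree T) B)).
Proof.
apply: uniq_perm; rewrite ?enum_uniq // => e; rewrite mem_enum; apply/idP/inputsP.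
  move=> he; have [j Ej] := lB_leaf he; subst e; rewrite mem_lB in he.
  split; first exact: leafZ_in.
    by rewrite properEcard sub1set in_B he cards1.
  move=> f /leaf_cases[[g0 g0T ->]|[j' ->]] jf fB.
    rewrite pre_proper // in fB; have := tree_neq0 tT g0T => -[i].
    by move: fB; rewrite properEcard cards1 ltnS leqn0 cards_eq0 => /andP[_ /eqP ->]; rewrite inE.
  by have := proper_leaf jf => /setP/(_ j); rewrite !inE eqxx.
case=> /leaf_cases[[g0 g0T ->]|[j ->]] eB h.
  rewrite pre_proper // in eB; have [i] := tree_neq0 tT g0T.
  by move: eB; rewrite properEcard cards1 ltnS leqn0 cards_eq0 => /andP[_ /eqP ->]; rewrite inE.
by rewrite mem_lB -in_B; move/proper_sub: eB; rewrite sub1set.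
Qed.

Lemma graft_erase e : e \in internal T -> graft_tree T :\ theta e = graft_tree (T :\ e).
Proof.
rewrite in_internal => /and3P[eT e1 _].
apply/setP => f; rewrite in_setD1 !in_setU.
have nl j : leaf_edge j != theta e.
  apply/eqP => h; have := pre_card pi_surj e.1.
  by rewrite -[pi @^-1: _]/((theta e).1) -h cards1 leqNgt e1.
have [->|fe] /= := eqVneq f (theta e).
  apply/esym/norP; split.
    by apply/imsetP => -[g0 /setD1P[ge _]] /graft_edge_inj h; rewrite h eqxx in ge.
  by apply/imsetP => -[j _ h]; have := nl j; rewrite h eqxx.
congr (_ || _); apply/imsetP/imsetP => -[g0 hg E].
  by exists g0 => //; apply/setD1P; split=> //; apply: contraNneq fe => h; rewrite E h.
by exists g0 => //; case/setD1P: hg.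
Qed.

End OneTree.

Variables (k : fieldType) (F : operad k) (q : nat) (c : F q) (s : 'S_(size Z)).
Hypothesis sz_lB : size lB = q.
Hypothesis hs : permutes s (splice (map theta (leaf_edges X)) i0 lB) (leaf_edges Z).
Local Notation im v1 v2 d1 d2 := (@image_dec k F F (fun n (a : F n) => a) unit (@mono_adm)
   mono_adm1 (fun _ _ _ _ _ _ => erefl) (fun _ _ _ _ _ _ _ _ _ => erefl) X Z theta v1 v2 d1 d2).

Lemma graft_labeled T (a : decoration (mono F) X) (b : decoration (mono F) Z) :
  is_tree tt T -> labeled T a -> (forall v, v \in vertices T -> im v (theta v) (a v) (b (theta v))) ->
  b B = mop B lB c -> labeled (graft_tree T) b.
Proof.
move=> tT la hb hB; apply/labeledP => w; rewrite (graft_vertices tT) => /setU1P[->|/imsetP[v vV ->]].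
  by rewrite hB; apply: graft_inputs_B.
have [tb _ _] := hb v vV; rewrite tb graft_inputs //.
apply: uniq_perm; rewrite ?enum_uniq ?(map_inj_uniq graft_edge_inj) ?(labeled_uniq la) // => e.
rewrite mem_enum; apply/mapP/imsetP => -[f hf ->]; exists f => //.
  by rewrite -(labeled_mem _ la).
by rewrite (labeled_mem _ la).
Qed.

(** Contracting the edges of [T] first reduces the claim to the graft of a
    corolla on a corolla, whose only internal edge is [B]. *)
Lemma graft_comp T (a : decoration (mono F) X) (b : decoration (mono F) Z) :
  is_tree tt T -> labeled T a -> (forall v, v \in vertices T -> im v (theta v) (a v) (b (theta v))) ->
  b B = mop B lB c ->
  (tree_comp tt (graft_tree T) b : F (size Z)) =
  oact s (ocomp (size Z) i0 (tree_comp tt T a : F (size X)) c).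
Proof.
move=> tT; move: T tT a b; apply: tree_ind => [T tT iT|T e tT eI IH] a b la hb hB; last first.
  have tG := graft_is_tree tT; have lG := graft_labeled tT la hb hB.
  have eG : theta e \in internal (graft_tree T).
    by rewrite graft_internal // in_setU1 imset_f ?orbT.
  rewrite (tree_comp_contract tG lG eG) (tree_comp_contract tT la eI) graft_erase //.
  apply: IH; first exact: (contract_labeled tT eI la).
    move=> v; rewrite vertices_erase => /setD1P[ve vV].
    apply: image_contract; [exact: opmap_id|exact: graft_edge_inj|exact: hb|].
    by apply: hb; apply: internal_vertex.
  rewrite contract_out // hB /=; apply/negP => /lB_leaf[j h].
  have := pre_card pi_surj e.1; rewrite -[pi @^-1: _]/((theta e).1) h cards1 leqNgt.
  by move: eI; rewrite in_internal => /and3P[_ -> _].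
have tG := graft_is_tree tT; have lG := graft_labeled tT la hb hB.
have rV : root_edge X tt \in vertices T by apply: root_vertex.
have BI : B \in internal (graft_tree T) by rewrite graft_internal // setU11.
have Z1 := size_gt1 BI.
have tC := tree_erase tG BI.
have iC : internal (graft_tree T :\ B) = set0.
  by rewrite internal_erase graft_internal // iT imset0 setU0 setDv.
have [tr _ cr] := hb _ rV; rewrite theta_root in tr cr.
have [t ht] := corolla_perm tT iT X1 la.
set l := tag (a (root_edge X tt)) in tr cr ht *.
have il : leaf_edge i0 \in l.
  by rewrite (perm_mem (permutes_perm_eq ht)) map_f // mem_enum.
have Bl : B \in map theta l by rewrite map_f.
have ul : uniq l by rewrite (perm_uniq (permutes_perm_eq ht)) leaf_edges_uniq.
have dis : [disjoint map theta l & lB].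
  apply/pred0P => f /=; apply/negP => /andP[/mapP[e el ->] hf]; have [j E] := lB_leaf hf.
  have [i Ei] : exists i, e = leaf_edge i.
    by move: el; rewrite (perm_mem (permutes_perm_eq ht)) => /mapP[i _ ->]; exists i.
  subst e; move: hf; rewrite E mem_lB => /eqP pj.
  have : j \in (theta (leaf_edge i)).1 by rewrite E inE.
  rewrite !inE pj => /eqP ii; move: B1; rewrite /B ii E cards1; by [].
set L := tag (b (root_edge Z tt)) in tr cr.
have sX : size l = size X by have /permutesP[] := ht.
have BL : B \in L by rewrite tr.
have Ec : contract B b (root_edge Z tt) = vdec_op (ccomp (cols (splice L (index B L) lB)) (index B L)
    (tagged (b (root_edge Z tt))) (ocast (size (cols lB)) c : mono F (cols lB) B.2)).
  by apply: contract_op; rewrite ?vdec_eta.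
have ht' : permutes t L (map theta (leaf_edges X)) by rewrite tr; apply: permutes_map.
have uX : uniq (map theta (leaf_edges X)) by rewrite map_inj_uniq ?leaf_edges_uniq //; apply: graft_edge_inj.
have iX : index B (map theta (leaf_edges X)) = i0.
  rewrite index_map; last exact: graft_edge_inj.
  by rewrite /leaf_edges index_map ?index_enum_ord //; apply: leaf_edge_inj.
have uL : uniq L by rewrite (perm_uniq (permutes_perm_eq ht')).
have dL : [disjoint L & lB] by rewrite tr.
have lti : (index B L < size X)%N by rewrite -sX -(size_map theta) -tr index_mem.
pose i := Ordinal lti.
have pw : perm_eq (splice L (index B L) lB) (splice (map theta (leaf_edges X)) i0 lB).
  rewrite -iX; apply: (perm_trans (splice_rem _ BL)).
  have BX : B \in map theta (leaf_edges X) by rewrite -(perm_mem (permutes_perm_eq ht')).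
  rewrite perm_sym; apply: (perm_trans (splice_rem _ BX)); rewrite perm_cat2r perm_sym.
  rewrite -(perm_cons B); apply: (perm_trans _ (perm_to_rem BX)); rewrite perm_sym.
  by apply: perm_trans (perm_to_rem BL); rewrite perm_sym (permutes_perm_eq ht').
have sw : size (splice L (index B L) lB) = size Z.
  by rewrite (perm_size pw); have /permutesP[] := hs.
have [w hw] := perm_eq_permutes pw sw.
have [bp ti] : block_perm i t (1%g : 'S_q) w /\ t i = index B (map theta (leaf_edges X)) :> nat.
  apply: (@block_perm_splice _ B L _ lB lB) => //; first exact: permutes1.
  by rewrite iX.
rewrite iX in ti.
have [_ sZ] := size_grafts (grafts_splice lB BL).
rewrite !size_map sw sz_lB tr size_map sX in sZ.
rewrite (tree_comp_contract tG lG BI) (@tree_comp_corolla _ _ _ _ _ _ iC Z1 _ (w * s)%g); last first.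
  by rewrite Ec; apply: permutesM hw hs.
rewrite (tree_comp_corolla iT X1 ht) Ec /= /col_act /= /col_comp /=.
set A := tagged (a _); set D := tagged (b _); rewrite ocast_id.
rewrite ocast_id (ocast_ocomp (p' := size Z)); last by rewrite size_map.
rewrite ocomp_castr; last by rewrite size_map sz_lB.
rewrite oactM; congr (oact s _); rewrite -ti.
have := @ocomp_act k F _ _ _ i t 1%g w (ocast (size X) A) c sZ bp; rewrite oact1 => ->.
congr (oact w _); rewrite ocomp_castl; last by rewrite size_map.
move: cr => /= ; rewrite -/D => ->; rewrite ocomp_castl //.
by rewrite !size_map [tag _]tr size_map.
Qed.

End Graft.

Section GraftExists.
Variables (k : fieldType) (F : operad k) (X Z : seq unit) (i0 : 'I_(size X)).
Variables (q : nat) (c : F q) (s : 'S_(size Z)).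
Hypotheses (X1 : (1 < size X)%N) (q1 : (1 < q)%N) (sZ : (size Z).+1 = (size X + q)%N).
Local Notation edgeX := (edge X).
Local Notation edgeZ := (edge Z).

Definition contr_nat (l : nat) : nat :=
  if (l < i0)%N then l else if (l < i0 + q)%N then i0 : nat else (l.+1 - q)%N.

Fact contr_bound (l : 'I_(size Z)) : (contr_nat l < size X)%N.
Proof. by rewrite /contr_nat; have := ltn_ord l; have := ltn_ord i0; case: ifP => ?; [|case: ifP => ?]; lia. Qed.

(** The input of the outer operation above which an input of the composite
    lies *)
Definition contr l : 'I_(size X) := Ordinal (contr_bound l).

Fact outer_bound (i : 'I_(size X)) : (outer_pos i0 q i < size Z)%N.
Proof. by rewrite /outer_pos; have := ltn_ord i; have := ltn_ord i0; case: ifP => ?; lia. Qed.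
Definition outer i : 'I_(size Z) := Ordinal (outer_bound i).

Lemma contr_outer i l : i != i0 -> (contr l == i) = (l == outer i).
Proof.
rewrite -!val_eqE /= /contr_nat /outer_pos => ii.
by case: ifP => ?; case: ifP => ?; try case: ifP => ?; apply/eqP/eqP; move: ii; lia.
Qed.

Lemma contr_in l : (contr l == i0) = (i0 <= l < i0 + q)%N.
Proof. by rewrite -val_eqE /= /contr_nat; case: ifP => ?; try case: ifP => ?; lia. Qed.

Definition graft_pi (j : 'I_(size Z)) : 'I_(size X) := contr (s^-1%g j).
Local Notation pi := graft_pi.
(** The leaves, in the order in which they are the inputs of the composite
    before [s] acts *)
Definition graft_list : seq edgeZ := [seq leaf_edge (s l) | l <- enum 'I_(size Z)].
Local Notation L := graft_list.
Definition graft_top : seq edgeZ := take q (drop i0 L).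
Local Notation lB := graft_top.
Local Notation theta := (@graft_edge X Z pi).

Fact top_bound : (i0 < size Z)%N.
Proof. by have := ltn_ord i0; lia. Qed.

Lemma graft_pi_surj i : exists j, pi j = i.
Proof.
have [->|ii] := eqVneq i i0.
  exists (s (Ordinal top_bound)); apply/eqP; rewrite /pi permK contr_in /=; lia.
by exists (s (outer i)); apply/eqP; rewrite /pi permK contr_outer.
Qed.

Lemma leaf_edge_perm_inj : injective (fun l => @leaf_edge _ Z (s l)).
Proof. by move=> l l' /leaf_edge_inj /perm_inj. Qed.

Lemma graft_topE : lB = [seq leaf_edge (s l) | l <- take q (drop i0 (enum 'I_(size Z)))].
Proof. by rewrite /lB /L -map_drop -map_take. Qed.

Lemma mem_top_ord l : (l \in take q (drop i0 (enum 'I_(size Z)))) = (contr l == i0).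
Proof.
rewrite contr_in -(mem_map val_inj) map_take map_drop val_enum_ord drop_iota take_iota mem_iota.
have := ltn_ord i0; have := ltn_ord l; rewrite add0n /minn /=.
move: (nat_of_ord l) (nat_of_ord i0) => l' i'; case: ifP; lia.
Qed.

Lemma size_graft_top : size lB = q.
Proof. by rewrite /lB size_take size_drop size_map size_enum_ord; have := ltn_ord i0; case: ifP => ?; lia. Qed.

Lemma mem_graft_top j : (leaf_edge j \in lB) = (pi j == i0).
Proof.
by rewrite graft_topE -[j](permKV s) (mem_map leaf_edge_perm_inj) mem_top_ord /pi permK.
Qed.

Lemma graft_top_leaf e : e \in lB -> exists j, e = leaf_edge j.
Proof. by rewrite graft_topE => /mapP[l _ ->]; exists (s l). Qed.

Lemma graft_top_uniq : uniq lB.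
Proof.
by rewrite graft_topE (map_inj_uniq leaf_edge_perm_inj) take_uniq // drop_uniq // enum_uniq.
Qed.

Lemma unit_edge (A : {set 'I_(size Z)}) j : A = [set j] -> (A, tt) = leaf_edge j :> edgeZ.
Proof. by move=> ->; rewrite /leaf_edge; case: (tnth _ _). Qed.

Lemma graft_theta_leaf i : i != i0 -> theta (leaf_edge i) = leaf_edge (s (outer i)).
Proof.
move=> ii; apply: unit_edge; apply/setP => j; rewrite !inE /pi contr_outer //.
by apply/eqP/eqP => [<-|->]; rewrite ?permKV ?permK.
Qed.

Lemma nth_graft_list e0 (l : 'I_(size Z)) : nth e0 L l = leaf_edge (s l).
Proof. by rewrite (nth_map l) ?size_enum_ord // nth_ord_enum. Qed.

Lemma graft_list_permutes : permutes s L (leaf_edges Z).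
Proof.
apply: permutesE; [by rewrite size_map size_enum_ord|exact: size_leaf_edges|].
by move=> e0 i; rewrite nth_graft_list nth_leaf_edges.
Qed.

Lemma graft_splice : splice (map theta (leaf_edges X)) i0 lB = L.
Proof.
have li0 := ltn_ord i0; have sL : size L = size Z by rewrite size_map size_enum_ord.
have sX : size (map theta (leaf_edges X)) = size X by rewrite size_map size_leaf_edges.
rewrite /splice -[RHS](cat_take_drop i0) -[in RHS](cat_take_drop q (drop i0 L)) -/lB drop_drop.
have nthX e0 i (li : (i < size X)%N) : nth e0 (map theta (leaf_edges X)) i = theta (leaf_edge (Ordinal li)).
  by rewrite (nth_map (leaf_edge (Ordinal li))) ?size_leaf_edges // (nth_leaf_edges _ (Ordinal li)).
congr (_ ++ (_ ++ _)).
  have e0 := leaf_edge (s (Ordinal top_bound)).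
  have sT : size (take i0 (map theta (leaf_edges X))) = i0 by rewrite size_take sX li0.
  have sT' : size (take i0 L) = i0 by rewrite size_take sL top_bound.
  apply: (@eq_from_nth _ e0); rewrite sT ?sT' //.
  move=> i li; rewrite !nth_take // nthX; first lia.
  move=> lX; have lZ : (i < size Z)%N by lia.
  rewrite (nth_graft_list e0 (Ordinal lZ)) graft_theta_leaf; last by rewrite -val_eqE /=; lia.
  by congr (leaf_edge (s _)); apply: val_inj; rewrite /= /outer_pos li.
have e0 := leaf_edge (s (Ordinal top_bound)).
apply: (@eq_from_nth _ e0); first by rewrite !size_drop sL sX; lia.
move=> i; rewrite size_drop sX => li; rewrite !nth_drop nthX; first lia.
move=> lX; have lZ : (q + i0 + i < size Z)%N by lia.
rewrite (nth_graft_list e0 (Ordinal lZ)) graft_theta_leaf; last by rewrite -val_eqE /=; lia.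
by congr (leaf_edge (s _)); apply: val_inj; rewrite /= /outer_pos; case: ifP; lia.
Qed.

(** This turns partial compositions in the operad into decorated trees: the
    new vertex [B] carries [c], and the other ones are those of [T]. *)
Lemma graft_exists (T : {set edgeX}) (a : decoration (mono F) X) : is_tree tt T -> labeled T a ->
  exists (T' : {set edgeZ}) (b : decoration (mono F) Z) (th : edgeX -> edgeZ) (B : edgeZ),
  [/\ is_tree tt T', labeled T' b, vertices T' = B |: th @: vertices T,
      #|inputs T' B| = q /\ mval (b B) = ocast _ c
    & (forall v, v \in vertices T -> [/\ th v != B, #|inputs T' (th v)| = #|inputs T v|
          & mval (b (th v)) = ocast _ (mval (a v))]) /\ injective th] /\
    (tree_comp tt T' b : F (size Z)) =
      oact s (ocomp (size Z) i0 (tree_comp tt T a : F (size X)) c).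
Proof.
move=> tT la; pose B := theta (leaf_edge i0).
have B1 : (1 < #|B.1|)%N.
  have p0 : (i0 < size Z)%N := top_bound; have p1 : (i0.+1 < size Z)%N by have := ltn_ord i0; lia.
  have ne : Ordinal p0 != Ordinal p1 by rewrite -val_eqE /=; lia.
  have : [set s (Ordinal p0); s (Ordinal p1)] \subset B.1.
    by apply/subsetP => j; rewrite !inE => /orP[] /eqP ->; rewrite /pi permK contr_in /=; lia.
  by move/subset_leq_card; rewrite cards2 (inj_eq perm_inj) ne.
have th_inj := graft_edge_inj graft_pi_surj.
have tl i : i != i0 -> exists j, theta (leaf_edge i) = leaf_edge j.
  by move=> ii; exists (s (outer i)); apply: graft_theta_leaf.
pose b : decoration (mono F) Z := fun e => if e == B then mop e lB c else
  if [pick v in vertices T | theta v == e] is Some v then mop e (map theta (tag (a v))) (mval (a v))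
  else mop e [::] (0 : F 0%N).
have bB : b B = mop B lB c by rewrite /b eqxx.
have VB v : v \in vertices T -> theta v != B.
  by move=> vV; apply/eqP => h; have := B_notin i0 graft_pi_surj T; rewrite -/B -h imset_f.
have bv v : v \in vertices T -> b (theta v) = mop (theta v) (map theta (tag (a v))) (mval (a v)).
  move=> vV; rewrite /b (negbTE (VB v vV)); case: pickP => [w /andP[_ /eqP /th_inj ->] //|/(_ v)].
  by rewrite vV eqxx.
have tG := graft_is_tree graft_pi_surj tT.
have im v : v \in vertices T -> @image_dec k F F (fun n (a : F n) => a) unit (@mono_adm)
   (@mono_adm1) (fun _ _ _ _ _ _ => erefl) (fun _ _ _ _ _ _ _ _ _ => erefl) X Z theta v (theta v) (a v) (b (theta v)).
  by move=> vV; rewrite bv.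
have lG := graft_labeled graft_pi_surj B1 mem_graft_top graft_top_leaf graft_top_uniq tl tT la im bB.
exists (graft_tree pi T), b, theta, B; split; last first.
  apply: (graft_comp graft_pi_surj X1 B1 mem_graft_top graft_top_leaf graft_top_uniq tl size_graft_top) => //.
  by rewrite graft_splice graft_list_permutes.
split=> //.
- exact: (graft_vertices graft_pi_surj B1 tl tT).
- split; last by rewrite bB.
  by rewrite cardE -(perm_size (graft_inputs_B graft_pi_surj B1 mem_graft_top graft_top_leaf graft_top_uniq tT)) size_graft_top.
split=> // v vV; split; [exact: VB| |by rewrite bv].
by rewrite (graft_inputs graft_pi_surj B1 tl tT vV) card_imset.
Qed.
End GraftExists.

(** * Ideals and coboundaries *)

(** It is the permutation between two graftings of lists of distinct
    elements, by [block_perm_splice]. *)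
Lemma block_perm_exists m n p (i : 'I_m) (t : 'S_n) : p.+1 = (m + n)%N ->
  exists u : 'S_p, block_perm i 1%g t u.
Proof.
move=> Ep; pose A := ('I_m + 'I_n)%type.
(* the inputs of the two operations as the elements of a disjoint union *)
pose l : seq A := map inl (enum 'I_m); pose w : seq A := map inr (enum 'I_n).
pose w1 : seq A := map inr [seq t^-1%g y | y <- enum 'I_n].
have sl : size l = m by rewrite size_map size_enum_ord.
have sw : size w = n by rewrite size_map size_enum_ord.
have ul : uniq l by rewrite map_inj_uniq ?enum_uniq // => ? ? [].
have uw : uniq w by rewrite map_inj_uniq ?enum_uniq // => ? ? [].
have il : inl i \in l by rewrite map_f // mem_enum.
have ix : index (inl i : A) l = i by rewrite index_map ?index_enum_ord // => ? ? [].
have pt : permutes t w w1.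
  apply: permutesE => //; first by rewrite /w1 2!size_map size_enum_ord.
  move=> x0 j; rewrite /w1 /w -map_comp.
  have E (f : 'I_n -> A) (y : 'I_n) : nth x0 (map f (enum 'I_n)) y = f y.
    by rewrite (nth_map y) ?size_enum_ord // nth_ord_enum.
  by rewrite !E /= permK.
have dis : [disjoint l & w].
  by apply/pred0P => f /=; apply/negP => /andP[/mapP[x _ ->] /mapP[y _]].
have ps : perm_eq (splice l (index (inl i : A) l) w) (splice l (index (inl i : A) l) w1).
  apply: (perm_trans (splice_rem w il)); rewrite perm_sym; apply: (perm_trans (splice_rem w1 il)).
  by rewrite perm_cat2l perm_sym; apply: permutes_perm_eq pt.
have sz : size (splice l (index (inl i : A) l) w) = p.
  have lt : (i < size l)%N by rewrite sl.
  rewrite ix /splice !size_cat size_take size_drop lt sw sl; move: Ep (ltn_ord i); lia.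
have [u hu] := perm_eq_permutes ps sz.
exists u; have [] // := @block_perm_splice A (inl i) l l w w1 m n p i 1%g t u ul uw dis il _ (permutes1 sl) pt hu.
Qed.

Section Decomposition.
Variables (k : fieldType) (F : operad k).

Lemma ocomp_actr m n p i (t : 'S_n) (a : F m) (b : F n) : (i < m)%N -> p.+1 = (m + n)%N ->
  exists u : 'S_p, ocomp p i a (oact t b) = oact u (ocomp p i a b).
Proof.
move=> im Ep; have [u hu] := block_perm_exists (Ordinal im) t Ep; exists u.
by have := ocomp_act a b Ep hu; rewrite perm1 oact1.
Qed.

(** Operations obtained from the unit by successive compositions with binary
    operations *)
Inductive generated : forall n, F n -> Prop :=
| generated_unit : generated (ounit : F 1%N)
| generated_zero n : generated (0 : F n)
| generated_lin n c (a b : F n) of generated a & generated b : generated (c *: a + b)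
| generated_bin m n i (s : 'S_n) (a : F m) (g : F 2%N) of (i < m)%N & n.+1 = (m + 2)%N & generated a :
    generated (oact s (ocomp n i a g)).

Lemma generated_act n (s : 'S_n) (a : F n) : generated a -> generated (oact s a).
Proof.
move=> h; elim: h s => {n a} [|n|n c a b _ IH1 _ IH2|m n i t a g im En ha _] s.
- have -> : s = 1%g by apply/permP => i; rewrite [LHS]ord1 [RHS]ord1.
  rewrite oact1; exact: generated_unit.
- by rewrite oact0; exact: generated_zero.
- by rewrite oact_linear; apply: generated_lin.
by rewrite -oactM; apply: generated_bin.
Qed.

Lemma generated_cast m n (a : F m) : m = n -> generated a -> generated (ocast n a).
Proof. by move=> e; subst n; rewrite ocast_id. Qed.

Lemma ocomp_unitr m p i (a : F m) : (i < m)%N -> p.+1 = (m + 1)%N -> ocomp p i a ounit = ocast p a.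
Proof.
move=> im; rewrite addn1 => -[e]; subst p; by rewrite ocast_id ocomp1r.
Qed.

(** By associativity, composing with [b] amounts to successive compositions
    with the binary operations from which it is built. *)
Lemma generated_comp m n p i (a : F m) (b : F n) : (i < m)%N -> p.+1 = (m + n)%N ->
  generated a -> generated b -> generated (ocomp p i a b).
Proof.
move=> im Ep ha hb; elim: hb p Ep => {n b} [|n|n c b b' _ IH1 _ IH2|n' n j s b g jn En hb IH] p Ep.
- by rewrite ocomp_unitr //; apply: generated_cast => //; lia.
- by rewrite ocomp0r; exact: generated_zero.
- by rewrite ocomp_linearr; apply: generated_lin; [apply: IH1|apply: IH2].
have [u ->] := ocomp_actr s a (ocomp n j b g) im Ep; apply: generated_act.
have Ep' : (p.-1).+1 = (m + n')%N by lia.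
rewrite -(@ocompA k F m n' 2 p.-1 n p i j) //; last by lia.
rewrite -[X in generated X]oact1; apply: generated_bin; [lia|lia|exact: IH].
Qed.

Lemma generated2 (g : F 2%N) : generated g.
Proof.
rewrite -[g]ocomp1l -[X in generated X]oact1; apply: generated_bin => //; exact: generated_unit.
Qed.

(** Each contraction of an edge is a partial composition. *)
Lemma tree_closed (Q : forall n, F n -> Prop) (X : seq unit) (T : {set edge X}) (a : decoration (mono F) X) :
  Q 1%N ounit -> (forall n (s : 'S_n) a, Q n a -> Q n (oact s a)) ->
  (forall m n p i (a : F m) (b : F n), (i < m)%N -> p.+1 = (m + n)%N -> Q m a -> Q n b -> Q p (ocomp p i a b)) ->
  is_tree tt T -> labeled T a -> (forall v, v \in vertices T -> Q _ (mval (a v))) ->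
  Q (size X) (tree_comp tt T a : F (size X)).
Proof.
move=> Q1 Qa Qc tT; move: T tT a.
have Qcast m n (c : F m) : m = n -> Q m c -> Q n (ocast n c) by move=> e; subst n; rewrite ocast_id.
apply: tree_ind => [T tT iT|T e tT eI IH] a la ha.
  have [X1|X1] := leqP (size X) 1.
    have X1' : (size X == 1)%N by rewrite eqn_leq X1 (size_gt0_tree tT).
    rewrite /tree_comp X1' [cact X _ _]/(@col_act _ mono_adm k F _ _ _ _ _ _) /col_act /=.
    apply: (Qcast); first by rewrite (eqP X1').
    apply: (Qa); apply: (Qcast) => //.
  have [s hs] := corolla_perm tT iT X1 la; rewrite (tree_comp_corolla iT X1 hs).
  rewrite [cact X _ _]/(@col_act _ mono_adm k F _ _ _ _ s (mval _)) /col_act /=.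
  apply: (Qcast) => //; apply: (Qa); apply: (Qcast); last by apply/ha/root_vertex.
  by rewrite size_map; have /permutesP[] := hs.
rewrite (tree_comp_contract tT la eI); apply: IH; first exact: (contract_labeled tT eI la).
move=> v; rewrite vertices_erase => /setD1P[ve vV].
have [ev|ev] := boolP (e \in tag (a v)); last by rewrite contract_out //; apply: ha.
rewrite contract_in //; have [l1 s1] := size_grafts (grafts_splice (tag (a e)) ev).
rewrite /mval /=; apply: Qc => //; first exact: ha.
by apply: ha; apply: internal_vertex.
Qed.

Variable R : F 3%N -> Prop.

(** Composites in which a relation is inserted in some operation, all
    operations inserted later on being binary *)
Inductive late_relation : forall n, F n -> Prop :=
| late_zero n : late_relation (0 : F n)
| late_lin n c (a b : F n) of late_relation a & late_relation b : late_relation (c *: a + b)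
| late_bin m n i (s : 'S_n) (a : F m) (g : F 2%N) of (i < m)%N & n.+1 = (m + 2)%N & late_relation a :
    late_relation (oact s (ocomp n i a g))
| late_rel m n i (s : 'S_n) (a : F m) r of (i < m)%N & n.+1 = (m + 3)%N & R r :
    late_relation (oact s (ocomp n i a r)).

Lemma late_act n (s : 'S_n) (a : F n) : late_relation a -> late_relation (oact s a).
Proof.
move=> h; elim: h s => {n a} [n|n c a b _ IH1 _ IH2|m n i t a g im En ha _|m n i t a r im En hr] s.
- by rewrite oact0; exact: late_zero.
- by rewrite oact_linear; apply: late_lin.
- by rewrite -oactM; apply: late_bin.
by rewrite -oactM; apply: late_rel.
Qed.

Lemma late_cast m n (a : F m) : m = n -> late_relation a -> late_relation (ocast n a).
Proof. by move=> e; subst n; rewrite ocast_id. Qed.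

Lemma late_compl m n p i (a : F m) (b : F n) : (i < m)%N -> p.+1 = (m + n)%N ->
  late_relation a -> generated b -> late_relation (ocomp p i a b).
Proof.
move=> im Ep ha hb; elim: hb p Ep => {n b} [|n|n c b b' _ IH1 _ IH2|n' n j s b g jn En hb IH] p Ep.
- by rewrite ocomp_unitr //; apply: late_cast => //; lia.
- by rewrite ocomp0r; exact: late_zero.
- by rewrite ocomp_linearr; apply: late_lin; [apply: IH1|apply: IH2].
have [u ->] := ocomp_actr s a (ocomp n j b g) im Ep; apply: late_act.
have Ep' : (p.-1).+1 = (m + n')%N by lia.
rewrite -(@ocompA k F m n' 2 p.-1 n p i j) //; last by lia.
rewrite -[X in late_relation X]oact1; apply: late_bin; [lia|lia|exact: IH].
Qed.

Lemma late_compr m n p i (a : F m) (b : F n) : (i < m)%N -> p.+1 = (m + n)%N ->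
  late_relation b -> late_relation (ocomp p i a b).
Proof.
move=> im Ep hb; elim: hb p Ep => {n b} [n|n c b b' _ IH1 _ IH2|n' n j s b g jn En hb IH|n' n j s b r jn En hr] p Ep.
- by rewrite ocomp0r; exact: late_zero.
- by rewrite ocomp_linearr; apply: late_lin; [apply: IH1|apply: IH2].
- have [u ->] := ocomp_actr s a (ocomp n j b g) im Ep; apply: late_act.
  have Ep' : (p.-1).+1 = (m + n')%N by lia.
  rewrite -(@ocompA k F m n' 2 p.-1 n p i j) //; last by lia.
  rewrite -[X in late_relation X]oact1; apply: late_bin; [lia|lia|exact: IH].
have [u ->] := ocomp_actr s a (ocomp n j b r) im Ep; apply: late_act.
have Ep' : (p.-2).+1 = (m + n')%N by lia.
rewrite -(@ocompA k F m n' 3 p.-2 n p i j) //; last by lia.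
rewrite -[X in late_relation X]oact1; apply: late_rel => //; lia.
Qed.

(** Composing on the left keeps the order of the insertions, by
    associativity, and composing on the right with a generated operation
    appends binary ones. *)
Lemma ideal_late n (a : F n) : (forall n (b : F n), generated b) -> ideal R a -> late_relation a.
Proof.
move=> G; elim=> {n a} [r hr|n|n c a b _ h1 _ h2|n s a _ h|m n p i a b im Ep _ h|m n p i a b im Ep _ h].
- by rewrite -[r]ocomp1l -[X in late_relation X]oact1; apply: late_rel.
- exact: late_zero.
- exact: late_lin.
- exact: late_act.
- exact: late_compl.
exact: late_compr.
Qed.

End Decomposition.

Section Coboundaries.
Variables (k : fieldType) (O : quadratic_operad k) (O' : quadratic_dual O).
Local Notation F := (q_free O).
Local Notation G := (d_op O').
Local Notation m := (\dim {:q_gen O}).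
Local Notation g := (fgen (q_free O)).
Local Notation g' := (@dual_gen k O O').
Local Notation inR := (fun r => r \in q_rel O).

(** The elements known to be images of coboundaries by [natsum_ternary] *)
Inductive relation_span (X : seq unit) : F (size X) -> Prop :=
| span_zero : relation_span (0 : F (size X))
| span_lin c (a b : F (size X)) of relation_span a & relation_span b : relation_span (c *: a + b)
| span_tree (T : {set edge X}) (a : decoration (mono F) X) u (r : F 3%N) of
    is_tree tt T & labeled T a & u \in vertices T & #|inputs T u| = 3%N &
    (forall v, v \in vertices T -> v != u -> #|inputs T v| = 2%N) &
    r \in q_rel O & mval (a u) = ocast _ r : relation_span (tree_comp tt T a : F (size X)).
Arguments relation_span : clear implicits.

Lemma relation_span_coboundary X f : relation_span X f -> in_coboundary O' f.
Proof.
elim=> {f} [|c a b _ h1 _ h2|T a u r tT la uV u3 v2 hr au]; first exact: in_coboundary0.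
  exact: in_coboundary_lin.
exact: (natsum_ternary O' tT la uV u3 v2 hr au).
Qed.

Lemma span_sum X (I : Type) (s : seq I) (P : pred I) (f : I -> F (size X)) :
  (forall i, P i -> relation_span X (f i)) -> relation_span X (\sum_(i <- s | P i) f i).
Proof.
move=> h; elim/big_ind: _ => // [|x y hx hy]; first exact: span_zero.
by rewrite -[x]scale1r; apply: span_lin.
Qed.

(** Tree monomials are composites of binary operations. *)
Lemma generated_free n (b : F n) : generated b.
Proof.
case: n b => [|n] b; first by rewrite (op_nullary b); exact: generated_zero.
pose X := nseq n.+1 tt; have [inv c1 c2] := fgen_bij (q_free O) (X := X) isT.
have e : size X = n.+1 by rewrite size_nseq.
have -> : b = ocast n.+1 (ocast (size X) b) by rewrite ocastK.
apply: generated_cast => //; set f := ocast _ b; rewrite -[f]c2 /tree_eval.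
have Gsum : forall (s : seq (monomial m X tt)) (f : monomial m X tt -> F (size X)),
    (forall i, generated (f i)) -> generated (\sum_(i <- s) f i).
  move=> s f' h; elim/big_ind: _ => // [|x y hx hy]; first exact: generated_zero.
  by rewrite -[x]scale1r; apply: generated_lin.
apply: Gsum => mu; rewrite -[_ *: _]addr0; apply: generated_lin; last exact: generated_zero.
have /andP[tT bT] := valP (tag mu).
apply: tree_closed => //.
- exact: generated_unit.
- exact: generated_act.
- exact: generated_comp.
- by apply/labeledP => v vV; apply: perm_refl.
move=> v vV; have s2 : size (cols (tag (mono_dec (mono_gen g) mu v))) = 2%N.
  by rewrite size_map -cardE; apply/eqP; move/forall_inP: bT; apply.
rewrite -[mval _](ocastK (n := 2)) //; apply: generated_cast => //; exact: generated2.
Qed.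

Lemma relation_span_bin (X Z : seq unit) (i0 : 'I_(size X)) (s : 'S_(size Z)) (x : F (size X)) (c : F 2%N) :
  (size Z).+1 = (size X + 2)%N -> relation_span X x ->
  relation_span Z (oact s (ocomp (size Z) i0 x c)).
Proof.
move=> sZ; elim=> {x} [|d a b _ h1 _ h2|T a u r tT la uV u3 v2 hr au].
- by rewrite ocomp0l oact0; exact: span_zero.
- by rewrite ocomp_linearl oact_linear; apply: span_lin.
have X1 := vertices_small uV.
have [T' [b [th [B [[tT' lb V' [B2 bB] [hv th_inj]] <-]]]]] := graft_exists i0 c s X1 (isT : (1 < 2)%N) sZ tT la.
have [uB tu bu] := hv u uV.
apply: (span_tree (u := th u) (r := r)) => //.
- by rewrite V' in_setU1 imset_f ?orbT.
- by rewrite tu.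
- move=> v; rewrite V' => /setU1P[->|/imsetP[w wV ->]]; first by rewrite B2.
  rewrite (inj_eq th_inj) => wu; have [_ -> _] := hv w wV; exact: v2.
rewrite bu au ocast_trans //.
by rewrite size_map; have /perm_size -> := labeledP _ _ la u uV; rewrite -cardE u3.
Qed.

Lemma relation_span_corolla (Z : seq unit) (r : F 3%N) : size Z = 3%N -> r \in q_rel O ->
  relation_span Z (ocast (size Z) r).
Proof.
move=> sZ hr; have Z1 : (1 < size Z)%N by rewrite sZ.
pose a : decoration (mono F) Z := fun e => mop e (leaf_edges Z) r.
have tC := corolla_tree tt Z1; have iC := corolla_internal Z tt.
have VC := corolla_vertices tt Z1.
have pin : perm_eq (leaf_edges Z) (enum (inputs (corolla Z tt) (root_edge Z tt))).
  by rewrite perm_sym; apply: inputs_corolla.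
have la : labeled (corolla Z tt) a by apply/labeledP => v; rewrite VC in_set1 => /eqP ->.
have hp : permutes (1%g : 'S_(size Z)) (tag (a (root_edge Z tt))) (leaf_edges Z).
  by apply: permutes1; rewrite size_leaf_edges.
have -> : ocast (size Z) r = tree_comp tt (corolla Z tt) a :> F (size Z).
  rewrite (tree_comp_corolla iC Z1 hp) [cact Z _ _]/(@col_act _ mono_adm k F _ _ _ _ 1%g (mval _)) /col_act /=.
  rewrite oact1 ocast_id /mval /= ocast_trans //.
  by rewrite size_map size_leaf_edges.
apply: (span_tree (u := root_edge Z tt) (r := r)) => //.
- by rewrite VC in_set1.
- by rewrite cardE -(perm_size pin) size_leaf_edges.
by move=> v; rewrite VC in_set1 => /eqP ->; rewrite eqxx.
Qed.

(** The operation in which the relation is inserted is a combination of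
    composites of generators along binary trees, on which the relation can
    be grafted. *)
Lemma relation_span_rel (X Z : seq unit) (i0 : 'I_(size X)) (s : 'S_(size Z)) (x : F (size X)) (r : F 3%N) :
  (size Z).+1 = (size X + 3)%N -> r \in q_rel O ->
  relation_span Z (oact s (ocomp (size Z) i0 x r)).
Proof.
move=> sZ hr; have [X1|X1] := leqP (size X) 1.
  have X11 : size X = 1%N by have := ltn_ord i0; lia.
  have Z3 : size Z = 3%N by lia.
  have i00 : (i0 : nat) = 0%N by have := ltn_ord i0; lia.
  have [c cx] := op_unary (ocast 1 x).
  have -> : x = c *: ocast (size X) ounit by rewrite -[x](ocastK (n := 1)) // cx (linZ _ _ (@ocast_linear _ _ _ _)).
  rewrite (linZ _ _ (ocomp_linearl _ _ _)) (linZ _ _ (oact_linear _)) ocomp_castl // i00.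
  have -> : ocomp (size Z) 0 ounit r = ocast (size Z) r :> F (size Z).
    by rewrite -(ocast_ocomp (p := 3)) // ocomp1l.
  have -> : oact s (ocast (size Z) r) = ocast (size Z) (oact (cast_perm Z3 s) (ocast 3 (ocast (size Z) r))).
    by rewrite -oact_cast ocastK.
  rewrite ocastK // -[_ *: _]addr0; apply: span_lin; last exact: span_zero.
  by apply: relation_span_corolla => //; apply: q_rel_stable.
have X0 : X != [::] by case: (X) X1.
have [inv c1 c2] := fgen_bij (q_free O) X0.
rewrite -[x]c2 /tree_eval (lin_sum _ _ _ (ocomp_linearl _ _ _)) (lin_sum _ _ _ (oact_linear _)).
apply: span_sum => mu _; rewrite (linZ _ _ (ocomp_linearl _ _ _)) (linZ _ _ (oact_linear _)).
rewrite -[_ *: _]addr0; apply: span_lin; last exact: span_zero.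
have /andP[tT bT] := valP (tag mu); rewrite -/(mono_tree mu) in tT bT.
have la : labeled (mono_tree mu) (mono_dec (mono_gen g) mu) by apply/labeledP => v vV; apply: perm_refl.
have [T' [b [th [B [[tT' lb V' [B2 bB] [hv th_inj]] <-]]]]] := graft_exists i0 r s X1 (isT : (1 < 3)%N) sZ tT la.
apply: (span_tree (u := B) (r := r)) => //; first by rewrite V' setU11.
move=> v; rewrite V' => /setU1P[->|/imsetP[w wV ->]]; first by rewrite eqxx.
by move=> _; have [_ -> _] := hv w wV; apply/eqP; move/forall_inP: bT; apply.
Qed.

Lemma late_relation_span n (f : F n) : late_relation inR f ->
  forall X, size X = n -> relation_span X (ocast (size X) f).
Proof.
elim=> {n f} [n|n c a b _ h1 _ h2|n p i s a c im Ep _ h|n p i s a r im Ep hr] X sX.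
- by rewrite ocast0; exact: span_zero.
- by rewrite ocast_linear; apply: span_lin; [apply: h1|apply: h2].
- have sN : size (nseq n tt) = n by rewrite size_nseq.
  have im' : (i < size (nseq n tt))%N by rewrite sN.
  subst p; rewrite ocast_id -(ocomp_castl (m' := size (nseq n tt))) //.
  by apply: (@relation_span_bin _ X (Ordinal im')); [rewrite sN|apply: h].
have sN : size (nseq n tt) = n by rewrite size_nseq.
have im' : (i < size (nseq n tt))%N by rewrite sN.
subst p; rewrite ocast_id -(ocomp_castl (m' := size (nseq n tt))) //.
by apply: (@relation_span_rel _ X (Ordinal im')); [rewrite sN|].
Qed.

(** Insert the relation first, graft binary vertices, and apply
    [natsum_ternary]. *)
Lemma ideal_coboundary (X : seq unit) (f : F (size X)) : ideal inR f -> in_coboundary O' f.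
Proof.
move=> hf; apply: relation_span_coboundary; rewrite -[f]ocast_id.
by apply: (late_relation_span _ erefl); apply: ideal_late => // n b; apply: generated_free.
Qed.

(** The image is also that of a coboundary, and [natsum] is injective. *)
Lemma natsum_ker (X : seq unit) phi : X != [::] -> cochain tt phi -> homogeneous 0 phi ->
  ideal inR (natsum g g' phi : F (size X)) ->
  exists eta, [/\ cochain tt eta, homogeneous (-1) eta & phi = cobar_d tt eta].
Proof.
move=> X0 c0 h0 hI; have [eta [ce he Ee]] := ideal_coboundary hI.
exists eta; split=> //.
have [_ lin dd _ _] := cobar_is_complex (mono G) X tt (-1).
have [cde hde] : cx_deg (cobar (mono G) X tt) (-1 + 1) (cobar_d tt eta) by apply: dd.
rewrite addNr in hde.
have [_ lin0' _ _ _] := cobar_is_complex (mono G) X tt 0.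
have [cc hh] := lin0' (-1) (cobar_d tt eta) phi (conj cde hde) (conj c0 h0).
have E0 : natsum g g' (-1 *: cobar_d tt eta + phi) = 0.
  by rewrite natsum_linear Ee scaleN1r addNr.
have z := natsum_inj X0 cc hh E0.
by apply/eqP; rewrite -subr_eq0 addrC -scaleN1r; apply/eqP.
Qed.

End Coboundaries.

(** * Renaming of the leaves *)

(** Whether a set of edges is a tree depends on the sets of leaves above its
    edges only; the colors may change. *)
Section Rename.
Variables (C1 C2 : finType) (X : seq C1) (Y : seq C2) (x : C1) (y : C2).
Variables (r : 'I_(size X) -> 'I_(size Y)) (r' : 'I_(size Y) -> 'I_(size X)).
Hypotheses (rK : cancel r r') (rK' : cancel r' r).
Local Notation edge1 := (edge X).
Local Notation edge2 := (edge Y).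
Variable theta : edge1 -> edge2.
Hypothesis theta1 : forall e, (theta e).1 = r @: e.1.
Hypothesis theta_root : theta (root_edge X x) = root_edge Y y.
Hypothesis theta_leaf : forall i, theta (leaf_edge i) = leaf_edge (r i).
Variable T : {set edge1}.
Hypothesis tT : is_tree x T.
Implicit Types (e f v : edge1).

Let rI : injective r := can_inj rK.

Lemma rename_inj : {in T &, injective theta}.
Proof.
move=> e f eT fT /(congr1 fst); rewrite !theta1 => /(imset_inj rI) E.
exact: (tree_inj tT eT fT E).
Qed.

Lemma rename_card e : #|(theta e).1| = #|e.1|.
Proof. by rewrite theta1 card_imset. Qed.

Lemma rename_proper e f : ((theta e).1 \proper (theta f).1) = (e.1 \proper f.1).
Proof.
rewrite !theta1 !properE; suff S (A B : {set 'I_(size X)}) : (r @: A \subset r @: B) = (A \subset B).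
  by rewrite !S.
apply/idP/idP => [|]; last exact: imsetS.
move=> /subsetP h; apply/subsetP => i iA; have := h (r i) (imset_f r iA).
by rewrite (mem_imset _ _ rI).
Qed.

Lemma rename_setT e : ((theta e).1 == setT) = (e.1 == setT).
Proof.
have sXY : #|'I_(size X)| = #|'I_(size Y)|.
  by apply: bij_eq_card; exists r'; [exact: rK|exact: rK'].
by rewrite !eqEcard !subsetT !cardsT -sXY rename_card.
Qed.

Lemma rename_tree : is_tree y (theta @: T).
Proof.
apply/and4P; split.
- by rewrite -theta_root imset_f // (root_in tT).
- by apply/forallP => j; rewrite -[j]rK' -theta_leaf imset_f // (leaf_in tT).
- apply/forall_inP => _ /imsetP[e eT ->]; rewrite theta1.
  by have [i ie] := tree_neq0 tT eT; apply/set0Pn; exists (r i); rewrite imset_f.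
apply/forall_inP => _ /imsetP[e eT ->]; apply/forall_inP => _ /imsetP[f fT ->].
have /and4P[_ _ _ /forall_inP/(_ e eT)/forall_inP/(_ f fT)/or4P h] := tT.
apply/or4P; case: h => [/eqP ->|h|h|h]; [by constructor 1| | |].
- by constructor 2; rewrite rename_proper.
- by constructor 3; rewrite rename_proper.
constructor 4; rewrite !theta1; apply/pred0P => j /=; apply/negP => /andP[/imsetP[i ie ->]].
by rewrite (mem_imset _ _ rI) => iF; move/pred0P/(_ i): h; rewrite /= ie iF.
Qed.

Lemma rename_vertices : vertices (theta @: T) = theta @: vertices T.
Proof.
apply/setP => e; rewrite in_vertices; apply/andP/imsetP.
  by case=> /imsetP[f fT ->]; rewrite rename_card => f1; exists f; rewrite // in_vertices fT.
by case=> f; rewrite in_vertices => /andP[fT f1] ->; rewrite rename_card imset_f.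
Qed.

Lemma rename_nonroot : nonroot (theta @: T) = theta @: nonroot T.
Proof.
apply/setP => e; rewrite in_nonroot; apply/andP/imsetP.
  by case=> /imsetP[f fT ->]; rewrite rename_setT => f1; exists f; rewrite // in_nonroot fT.
by case=> f; rewrite in_nonroot => /andP[fT f1] ->; rewrite rename_setT imset_f.
Qed.

Lemma rename_internal : internal (theta @: T) = theta @: internal T.
Proof.
rewrite /internal rename_vertices rename_nonroot; apply/setP => e.
apply/setIP/imsetP => [[/imsetP[f fV ->] /imsetP[g gN E]]|[f /setIP[fV fN] ->]]; last by rewrite !imset_f.
exists f => //; apply/setIP; split=> //; suff -> : f = g by [].
apply: rename_inj E; first exact: vertex_in.
by move: gN; rewrite in_nonroot => /andP[].
Qed.

Lemma rename_inputs v : inputs (theta @: T) (theta v) = theta @: inputs T v.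
Proof.
apply/setP => e; apply/inputsP/imsetP.
  case=> /imsetP[f fT ->]; rewrite rename_proper => fv h; exists f => //.
  apply/inputsP; split=> // g gT fg gv; apply: (h (theta g)); first exact: imset_f.
    by rewrite rename_proper.
  by rewrite rename_proper.
case=> f /inputsP[fT fv h] ->; split; [exact: imset_f|by rewrite rename_proper|].
by move=> _ /imsetP[g gT ->]; rewrite !rename_proper; apply: h.
Qed.

Lemma rename_erase e : e \in T -> theta @: T :\ theta e = theta @: (T :\ e).
Proof.
move=> eT; apply/setP => f; apply/setD1P/imsetP => [[fe /imsetP[g gT E]]|[g /setD1P[ge gT] ->]].
  by exists g => //; apply/setD1P; split=> //; apply: contraNneq fe => <-; rewrite E.
by split; [apply: contraNneq ge => /(rename_inj gT eT) ->|exact: imset_f].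
Qed.

Lemma rename_enum (A : {set edge1}) l : A \subset T -> perm_eq l (enum A) ->
  perm_eq (map theta l) (enum (theta @: A)).
Proof.
move=> sA pl; apply: (perm_trans (perm_map theta pl)); apply: uniq_perm; rewrite ?enum_uniq //.
  rewrite map_inj_in_uniq ?enum_uniq // => e f; rewrite !mem_enum => eA fA.
  by apply: rename_inj; apply: (subsetP sA).
move=> e; rewrite mem_enum; apply/mapP/imsetP => -[f]; rewrite ?mem_enum => fA ->; exists f => //.
by rewrite mem_enum.
Qed.

Lemma rename_order w : perm_eq w (enum (nonroot T)) -> perm_eq (map theta w) (enum (nonroot (theta @: T))).
Proof.
by rewrite rename_nonroot; apply: rename_enum; apply/subsetP => e; rewrite in_nonroot => /andP[].
Qed.

Lemma rename_inputs_enum v l : perm_eq l (enum (inputs T v)) ->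
  perm_eq (map theta l) (enum (inputs (theta @: T) (theta v))).
Proof.
by rewrite rename_inputs; apply: rename_enum; apply/subsetP => e; apply: inputs_in.
Qed.

Lemma rename_card_inputs v : #|inputs (theta @: T) (theta v)| = #|inputs T v|.
Proof. by rewrite !cardE -(perm_size (rename_inputs_enum (perm_refl _))) size_map. Qed.

Lemma rename_binary : is_binary (theta @: T) = is_binary T.
Proof.
apply/forall_inP/forall_inP => h v vV.
  by rewrite -rename_card_inputs; apply: h; rewrite rename_vertices imset_f.
by move: vV; rewrite rename_vertices => /imsetP[w wV ->]; rewrite rename_card_inputs; apply: h.
Qed.

Lemma rename_degree : size X = size Y -> tree_degree (theta @: T) = tree_degree T.
Proof.
move=> sXY; rewrite /tree_degree rename_internal card_in_imset.
  by move: #|internal T| => n; rewrite sXY.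
by move=> e f eI fI; apply: rename_inj; apply: internal_in.
Qed.

Section RenameForm.
Variables (k : fieldType) (P : coperad C1 k) (Q : coperad C2 k).
Variable F : forall v (l : seq edge1), P (cols l) v.2 -> Q (cols (map theta l)) (theta v).2.
Hypothesis F_linear : forall v l, linear (@F v l).
Hypothesis F_act : forall v n (s : 'S_n) (l l' : seq edge1) (p : P (cols l) v.2), permutes s l l' ->
  F (cact (cols l') s p) = cact (cols (map theta l')) s (F p).
Variable D : decoration P X -> decoration Q Y.
Hypothesis DE : forall a v, v \in vertices T -> D a (theta v) = vdec_op (F (tagged (a v))).

Lemma rename_labeled a : labeled T a -> labeled (theta @: T) (D a).
Proof.
move=> la; apply/labeledP => w; rewrite rename_vertices => /imsetP[v vV ->].
by rewrite DE //; apply: rename_inputs_enum; apply: (labeledP _ _ la).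
Qed.

Lemma rename_mform (V : lmodType k) (G : decoration Q Y -> V) :
  mform (theta @: T) G -> mform T (fun a => G (D a)).
Proof.
move=> [g1 g2 g3].
have agD a b : agree (vertices T) a b -> agree (vertices (theta @: T)) (D a) (D b).
  by move=> ab w; rewrite rename_vertices => /imsetP[v vV ->]; rewrite !DE // ab.
split.
- by move=> a b la ab; apply: g1; [exact: rename_labeled|exact: agD].
- move=> a v l vV la.
  have E p : agree (vertices (theta @: T)) (D (dfwith a (@vdec_op _ _ P X v l p)))
       (dfwith (D a) (@vdec_op _ _ Q Y (theta v) (map theta l) (F p))).
    move=> w; rewrite rename_vertices => /imsetP[u uV ->]; rewrite DE //.
    have [<-|vu] := eqVneq v u; first by rewrite !dfwith_in.
    rewrite !dfwith_out ?DE //; apply: contra vu => /eqP h; apply/eqP.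
    by apply: rename_inj h; apply: vertex_in.
  have lE p : labeled (theta @: T) (D (dfwith a (@vdec_op _ _ P X v l p))).
    by apply: rename_labeled; rewrite (labeled_dfwith _ _ _ 0).
  move=> c p q; rewrite !(g1 _ _ (lE _) (E _)) F_linear; apply: g2.
    by rewrite rename_vertices imset_f.
  by rewrite (labeled_dfwith _ _ _ (F 0)) -(labeled_agree (E 0)).
move=> a b la ab; apply: g3; first exact: rename_labeled.
move=> w; rewrite rename_vertices => /imsetP[v vV ->]; rewrite !DE //.
have [s hs ->] := ab v vV; rewrite /= F_act //; apply: relab_op.
exact: permutes_map.
Qed.

End RenameForm.
End Rename.

(** * Forgetting the colors *)

Lemma bar_adm_perm_eq (X Y : seq color) c : perm_eq X Y -> bar_adm X c = bar_adm Y c.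
Proof. by case: c => /= h; [apply: perm_all|rewrite (seq.permP h)]. Qed.

Section Colors.
Variables (X : seq color) (x : color).
Local Notation X' := (nseq (size X) tt).
Local Notation edge1 := (edge X').
Local Notation edge2 := (edge X).

Fact size_uncolored : size X' = size X. Proof. exact: size_nseq. Qed.
Definition relabel : 'I_(size X') -> 'I_(size X) := cast_ord size_uncolored.
Definition unlabel : 'I_(size X) -> 'I_(size X') := cast_ord (esym size_uncolored).
Lemma relabelK : cancel relabel unlabel. Proof. exact: cast_ordK. Qed.
Lemma unlabelK : cancel unlabel relabel. Proof. exact: cast_ordKV. Qed.

Definition dashed_leaves : {set 'I_(size X)} := [set i | tnth (in_tuple X) i == dashed].

(** The color that an edge must have for the operations decorating the tree
    to be nonzero *)
Definition edge_color (A : {set 'I_(size X)}) : color :=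
  if [disjoint A & dashed_leaves] then full else dashed.

Definition up (e : edge1) : edge2 := (relabel @: e.1, edge_color (relabel @: e.1)).
Definition down (e : edge2) : edge1 := (unlabel @: e.1, tt).

Lemma edge_color_dashed (A : {set _}) i : i \in A -> i \in dashed_leaves -> edge_color A = dashed.
Proof. by move=> iA iD; rewrite /edge_color; case: ifP => // /pred0P/(_ i) /=; rewrite iA iD. Qed.

Lemma edge_color_has (A : {set _}) : edge_color A = dashed -> exists2 i, i \in A & i \in dashed_leaves.
Proof.
rewrite /edge_color; case: ifPn => // /pred0Pn[i /andP[iA iD]] _; by exists i.
Qed.

Lemma downK : cancel up down.
Proof.
by move=> [A []]; rewrite /down /up /= -imset_comp (eq_imset _ relabelK) imset_id.
Qed.

Lemma up_inj : injective up. Proof. exact: can_inj downK. Qed.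

Lemma upK e : e.2 = edge_color e.1 -> up (down e) = e.
Proof.
case: e => A c /= ->; rewrite /up /down /= -imset_comp (eq_imset _ unlabelK) imset_id //.
Qed.

Lemma up_leaf i : up (leaf_edge i) = leaf_edge (relabel i).
Proof.
rewrite /up /leaf_edge /= imset_set1; congr (_, _); rewrite /edge_color disjoints1 inE.
by case: (tnth _ _).
Qed.

Lemma down_leaf i : down (leaf_edge i) = leaf_edge (unlabel i).
Proof. by rewrite /down /leaf_edge /= imset_set1; case: (tnth _ _). Qed.

Lemma down_root : down (root_edge X x) = root_edge X' tt.
Proof.
congr (_, _); apply/setP => i; rewrite !inE; apply/imsetP; exists (relabel i) => //.
by rewrite relabelK.
Qed.

Lemma relabel_setT : relabel @: [set: 'I_(size X')] = setT.
Proof.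
by apply/setP => i; rewrite !inE; apply/imsetP; exists (unlabel i); rewrite ?unlabelK.
Qed.

Lemma card_dashed : count_mem dashed X = #|dashed_leaves|.
Proof.
rewrite -[X in count_mem _ X](map_tnth_enum (in_tuple X)) count_map -sum1_count -sum1_card.
by rewrite big_enum_cond; apply: eq_bigl => i /=; rewrite !inE.
Qed.

Lemma adm_color : X != [::] -> bar_adm X x ->
  (#|dashed_leaves| <= 1)%N /\ edge_color setT = x.
Proof.
move=> X0; rewrite -card_dashed /edge_color -setI_eq0 setTI -cards_eq0 -card_dashed.
case: x => /= [h|/eqP -> //]; suff -> : count_mem dashed X = 0%N by [].
by apply/eqP; rewrite -leqn0 leqNgt -has_count; apply/hasPn => c /(allP h) /eqP ->.
Qed.

Lemma up_root : X != [::] -> bar_adm X x -> up (root_edge X' tt) = root_edge X x.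
Proof. by move=> X0 h; rewrite /up /= relabel_setT; have [_ ->] := adm_color X0 h. Qed.

(** The inputs of a vertex lie below disjoint sets of leaves, so that only
    one of them can lie below the dashed leaf. *)
Lemma up_adm T v l : (#|dashed_leaves| <= 1)%N -> is_tree tt T -> v \in vertices T ->
  perm_eq l (enum (inputs T v)) -> bar_adm (cols (map up l)) (up v).2.
Proof.
move=> h1 tT vV pl; rewrite (bar_adm_perm_eq (Y := cols (map up (enum (inputs T v))))); last first.
  by do 2!apply: perm_map.
have sub f : f \in inputs T v -> relabel @: f.1 \subset relabel @: v.1.
  by case/inputsP => _ /proper_sub fv _; apply: imsetS.
case Ec: (up v).2 => /=.
  apply/allP => c /mapP[e' /mapP[f]]; rewrite mem_enum => fi -> ->; apply/eqP.
  case Ef: (up f).2 => //; have [i iA iD] := edge_color_has Ef.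
  by move: Ec; rewrite (edge_color_dashed (subsetP (sub f fi) i iA) iD).
have [_ /imsetP[j jv ->] iD] := edge_color_has Ec.
have [f fi jf] := cover_input tT vV jv.
rewrite -map_comp count_map (@eq_in_count _ _ (pred1 f)).
  by rewrite count_uniq_mem ?enum_uniq // mem_enum fi.
move=> f2; rewrite mem_enum => fi2 /=; apply/eqP/eqP => [E|->]; last first.
  exact: (edge_color_dashed (imset_f _ jf) iD).
have [_ /imsetP[j2 j2f ->] iD2] := edge_color_has E.
have Ej : j2 = j.
  apply: (can_inj relabelK); apply: (card_le1_eqP h1) => //.
apply/eqP/negPn/negP => ff; have := inputs_disjoint tT fi2 fi ff.
by move/pred0P/(_ j) => /=; rewrite jf -Ej j2f.
Qed.

(** Going down from the leaves: a full edge has full inputs only, and a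
    dashed one exactly one dashed input. *)
Lemma tree_colors T e : is_tree x T ->
  (forall v, v \in vertices T -> bar_adm (cols (enum (inputs T v))) v.2) ->
  e \in T -> e.2 = edge_color e.1.
Proof.
move=> tT hT; move En : #|e.1| => n; elim/ltn_ind: n e En => n IH e En eT.
have [e1|/negbTE e1] := boolP (1 < #|e.1|)%N; last first.
  have [i ->] := leafP tT eT e1; rewrite -[i]unlabelK -up_leaf /= imset_set1.
  by rewrite /edge_color disjoints1 inE; case: (tnth _ _).
have eV : e \in vertices T by rewrite in_vertices eT.
have ci f : f \in inputs T e -> f.2 = edge_color f.1.
  move=> fi; apply: (IH _ _ _ erefl); last exact: inputs_in fi.
  by rewrite -En; apply: proper_card; case/inputsP: fi.
have := hT e eV; case Ec: e.2 => /= h.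
  case E: (edge_color e.1) => //; have [i ie iD] := edge_color_has E.
  have [f fi jf] := cover_input tT eV ie.
  have : f.2 = full by apply/eqP; apply: (allP h); apply: map_f; rewrite mem_enum.
  by rewrite (ci f fi) (edge_color_dashed jf iD).
have : has (pred1 dashed) (cols (enum (inputs T e))) by rewrite has_count (eqP h).
case/hasP => c /mapP[f fi ->] /eqP; rewrite mem_enum in fi.
rewrite (ci f fi) => /edge_color_has[i jf iD]; apply/esym.
by apply: edge_color_dashed iD; case/inputsP: fi => _ /proper_sub/subsetP h' _; apply: h'.
Qed.

(** Admissible types are stable under grafting, and so under contraction,
    down to a corolla. *)
Lemma tree_adm (k : fieldType) (O : operad k) T (a : decoration (bar O) X) : is_tree x T -> labeled T a ->
  (forall v, v \in vertices T -> bar_adm (cols (tag (a v))) v.2) -> bar_adm X x.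
Proof.
move=> tT; move: T tT a; apply: tree_ind => [T tT iT|T e tT eI IH] a la ha; last first.
  apply: (IH (contract e a)); first exact: (contract_labeled tT eI la).
  move=> v; rewrite vertices_erase => /setD1P[ve vV].
  have [ev|ev] := boolP (e \in tag (a v)); last by rewrite contract_out //; apply: ha.
  rewrite contract_in //; apply: (bar_adm_graft (grafts_splice (tag (a e)) ev)); first exact: ha.
  by apply: ha; apply: internal_vertex.
have [X1|X1] := leqP (size X) 1.
  have sX : size X = 1%N by apply/eqP; rewrite eqn_leq X1 (size_gt0_tree tT).
  have o0 : (0 < size X)%N by rewrite sX.
  pose i0 := Ordinal o0.
  have E : root_edge X x = leaf_edge i0.
    apply: (tree_inj tT (root_in tT) (leaf_in tT i0)); apply/eqP; rewrite eq_sym eqEcard subsetT /= cardsT.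
    by rewrite card_ord cards1 sX.
  have -> : x = tnth (in_tuple X) i0 by have := congr1 snd E.
  rewrite (tnth_nth full) /=; move: sX; case: (X) => [|c [|? ?]] //= _; by rewrite bar_adm1.
have [s hs] := corolla_perm tT iT X1 la.
have := permutes_map (fun f : edge2 => f.2) hs; rewrite cols_leaf_edges => hm.
by rewrite -(bar_adm_perm x hm); apply: ha; apply: root_vertex.
Qed.

End Colors.

Lemma map_rem (A B : eqType) (f : A -> B) e s : injective f -> map f (rem e s) = rem (f e) (map f s).
Proof. by move=> fI; elim: s => //= z s <-; rewrite (inj_eq fI); case: eqP. Qed.

Section Transport.
Variables (k : fieldType) (G : operad k) (X : seq color) (x : color).
Hypotheses (X0 : X != [::]) (aX : bar_adm X x).
Local Notation X' := (nseq (size X) tt).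
Local Notation edge1 := (edge X').
Local Notation edge2 := (edge X).
Local Notation D1 := (decoration (mono G) X').
Local Notation D2 := (decoration (bar G) X).
Local Notation r := (@relabel X).
Local Notation r' := (@unlabel X).
Local Notation up := (@up X).
Local Notation down := (@down X).
Local Notation cin := (@col_in _ bar_adm k G _ _).
Local Notation im v1 v2 d1 d2 := (@image_dec k G G (fun n (a : G n) => a) color bar_adm
  bar_adm1 bar_adm_perm bar_adm_graft X' X up v1 v2 d1 d2).

Definition bop (v : edge2) (l : seq edge2) n (q : G n) : vdec (bar G) v :=
  @vdec_op _ _ (bar G) X v l (@col_out _ bar_adm k G (cols l) v.2 (ocast (size (cols l)) q)).

Definition up_dec (b : D1) : D2 := fun v => bop v (map up (tag (b (down v)))) (mval (b (down v))).
Definition down_dec (a : D2) : D1 := fun v => mop v (map down (tag (a (up v)))) (cin (tagged (a (up v)))).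

Lemma up_decE b v : up_dec b (up v) = bop (up v) (map up (tag (b v))) (mval (b v)).
Proof. by rewrite /up_dec downK. Qed.

Lemma down_decE a v : up (down v) = v ->
  down_dec a (down v) = mop (down v) (map down (tag (a v))) (cin (tagged (a v))).
Proof. by move=> E; rewrite /down_dec E. Qed.

Let d1 : (#|dashed_leaves X| <= 1)%N. Proof. by case: (adm_color X0 aX). Qed.
Let up_root' : up (root_edge X' tt) = root_edge X x. Proof. exact: up_root. Qed.
Let up1 e : (up e).1 = r @: e.1. Proof. by []. Qed.
Let down1 e : (down e).1 = r' @: e.1. Proof. by []. Qed.

Section UpTree.
Variables (T : {set edge1}) (tT : is_tree tt T).

Definition up_tree := rename_tree (@relabelK X) (@unlabelK X) up1 up_root' (@up_leaf X) tT.
Definition up_vertices := rename_vertices (@relabelK X) up1 T.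
Definition up_internal := rename_internal (@relabelK X) (@unlabelK X) up1 tT.
Definition up_order := rename_order (@relabelK X) (@unlabelK X) up1 tT.

Lemma up_dec_image b v : labeled T b -> v \in vertices T -> im v (up v) (b v) (up_dec b (up v)).
Proof.
move=> lb vV; rewrite up_decE; have ad := up_adm d1 tT vV (labeledP _ _ lb v vV).
by split=> //=; rewrite col_outK.
Qed.

Lemma image_dec_unique v1 v2 d e e' : im v1 v2 d e -> im v1 v2 d e' -> e = e'.
Proof.
case: e e' => l p [l' p'] [/= E1 a1 c1] [/= E2 a2 c2]; have El : l' = l by rewrite E1.
clear E1 E2; subst l'; have -> : p = p' by rewrite -[p]col_inK -[p']col_inK c1 c2.
  by [].
Qed.

Let F v (l : seq edge1) (p : mono G (cols l) v.2) : bar G (cols (map up l)) (up v).2 :=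
  @col_out _ bar_adm k G _ _ (ocast (size (cols (map up l))) (p : G (size (cols l)))).

Let F_linear v l : linear (@F v l).
Proof. by move=> c p q; rewrite /F ocast_linear; apply: col_out_linear. Qed.

Let F_act v n (s : 'S_n) (l l' : seq edge1) (p : mono G (cols l) v.2) : permutes s l l' ->
  F (cact (cols l') s p) = cact (cols (map up l')) s (F p).
Proof.
move=> hs; have /permutesP[s1 s2 _] := hs.
have hs2 := permutes_map (fun f : edge2 => f.2) (permutes_map up hs).
have [ad|nad] := boolP (bar_adm (cols (map up l')) (up v).2); last first.
  by rewrite [LHS](col_eq0 _ nad) [RHS](col_eq0 _ nad).
rewrite /F [cact (cols (map up l')) s _]/(@col_act _ bar_adm k G _ _ _ _ s _) /col_act.
rewrite col_outK ?(bar_adm_perm _ hs2) //; congr col_out.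
rewrite [cact _ s p]/(@col_act _ mono_adm k G _ _ _ _ s _) /col_act /=.
change (ocast (size (cols (map up l'))) (ocast (size (cols l')) (oact s (ocast n (p : G (size (cols l)))))) =
  ocast (size (cols (map up l'))) (oact s (ocast n (ocast (size (cols (map up l))) (p : G (size (cols l))))))).
by rewrite ocast_trans ?size_map // ocast_trans // !size_map.
Qed.

Let DE b v : v \in vertices T -> up_dec b (up v) = vdec_op (F (tagged (b v))).
Proof. by move=> _; rewrite up_decE. Qed.

Lemma up_labeled b : labeled T b -> labeled (up @: T) (up_dec b).
Proof. exact: (rename_labeled (@relabelK X) up1 tT DE). Qed.

Lemma up_mform (V : lmodType k) (H : D2 -> V) : mform (up @: T) H -> mform T (fun b => H (up_dec b)).
Proof. exact: (rename_mform (@relabelK X) up1 tT F_linear F_act DE). Qed.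

(** Both sides are the image of the contracted decoration, and images are
    unique. *)
Lemma up_contract b e : labeled T b -> e \in internal T ->
  agree (vertices (up @: (T :\ e))) (contract (up e) (up_dec b)) (up_dec (contract e b)).
Proof.
move=> lb eI w; rewrite (rename_vertices (@relabelK X) up1).
move=> /imsetP[v vV ->]; have vT := vV.
rewrite vertices_erase in vT; case/setD1P: vT => ve vT.
apply: (@image_dec_unique v (up v) (contract e b v)).
  apply: image_contract; [exact: opmap_id|exact: up_inj|exact: up_dec_image|].
  by apply: up_dec_image => //; apply: internal_vertex.
rewrite up_decE; have lc := contract_labeled tT eI lb.
have ad := up_adm d1 (tree_erase tT eI) vV (labeledP _ _ lc v vV).
by split=> //=; rewrite col_outK.
Qed.

End UpTree.

(** Restriction of a cochain to the trees colored by [edge_color] *)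
Definition pull (phi : precochain (bar G) X) : precochain (mono G) X' := fun T w b =>
  if cobar_data tt T w b then phi (up @: T) (map up w) (up_dec b) else 0.

Lemma up_data T w b : cobar_data tt T w b -> cobar_data x (up @: T) (map up w) (up_dec b).
Proof.
by case/and3P=> tT pw lb; apply/and3P; split; [exact: up_tree|exact: up_order|exact: up_labeled].
Qed.

Lemma pull_cochain phi : cochain x phi -> cochain tt (pull phi).
Proof.
move=> h; apply: mk_cochain => [T w a /negbTE nc|T w tT|T w w' b cd pw]; first by rewrite /pull nc.
  have [pw|npw] := boolP (perm_eq w (enum (nonroot T))); last first.
    apply: (@mform_eq _ _ _ _ _ _ _ (fun=> 0)); last exact: mform0.
    by move=> b lb; rewrite /pull /cobar_data (negbTE npw) andbF.
  apply: (@mform_eq _ _ _ _ _ _ _ (fun b => phi (up @: T) (map up w) (up_dec b))).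
    by move=> b lb; rewrite /pull /cobar_data tT pw lb.
  by apply: (@up_mform T tT k^o); apply: (cochain_mform h).
have cd' : cobar_data tt T w' b.
  case/and3P: cd => t p l; apply/and3P; split=> //.
  by rewrite (perm_trans _ p) // perm_sym.
rewrite /pull cd cd'; have uw : uniq w by case/and3P: cd => _ /perm_uniq -> _; apply: enum_uniq.
have um : uniq (map up w) by rewrite (map_inj_uniq (@up_inj X)).
by rewrite (cochain_par h _ _ um (perm_map up pw)) (par_map pw uw um).
Qed.

Lemma pull_homogeneous d phi : homogeneous d phi -> homogeneous d (pull phi).
Proof.
move=> h T w b dT; rewrite /pull; case: ifP => // /and3P[tT _ _]; apply: h.
by rewrite (rename_degree (@relabelK X) (@unlabelK X) up1 tT) // size_nseq.
Qed.

Lemma pull_d phi : cochain x phi -> pull (cobar_d x phi) = cobar_d tt (pull phi).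
Proof.
move=> h; apply: functional_extensionality_dep => T; apply: functional_extensionality_dep => w.
apply: functional_extensionality_dep => b; rewrite /pull {2}/cobar_d; case: ifP => // cd.
have /and3P[tT pw lb] := cd.
rewrite (cobar_dE phi (up_data cd)) up_internal //.
rewrite big_imset /=; last by move=> e f _ _; apply: up_inj.
apply: eq_bigr => e eI; have [_ _ cde] := internal_order cd eI.
rewrite cde (index_map (@up_inj X)) -(map_rem _ _ (@up_inj X)); congr (_ * _).
rewrite (rename_erase (@relabelK X) up1 tT); last exact: internal_in eI.
by apply: (cochain_agree h); apply: up_contract.
Qed.

(** By linearity at [v], where the only decoration with these inputs is 0. *)
Lemma cochain_nonadm phi T w (a : D2) v : cochain x phi -> v \in vertices T ->
  ~~ bar_adm (cols (tag (a v))) v.2 -> phi T w a = 0.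
Proof.
move=> h vV na; have lin := cochain_linear h w a (l := tag (a v)) vV.
transitivity (phi T w (dfwith a (vdec_op (tagged (a v))))); first by rewrite vdec_eta dfwith_id.
have -> : tagged (a v) = 0 := col_eq0 _ na.
exact: (lin0 lin).
Qed.

(** The trees on which cochains do not have to vanish *)
Definition colored (T : {set edge2}) := [forall e in T, e.2 == edge_color e.1].

Lemma coloredP T e : colored T -> e \in T -> up (down e) = e.
Proof. by move=> /forall_inP h eT; apply/upK/eqP/h. Qed.

Lemma up_down_tree (T : {set edge2}) : colored T -> up @: (down @: T) = T.
Proof.
move=> cT; rewrite -imset_comp -[RHS]imset_id; apply: eq_in_imset => e eT.
exact: (coloredP cT eT).
Qed.

Lemma down_up_tree (T : {set edge1}) : down @: (up @: T) = T.
Proof. by rewrite -imset_comp (eq_imset _ (@downK X)) imset_id. Qed.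

Lemma up_colored (T : {set edge1}) : colored (up @: T).
Proof. by apply/forall_inP => _ /imsetP[e _ ->]. Qed.

Lemma cochain_colored phi T w (a : D2) : cochain x phi -> phi T w a != 0 -> cobar_data x T w a && colored T.
Proof.
move=> h nz; have [cd|nc] := boolP (cobar_data x T w a); last first.
  by rewrite (cochain_support h) ?eqxx in nz.
have /and3P[tT pw la] := cd; apply/forall_inP => e eT; apply/eqP.
apply: (tree_colors tT) => // v vV.
rewrite -(bar_adm_perm_eq (X := cols (tag (a v)))); last by apply: perm_map; apply: (labeledP _ _ la).
by apply/negPn/negP => na; rewrite (cochain_nonadm w h vV na) eqxx in nz.
Qed.

Section DownTree.
Variables (T : {set edge2}) (tT : is_tree x T) (cT : colored T).

Let F v (l : seq edge2) (p : bar G (cols l) v.2) : mono G (cols (map down l)) (down v).2 :=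
  ocast (size (cols (map down l))) (@col_in _ bar_adm k G _ _ p).

Let F_linear v l : linear (@F v l).
Proof. by move=> c p q; rewrite /F col_in_linear ocast_linear. Qed.

Let F_act v n (s : 'S_n) (l l' : seq edge2) (p : bar G (cols l) v.2) : permutes s l l' ->
  F (cact (cols l') s p) = cact (cols (map down l')) s (F p).
Proof.
move=> hs; have /permutesP[s1 s2 _] := hs.
have hs2 := permutes_map (fun f : edge2 => f.2) hs.
have [ad|nad] := boolP (bar_adm (cols l') v.2); last first.
  have E0 : cact (P := bar G) (x := v.2) (cols l') s p = 0 := col_eq0 _ nad.
  rewrite E0 /F.
  have -> : p = 0 by apply: col_eq0; rewrite (bar_adm_perm _ hs2).
  by rewrite !col_in_zero !ocast0 [RHS](lin0 (@cact_linear _ _ (mono G) _ _ _ _ s)).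
rewrite [cact (cols (map down l')) s _]/(@col_act _ mono_adm k G _ _ _ _ s _) /col_act.
rewrite /F [cact _ s p]/(@col_act _ bar_adm k G _ _ _ _ s _) /col_act col_outK //.
rewrite ocast_trans; last by rewrite size_map s2.
by rewrite [in RHS]ocast_trans // !size_map.
Qed.

Let DE a v : v \in vertices T -> down_dec a (down v) = vdec_op (F (tagged (a v))).
Proof. by move=> vV; rewrite down_decE // (coloredP cT) // vertex_in. Qed.

Definition down_tree := rename_tree (@unlabelK X) (@relabelK X) down1 (@down_root X x) (@down_leaf X) tT.
Definition down_order := rename_order (@unlabelK X) (@relabelK X) down1 tT.

Lemma down_labeled a : labeled T a -> labeled (down @: T) (down_dec a).
Proof. exact: (rename_labeled (@unlabelK X) down1 tT DE). Qed.

Lemma down_mform (V : lmodType k) (H : D1 -> V) : mform (down @: T) H -> mform T (fun b => H (down_dec b)).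
Proof. exact: (rename_mform (@unlabelK X) down1 tT F_linear F_act DE). Qed.

Lemma up_down_dec a : labeled T a -> (forall v, v \in vertices T -> bar_adm (cols (tag (a v))) v.2) ->
  agree (vertices T) a (up_dec (down_dec a)).
Proof.
move=> la ha v vV; have vT := vertex_in vV.
have E := coloredP cT vT; rewrite /up_dec down_decE //.
have El : map up (map down (tag (a v))) = tag (a v).
  rewrite -map_comp -[RHS]map_id; apply/eq_in_map => e; rewrite (labeled_mem _ la) // => ei.
  exact: (coloredP cT (inputs_in ei)).
rewrite /= El -[LHS]vdec_eta /bop; congr vdec_op.
by rewrite /mval /= ocast_trans ?size_map // ocast_id col_inK.
Qed.

End DownTree.

(** Extension by 0 to the trees with other colors *)
Definition push (eta : precochain (mono G) X') : precochain (bar G) X := fun T w a =>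
  if cobar_data x T w a && colored T then eta (down @: T) (map down w) (down_dec a) else 0.

Lemma down_data T w a : cobar_data x T w a -> colored T -> cobar_data tt (down @: T) (map down w) (down_dec a).
Proof.
by case/and3P=> tT pw la cT; apply/and3P; split; [exact: down_tree|exact: down_order|exact: down_labeled].
Qed.

Lemma down_uniq T w : is_tree x T -> colored T -> perm_eq w (enum (nonroot T)) -> uniq (map down w).
Proof. by move=> tT cT pw; rewrite (perm_uniq (down_order tT pw)) enum_uniq. Qed.

Lemma push_cochain eta : cochain tt eta -> cochain x (push eta).
Proof.
move=> h; apply: mk_cochain => [T w a /negbTE nc|T w tT|T w w' a cd pw]; first by rewrite /push nc.
  have [/andP[pw cT]|npw] := boolP (perm_eq w (enum (nonroot T)) && colored T); last first.
    apply: (@mform_eq _ _ _ _ _ _ _ (fun=> 0)); last exact: mform0.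
    move=> b lb; rewrite /push /cobar_data; case: ifP => // /andP[/and3P[_ pw _] cT].
    by rewrite pw cT in npw.
  apply: (@mform_eq _ _ _ _ _ _ _ (fun b => eta (down @: T) (map down w) (down_dec b))).
    by move=> b lb; rewrite /push /cobar_data tT pw lb cT.
  by apply: (@down_mform T tT cT k^o); apply: (cochain_mform h).
have cd' : cobar_data x T w' a.
  case/and3P: cd => t p l; apply/and3P; split=> //.
  by rewrite (perm_trans _ p) // perm_sym.
rewrite /push cd cd' /=; case: ifP => cT; last by rewrite mulr0.
have /and3P[tT pe _] := cd; have uw : uniq w by rewrite (perm_uniq pe) enum_uniq.
have um := down_uniq tT cT pe.
by rewrite (cochain_par h _ _ um (perm_map down pw)) (par_map pw uw um).
Qed.

Lemma push_homogeneous d eta : homogeneous d eta -> homogeneous d (push eta).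
Proof.
move=> h T w b dT; rewrite /push; case: ifP => // /andP[/and3P[tT _ _] _]; apply: h.
by rewrite (rename_degree (@unlabelK X) (@relabelK X) down1 tT) // size_nseq.
Qed.

Lemma pull_push eta : cochain tt eta -> pull (push eta) = eta.
Proof.
move=> h; apply: functional_extensionality_dep => T; apply: functional_extensionality_dep => w.
apply: functional_extensionality_dep => b; rewrite /pull; case: ifPn => [cd|nc]; last first.
  by rewrite (cochain_support h).
rewrite /push (up_data cd) up_colored /= down_up_tree.
have mapK l : map down (map up l) = l by rewrite mapK //; exact: downK.
rewrite mapK; have /and3P[tT pw lb] := cd; apply: (cochain_agree h) => v vV.
rewrite /down_dec up_decE /= mapK -[RHS]vdec_eta /mop; congr vdec_op.
rewrite col_outK; last exact: (up_adm d1 tT vV (labeledP _ _ lb v vV)).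
rewrite ocast_trans; last by rewrite !size_map.
by rewrite ocast_id.
Qed.

(** Cochains vanish on the trees that are not restricted to. *)
Lemma pull_inj phi psi : cochain x phi -> cochain x psi -> pull phi = pull psi -> phi = psi.
Proof.
move=> h1 h2 E; apply: functional_extensionality_dep => T; apply: functional_extensionality_dep => w.
apply: functional_extensionality_dep => a.
have key phi' : cochain x phi' -> phi' T w a != 0 ->
    [/\ cobar_data x T w a, colored T & forall v, v \in vertices T -> bar_adm (cols (tag (a v))) v.2].
  move=> h nz; have /andP[cd cT] := cochain_colored h nz; split=> // v vV.
  by apply/negPn/negP => na; rewrite (cochain_nonadm w h vV na) eqxx in nz.
have main : [/\ cobar_data x T w a, colored T & forall v, v \in vertices T -> bar_adm (cols (tag (a v))) v.2] ->
    phi T w a = psi T w a.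
  case=> cd cT ha; have /and3P[tT pw la] := cd.
  have := congr1 (fun f : precochain (mono G) X' => f (down @: T) (map down w) (down_dec a)) E.
  rewrite /pull (down_data cd cT) up_down_tree //.
  have -> : map up (map down w) = w.
    rewrite -map_comp -[RHS]map_id; apply/eq_in_map => e; rewrite (perm_mem pw) mem_enum in_nonroot => /andP[eT _].
    exact: (coloredP cT eT).
  have ag := up_down_dec cT la ha.
  by rewrite -(cochain_agree h1 w ag) -(cochain_agree h2 w ag).
have [z1|/(key _ h1)] := eqVneq (phi T w a) 0; last exact: main.
have [z2|/(key _ h2)] := eqVneq (psi T w a) 0; last exact: main.
by rewrite z1 z2.
Qed.

End Transport.

Lemma gsum_lin (k : fieldType) m (C : finType) (P Q : coperad C k) X gP gQ (U V : lmodType k)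
    (f : U -> V) L vs (G : decoration P X -> decoration Q X -> U) a b : linear f ->
  f (@gsum k m C P Q X gP gQ U L vs G a b) = gsum gP gQ L vs (fun a b => f (G a b)) a b.
Proof.
move=> lf; elim: vs a b => //= v vs IH a b.
by rewrite (lin_sum _ _ _ lf); apply: eq_bigr => i _; apply: IH.
Qed.

Section NaturalPull.
Variables (k : fieldType) (O : quadratic_operad k) (O' : quadratic_dual O).
Variables (X : seq color) (x : color).
Hypotheses (X0 : X != [::]) (aX : bar_adm X x).
Local Notation F := (q_free O).
Local Notation G := (d_op O').
Local Notation m := (\dim {:q_gen O}).
Local Notation g := (fgen (q_free O)).
Local Notation g' := (@dual_gen k O O').
Local Notation og := (@op_gen k O).
Local Notation X' := (nseq (size X) tt).
Local Notation edge1 := (edge X').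
Local Notation up := (@up X).
Local Notation down := (@down X).
Local Notation qq := (q_quo O).
Local Notation im v1 v2 d1 d2 := (@image_dec k F O (fun n a => qq n a) color bar_adm
  bar_adm1 bar_adm_perm bar_adm_graft X' X up v1 v2 d1 d2).
Implicit Types (phi : precochain (bar G) X).

Lemma quo_opmap : opmap (fun n (a : F n) => qq n a).
Proof. by split; [exact: quo_unit|exact: quo_act|exact: quo_comp]. Qed.

Lemma qq_linear n : linear (fun a : F n => qq n a).
Proof. by move=> c a b; rewrite linearP. Qed.

Lemma op_sign_dual_bar : op_sign_dual og g'.
Proof.
move=> s V B B1 B2.
have := @op_sign_dual_quadratic k O O' s V (fun p q => B (qq 2%N p) q).
move=> H; rewrite -[RHS]H //; last by move=> q c a b; rewrite qq_linear B1.
by apply: eq_bigr => i _; rewrite /op_gen quo_act.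
Qed.

Lemma sign_dual_bar : sign_dual (bar_gen og) (bar_gen g').
Proof. exact: sign_dual_col op_sign_dual_bar. Qed.

Lemma natural_map_sum phi : cochain x phi -> natural_map phi =
  \sum_(T : {set edge X} | is_tree x T && is_binary T)
    tree_sum x (bar_gen og) (bar_gen g') phi T (std_list T) (enum (vertices T)).
Proof.
move=> h; rewrite /natural_map /tree_eval.
have loc (T : {set edge X}) (a a' : decoration (bar O) X) (b b' : decoration (bar G) X) :
    is_tree x T -> is_binary T -> labeled T a -> labeled T b ->
    agree (vertices T) a a' -> agree (vertices T) b b' ->
    term x phi T (vertexwise_order T) a b = term x phi T (vertexwise_order T) a' b'.
  move=> tT bT la lb aa bb; rewrite /term (cochain_agree h _ bb).
  by rewrite (mf_agree (tree_comp_mform (bar O) tT) la aa).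
under eq_bigr => mu _ do rewrite ffunE.
exact: (monomial_sum (bar_gen og) (bar_gen g') loc).
Qed.

Section OneTree.
Variables (phi : precochain (bar G) X) (T : {set edge1}).
Hypotheses (h : cochain x phi) (tT : is_tree tt T) (bT : is_binary T).

Let up1 e : (up e).1 = @relabel X @: e.1. Proof. by []. Qed.

Let L2 (v : edge X) : seq (edge X) := map up (std_list T (down v)).
Let vs := enum (vertices T).

Let s2 v : v \in vertices T -> size (cols (std_list T v)) = 2%N.
Proof. by move=> vV; rewrite size_map -cardE; apply/eqP; move/forall_inP: bT; apply. Qed.

Let d1 : (#|dashed_leaves X| <= 1)%N. Proof. by case: (adm_color X0 aX). Qed.

Lemma up_tree_comp (c1 : decoration (mono F) X') (c2 : decoration (bar O) X) : labeled T c1 ->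
  {in vertices T, forall v, im v (up v) (c1 v) (c2 (up v))} ->
  @col_in _ bar_adm k O _ _ (tree_comp x (up @: T) c2) = qq _ (ocast (size X) (mtree_comp tt T c1)).
Proof.
move=> lc hc; have := @image_tree_comp k F O (fun n a => qq n a) quo_opmap color bar_adm
  bar_adm1 bar_adm_perm bar_adm_graft X' X up (@up_inj X) tt x.
apply => //.
- apply: (@eq_from_nth _ (root_edge X x)); first by rewrite size_leaf_edges size_map size_leaf_edges size_nseq.
  move=> i; rewrite size_leaf_edges => li; have li' : (i < size X')%N by rewrite size_nseq.
  rewrite (nth_map (root_edge X' tt)) ?size_leaf_edges //.
  rewrite (nth_leaf_edges _ (Ordinal li)) (nth_leaf_edges _ (Ordinal li')) up_leaf; congr leaf_edge.
  exact: ord_inj.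
- exact: up_root.
- by move=> T0; apply: up_tree.
- by move=> T0; apply: up_internal.
move=> T0 a1 a2 tT0 la ha; apply/labeledP => w; rewrite up_vertices => /imsetP[v vV ->].
have [tv _ _] := ha v vV; rewrite tv.
by apply: (rename_inputs_enum (@relabelK X) up1 tT0); apply: (labeledP _ _ la).
Qed.

Lemma tree_sum_pull :
  @col_in _ bar_adm k O _ _ (tree_sum x (bar_gen og) (bar_gen g') phi (up @: T) (std_list (up @: T))
     (enum (vertices (up @: T)))) =
  ocast (size X) (qq _ (tree_sum tt (mono_gen g) (mono_gen g') (pull phi) T (std_list T) vs)).
Proof.
have tU := up_tree X0 aX tT.
have bU : is_binary (up @: T) by rewrite (rename_binary (@relabelK X) up1 tT).
have VU := up_vertices T.
rewrite (tree_sum_indep sign_dual_bar (L' := L2) (vs' := map up vs) tU bU h (perm_refl _)); first last.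
- move=> w wv; rewrite /L2; move: wv => /mapP[v vV ->]; rewrite downK.
  exact: (rename_inputs_enum (@relabelK X) up1 tT).
- exact: std_lists.
- rewrite VU; apply: (rename_enum (@relabelK X) up1 tT); last exact: perm_refl.
  by apply/subsetP => v; apply: vertex_in.
rewrite /tree_sum 
  (@gsum_lin k m _ (bar O) (bar G) X (bar_gen og) (bar_gen g') _ _ _ _ _ _ _ _ (@col_in_linear _ bar_adm k O X x)).
apply/esym.
have lf : linear (fun u : mono F X' tt => ocast (size X) (qq (size X') u)).
  by move=> c a b; rewrite qq_linear ocast_linear.
apply: (@gsum_map k m _ _ (mono F) (mono G) (bar O) (bar G) X' X (mono_gen g) (mono_gen g')
  (bar_gen og) (bar_gen g') _ _ _ up (std_list T) L2 vs _ _ _ _ _ _ lf) => //.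
- exact: enum_uniq.
- by move=> e f _ _; apply: up_inj.
move=> c1 e1 c2 e2 h1 _ _.
have hv v : v \in vertices T -> exists i,
        [/\ c1 v = gdec (mono_gen g) v (std_list T v) i, e1 v = gdec (mono_gen g') v (std_list T v) i,
            c2 (up v) = gdec (bar_gen og) (up v) (map up (std_list T v)) i
          & e2 (up v) = gdec (bar_gen g') (up v) (map up (std_list T v)) i].
  by move=> vV; have := h1 v; rewrite mem_enum /L2 downK; apply.
have lc : labeled T c1 by apply/labeledP => v vV; have [i [-> _ _ _]] := hv v vV.
have le : labeled T e1 by apply/labeledP => v vV; have [i [_ -> _ _]] := hv v vV.
have pw : perm_eq (flatten (map (std_list T) vs)) (enum (nonroot T)).
  by apply: (perm_flatten_inputs tT (L := std_list T)) => //; apply: std_lists.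
have Ew : flatten (map L2 (map up vs)) = map up (flatten (map (std_list T) vs)).
  by rewrite map_flatten -!map_comp; congr flatten; apply: eq_map => v /=; rewrite /L2 downK.
rewrite /term Ew (linZ _ _ (@qq_linear _)) (linZ _ _ (@ocast_linear _ _ _ _)).
rewrite (linZ _ _ (@col_in_linear _ bar_adm k O X x)) /pull /cobar_data tT pw le /=; congr (_ *: _).
  apply: (cochain_agree h) => w; rewrite up_vertices => /imsetP[v vV ->].
  have [i [_ Ee _ Ee2]] := hv v vV; rewrite up_decE Ee Ee2 /gdec /bop; congr vdec_op.
  by rewrite /bar_gen /mval /= ocast_trans // s2.
rewrite (up_tree_comp (c1 := c1)) //.
  by rewrite (opm_cast (fun n (a : F n) => qq n a)) // size_nseq.
move=> v vV; have [i [Ec _ Ec2 _]] := hv v vV; rewrite Ec Ec2 /gdec.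
have ad := up_adm d1 tT vV (perm_refl _).
split=> //=; rewrite /bar_gen col_outK //.
have sz : size (cols (map up (std_list T v))) = 2%N by rewrite size_map size_map -(size_map snd) s2.
rewrite /mval /= ocast_trans ?s2 // -/(op_gen _).
by rewrite (opm_cast (fun n (a : F n) => qq n a)) // sz.
Qed.

End OneTree.

(** Through the identification of cochains, the natural map is evaluation in
    the free operad followed by the quotient map. *)
Lemma natural_pull phi : cochain x phi ->
  @col_in _ bar_adm k O X x (natural_map phi) =
  ocast (size X) (qq _ (natsum g g' (pull phi) : F (size X'))).
Proof.
move=> h; rewrite natural_map_sum // (lin_sum _ _ _ (@col_in_linear _ bar_adm k O X x)).
rewrite (bigID (@colored X)) /= [X in _ + X]big1 ?addr0; last first.
  move=> T /andP[/andP[tT bT] nc]; rewrite /tree_sum gsum_zero ?col_in_zero // => a b.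
  rewrite /term; have [->|nz] := eqVneq (phi T (flatten (map (std_list T) (enum (vertices T)))) b) 0.
    by rewrite scale0r.
  by have /andP[_ cT] := cochain_colored h nz; rewrite cT in nc.
rewrite (reindex_onto (fun T : {set edge1} => up @: T) (fun T => down @: T)) /=; last first.
  by move=> T /andP[_ cT]; apply: up_down_tree.
rewrite /natsum (lin_sum _ _ _ (@qq_linear _)) (lin_sum _ _ _ (@ocast_linear _ _ _ _)).
apply: eq_big => [T|T /andP[/andP[/andP[tU bU] cU] _]].
  rewrite down_up_tree eqxx up_colored !andbT; apply/andP/andP => -[tU bU].
    have tT : is_tree tt T by rewrite -(down_up_tree T); apply: down_tree tU.
    by split=> //; rewrite -(rename_binary (@relabelK X) (fun e => erefl : (up e).1 = @relabel X @: e.1) tT).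
  by split; [apply: up_tree|rewrite (rename_binary (@relabelK X) (fun e => erefl : (up e).1 = @relabel X @: e.1) tU)].
have tT : is_tree tt T by rewrite -(down_up_tree T); apply: down_tree tU.
apply: tree_sum_pull => //.
by rewrite -(rename_binary (@relabelK X) (fun e => erefl : (up e).1 = @relabel X @: e.1) tT).
Qed.

End NaturalPull.

(** * The quasi-isomorphism *)

Lemma concentrated_is_complex (k : fieldType) (V : lmodType k) : is_complex (concentrated V).
Proof.
move=> d; split=> /=.
- by right.
- move=> c a b [->|->]; first by left.
  by case=> [->|->]; [left|right; rewrite scaler0 addr0].
- by right.
- by move=> *; rewrite scaler0 addr0.
by [].
Qed.

Lemma cobar_d0 (C : finType) (k : fieldType) (P : coperad C k) X x : cobar_d x (0 : precochain P X) = 0.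
Proof.
apply: functional_extensionality_dep => T; apply: functional_extensionality_dep => w.
apply: functional_extensionality_dep => a; rewrite /cobar_d; case: ifP => // _.
by apply: big1 => e _; apply: mulr0.
Qed.

Lemma cochain_degree (C : finType) (k : fieldType) (P : coperad C k) X x d (phi : precochain P X) :
  cochain x phi -> homogeneous d phi -> 0 < d -> phi = 0.
Proof.
move=> h hd d0; apply: functional_extensionality_dep => T; apply: functional_extensionality_dep => w.
apply: functional_extensionality_dep => a.
have [/and3P[tT _ _]|nc] := boolP (cobar_data x T w a); last exact: (cochain_support h).
apply: hd; apply/eqP => E; have := degree_le0 tT; rewrite E; lia.
Qed.

Section Main.
Variables (k : fieldType) (O : quadratic_operad k) (O' : quadratic_dual O).
Local Notation F := (q_free O).
Local Notation G := (d_op O').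
Local Notation m := (\dim {:q_gen O}).
Local Notation g := (fgen (q_free O)).
Local Notation g' := (@dual_gen k O O').
Local Notation qq := (q_quo O).
Local Notation inR := (fun r => r \in q_rel O).

(** Tree monomials span the free operad. *)
Lemma natsum_surj (X : seq unit) (f : F (size X)) : X != [::] ->
  exists phi : precochain (mono G) X, [/\ cochain tt phi, homogeneous 0 phi & natsum g g' phi = f].
Proof.
move=> X0; have [inv c1 c2] := fgen_bij F X0; rewrite -[f]c2 /tree_eval.
have [[c0 h0] lin _ _ _] := cobar_is_complex (mono G) X tt 0.
have l := @natsum_linear k O O' X.
elim/big_ind: _ => [|u v [e1 [a1 b1 E1]] [e2 [a2 b2 E2]]|mu _].
- by exists 0; split=> //; apply: lin0 l.
- have [c h] := lin 1 e1 e2 (conj a1 b1) (conj a2 b2).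
  by exists (1 *: e1 + e2); split=> //; rewrite l E1 E2 scale1r.
have /andP[tT bT] := valP (tag mu).
have la : labeled (mono_tree mu) (mono_dec (mono_gen g) mu) by apply/labeledP => v vV; apply: perm_refl.
have [phi [a b E]] := natsum_binary O' tT la bT.
have [c h] := lin (inv f mu) phi 0 (conj a b) (conj c0 h0).
exists (inv f mu *: phi + 0); split=> //.
by rewrite l E (lin0 l) addr0.
Qed.

Variables (X : seq color) (x : color).
Local Notation nat_map := (@natural_map k O O' X x).

Lemma natural_map_linear c (a b : cobar (bar G) X x) : nat_map (c *: a + b) = c *: nat_map a + nat_map b.
Proof.
rewrite /natural_map /tree_eval scaler_sumr -big_split; apply: eq_bigr => mu _ /=.
by rewrite !ffunE scalerA -scalerDl.
Qed.

(** Binary trees have degree 0. *)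
Lemma natural_map_degree d (a : cobar (bar G) X x) : homogeneous d a -> d != 0 -> nat_map a = 0.
Proof.
move=> h d0; rewrite /natural_map /tree_eval big1 // => mu _; rewrite ffunE h ?scale0r //.
have /andP[tT bT] := valP (tag mu).
have := degree0_binary tT; rewrite bT => /eqP E.
by apply/eqP => E'; move: d0; rewrite -E' E eqxx.
Qed.

Lemma natural_map0 : nat_map 0 = 0.
Proof. by apply: (@natural_map_degree 1). Qed.

(** A nonzero value would come from a tree decorated by nonzero operations. *)
Lemma cochain_inadmissible phi : ~~ bar_adm X x -> cochain x phi -> phi = 0 :> precochain (bar G) X.
Proof.
move=> na h; apply: functional_extensionality_dep => T; apply: functional_extensionality_dep => w.
apply: functional_extensionality_dep => a; apply/eqP/negPn/negP => nz; move/negP: na; apply.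
have [cd|nc] := boolP (cobar_data x T w a); last by rewrite (cochain_support h) ?eqxx in nz.
have /and3P[tT pw la] := cd; apply: (tree_adm tT la) => v vV.
by apply/negPn/negP => nv; rewrite (cochain_nonadm w h vV nv) eqxx in nz.
Qed.

Hypothesis X0 : X != [::].
Local Notation X' := (nseq (size X) tt).
Let X'0 : X' != [::]. Proof. by case: (X) X0. Qed.

Section Admissible.
Hypothesis aX : bar_adm X x.

Lemma natural_map_ker phi : cochain x phi -> nat_map phi = 0 <-> ideal inR (natsum g g' (pull phi) : F (size X')).
Proof.
move=> h; split=> [E|I].
  apply/(quo_ker qq); have := natural_pull X0 aX h; rewrite E col_in_zero => /esym E'.
  have := congr1 (ocast (size X')) E'; rewrite ocastK ?ocast0 //; exact: size_nseq.
rewrite -[LHS]col_inK natural_pull //; have -> : qq _ (natsum g g' (pull phi) : F (size X')) = 0 by apply/(quo_ker qq).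
by rewrite ocast0 col_out0.
Qed.

Lemma natural_map_d phi : cochain x phi -> nat_map (cobar_d x phi) = 0.
Proof.
move=> h; apply/natural_map_ker; first exact: cobar_d_cochain.
rewrite (pull_d X0 aX h); apply: natsum_d_ideal; exact: pull_cochain h.
Qed.

(** [push] turns a primitive of the restriction into a primitive. *)
Lemma pull_coboundary d phi eta : cochain x phi -> cochain tt eta -> homogeneous d eta ->
  pull phi = cobar_d tt eta ->
  exists2 psi : cobar (bar G) X x, cx_deg (cobar (bar G) X x) d psi & phi = cx_d psi.
Proof.
move=> h c hd E; exists (push x eta).
  by split; [apply: push_cochain|apply: push_homogeneous].
have cp := push_cochain x c.
apply: (pull_inj h); first by apply: cobar_d_cochain cp.
by rewrite [RHS](pull_d X0 aX cp) (pull_push X0 aX c).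
Qed.

Lemma natural_map_surj (b : bar O X x) : exists phi,
  [/\ cochain x phi, homogeneous 0 phi & nat_map phi = b].
Proof.
have [f Ef] := quo_surj qq (@col_in _ bar_adm k O X x b).
have [phi [c h E]] := natsum_surj (ocast (size X') f) X'0.
exists (push x phi); split; [exact: push_cochain c|exact: push_homogeneous|].
rewrite -[LHS]col_inK natural_pull //; last exact: push_cochain c.
rewrite pull_push // E (opm_cast (fun n (a : F n) => qq n a)) ?size_nseq // ocastK ?size_nseq //.
by rewrite Ef col_inK.
Qed.

End Admissible.

Lemma natural_map_quasi_iso : koszul O' -> quasi_iso nat_map.
Proof.
move=> HK; split.
- exact: cobar_is_complex.
- exact: concentrated_is_complex.
- move=> d; split.
  + move=> a [c h]; have [->|d0] := eqVneq d 0; first by left.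
    by right; apply: natural_map_degree h d0.
  + by move=> c a b _ _; apply: natural_map_linear.
  move=> a [c h]; have [aX|na] := boolP (bar_adm X x); last exact: col_eq0.
  exact: natural_map_d.
move=> d; have [aX|na] := boolP (bar_adm X x); last first.
  split=> [a [c h] _ _|b _ _].
    have [[c0 h0] _ _ _ _] := cobar_is_complex (bar G) X x (d - 1).
    by exists 0 => //; rewrite (cochain_inadmissible na c) /= cobar_d0.
  have [[c0 h0] _ _ _ _] := cobar_is_complex (bar G) X x d.
  exists 0; split=> //; first exact: cobar_d0.
  by exists 0; [right|rewrite natural_map0 addr0; apply: col_eq0].
split=> [a [c h] da [b' _ fa]|b [->|->] _].
- have [E|d0] := eqVneq d 0.
    subst d; have [eta [ce he E]] : exists eta, [/\ cochain tt eta, homogeneous (-1) eta & pull a = cobar_d tt eta].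
      apply: natsum_ker => //; [exact: pull_cochain c|exact: pull_homogeneous|].
      exact/natural_map_ker.
    by rewrite sub0r; apply: (pull_coboundary aX c ce he).
  have n0 : (0 < size X)%N by case: (X) X0.
  have cd : cx_deg (cobar (mono O') X' tt) d (pull a).
    by split; [apply: pull_cochain c|apply: pull_homogeneous].
  have dp : cx_d (pull a : cobar (mono O') X' tt) = 0.
    rewrite /= -(pull_d X0 aX c); have -> : cobar_d x a = 0 := da.
    apply: functional_extensionality_dep => T; apply: functional_extensionality_dep => w.
    by apply: functional_extensionality_dep => ?; rewrite /pull; case: ifP.
  have [eta [ce he] E] := HK _ d n0 d0 _ cd dp.
  exact: (pull_coboundary aX c ce he (esym E)).
- have [phi [c h E]] := natural_map_surj aX b.
  exists phi; split=> //; last by exists 0; [right|rewrite E /= addr0].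
  apply: (@cochain_degree _ _ _ _ x (0 + 1)); [exact: cobar_d_cochain|exact: cobar_d_homogeneous|by []].
have [[c0 h0] _ _ _ _] := cobar_is_complex (bar G) X x d.
exists 0; split=> //; first exact: cobar_d0.
by exists 0; [right|rewrite natural_map0 addr0].
Qed.

End Main.

Theorem proposition1p15 (k : fieldType) (char0 : [pchar k] =i pred0)
    (O : quadratic_operad k) (O' : quadratic_dual O) (HK : koszul O')
    (X : seq color) (x : color) (X_nonempty : X != [::]) :
  quasi_iso (@natural_map k O O' X x).
Proof. exact: natural_map_quasi_iso. Qed.
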